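(* Let $S$ be a sigmoidal nonlinearity and, for $\delta\neq 0$, let $B_\delta(u):=S(u+\delta)-S(u-\delta)-2S(\delta)$. For $\delta>0$ and sufficiently small, the static behavior $$-y+S\big(B_\delta(u+\gamma y/2)+y+\alpha+\beta y\big)=0,\qquad (\alpha,\beta,\gamma)\in\mathbb{R}^3,$$ with input $u$ and output $y$, is a universal unfolding of the winged cusp singularity, with $\alpha,\beta,\gamma$ as unfolding parameters. Its persistent static behaviors are given by the persistent bifurcation diagrams of the winged cusp, i.e. (up to equivalence of bifurcation diagrams) by the persistent bifurcation diagrams of the normal form $G_{wcusp}(y,u;\alpha,\beta,\gamma)=-y^3-u^2+\alpha+\beta y+\gamma u y$.
   Context: Notation: $S^{(n)}$ denotes the $n$-th derivative of a smooth function $S$ of one real variable; subscripts denote partial derivatives. A static behavior (bifurcation diagram) is the set of pairs $(y,u)\in\mathbb{R}\times\mathbb{R}$ satisfying $g(y,u)=0$ for a smooth function $g$; it is identified with the mapping $g$. The variable $y$ is the output and $u$ is the input (bifurcation parameter). All statements are local near the origin. Sigmoidal nonlinearity: a smooth function $S:\mathbb{R}\to\mathbb{R}$ (with associated sigmoidal static behavior $-y+S(u)=0$) such that (a) $S(-u)=-S(u)$ for all $u\in\mathbb{R}$; (b) $S^{(1)}(u)>0$ for all $u\in\mathbb{R}$; (c) $\lim_{u\to\pm\infty}S^{(1)}(u)=0$; (d) for all $n\in\mathbb{N}$, $S^{(2n+1)}(0)\neq 0$, with $S^{(1)}(0)=1$; (e) for all $n\in\mathbb{N}$, $\mathrm{sgn}(S^{(2n)}(u))=-\mathrm{sgn}(u)$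 for all $u\neq 0$. Equivalence: two smooth mappings $h,g:\mathbb{R}\times\mathbb{R}\to\mathbb{R}$ are equivalent near the origin if there exist smooth functions $Y(y,u)$, $U(u)$, $Q(y,u)$, with $Y(0,0)=U(0)=0$ and $Y_y>0$, $U_u>0$, $Q>0$, such that $h(y,u)=Q(y,u)\,g(Y(y,u),U(u))$ near the origin. They are strongly equivalent if this holds with $U(u)=u$. Winged cusp singularity: the codimension-$3$ singularity with normal form $g_{wcusp}(y,u)=-y^3-u^2$; the normal form of its universal unfolding is $G_{wcusp}(y,u;\alpha,\beta,\gamma)=-y^3-u^2+\alpha+\beta y+\gamma u y$. Universal unfolding: given a smooth mapping $g(y,u)$ possessing a codimension-$k$ singularity at the origin, a universal unfolding of $g$ is a $k$-parameter family of smooth mappings $G(\cdot,\cdot;a)$, $a\in\mathbb{R}^k$, such that (a) $G(y,u;0)=g(y,u)$; (b) for all smooth functions $p(y,u)$ and sufficiently small $c>0$, there exist smooth mappings $Q,Y,U,A$ such that $$g(y,u)+c\,p(y,u)=Q(y,u,c)\,G\big(Y(y,u,c),U(u,c);A(c)\big),$$ where $Q(y,u,0)\equiv 1$, $Y(y,u,0)\equiv y$, $U(u,0)\equiv u$, $A(0)=0$. The components of $a$ are the unfolding parameters. A family is said to be a universal unfolding of the winged cusp singularity if its member at zero parameter value is strongly equivalent near the origin to $g_{wcusp}$ and the family is a universal unfolding (with $k=3$) of that member. Persistent diagrams: for an unfolding $G(y,u;a)$, considered for $(y,u,a)$ near the origin, the transition variety is the set of $a$ for which at least one of the following occurs: there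 is $(y,u)$ with $G=G_y=G_u=0$; there is $(y,u)$ with $G=G_y=G_{yy}=0$; there are $u$ and $y_1\neq y_2$ with $G=G_y=0$ at both $(y_1,u)$ and $(y_2,u)$. The diagram $G(\cdot,\cdot;a)=0$ is persistent if $a$ (near $0$) is not in the transition variety. Diagrams are compared up to the equivalence of bifurcation diagrams: multiplication by a positive smooth function and a smooth change of coordinates $(y,u)\mapsto(Y(y,u),U(u))$ with $Y_y>0$, $U_u>0$ between neighborhoods of the origin (not required to fix the origin). *)

(* Defs.v *)
From HB Require Import structures.
From mathcomp Require Import all_boot all_order all_algebra.
From mathcomp Require Import all_classical all_reals all_analysis.

Set Implicit Arguments.
Unset Strict Implicit.
Unset Printing Implicit Defensive.

Import Order.TTheory GRing.Theory Num.Theory.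
Import numFieldNormedType.Exports.

Local Open Scope classical_set_scope.
Local Open Scope ring_scope.

(* Used only for finite-dimensional [V] and open [D], where it is the usual
   class of [k] times continuously differentiable functions on [D]. *)
Fixpoint Ck (R : realType) (V W : normedModType R) (k : nat) (D : set V)
    (f : V -> W) : Prop :=
  match k with
  | 0 => forall x, D x -> {for x, continuous f}
  | k'.+1 => (forall x, D x -> differentiable f x) /\
             forall v : V, Ck k' D ('D_v f)
  end.

Definition smooth (R : realType) (V W : normedModType R) (D : set V)
    (f : V -> W) : Prop :=
  forall k, Ck k D f.

Definition smooth_near0 (R : realType) (V W : normedModType R)
    (f : V -> W) : Prop :=
  exists2 D : set V, open_nbhs 0 D & smooth D f.

(* In a mapping [g y u] (or [G y u a], with parameter [a]), [y] is the output
   and [u] the input. *)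
Definition d_y (R : realType) (g : R -> R -> R) : R -> R -> R :=
  fun y u => derive1 (fun t => g t u) y.

Definition d_u (R : realType) (g : R -> R -> R) : R -> R -> R :=
  fun y u => derive1 (fun t => g y t) u.

(* The sign condition on even derivatives is imposed on the second derivative
   only.  For the function itself it contradicts oddness and monotonicity.  For
   the fourth derivative it would make S'' concave on [0, +oo[ with S''(0) = 0,
   so that S''(u) <= u S''(1) < 0 for u >= 1, and S' could not stay positive. *)
Record sigmoidal (R : realType) (S : R -> R) : Prop := Sigmoidal {
  sigmoidal_smooth : smooth setT S ;
  sigmoidal_odd : forall u, S (- u) = - S u ;
  sigmoidal_incr : forall u, 0 < derive1 S u ;
  sigmoidal_cvg_pinfty : derive1 S u @[u --> +oo] --> (0 : R) ;
  sigmoidal_cvg_ninfty : derive1 S u @[u --> -oo] --> (0 : R) ;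
  sigmoidal_odd_derivatives : forall n : nat, derive1n n.*2.+1 S 0 != 0 ;
  sigmoidal_slope0 : derive1 S 0 = 1 ;
  sigmoidal_sg2 : forall u, u != 0 -> Num.sg (derive1n 2 S u) = - Num.sg u
}.

Definition strongly_equivalent (R : realType) (h g : R -> R -> R) : Prop :=
  exists Q Y : R -> R -> R,
    [/\ smooth_near0 (fun z : R * R => Q z.1 z.2),
        smooth_near0 (fun z : R * R => Y z.1 z.2),
        Y 0 0 = 0 &
        \forall z \near (0 : R * R),
          [/\ 0 < Q z.1 z.2, 0 < d_y Y z.1 z.2 &
              h z.1 z.2 = Q z.1 z.2 * g (Y z.1 z.2) z.2]].

(* All identities are between germs: at (y, u) = 0, resp. at (y, u, c) = 0 on
   the side c > 0. *)
Definition universal_unfolding (R : realType) (k : nat) (g : R -> R -> R)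
    (G : R -> R -> 'rV[R]_k -> R) : Prop :=
  [/\ smooth_near0 (fun z : R * R * 'rV[R]_k => G z.1.1 z.1.2 z.2),
      \forall z \near (0 : R * R), G z.1 z.2 0 = g z.1 z.2 &
      forall p : R -> R -> R, smooth_near0 (fun z : R * R => p z.1 z.2) ->
      exists (Q Y : R -> R -> R -> R) (U : R -> R -> R) (A : R -> 'rV[R]_k),
      [/\ [/\ smooth_near0 (fun z : R * R * R => Q z.1.1 z.1.2 z.2),
              smooth_near0 (fun z : R * R * R => Y z.1.1 z.1.2 z.2),
              smooth_near0 (fun z : R * R => U z.1 z.2) &
              smooth_near0 A],
          \forall z \near (0 : R * R),
            [/\ Q z.1 z.2 0 = 1, Y z.1 z.2 0 = z.1 & U z.2 0 = z.2],
          A 0 = 0 &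
          \forall z \near (0 : R * R * R),
            let: (y, u, c) := z in
            0 < c ->
            g y u + c * p y u = Q y u c * G (Y y u c) (U u c) (A c)]].

Definition wcusp (R : realType) (y u : R) : R := - y ^+ 3 - u ^+ 2.

Definition wcusp_normal_unfolding (R : realType) (y u : R) (a : 'rV[R]_3) : R :=
  - y ^+ 3 - u ^+ 2 + a 0 0 + a 0 1 * y + a 0 2 * u * y.

Definition wcusp_universal_unfolding (R : realType)
    (G : R -> R -> 'rV[R]_3 -> R) : Prop :=
  strongly_equivalent (fun y u => G y u 0) (@wcusp R) /\
  universal_unfolding (fun y u => G y u 0) G.

Definition transition_variety (R : realType) (k : nat) (D : set (R * R))
    (G : R -> R -> 'rV[R]_k -> R) : set 'rV[R]_k :=
  [set a | let g := fun y u => G y u a in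
    [\/ exists y u, D (y, u) /\ [/\ g y u = 0, d_y g y u = 0 & d_u g y u = 0],
        exists y u, D (y, u) /\
          [/\ g y u = 0, d_y g y u = 0 & d_y (d_y g) y u = 0] |
        exists u y1 y2,
          [/\ y1 <> y2,
              D (y1, u) /\ (g y1 u = 0 /\ d_y g y1 u = 0) &
              D (y2, u) /\ (g y2 u = 0 /\ d_y g y2 u = 0)]]].

(* Equivalence of the diagram of [h] in the open set [N] with the diagram of
   [g] in the open set [M]. *)
Definition diagram_equivalent (R : realType) (N M : set (R * R))
    (h g : R -> R -> R) : Prop :=
  exists (Q Y : R -> R -> R) (U : R -> R),
    [/\ smooth N (fun z => Q z.1 z.2),
        smooth N (fun z => Y z.1 z.2),
        smooth (snd @` N) U,
        set_bij N M (fun z => (Y z.1 z.2, U z.2)) &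
        forall y u, N (y, u) ->
          [/\ 0 < Q y u, 0 < d_y Y y u, 0 < derive1 U u &
              h y u = Q y u * g (Y y u) (U u)]].

(* Every persistent diagram of [F] near the origin is equivalent to a
   persistent diagram of [G] near the origin.  All data live in balls of an
   arbitrary small radius [r]; the neighborhoods [N] and [M] on which diagrams
   are compared contain a ball whose radius [s] does not depend on the
   parameter [a], since otherwise [N] could shrink with [a] so as to avoid the
   diagram altogether. *)
Definition persistent_diagrams_among (R : realType) (k l : nat)
    (F : R -> R -> 'rV[R]_k -> R) (G : R -> R -> 'rV[R]_l -> R) : Prop :=
  exists2 r0 : R, 0 < r0 & forall r : R, 0 < r < r0 ->
  exists s rho : R, [/\ 0 < s, 0 < rho &
    forall a : 'rV[R]_k, `|a| < rho ->
      ~ transition_variety (ball (0 : R * R) r) F a ->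
      exists b : 'rV[R]_l,
        [/\ `|b| < r, ~ transition_variety (ball (0 : R * R) r) G b &
            exists N M : set (R * R),
              [/\ open N /\ open M,
                  ball 0 s `<=` N /\ N `<=` ball 0 r,
                  ball 0 s `<=` M /\ M `<=` ball 0 r &
                  diagram_equivalent N M
                    (fun y u => F y u a) (fun y u => G y u b)]]].

Definition same_persistent_diagrams (R : realType) (k l : nat)
    (F : R -> R -> 'rV[R]_k -> R) (G : R -> R -> 'rV[R]_l -> R) : Prop :=
  persistent_diagrams_among F G /\ persistent_diagrams_among G F.

Definition bump_response (R : realType) (S : R -> R) (delta u : R) : R :=
  S (u + delta) - S (u - delta) - 2 * S delta.

Definition wcusp_behavior (R : realType) (S : R -> R) (delta : R)
    (y u : R) (a : 'rV[R]_3) : R :=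
  let alpha := a 0 0 in
  let beta := a 0 1 in
  let gamma := a 0 2 in
  - y + S (bump_response S delta (u + gamma * y / 2) + y + alpha + beta * y).

(* Main.v *)
Require Import Defs.
From HB Require Import structures.
From mathcomp Require Import all_boot all_order all_algebra.
From mathcomp Require Import all_classical all_reals all_analysis.
From mathcomp Require Import ring lra.
Import Order.TTheory GRing.Theory Num.Theory.
Import numFieldNormedType.Exports.
Local Open Scope classical_set_scope.
Local Open Scope ring_scope.

Set Implicit Arguments.
Unset Strict Implicit.
Unset Printing Implicit Defensive.

(* Oddness gives S(x) = x + x^3 R(x) with R(0) < 0, so that -y + S(y + X) is a unit times X - y^3 C(y),
   and B_delta(v) = - v^2 B(v) with B(0) > 0.  Up to a unit the behavior is therefore the family
   - y^3 C(y) - v^2 B(v) + alpha + beta y with v = u + gamma y / 2.  Giving y, u, alpha, beta, gamma the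
   weights 2, 3, 6, 4, 1 deforms it, with parameter e, to the same family with constant C and B (e = 0),
   which becomes the normal form after completing the cube and the square.

   Both the deformation in e and the perturbation by c p are trivialized by flows, once the derivative of
   the family with respect to the deformation parameter is a combination of K, K_y, K_u with coefficients
   depending on (y, u, parameters), (y, u, parameters), (u, parameters), plus a combination of the
   derivatives in alpha, beta, gamma with coefficients depending on the parameters.  This infinitesimal
   versality follows from Weierstrass division of order 2 in y and of orders 1 and 3 in u.  Division
   of order 2 reduces to Whitney's theorem on even functions.  For order 3 one divides first with a root r
   of the cubic adjoined; the remainders are constant on the fibers of (r, p) -> (p, - r^3 - p r), and a
   smooth fiber-constant s descends to a smooth function, because its derivatives in (p, q) are again
   induced by fiber-constant functions: 's_r / (3 r^2 + p)' is smooth and fiber-constant. *)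

(** * Smooth germs *)

(** Smooth dependence on parameters is proved once, for limits of Euler polygons; Hadamard quotients
    and implicit functions are then read off as endpoints of flows.

    Why orders 2, 1 and 3: modulo [K_y], of order 2 in y, every function becomes a pair of functions
    of u and the parameters. At zero parameters [K_u] gives the pair (-2 b u, 0) and [y K] the pair
    (0, - b u^2). Their determinant has order 3 in u, and the quotient is spanned by 1, y, u y,
    whence three unfolding parameters.

    A flow yields equivalences only for e near 0; the weights carry such an e to 1. The field has to
    vanish at the origin for zero parameters, since otherwise the singularity would move. Each
    change of coordinates carries its inverse, the flow of the opposite field, so equivalence is
    symmetric by construction.

    Persistence is not a property of germs: a change of coordinates does not carry a ball to itself,
    so a transition point could enter or leave. For the normal form these points tend to the origin
    with the parameters, which allows one to pass between balls. *)

Section Differentiability.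
Context {R : realType}.
Implicit Types V W : normedModType R.

Lemma nearP V (x : V) (P : V -> Prop) :
  (\forall y \near x, P y) <-> exists2 d : R, 0 < d & forall y, `|y - x| < d -> P y.
Proof.
split=> [/nbhs_ballP[d d0 H]|[d d0 H]].
  exists d => // y yx; apply: H; by rewrite -ball_normE /ball_ /= distrC.
apply/nbhs_ballP; exists d => // y; rewrite -ball_normE /ball_ /= distrC; exact: H.
Qed.

Lemma near0P V (P : V -> Prop) :
  (\forall y \near (0 : V), P y) <-> exists2 d : R, 0 < d & forall y, `|y| < d -> P y.
Proof.
by rewrite nearP; split=> -[d d0 H]; exists d => // y; move: (H y); rewrite subr0.
Qed.

Lemma contP V W (f : V -> W) (x : V) :
  {for x, continuous f} <->
  forall e : R, 0 < e -> exists2 d : R, 0 < d & forall y, `|y - x| < d -> `|f y - f x| < e.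
Proof.
split=> [fc e e0|H].
  by apply/nearP; move/cvgrPdist_lt: fc => /(_ e e0); under eq_near do rewrite distrC.
apply/cvgrPdist_lt => e e0; under eq_near do rewrite distrC; apply/nearP; exact: H.
Qed.

Definition mklin V W (f : V -> W) (lf : linear f) : {linear V -> W} :=
  HB.pack f (GRing.isLinear.Build R V W _ f lf).

Lemma linear_bound V W (f : {linear V -> W}) : continuous f ->
  exists2 M : R, 0 < M & forall x, `|f x| <= M * `|x|.
Proof.
move=> fc; have /contP /(_ 1 ltr01) [d d0 H] := fc 0.
exists (2 / d); first by rewrite divr_gt0.
move=> x; have [->|x0] := eqVneq x 0; first by rewrite raddf0 !normr0 mulr0.
have nx : 0 < `|x| by rewrite normr_gt0.
pose a := (d / 2) / `|x|.
have a0 : 0 < a by rewrite !divr_gt0.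
have aE : `|a| * `|x| = d / 2 by rewrite gtr0_norm// /a divfK ?gt_eqF.
have := H (a *: x); rewrite subr0 raddf0 subr0 linearZ (normrZ a x) (normrZ a (f x)) aE.
rewrite ltr_pdivrMr// ltr_pMr// ltr1n => /(_ isT).
rewrite gtr0_norm// /a mulrAC ltr_pdivrMr// mul1r => /ltW h.
have -> : `|f x| = 2 / d * (d / 2 * `|f x|) by field; rewrite gt_eqF.
by apply: ler_wpM2l => //; rewrite divr_ge0 ?ltW.
Qed.

Lemma linear_bound_continuous V W (f : {linear V -> W}) (M : R) :
  (forall x, `|f x| <= M * `|x|) -> continuous f.
Proof.
move=> Mf x; apply/contP => e e0; exists (e / (`|M| + 1)).
  by rewrite divr_gt0 // ltr_wpDl.
move=> y; rewrite ltr_pdivlMr ?ltr_wpDl// => yx.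
rewrite -linearB; apply: le_lt_trans (Mf _) _; apply: le_lt_trans yx.
by rewrite mulrC ler_wpM2l// (le_trans (ler_norm _))// lerDl.
Qed.

Lemma differentiable_approx V W (f : V -> W) (x : V) (L : {linear V -> W}) :
  continuous L ->
  (forall e : R, 0 < e -> exists2 d : R, 0 < d & forall h, `|h| < d -> `|f (h + x) - f x - L h| <= e * `|h|) ->
  differentiable f x /\ 'd f x = L :> (V -> W).
Proof.
move=> Lc fo.
have E : f \o shift x = cst (f x) + L +o_ (0 : V) id.
  apply/eqaddoP => e e0; apply/near0P; have [d d0 H] := fo e e0; exists d => // h hd.
  by have := H h hd; rewrite /= opprD addrA.
have dE := diff_unique Lc E.
by split=> //; apply/diff_locallyP; rewrite dE.
Qed.

Lemma differentiable_approxP V W (f : V -> W) (x : V) (e : R) :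
  differentiable f x -> 0 < e ->
  exists2 d : R, 0 < d & forall h, `|h| < d -> `|f (h + x) - f x - 'd f x h| <= e * `|h|.
Proof.
move=> /diff_locally/eqaddoP /(_ e) fo /fo /near0P [d d0 H]; exists d => // h hd.
by have := H h hd; rewrite /= opprD addrA.
Qed.

Lemma near_differentiable V W (f g : V -> W) (x : V) :
  (\forall y \near x, f y = g y) -> differentiable f x -> differentiable g x.
Proof.
move=> fg df.
suff [] : differentiable g x /\ 'd g x = 'd f x :> (V -> W) by [].
apply: differentiable_approx; first exact: diff_continuous.
move=> e e0; have [d d0 H] := differentiable_approxP df e0.
have [d' d'0 H'] := (nearP _ _).1 fg.
exists (Num.min d d'); first by rewrite lt_min d0.
move=> h; rewrite lt_min => /andP[hd hd'].
by rewrite -(nbhs_singleton fg) -H' ?addrK//; exact: H.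
Qed.

Lemma derive_lin V W (f : V -> W) x (v w : V) (a : R) : differentiable f x ->
  'D_(a *: v + w) f x = a *: 'D_v f x + 'D_w f x.
Proof. by move=> df; rewrite !deriveE // linearP. Qed.

Lemma linear_derive V W (L : {linear V -> W}) v x : is_derive x v L (L v).
Proof.
suff H : (fun h : R => h^-1 *: (L (h *: v + x) - L x)) @ 0^' --> L v.
  by apply: DeriveDef; [apply/cvg_ex; exists (L v)|exact: cvg_lim].
apply: cvg_near_cst; near=> h.
rewrite linearP addrK scalerA mulVf ?scale1r//; near: h; exact: nbhs_dnbhs_neq.
Unshelve. all: by end_near. Qed.

Lemma line_derive V W (f : V -> W) (v z : V) (t : R) :
  derivable f (t *: v + z) v ->
  is_derive t (1 : R) (fun s : R => f (s *: v + z)) ('D_v f (t *: v + z)).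
Proof.
move=> df; rewrite /derivable /derive in df *.
have E : (fun h : R => h^-1 *: (f ((h *: 1 + t) *: v + z) - f (t *: v + z))) =
         (fun h : R => h^-1 *: (f (h *: v + (t *: v + z)) - f (t *: v + z))).
  by apply/funext => h; rewrite scalerDl addrA /GRing.scale /= mulr1.
by apply: DeriveDef; rewrite /derivable /derive /= E.
Qed.

Lemma mvt_line V (f : V -> R) (v z : V) (t : R) :
  (forall s : R, `|s| <= `|t| -> derivable f (s *: v + z) v) ->
  exists2 s : R, `|s| <= `|t| & f (t *: v + z) - f z = t * 'D_v f (s *: v + z).
Proof.
move=> df.
have cont s : `|s| <= `|t| -> {for s, continuous (fun s : R => f (s *: v + z))}.
  move=> /df /line_derive H.
  by apply: differentiable_continuous; apply/derivable1_diffP; case: H.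
have [t0|t0|<-] := ltgtP 0 t; last first.
- by exists 0; rewrite ?normr0// scale0r add0r subrr mul0r.
- have tE : `|t| = - t by rewrite ltr0_norm.
  have dom s : s \in `[t, 0]%R -> `|s| <= `|t|.
    by rewrite in_itv/= => /andP[s0 st]; rewrite tE ler0_norm ?lerN2.
  have [|||s sI] := @MVT R (fun s => f (s *: v + z)) (fun s => 'D_v f (s *: v + z)) t 0.
  + by [].
  + move=> s sI; apply: line_derive; apply: df; apply: dom.
    exact: subset_itv_oo_cc sI.
  + apply: derivable_within_continuous => s /dom/df/line_derive; by case.
  + rewrite scale0r add0r sub0r => E; exists s; last first.
      by apply: oppr_inj; rewrite opprB E mulrN mulrC.
    by rewrite dom//; exact: subset_itv_oo_cc sI.
- have tE : `|t| = t by rewrite gtr0_norm.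
  have dom s : s \in `[0, t]%R -> `|s| <= `|t|.
    by rewrite in_itv/= => /andP[s0 st]; rewrite tE ger0_norm.
  have [|||s sI] := @MVT R (fun s => f (s *: v + z)) (fun s => 'D_v f (s *: v + z)) 0 t.
  + by [].
  + move=> s sI; apply: line_derive; apply: df; apply: dom.
    exact: subset_itv_oo_cc sI.
  + apply: derivable_within_continuous => s /dom/df/line_derive; by case.
  + rewrite scale0r add0r subr0 => E; exists s; last by rewrite E mulrC.
    by rewrite dom//; exact: subset_itv_oo_cc sI.
Qed.

End Differentiability.

(** A frame with continuous coordinate functionals. Frames concatenate along products, so all spaces
    built from [R], rows and pairs are covered, and a derivative in any direction is a combination
    of finitely many. *)
Class findim {R : realType} (V : normedModType R) : Prop := findimP :
  exists (I : finType) (e : I -> V) (l : I -> {linear V -> R}),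
    (forall i, continuous (l i)) /\ forall x, x = \sum_i l i x *: e i.

Section FinDim.
Context {R : realType}.
Implicit Types V W : normedModType R.

#[global] Instance findim_R : findim R.
Proof.
exists unit, (fun=> 1), (fun=> (mklin (f := @id R) (fun a x y => erefl))); split.
  by move=> _ x; exact: cvg_id.
by move=> x; rewrite (big_pred1 tt) => [|[]]//=; rewrite /GRing.scale/= mulr1.
Qed.

#[global] Instance findim_rV n : findim ('rV[R]_n : normedModType R).
Proof.
have L (i : 'I_n) : linear (fun x : 'rV[R]_n => x 0 i) by move=> a x y; rewrite !mxE.
exists 'I_n, (fun i => delta_mx 0 i), (fun i => mklin (@L i)); split.
  move=> i; apply: (@linear_bound_continuous _ _ _ _ 1) => x.
  rewrite mul1r /Num.norm/= mx_normrE.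
  by rewrite (le_trans _ (le_bigmax _ _ (0, i)))//=.
by move=> x; rewrite {1}(row_sum_delta x).
Qed.

Lemma linear_fst V W : linear (@fst V W). Proof. by []. Qed.
Lemma linear_snd V W : linear (@snd V W). Proof. by []. Qed.
Lemma linear_inl V W : linear (fun x : V => (x, 0 : W)).
Proof. by move=> a x y; rewrite [RHS]/GRing.add/= /add_pair/= scaler0 add0r. Qed.
Lemma linear_inr V W : linear (fun x : W => (0 : V, x)).
Proof. by move=> a x y; rewrite [RHS]/GRing.add/= /add_pair/= scaler0 add0r. Qed.

#[global] Instance findim_prod V W : findim V -> findim W -> findim (V * W : normedModType R)%type.
Proof.
move=> [I [e [l [lc le]]]] [J [f [k [kc ke]]]].
have L1 i : linear (fun x : V * W => l i x.1) by move=> a x y /=; rewrite linearP.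
have L2 i : linear (fun x : V * W => k i x.2) by move=> a x y /=; rewrite linearP.
exists (I + J)%type, (fun i => match i with inl i => (e i, 0) | inr j => (0, f j) end),
  (fun i => match i with inl i => mklin (@L1 i) | inr j => mklin (@L2 j) end); split.
  case=> i x /=.
    by apply: (@continuous_comp _ _ _ fst (l i)); [exact: cvg_fst|exact: lc].
  by apply: (@continuous_comp _ _ _ snd (k i)); [exact: cvg_snd|exact: kc].
move=> [x y]; rewrite big_sumType /=.
have -> : \sum_i l i x *: (e i, 0 : W) = (x, 0).
  rewrite [in RHS](le x).
  transitivity (\sum_i (mklin (@linear_inl V W) (l i x *: e i))).
    by apply: eq_bigr => i _; rewrite linearZ.
  by rewrite -linear_sum.
have -> : \sum_i k i y *: (0 : V, f i) = (0, y).
  rewrite [in RHS](ke y).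
  transitivity (\sum_i (mklin (@linear_inr V W) (k i y *: f i))).
    by apply: eq_bigr => i _; rewrite linearZ.
  by rewrite -linear_sum.
by rewrite /GRing.add/= /add_pair/= addr0 add0r.
Qed.

End FinDim.

(** * Rules for maps of class C^k *)

Section Calculus.
Context {R : realType}.
Implicit Types V W U : normedModType R.

Lemma open_near V (D : set V) x : open D -> D x -> \forall y \near x, D y.
Proof. by move=> oD Dx; exact: open_nbhs_nbhs. Qed.

Lemma Ck_ext k V W (D : set V) (f g : V -> W) : open D ->
  (forall x, D x -> f x = g x) -> Ck k D f -> Ck k D g.
Proof.
move=> oD; elim: k f g => [|k IH] f g fg /=.
  move=> fc x Dx; have := fc _ Dx; rewrite /prop_for/continuous_at -(fg _ Dx).
  apply: cvg_trans; apply: near_eq_cvg.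
  by apply: filterS (open_near oD Dx) => y /fg.
move=> [df Df]; split=> [x Dx|v].
  apply: near_differentiable (df _ Dx).
  by apply: filterS (open_near oD Dx) => y /fg.
apply: IH (Df v) => x Dx; apply: near_eq_derive.
by apply: filterS (open_near oD Dx) => y /fg.
Qed.

Lemma Ck_sub k V W (D D' : set V) (f : V -> W) : D' `<=` D -> Ck k D f -> Ck k D' f.
Proof.
move=> DD; elim: k f => [|k IH] f /=; first by move=> H x /DD; exact: H.
by move=> [df Df]; split=> [x /DD|v]; [exact: df|exact: IH].
Qed.

Lemma Ck_cont k V W (D : set V) (f : V -> W) : Ck k D f ->
  forall x, D x -> {for x, continuous f}.
Proof.
case: k => [//|k] [df _] x Dx; exact/differentiable_continuous/df.
Qed.

Lemma CkS k V W (D : set V) (f : V -> W) : Ck k.+1 D f -> Ck k D f.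
Proof.
elim: k f => [|k IH] f; first by move=> H x; exact: (Ck_cont H).
by case=> df Df; split=> // v; exact/IH/Df.
Qed.

Lemma Ck_cst k V W (D : set V) (a : W) : Ck k D (cst a).
Proof.
elim: k a => [|k IH] a /=; first by move=> x _; exact: cvg_cst.
split=> [x _|v]; first exact: differentiable_cst.
by rewrite [X in Ck k D X](_ : _ = cst 0)//; apply/funext => x; rewrite derive_cst.
Qed.

Lemma linear_Ck k V W (D : set V) (L : {linear V -> W}) : continuous L -> Ck k D L.
Proof.
move=> Lc; case: k => [|k] /=; first by move=> x _; exact: Lc.
split=> [x _|v]; first exact: linear_differentiable.
rewrite [X in Ck k D X](_ : _ = cst (L v)); first exact: Ck_cst.
by apply/funext => x; apply: derive_val; exact: linear_derive.
Qed.

Lemma CkD k V W (D : set V) (f g : V -> W) : open D ->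
  Ck k D f -> Ck k D g -> Ck k D (fun x => f x + g x).
Proof.
move=> oD; elim: k f g => [|k IH] f g /=.
  by move=> fc gc x Dx; apply: cvgD; [exact: fc|exact: gc].
move=> [df Df] [dg Dg]; split=> [x Dx|v].
  by apply: differentiableD; [exact: df|exact: dg].
apply: Ck_ext (IH _ _ (Df v) (Dg v)) => // x Dx /=.
by rewrite deriveD//; apply: diff_derivable; [exact: df|exact: dg].
Qed.

Lemma Ck_linpost k V W U (D : set V) (L : {linear W -> U}) (f : V -> W) :
  open D -> continuous L -> Ck k D f -> Ck k D (fun x => L (f x)).
Proof.
move=> oD Lc; elim: k f => [|k IH] f /=.
  by move=> fc x Dx; apply: continuous_comp; [exact: fc|exact: Lc].
move=> [df Df]; split=> [x Dx|v].
  by apply: differentiable_comp; [exact: df|exact: linear_differentiable].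
apply: Ck_ext (IH _ (Df v)) => // x Dx /=.
have dfx := df _ Dx; have dL : differentiable L (f x) by exact: linear_differentiable.
rewrite (deriveE _ dfx) (deriveE v (differentiable_comp dfx dL)).
by rewrite (diff_comp dfx dL)/= diff_lin.
Qed.

Lemma Ck_sum k V W (D : set V) (I : Type) (s : seq I) (f : I -> V -> W) : open D ->
  (forall i, Ck k D (f i)) -> Ck k D (fun x => \sum_(i <- s) f i x).
Proof.
move=> oD Cf; elim: s => [|i s IH].
  by apply: (Ck_ext oD _ (Ck_cst k D 0)) => x _; rewrite big_nil.
by apply: (Ck_ext oD _ (CkD oD (Cf i) IH)) => x _; rewrite big_cons.
Qed.

Lemma CkM k V (D : set V) (f g : V -> R) : open D ->
  Ck k D f -> Ck k D g -> Ck k D (fun x => f x * g x).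
Proof.
move=> oD; elim: k f g => [|k IH] f g.
  by move=> fc gc x Dx; apply: cvgM; [exact: fc|exact: gc].
move=> Cf Cg; move: (Cf) (Cg) => [df Df] [dg Dg]; split=> [x Dx|v].
  by apply: differentiableM; [exact: df|exact: dg].
apply: Ck_ext (CkD oD (IH _ _ (CkS Cf) (Dg v)) (IH _ _ (CkS Cg) (Df v))) => // x Dx /=.
by rewrite deriveM//; apply: diff_derivable; [exact: df|exact: dg].
Qed.

Lemma continuous_scaler V (w : V) : continuous (fun a : R => a *: w).
Proof. exact: scalel_continuous. Qed.

Lemma linear_scaler V (w : V) : linear (fun a : R => a *: w).
Proof. by move=> a x y; rewrite scalerDl scalerA. Qed.

Lemma CkZ k V W (D : set V) (a : V -> R) (f : V -> W) : findim W -> open D ->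
  Ck k D a -> Ck k D f -> Ck k D (fun x => a x *: f x).
Proof.
move=> [I [e [l [lc le]]]] oD Ca Cf.
apply: (Ck_ext (f := fun x => \sum_i (mklin (@linear_scaler W (e i)) (a x * l i (f x))))) => //.
  move=> x _ /=; rewrite [in RHS](le (f x)) scaler_sumr.
  by apply: eq_bigr => i _; rewrite scalerA.
apply: Ck_sum => // i; apply: Ck_linpost => //; first exact: continuous_scaler.
by apply: CkM => //; exact: Ck_linpost.
Qed.

Lemma Ck_pair k V W U (D : set V) (f : V -> W) (g : V -> U) : open D ->
  Ck k D f -> Ck k D g -> Ck k D (fun x => (f x, g x)).
Proof.
move=> oD; elim: k f g => [|k IH] f g.
  by move=> fc gc x Dx; apply: cvg_pair; [exact: fc|exact: gc].
move=> [df Df] [dg Dg]; split=> [x Dx|v].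
  by apply: differentiable_pair; [exact: df|exact: dg].
apply: Ck_ext (IH _ _ (Df v) (Dg v)) => // x Dx /=.
have dfx := df _ Dx; have dgx := dg _ Dx.
by rewrite (deriveE _ dfx) (deriveE _ dgx) (deriveE _ (differentiable_pair dfx dgx)) diff_pair.
Qed.

(** In a frame of [W] the chain rule is a finite sum of products of a coordinate of ['D_v g] and a
    partial derivative of [f] composed with [g]; the induction hypothesis covers the second
    factor. *)
Lemma Ck_comp k V W U (D : set V) (D' : set W) (f : W -> U) (g : V -> W) :
  findim W -> findim U -> open D -> open D' -> (forall x, D x -> D' (g x)) ->
  Ck k D' f -> Ck k D g -> Ck k D (fun x => f (g x)).
Proof.
move=> fW fU oD oD' DD; elim: k f g DD => [|k IH] f g DD.
  by move=> fc gc x Dx; apply: continuous_comp; [exact: gc|exact/fc/DD].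
move=> [df Df] Cg; move: (Cg) => [dg Dg]; split=> [x Dx|v].
  by apply: differentiable_comp; [exact: dg|exact/df/DD].
have [I [e [l [lc le]]]] := fW.
apply: (Ck_ext (f := fun x => \sum_i l i ('D_v g x) *: 'D_(e i) f (g x))) => //.
  move=> x Dx; have dgx := dg _ Dx; have dfx := df _ (DD _ Dx).
  rewrite [RHS](deriveE _ (differentiable_comp dgx dfx)) (diff_comp dgx dfx)/=.
  rewrite -(deriveE _ dgx) [in RHS](le ('D_v g x)) linear_sum; apply: eq_bigr => i _.
  by rewrite linearZ/= -deriveE.
apply: Ck_sum => // i; apply: CkZ => //; first exact: (Ck_linpost oD (lc i) (Dg v)).
exact: (IH ('D_(e i) f) g DD (Df _) (CkS Cg)).
Qed.

Lemma near_CkP k V W (D : set V) (f : V -> W) :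
  (forall x, D x -> exists2 D', open D' /\ D' x & Ck k D' f) -> Ck k D f.
Proof.
elim: k f => [|k IH] f H.
  by move=> x /H [D' [oD' D'x] /(_ x D'x)].
split=> [x /H [D' [oD' D'x] [H' _]]|v]; first exact: H'.
by apply: IH => x /H [D' oD' [_ /(_ v)]] ?; exists D'.
Qed.

(* The mean value theorem along the coordinate directions, one at a time. *)
Lemma C1_differentiable V (D : set V) (f : V -> R) (I : finType) (e : I -> V)
  (l : I -> {linear V -> R}) (x : V) : open D -> D x ->
  (forall i, continuous (l i)) -> (forall x, x = \sum_i l i x *: e i) ->
  (forall i y, D y -> derivable f y (e i)) ->
  (forall i, {for x, continuous ('D_(e i) f)}) -> differentiable f x.
Proof.
move=> oD Dx lc le df Dfc.
pose g i : R := 'D_(e i) f x.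
have L : linear (fun h => \sum_i l i h * g i).
  move=> a u v; rewrite scaler_sumr -big_split/=; apply: eq_bigr => i _.
  by rewrite linearP mulrDl scalerAl.
have lb i := linear_bound (lc i).
have nlb i : exists C : R, 0 < C /\ forall h, `|l i h| <= C * `|h|.
  by have [C C0 H] := lb i; exists C.
have [C HC] := choice nlb.
suff [] : differentiable f x /\ 'd f x = mklin L :> (V -> R) by [].
apply: differentiable_approx.
  apply: (@linear_bound_continuous _ _ _ _ (\sum_i C i * `|g i|)) => h /=.
  rewrite mulr_suml; apply: le_trans (ler_norm_sum _ _ _) _; apply: ler_sum => i _.
  by rewrite normrM mulrAC ler_wpM2r//; exact: (HC i).2.
suff H (s : seq I) : forall ep : R, 0 < ep -> exists2 d : R, 0 < d & forall h, `|h| < d ->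
    `|f (\sum_(i <- s) l i h *: e i + x) - f x - \sum_(i <- s) l i h * g i| <= ep * `|h|.
  move=> ep ep0; have [d d0 Hd] := H (enum I) _ ep0; exists d => // h /Hd.
  by rewrite !big_enum/= -le.
elim: s => [|i s IH] ep ep0.
  exists 1 => // h _; rewrite !big_nil add0r !subrr normr0 mulr_ge0// ltW//.
have [d d0 Hd] := IH (ep / 2) (divr_gt0 ep0 (ltr0Sn _ _)).
have Ci0 := (HC i).1.
have ep'0 : 0 < ep / 2 / C i by rewrite !divr_gt0.
have [d1 d10 H1] := (contP _ _).1 (Dfc i) _ ep'0.
have [d2 d20 H2] := (nearP _ _).1 (open_near oD Dx).
(* All points met while the coordinates of [h] are changed one by one lie within [M] times the norm
   of [h] from [x]; [d'] is chosen accordingly. *)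
pose M := C i * `|e i| + \sum_(j <- s) C j * `|e j|.
have M0 : 0 <= M.
  apply: addr_ge0; first by rewrite mulr_ge0// ltW.
  by apply: sumr_ge0 => j _; rewrite mulr_ge0// ltW// (HC j).1.
pose d' := Num.min d (Num.min d1 d2 / (M + 1)).
exists d'; first by rewrite /d' lt_min d0 divr_gt0 ?lt_min ?d10// ltr_wpDl.
move=> h; rewrite lt_min => /andP[hd hd'].
have hM (t : R) : `|t| <= `|l i h| ->
    `|t *: e i + (\sum_(j <- s) l j h *: e j + x) - x| < Num.min d1 d2.
  move=> tl; rewrite addrA addrK.
  move: hd'; rewrite ltr_pdivlMr ?ltr_wpDl// => hd'.
  apply: le_lt_trans hd'; rewrite mulrDr mulr1.
  apply: (@le_trans _ _ (`|h| * M)); last by rewrite lerDl.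
  rewrite mulrC mulrDl; apply: le_trans (ler_normD _ _) _; apply: lerD.
    rewrite normrZ mulrAC ler_wpM2r//; exact: le_trans tl ((HC i).2 h).
  rewrite mulr_suml; apply: le_trans (ler_norm_sum _ _ _) _; apply: ler_sum => j _.
  by rewrite normrZ mulrAC ler_wpM2r//; exact: (HC j).2.
rewrite !big_cons; set z := \sum_(j <- s) _ + x in hM *.
have [|t tl E] := @mvt_line _ _ f (e i) z (l i h).
  by move=> t tl; apply: df; apply: H2; have := hM t tl; rewrite lt_min => /andP[].
rewrite -(addrA (l i h *: e i)) -/z.
have -> : f (l i h *: e i + z) - f x - (l i h * g i + \sum_(j <- s) l j h * g j) =
  (f z - f x - \sum_(j <- s) l j h * g j) + (f (l i h *: e i + z) - f z - l i h * g i).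
  by ring.
rewrite E -mulrBr; apply: le_trans (ler_normD _ _) _; rewrite [ep]splitr mulrDl.
apply: lerD; first exact: Hd.
rewrite normrM; have := hM t tl; rewrite lt_min => /andP[ht _].
have /ltW H3 := H1 _ ht.
apply: (@le_trans _ _ ((C i * `|h|) * (ep / 2 / C i))).
  by apply: ler_pM => //; exact: (HC i).2.
by rewrite mulrC mulrA divfK ?gt_eqF.
Qed.

(* Coordinates of [W] reduce the vector-valued case to [C1_differentiable]. *)
Lemma CkS_intro k V W (D : set V) (f : V -> W) (I : finType) (e : I -> V)
  (l : I -> {linear V -> R}) : findim W -> open D ->
  (forall i, continuous (l i)) -> (forall x, x = \sum_i l i x *: e i) ->
  (forall i y, D y -> derivable f y (e i)) ->
  (forall i, Ck k D ('D_(e i) f)) -> Ck k.+1 D f.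
Proof.
move=> [J [e' [l' [lc' le']]]] oD lc le df Df.
have dl (L : {linear W -> R}) v y : continuous L -> derivable f y v ->
    is_derive y v (fun x => L (f x)) (L ('D_v f y)).
  move=> Lc dfy.
  have H : (fun h : R => h^-1 *: (L (f (h *: v + y)) - L (f y))) @ 0^' --> L ('D_v f y).
    rewrite [X in X @ _](_ : _ = L \o (fun h : R => h^-1 *: (f (h *: v + y) - f y))).
      by move: dfy; rewrite /derivable => dfy; apply: cvg_comp (dfy) (Lc _).
    by apply/funext => h /=; rewrite linearZ (raddfB L).
  by apply: DeriveDef; [apply/cvg_ex; exists (L (derive f y v))|exact: cvg_lim].
have diff x : D x -> differentiable f x.
  move=> Dx.
  have -> : f = (fun x => \sum_j (mklin (@linear_scaler W (e' j)) (l' j (f x)))).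
    by apply/funext => y; rewrite {1}(le' (f y)).
  rewrite (_ : (fun _ => _) = \sum_j (fun x => mklin (@linear_scaler W (e' j)) (l' j (f x)))); last first.
    by apply/funext => y; rewrite fct_sumE.
  elim/big_ind: _ => [|g h dg dh|j _]; first exact: differentiable_cst.
    exact: differentiableD.
  apply: (@differentiable_comp _ _ _ _ (fun x => l' j (f x)) (mklin (@linear_scaler W (e' j)))); last first.
    apply: linear_differentiable; exact: continuous_scaler.
  apply: (C1_differentiable oD Dx lc le) => [i y Dy|i].
    by have [] := dl _ _ _ (lc' j) (df i y Dy).
  have := Ck_cont (Ck_linpost oD (lc' j) (Df i)) Dx.
  rewrite /prop_for/continuous_at.
  have [_ E] := dl _ _ _ (lc' j) (df i x Dx); rewrite -E.
  apply: cvg_trans; apply: near_eq_cvg; apply: filterS (open_near oD Dx) => y Dy.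
  by have [_ ->] := dl _ _ _ (lc' j) (df i y Dy).
split=> // v.
apply: (Ck_ext (f := fun x => \sum_i l i v *: 'D_(e i) f x)) => //.
  move=> x Dx; rewrite (deriveE v (diff x Dx)) [in RHS](le v) linear_sum.
  by apply: eq_bigr => i _; rewrite linearZ/= -deriveE//; exact: diff.
by apply: Ck_sum => // i; apply: CkZ => //; [exists J, e', l'|exact: Ck_cst].
Qed.

End Calculus.

(** One neighborhood serves all orders. Hence smoothness at a point spreads to nearby points, and at
    0 it is the condition [smooth_near0]. *)
Definition smoothAt {R : realType} {V W : normedModType R} (x : V) (f : V -> W) : Prop :=
  exists2 D : set V, open D /\ D x & smooth D f.

Section SmoothAt.
Context {R : realType}.
Implicit Types V W U : normedModType R.

Lemma smoothAt_near V W (x : V) (f g : V -> W) :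
  (\forall y \near x, f y = g y) -> smoothAt x f -> smoothAt x g.
Proof.
move=> fg [D [oD Dx] Df].
have oI : open (D `&` (fun y => f y = g y)^°) by apply: openI => //; exact: open_interior.
exists (D `&` (fun y => f y = g y)^°); first by split=> //; split=> //; exact: fg.
move=> k; apply: (Ck_ext oI) (Ck_sub _ (Df k)) => [y [_ /interior_subset]//|y []//].
Qed.

Lemma near_comp V W (g : V -> W) (x : V) (P : W -> Prop) : {for x, continuous g} ->
  (\forall y \near g x, P y) -> \forall z \near x, P (g z).
Proof. by move=> gc H; exact: gc. Qed.

Lemma smoothAt_nbhs V W (x : V) (f : V -> W) : smoothAt x f ->
  \forall y \near x, smoothAt y f.
Proof.
move=> [D [oD Dx] Df]; apply: filterS (open_near oD Dx) => y Dy.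
by exists D.
Qed.

Lemma smoothP V W (D : set V) (f : V -> W) :
  (forall x, D x -> smoothAt x f) -> smooth D f.
Proof.
by move=> H k; apply: near_CkP => x /H [D' oD Df]; exists D'.
Qed.

Lemma smoothT_At V W (f : V -> W) x : smooth setT f -> smoothAt x f.
Proof. by move=> fs; exists setT => //; split=> //; exact: openT. Qed.

Lemma smoothAt_diff V W (x : V) (f : V -> W) : smoothAt x f -> differentiable f x.
Proof. by move=> [D [oD Dx] /(_ 1)[]] + _; exact. Qed.

Lemma smoothAt_cont V W (x : V) (f : V -> W) : smoothAt x f -> {for x, continuous f}.
Proof. by move=> /smoothAt_diff; exact: differentiable_continuous. Qed.

Lemma smoothAt_derive V W (x v : V) (f : V -> W) : smoothAt x f -> smoothAt x ('D_v f).
Proof.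
by move=> [D oD Df]; exists D => // k; have [_] := Df k.+1; exact.
Qed.

Lemma smoothAt_cst V W (x : V) (a : W) : smoothAt x (fun=> a).
Proof. by exists setT; [split=> //; exact: openT|move=> k; exact: Ck_cst]. Qed.

Lemma smoothAt_lin V W (x : V) (L : {linear V -> W}) : continuous L -> smoothAt x L.
Proof. by move=> Lc; exists setT; [split=> //; exact: openT|move=> k; exact: linear_Ck]. Qed.

Lemma smoothAt_id V (x : V) : smoothAt x (fun z => z).
Proof. by apply: (@smoothAt_lin V V x (mklin (f := @id V) (fun a x y => erefl))) => y; exact: cvg_id. Qed.

Lemma smoothAt2 V W W' U (x : V) (f : V -> W) (g : V -> W') (h : V -> U) :
  (forall k D, open D -> Ck k D f -> Ck k D g -> Ck k D h) ->
  smoothAt x f -> smoothAt x g -> smoothAt x h.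
Proof.
move=> H [D [oD Dx] Df] [D' [oD' D'x] Dg].
exists (D `&` D'); first by split=> //; exact: openI.
by move=> k; apply: H; [exact: openI|exact: Ck_sub (Df k)|exact: Ck_sub (Dg k)].
Qed.

Lemma smoothAtD V W (x : V) (f g : V -> W) :
  smoothAt x f -> smoothAt x g -> smoothAt x (fun z => f z + g z).
Proof. by apply: smoothAt2 => k D; exact: CkD. Qed.

Lemma smoothAtM V (x : V) (f g : V -> R) :
  smoothAt x f -> smoothAt x g -> smoothAt x (fun z => f z * g z).
Proof. by apply: smoothAt2 => k D; exact: CkM. Qed.

Lemma smoothAtZ V W (x : V) (a : V -> R) (f : V -> W) : findim W ->
  smoothAt x a -> smoothAt x f -> smoothAt x (fun z => a z *: f z).
Proof. by move=> fW; apply: smoothAt2 => k D; exact: CkZ. Qed.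

Lemma smoothAt_pair V W U (x : V) (f : V -> W) (g : V -> U) :
  smoothAt x f -> smoothAt x g -> smoothAt x (fun z => (f z, g z)).
Proof. by apply: smoothAt2 => k D; exact: Ck_pair. Qed.

Lemma smoothAt_linpost V W U (x : V) (L : {linear W -> U}) (f : V -> W) :
  continuous L -> smoothAt x f -> smoothAt x (fun z => L (f z)).
Proof.
move=> Lc [D [oD Dx] Df]; exists D => // k; exact: Ck_linpost.
Qed.

Lemma smoothAt_fst V W U (x : V) (f : V -> W * U) :
  smoothAt x f -> smoothAt x (fun z => (f z).1).
Proof.
apply: (@smoothAt_linpost _ _ _ x (mklin (@linear_fst _ W U)) f) => y; exact: cvg_fst.
Qed.

Lemma smoothAt_snd V W U (x : V) (f : V -> W * U) :
  smoothAt x f -> smoothAt x (fun z => (f z).2).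
Proof.
apply: (@smoothAt_linpost _ _ _ x (mklin (@linear_snd _ W U)) f) => y; exact: cvg_snd.
Qed.

Lemma smoothAtN V W (x : V) (f : V -> W) : smoothAt x f -> smoothAt x (fun z => - f z).
Proof.
have L : linear (fun w : W => - w) by move=> a u v; rewrite opprD scalerN.
apply: (@smoothAt_linpost _ _ _ x (mklin L) f) => y; exact: opp_continuous.
Qed.

Lemma smoothAtB V W (x : V) (f g : V -> W) :
  smoothAt x f -> smoothAt x g -> smoothAt x (fun z => f z - g z).
Proof. by move=> fs /smoothAtN; exact: smoothAtD. Qed.

Lemma smoothAtX V (x : V) (f : V -> R) n : smoothAt x f -> smoothAt x (fun z => f z ^+ n).
Proof.
move=> fs; elim: n => [|n IH]; first exact: smoothAt_cst.
by under eq_fun do rewrite exprS; exact: smoothAtM.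
Qed.

Lemma smoothAt_sum V W (x : V) (I : Type) (s : seq I) (f : I -> V -> W) :
  (forall i, smoothAt x (f i)) -> smoothAt x (fun z => \sum_(i <- s) f i z).
Proof.
move=> fs; elim: s => [|i s IH].
  by under eq_fun do rewrite big_nil; exact: smoothAt_cst.
by under eq_fun do rewrite big_cons; exact: smoothAtD.
Qed.

Lemma smoothAt_comp V W U (x : V) (f : W -> U) (g : V -> W) : findim W -> findim U ->
  smoothAt (g x) f -> smoothAt x g -> smoothAt x (fun z => f (g z)).
Proof.
move=> fW fU [D' [oD' D'x] Df] [D [oD Dx] Dg].
have oI : open (D `&` (g @^-1` D')).
  have gc : {in D, continuous g}.
    by move=> y; rewrite inE => Dy; exact: (Ck_cont (Dg 0)).
  rewrite openE => y [Dy gy]; apply: filterI; first exact: open_near.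
  by apply: (gc y); rewrite ?inE//; exact: open_near.
exists (D `&` (g @^-1` D')); first by split.
move=> k; apply: (Ck_comp (D' := D')) => //; last exact: Ck_sub (Dg k).
by move=> y [].
Qed.

Lemma smoothAt_inv (x : R) : x != 0 -> smoothAt x (fun z : R => z^-1).
Proof.
move=> x0; have o0 : open [set z : R | z != 0].
  rewrite openE => z /= z0; apply: (nearP _ (fun y : R => y != 0)).2.
  exists `|z|; first by rewrite normr_gt0.
  by move=> y; apply: contraTneq => ->; rewrite sub0r normrN ltxx.
exists [set z : R | z != 0]; first by split.
have di z : z != 0 -> differentiable (fun z : R => z^-1) z.
  by move=> z0; exact: differentiableV.
elim=> [|k IH]; first by move=> z z0; exact/differentiable_continuous/di.
split=> // v.
apply: (Ck_ext (f := fun z : R => - v * (z^-1 * z^-1))) => //.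
  move=> z z0; rewrite (@deriveV _ _ id)//= derive_id.
  by rewrite /GRing.scale/= expr2 invfM mulNr mulrC mulNr.
by apply: CkM => //; [exact: Ck_cst|exact: CkM].
Qed.

Lemma smoothAtV V (x : V) (f : V -> R) : f x != 0 -> smoothAt x f ->
  smoothAt x (fun z => (f z)^-1).
Proof. by move=> fx; apply: smoothAt_comp => //; exact: smoothAt_inv. Qed.

Lemma derivable_pair V W U (f : V -> W) (g : V -> U) x v df dg :
  is_derive x v f df -> is_derive x v g dg ->
  is_derive x v (fun z => (f z, g z)) (df, dg).
Proof.
move=> [f1 <-] [g1 <-].
have H : (fun h : R => h^-1 *: ((f (h *: v + x), g (h *: v + x)) - (f x, g x))) @ 0^' -->
    ('D_v f x, 'D_v g x).
  by apply: cvg_pair; [exact: f1|exact: g1].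
by apply: DeriveDef; [apply/cvg_ex; exists ('D_v f x, 'D_v g x)|exact: cvg_lim].
Qed.

Lemma is_derive_post V W U (L : {linear W -> U}) (f : V -> W) x v df : continuous L ->
  is_derive x v f df -> is_derive x v (fun z => L (f z)) (L df).
Proof.
move=> Lc [f1 <-].
have H : (fun h : R => h^-1 *: (L (f (h *: v + x)) - L (f x))) @ 0^' --> L ('D_v f x).
  rewrite [X in X @ _](_ : _ = L \o (fun h : R => h^-1 *: (f (h *: v + x) - f x))).
    by move: f1; rewrite /derivable => f1; apply: cvg_comp (f1) (Lc _).
  by apply/funext => h /=; rewrite linearZ (raddfB L).
by apply: DeriveDef; [apply/cvg_ex; exists (L ('D_v f x))|exact: cvg_lim].
Qed.

Lemma is_derive_fst V W U (f : V -> W * U) x v df :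
  is_derive x v f df -> is_derive x v (fun z => (f z).1) df.1.
Proof. by apply: (is_derive_post (L := mklin (@linear_fst _ W U))) => y; exact: cvg_fst. Qed.

Lemma is_derive_snd V W U (f : V -> W * U) x v df :
  is_derive x v f df -> is_derive x v (fun z => (f z).2) df.2.
Proof. by apply: (is_derive_post (L := mklin (@linear_snd _ W U))) => y; exact: cvg_snd. Qed.

(* The chain rule along the curve [t |-> g (x + t v)], which need only be derivable. *)
Lemma is_derive_chain V W U (f : W -> U) (g : V -> W) x v dg :
  is_derive x v g dg -> differentiable f (g x) ->
  is_derive x v (fun z => f (g z)) ('D_dg f (g x)).
Proof.
move=> [g1 gE] df.
pose c (t : R) := g (t *: v + x).
have c0 : c 0 = g x by rewrite /c scale0r add0r.
have [dc cE] : is_derive (0 : R) (1 : R) c dg.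
  by rewrite -gE -[X in 'D_v g X](add0r x) -(scale0r v); apply: line_derive; rewrite scale0r add0r.
have dc' : differentiable c 0 by exact/derivable1_diffP.
have dfc : differentiable f (c 0) by rewrite c0.
have [D E] : is_derive (0 : R) (1 : R) (f \o c) ('D_dg f (g x)).
  apply: DeriveDef; first exact/derivable1_diffP/differentiable_comp.
  rewrite deriveE; last exact: differentiable_comp.
  by rewrite (diff_comp dc' dfc)/= -(deriveE _ dc') cE -deriveE// c0.
have HE : (fun h : R => h^-1 *: (f (g (h *: v + x)) - f (g x))) =
    (fun h : R => h^-1 *: ((f \o c) (h *: 1 + 0) - (f \o c) 0)).
  by apply/funext => h /=; rewrite c0 /c addr0 /GRing.scale/= mulr1.
by move: D E; rewrite /derivable /derive -HE.
Qed.

Lemma smoothAt_is_derive V W (f : V -> W) x v : smoothAt x f -> is_derive x v f ('D_v f x).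
Proof. by move=> /smoothAt_diff H; apply/derivableP; exact: diff_derivable. Qed.

Lemma derive_sumE V W (I : finType) (e : I -> V) (l : I -> {linear V -> R}) (f : V -> W) x v :
  (forall x, x = \sum_i l i x *: e i) -> differentiable f x ->
  'D_v f x = \sum_i l i v *: 'D_(e i) f x.
Proof.
move=> le df; rewrite deriveE// [in LHS](le v) linear_sum; apply: eq_bigr => i _.
by rewrite linearZ/= deriveE.
Qed.

(** In a frame of [V] the tangent map is a sum of products of a coordinate of the direction and a
    partial derivative at the point. This joint smoothness is needed to lift a vector field to
    tangent vectors. *)
Lemma smoothAt_tangent V W (x w : V) (f : V -> W) : findim V -> findim W ->
  smoothAt x f -> smoothAt (x, w) (fun p : V * V => 'D_(p.2) f p.1).
Proof.
move=> fV fW fs; have [I [e [l [lc le]]]] := fV.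
apply: (smoothAt_near (f := fun p : V * V => \sum_i l i p.2 *: 'D_(e i) f p.1)).
  have : \forall p \near (x, w), smoothAt p.1 f.
    apply: (@near_comp _ _ (@fst V V) (x, w) (fun y => smoothAt y f)).
      exact: cvg_fst.
    exact: smoothAt_nbhs.
  by apply: filterS => p /smoothAt_diff dp; rewrite -derive_sumE.
apply: smoothAt_sum => i; apply: smoothAtZ.
  by apply: smoothAt_linpost => //; apply: smoothAt_snd; exact: smoothAt_id.
apply: (@smoothAt_comp (V * V)%type V W (x, w) ('D_(e i) f) fst) => //=.
  exact: smoothAt_derive.
by apply: smoothAt_fst; exact: smoothAt_id.
Qed.

End SmoothAt.

(** Descends through polynomial expressions, pairs and projections. [assumption] comes first, so
    that composites proved smooth beforehand stop the descent. *)
Ltac sm1 := first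
 [ assumption
 | match goal with
   | |- smoothAt _ (@fst _ _) => refine (smoothAt_fst (smoothAt_id _))
   | |- smoothAt _ (@snd _ _) => refine (smoothAt_snd (smoothAt_id _))
   | |- smoothAt _ (fun _ => fst _) => refine (smoothAt_fst _)
   | |- smoothAt _ (fun _ => snd _) => refine (smoothAt_snd _)
   | |- smoothAt _ (fun x => x) => exact: smoothAt_id
   end
 | refine (smoothAt_cst _ _)
 | refine (smoothAtD _ _) | refine (smoothAtN _) | refine (smoothAtM _ _)
 | refine (smoothAtX _ _) | refine (smoothAt_pair _ _) | refine (smoothAtZ _ _ _); [exact _| |] ].
Ltac sm := repeat sm1.

(** * Mean value estimates, compactness and limits of derivatives *)

Section Estimates.
Context {R : realType}.
Implicit Types V W U E : normedModType R.

Lemma mvt01 V (f : V -> R) (v z : V) :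
  (forall s : R, 0 <= s <= 1 -> derivable f (s *: v + z) v) ->
  exists2 s : R, 0 <= s <= 1 & f (v + z) - f z = 'D_v f (s *: v + z).
Proof.
move=> df.
have [|||s sI] := @MVT R (fun s => f (s *: v + z)) (fun s => 'D_v f (s *: v + z)) 0 1.
- by [].
- move=> s sI; apply: line_derive; apply: df.
  by have := subset_itv_oo_cc sI; rewrite in_itv.
- apply: derivable_within_continuous => s; rewrite in_itv/= => /df/line_derive; by case.
- rewrite scale0r add0r scale1r subr0 mulr1 => E; exists s => //.
  by have := subset_itv_oo_cc sI; rewrite in_itv.
Qed.

Lemma findim_coord_bound V : findim V ->
  exists I : finType, exists e : I -> V, exists l : I -> {linear V -> R}, exists2 C : R, 0 < C &
  [/\ forall i, continuous (l i), forall x, x = \sum_i l i x *: e i,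
      forall i x, `|l i x| <= C * `|x| &
      forall (a : I -> R) (b : R), 0 <= b -> (forall i, `|a i| <= b) ->
        `|\sum_i a i *: e i| <= C * b].
Proof.
move=> [I [e [l [lc le]]]].
have Hc' i : exists c : R, 0 < c /\ forall x, `|l i x| <= c * `|x|.
  by have [M M0 H] := linear_bound (lc i); exists M.
have [c Hc] := choice Hc'.
pose C := 1 + \sum_i c i + \sum_i `|e i|.
have s1 : 0 <= \sum_i c i by apply: sumr_ge0 => i _; exact/ltW/(Hc i).1.
have s2 : 0 <= \sum_i `|e i| by apply: sumr_ge0 => i _.
exists I, e, l, C; first by rewrite /C -addrA ltr_wpDr// addr_ge0.
split=> // [i x|a b b0 ab].
  apply: le_trans ((Hc i).2 x) _; apply: ler_wpM2r => //.
  have s3 : 0 <= \sum_(j | j != i) c j by apply: sumr_ge0 => j _; exact/ltW/(Hc j).1.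
  by rewrite /C (bigD1 i)//=; move: s2 s3; lra.
apply: le_trans (ler_norm_sum _ _ _) _.
apply: (@le_trans _ _ (\sum_i `|e i| * b)).
  by apply: ler_sum => i _; rewrite normrZ mulrC ler_wpM2l.
by rewrite -mulr_suml ler_wpM2r// /C lerDr addr_ge0.
Qed.

Lemma closed_norm_le V (r : R) : closed [set x : V | `|x| <= r].
Proof.
exact: (continuous_closedP _).1 (@norm_continuous _ V) _ (@closed_le _ r).
Qed.

(** The coordinate functionals bound the coordinates of a point by its norm, so the ball is the
    continuous image of a closed bounded set of row vectors. *)
Lemma compact_closed_ball V (r : R) : findim V -> compact [set x : V | `|x| <= r].
Proof.
move=> /findim_coord_bound [I [e [l [C C0 [lc le lb eb]]]]].
have TL : linear (fun a : 'rV[R]_#|I| => \sum_i a 0 (enum_rank i) *: e i).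
  move=> a u v; rewrite scaler_sumr -big_split/=; apply: eq_bigr => i _.
  by rewrite !mxE scalerDl scalerA.
have cb (a : 'rV[R]_#|I|) j : `|a 0 j| <= `|a|.
  rewrite [leRHS]/Num.norm/= mx_normrE; exact: (le_trans _ (le_bigmax _ _ (0, j))).
have Tc : continuous (mklin TL).
  by apply: (linear_bound_continuous (M := C)) => a; apply: eb.
pose A : set 'rV[R]_#|I| := [set a | `|a| <= C * `|r|] `&` (mklin TL @^-1` [set x | `|x| <= r]).
have cA : compact A.
  apply: bounded_closed_compact.
    exists (C * `|r|); split; first exact: num_real.
    by move=> x xM a [/= Ha _]; exact: le_trans Ha (ltW xM).
  apply: closedI; last first.
    exact: (proj1 (continuous_closedP (mklin TL)) Tc _ (@closed_norm_le V r)).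
  exact: closed_norm_le.
rewrite (_ : mkset _ = mklin TL @` A).
  by apply: continuous_compact => //; exact: continuous_subspaceT.
apply/seteqP; split=> [x /= xr|x [a [_ Ha] <-]]; last exact: Ha.
have E : mklin TL (\row_j l (enum_val j) x) = x.
  by rewrite /= [RHS]le; apply: eq_bigr => i _; rewrite mxE enum_rankK.
exists (\row_j l (enum_val j) x); rewrite //; split; last by rewrite /= -[X in `|X| <= _]/(mklin TL _) E.
rewrite /= [leLHS]/Num.norm/= mx_normrE; apply: bigmax_le => [|[i j] _].
  by rewrite mulr_ge0// ltW.
rewrite mxE; apply: le_trans (lb _ _) _; apply: ler_wpM2l; first exact: ltW.
exact: le_trans xr (ler_norm r).
Qed.

Lemma bounded_on_balls V W (f : V -> W) (r : R) : findim V -> continuous f ->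
  exists2 B : R, 0 < B & forall x, `|x| <= r -> `|f x| <= B.
Proof.
move=> fV fc; have cK := @compact_closed_ball V r fV.
have /compact_bounded[M [_ HM]] : compact (f @` [set x : V | `|x| <= r]).
  by apply: continuous_compact => //; exact: continuous_subspaceT.
exists (`|M| + 1); first by rewrite ltr_wpDl.
move=> x xr; apply: (HM (`|M| + 1)); last by exists x.
by rewrite (le_lt_trans (ler_norm M))// ltrDl.
Qed.

Lemma lipschitz_ball V W (f : V -> W) (r : R) : findim V -> findim W ->
  (forall x, `|x| <= r -> differentiable f x) ->
  (forall v, exists B : R, forall x, `|x| <= r -> `|'D_v f x| <= B) ->
  exists2 L : R, 0 < L & forall x y, `|x| <= r -> `|y| <= r -> `|f x - f y| <= L * `|x - y|.
Proof.
move=> /findim_coord_bound [I [e [l [C C0 [lc le lb eb]]]]].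
move=> /findim_coord_bound [J [e' [l' [C' C'0 [lc' le' lb' eb']]]]] df Df.
have [B HB] := choice (fun i => Df (e i)).
pose S := \sum_i C * `|B i|.
have S0 : 0 <= S by apply: sumr_ge0 => i _; rewrite mulr_ge0// ltW.
exists (C' * (C' * S) + 1); first by rewrite ltr_wpDl// !mulr_ge0// ltW.
move=> x y xr yr; apply: (@le_trans _ _ (C' * (C' * S) * `|x - y|)); last first.
  by rewrite ler_wpM2r// lerDl.
rewrite [X in `|X|]le' -mulrA; apply: eb' => [|j].
  by rewrite !mulr_ge0// ltW.
have dfr s : 0 <= s <= 1 -> `|s *: (x - y) + y| <= r.
  move=> /andP[s0 s1].
  have -> : s *: (x - y) + y = s *: x + (1 - s) *: y.
    by rewrite scalerBr scalerBl scale1r addrAC addrA.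
  apply: le_trans (ler_normD _ _) _; rewrite !normrZ !ger0_norm ?subr_ge0//.
  rewrite (_ : r = s * r + (1 - s) * r); last by ring.
  by apply: lerD; apply: ler_wpM2l; rewrite ?subr_ge0.
have [|s s01] := @mvt01 _ (fun z => l' j (f z)) (x - y) y.
  move=> s /dfr/df; move=> H; have H1 : is_derive (s *: (x - y) + y) (x - y) f ('D_(x - y) f (s *: (x - y) + y)).
    by apply/derivableP; exact: diff_derivable.
  by have [] := is_derive_post (lc' j) H1.
rewrite subrK (linearB (l' j)) => ->.
have dz := df _ (dfr s s01).
have H1 : is_derive (s *: (x - y) + y) (x - y) f ('D_(x - y) f (s *: (x - y) + y)).
  by apply/derivableP; exact: diff_derivable.
have [_ ->] := is_derive_post (lc' j) H1.
apply: le_trans (lb' _ _) _; rewrite -mulrA; apply: ler_wpM2l; first exact: ltW.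
rewrite (derive_sumE _ le dz); apply: le_trans (ler_norm_sum _ _ _) _.
rewrite mulr_suml; apply: ler_sum => i _; rewrite normrZ mulrAC; apply: ler_pM => //.
exact: le_trans (HB i _ (dfr s s01)) (ler_norm _).
Qed.

Lemma smooth_lipschitz V W (f : V -> W) (r : R) : findim V -> findim W -> smooth setT f ->
  exists2 L : R, 0 < L & forall x y, `|x| <= r -> `|y| <= r -> `|f x - f y| <= L * `|x - y|.
Proof.
move=> fV fW fs; apply: lipschitz_ball => // [x _|v].
  exact/smoothAt_diff/smoothT_At.
have c : continuous ('D_v f).
  by move=> x; apply: smoothAt_cont; apply: smoothAt_derive; exact: smoothT_At.
by have [B _ HB] := bounded_on_balls r fV c; exists B.
Qed.

Lemma smoothAt_lipschitz V W (f : V -> W) : findim V -> findim W -> smoothAt 0 f ->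
  exists d L : R, [/\ 0 < d, 0 < L &
   forall x y, `|x| <= d -> `|y| <= d -> `|f x - f y| <= L * `|x - y|].
Proof.
move=> fV fW fs; have [I [e [l [C C0 [lc le lb eb]]]]] := findim_coord_bound fV.
have [d1 d10 H1] := (near0P _).1 (smoothAt_nbhs fs).
have H i : exists d : R, 0 < d /\ forall x, `|x| < d -> `|'D_(e i) f x| <= `|'D_(e i) f 0| + 1.
  have := smoothAt_cont (smoothAt_derive (e i) fs); move=> /contP /(_ 1 ltr01)[d d0 Hd].
  exists d; split=> // x xd; have := Hd x; rewrite subr0 => /(_ xd)/ltW.
  by move=> h; rewrite -lerBlDl (le_trans _ h)// lerB_dist.
have [d2 Hd2] := choice H.
pose d := \big[Order.min/d1]_i d2 i / 2.
have mpos : 0 < \big[Order.min/d1]_i d2 i.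
  by apply: lt_bigmin => // i _; exact: (Hd2 i).1.
have d0 : 0 < d by rewrite divr_gt0.
have dm : d < \big[Order.min/d1]_i d2 i by rewrite /d ltr_pdivrMr// ltr_pMr// ltr1n.
have dd1 x : `|x| <= d -> smoothAt x f.
  by move=> xd; apply: H1; apply: le_lt_trans xd (lt_le_trans dm _); exact: bigmin_le_id.
have [|v|L L0 HL] := @lipschitz_ball V W f d fV fW; last by exists d, L.
  by move=> x /dd1/smoothAt_diff.
exists (\sum_i `|l i v| * (`|'D_(e i) f 0| + 1)) => x xd.
rewrite (derive_sumE _ le (smoothAt_diff (dd1 x xd))).
apply: le_trans (ler_norm_sum _ _ _) _; apply: ler_sum => i _.
rewrite normrZ ler_wpM2l//; apply: (Hd2 i).2.
by apply: le_lt_trans xd (lt_le_trans dm _); exact: bigmin_le_cond.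
Qed.

(* [u n - 2 K / 2^n] is nondecreasing and [u n + 2 K / 2^n] nonincreasing. *)
Lemma cvg_dyadic (u : nat -> R) (K : R) :
  (forall n, `|u n - u n.+1| <= K / 2 ^+ n) ->
  exists l : R, u n @[n --> \oo] --> l /\ forall n, `|u n - l| <= 2 * K / 2 ^+ n.
Proof.
move=> H.
have p0 n : (0 : R) < 2 ^+ n by rewrite exprn_gt0.
have K0 : 0 <= K by have := le_trans (normr_ge0 _) (H 0%N); rewrite expr0 divr1.
pose t n : R := 2 * K / 2 ^+ n.
have t0 n : 0 <= t n by rewrite divr_ge0 ?mulr_ge0// ltW.
have tS n : t n - t n.+1 = K / 2 ^+ n by rewrite /t exprS; field; rewrite gt_eqF.
pose v n := u n - t n. pose w n := u n + t n.
have vi : nondecreasing_seq v.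
  apply/nondecreasing_seqP => n; have := H n; rewrite ler_norml => /andP[_ h].
  by rewrite /v; have := tS n; move: h; lra.
have wd : nonincreasing_seq w.
  apply/nonincreasing_seqP => n; have := H n; rewrite ler_norml => /andP[h _].
  by rewrite /w; have := tS n; move: h; lra.
have vw n m : v n <= w m.
  apply: (@le_trans _ _ (v (maxn n m))); first by apply: vi; exact: leq_maxl.
  apply: (@le_trans _ _ (w (maxn n m))); last by apply: wd; exact: leq_maxr.
  by rewrite /v /w; have := t0 (maxn n m); lra.
have vc : cvgn v.
  apply: nondecreasing_is_cvgn => //; exists (w 0%N) => _ [n _ <-]; exact: vw.
exists (limn v).
have B n : `|u n - limn v| <= t n.
  have h1 : v n <= limn v by exact: nondecreasing_cvgn_le.
  have h2 : limn v <= w n by apply: limr_le => //; apply: nearW => m; exact: vw.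
  by move: h1 h2; rewrite /v /w ler_norml; lra.
split=> //.
have tc : t n @[n --> \oo] --> 0.
  rewrite -(mulr0 (2 * K)); apply: cvgMr.
  rewrite (_ : (fun n => (2 ^+ n)^-1) = (fun n => (2^-1) ^+ n)); last first.
    by apply/funext => n; rewrite exprVn.
  by apply: cvg_expr; rewrite ger0_norm ?invr_ge0// invf_lt1 ?ltr1n.
apply/cvgrPdist_le => e e0; move/cvgrPdist_le: tc => /(_ e e0).
apply: filterS => n; rewrite sub0r normrN ger0_norm// distrC => h.
exact: le_trans (B n) h.
Qed.

(** The mean value theorem is applied to [f_ n], whose derivative is uniformly close to [G];
    continuity of [G] at [x] then controls the difference quotient of [F]. *)
Lemma derive_limit V (f_ : nat -> V -> R) (F G : V -> R) (x v : V) (d : R) (ep : nat -> R) :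
  0 < d -> ep n @[n --> \oo] --> 0 -> {for x, continuous G} ->
  (forall n y, `|y - x| < d -> derivable (f_ n) y v) ->
  (forall n y, `|y - x| < d -> `|f_ n y - F y| <= ep n) ->
  (forall n y, `|y - x| < d -> `|'D_v (f_ n) y - G y| <= ep n) ->
  is_derive x v F (G x).
Proof.
move=> d0 epc Gc fd fF fG.
suff H : (fun h : R => h^-1 *: (F (h *: v + x) - F x)) @ 0^' --> G x.
  by apply: DeriveDef; [apply/cvg_ex; exists (G x)|exact: cvg_lim].
apply/cvgrPdist_le => e e0.
have e20 : 0 < e / 2 by rewrite divr_gt0.
have /contP /(_ _ e20) [d1 d10 H1] := Gc.
have dv : 0 < Num.min d d1 / (`|v| + 1) by rewrite divr_gt0 ?lt_min ?d0// ltr_wpDl.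
near=> h.
have h0 : h != 0 by near: h; exact: nbhs_dnbhs_neq.
have hd : `|h| * `|v| < Num.min d d1.
  have : `|h| < Num.min d d1 / (`|v| + 1).
    by near: h; exact: dnbhs0_lt.
  rewrite ltr_pdivlMr ?ltr_wpDl//; apply: le_lt_trans.
  by rewrite ler_wpM2l// lerDl.
have sd s : `|s| <= `|h| -> `|s *: v + x - x| < Num.min d d1.
  by move=> sh; rewrite addrK normrZ; apply: le_lt_trans hd; rewrite ler_wpM2r.
suff : `|F (h *: v + x) - F x - h * G x| <= `|h| * e.
  move=> Hh; rewrite distrC.
  have -> : h^-1 *: (F (h *: v + x) - F x) - G x = h^-1 * (F (h *: v + x) - F x - h * G x).
    by rewrite /GRing.scale/=; field.
  by rewrite normrM normfV ler_pdivrMl ?normr_gt0// mulrC.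
(* [n] depends on [h]: two endpoint errors [ep n], plus the derivative error multiplied by the size
   of [h], must stay below the size of [h] times [e / 2]. *)
have [n Hn] : exists n, `|ep n| * (2 + `|h|) <= `|h| * (e / 2).
  have q0 : 0 < `|h| * (e / 2) / (2 + `|h|).
    by rewrite divr_gt0 ?mulr_gt0 ?normr_gt0// ltr_pwDl.
  move/cvgrPdist_le: epc => /(_ _ q0) [n _ Hn]; exists n.
  have := Hn n (leqnn n); rewrite /= sub0r normrN ler_pdivlMr// ltr_pwDl//.
have [|s sh E] := @mvt_line _ _ (f_ n) v x h.
  move=> s sh; apply: fd; have := sd s sh; by rewrite lt_min => /andP[].
have /andP[sd1 sd2] : (`|s *: v + x - x| < d) && (`|s *: v + x - x| < d1).
  by have := sd s sh; rewrite lt_min.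
have /andP[hd1 _] : (`|h *: v + x - x| < d) && (`|h *: v + x - x| < d1).
  by have := sd h (lexx _); rewrite lt_min.
have xd : `|x - x| < d by rewrite subrr normr0.
have epn := ler_norm (ep n).
have b1 := le_trans (fF n _ hd1) epn; have b2 := le_trans (fF n _ xd) epn.
have b3 := le_trans (fG n _ sd1) epn; have b4 := ltW (H1 _ sd2).
set A := f_ n (h *: v + x) in b1 E; set B := f_ n x in b2 E.
set D := 'D_v _ _ in b3 E; set G1 := G (s *: v + x) in b3 b4.
have -> : F (h *: v + x) - F x - h * G x =
  - (A - F (h *: v + x)) + (B - F x) + h * ((D - G1) + (G1 - G x)) by move: E; lra.
apply: le_trans (ler_normD _ _) _; rewrite normrM.
apply: (@le_trans _ _ ((`|ep n| + `|ep n|) + `|h| * (`|ep n| + e / 2))).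
  apply: lerD.
    by apply: le_trans (ler_normD _ _) _; rewrite normrN lerD.
  by rewrite ler_wpM2l//; apply: le_trans (ler_normD _ _) _; rewrite lerD.
by move: Hn; lra.
Unshelve. all: by end_near. Qed.

Lemma is_derive_sumf V W (J : Type) (s : seq J) (f : J -> V -> W) (df : J -> W) x v :
  (forall j, is_derive x v (f j) (df j)) ->
  is_derive x v (fun z => \sum_(j <- s) f j z) (\sum_(j <- s) df j).
Proof.
move=> H; elim: s => [|j s IH].
  rewrite big_nil; under eq_fun do rewrite big_nil; exact: is_derive_cst.
by rewrite big_cons; under eq_fun do rewrite big_cons; exact: is_deriveD.
Qed.

Lemma is_derive_coords V W (F : V -> W) (G : W) x v (J : finType) (e : J -> W)
    (l : J -> {linear W -> R}) : (forall w, w = \sum_j l j w *: e j) ->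
  (forall j, is_derive x v (fun z => l j (F z)) (l j G)) -> is_derive x v F G.
Proof.
move=> le H.
have -> : F = (fun z => \sum_j mklin (@linear_scaler _ W (e j)) (l j (F z))).
  by apply/funext => z /=; rewrite -le.
rewrite [G]le; apply: (@is_derive_sumf V W J _ (fun j z => mklin (@linear_scaler _ W (e j)) (l j (F z))) (fun j => l j G *: e j)) => j.
by apply: (is_derive_post (L := mklin (@linear_scaler _ W (e j)))) => //; exact: continuous_scaler.
Qed.

End Estimates.

(** * Flows *)

Definition estep {R : realType} {E : normedModType R} (X : E -> E) (h : R) (z : E) : E :=
  z + h *: X z.

(** Unit time in [2 ^ n] equal steps. Passing to [n.+1] halves every step, so successive polygons
    can be compared and [cvg_dyadic] applies. *)
Definition euler {R : realType} {E : normedModType R} (X : E -> E) (n : nat) : E -> E :=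
  iter (2 ^ n) (estep X (2 ^- n)).

Definition flow {R : realType} {E : normedModType R} (X : E -> E) (z : E) : E :=
  lim (euler X n z @[n --> \oo]).

(* Completeness, encoded as boundedness of the Euler polygons over unit time. *)
Definition complete_field {R : realType} {E : normedModType R} (X : E -> E) : Prop :=
  smooth setT X /\
  forall r : R, exists M : R, forall n j z, (j <= 2 ^ n)%N -> `|z| <= r ->
    `|iter j (estep X (2 ^- n)) z| <= M.

(** The first variation of [X]. Its Euler polygons are the derivatives of those of [X]
    ([iter_tangent]), which turns regularity of the flow into an induction over tangent lifts. *)
Definition tangent_field {R : realType} {E : normedModType R} (X : E -> E) (p : E * E) : E * E :=
  (X p.1, 'D_(p.2) X p.1).

Section Euler.
Context {R : realType}.
Implicit Types E : normedModType R.

(** The discrete Gronwall inequality. The induction works because [(1 + c) ^+ j.+1] is at least 1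
    and absorbs the new term [b]. *)
Lemma gronwall (u : nat -> R) (b c : R) N : 0 <= b -> 0 <= c -> 0 <= u 0%N ->
  (forall j, (j < N)%N -> u j.+1 <= (1 + c) * u j + b) ->
  forall j, (j <= N)%N -> u j <= (u 0%N + j%:R * b) * (1 + c) ^+ j.
Proof.
move=> b0 c0 u0 H; elim=> [|j IH] jN; first by rewrite mul0r addr0 expr0 mulr1.
apply: le_trans (H j jN) _.
have c1 : 1 <= (1 + c) ^+ j.+1 by rewrite exprn_ege1// lerDl.
have hb : b <= b * (1 + c) ^+ j.+1 by rewrite ler_peMr.
have := ler_wpM2l (addr_ge0 ler01 c0) (IH (ltnW jN)).
rewrite -natr1 exprS in hb c1 *; move: hb; lra.
Qed.

Lemma pow_le_exp (L : R) n j : 0 <= L -> (j <= 2 ^ n)%N ->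
  (1 + 2 ^- n * L) ^+ j <= expR L.
Proof.
move=> L0 jn.
have p0 : (0 : R) < 2 ^+ n by rewrite exprn_gt0.
apply: (@le_trans _ _ (expR (2 ^- n * L) ^+ j)).
  apply: lerXn2r; rewrite ?nnegrE ?expR_ge0//; last exact: expR_ge1Dx.
  by rewrite addr_ge0// mulr_ge0// invr_ge0 ltW.
rewrite -expRM_natl ler_expR mulrA -[leRHS]mul1r ler_wpM2r//.
by rewrite ler_pdivrMr// mul1r -natrX ler_nat.
Qed.

Lemma Ehalf n : (2 ^- n.+1 : R) = 2 ^- n / 2.
Proof. by rewrite exprS invfM mulrC. Qed.

Lemma h_gt0 n : (0 : R) < 2 ^- n.
Proof. by rewrite invr_gt0 exprn_gt0. Qed.

Lemma h_le1 n : (2 ^- n : R) <= 1.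
Proof. by rewrite invf_le1 ?exprn_gt0// exprn_ege1// ler1n. Qed.

Lemma h_mul n : (2 ^ n)%:R * 2 ^- n = 1 :> R.
Proof. by rewrite natrX mulfV// expf_neq0// pnatr_eq0. Qed.

Lemma h_cvg0 (K : R) : K * 2 ^- n @[n --> \oo] --> (0 : R).
Proof.
rewrite -(mulr0 K); apply: cvgMr.
rewrite (_ : (fun n => 2 ^- n) = (fun n => (2^-1) ^+ n)); last first.
  by apply/funext => n; rewrite exprVn.
by apply: cvg_expr; rewrite ger0_norm ?invr_ge0// invf_lt1 ?ltr1n.
Qed.

(* Two half steps differ from a full step by [O(h^2)]. *)
Lemma euler_cauchy E (X : E -> E) (r : R) : findim E -> complete_field X ->
  exists2 K : R, 0 < K & forall n z, `|z| <= r -> `|euler X n z - euler X n.+1 z| <= K / 2 ^+ n.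
Proof.
move=> fE [Xs Xb]; have [M HM] := Xb r.
have [L1 L10 HL] := smooth_lipschitz M fE fE Xs.
have [B B0 HB] := bounded_on_balls M fE (fun x => smoothAt_cont (smoothT_At x Xs)).
(* One constant bounds both [X] and its Lipschitz constant on the ball, so that a half step moves a
   point by at most [h / 2 * L] and the error recursion involves [h * L] only. *)
pose L := L1 + B.
have L0 : 0 < L by rewrite addr_gt0.
have HL' x y : `|x| <= M -> `|y| <= M -> `|X x - X y| <= L * `|x - y|.
  by move=> xM yM; apply: le_trans (HL _ _ xM yM) _; rewrite ler_wpM2r// lerDl ltW.
have HB' x : `|x| <= M -> `|X x| <= L.
  by move=> xM; apply: le_trans (HB _ xM) _; rewrite lerDr ltW.
exists (L ^+ 2 * expR L); first by rewrite mulr_gt0 ?expR_gt0 ?exprn_gt0.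
move=> n z zr; set h : R := 2 ^- n.
have h0 : 0 < h := h_gt0 n.
pose a j := iter j (estep X h) z.
pose b j := iter j (estep X (2 ^- n.+1)) z.
pose u j := `|a j - b j.*2|.
have aM j : (j <= 2 ^ n)%N -> `|a j| <= M by move=> jn; exact: HM.
have bM j : (j <= 2 ^ n.+1)%N -> `|b j| <= M by move=> jn; exact: HM.
have hL0 : 0 <= h * L by rewrite mulr_ge0// ltW.
have hL20 : 0 <= h ^+ 2 * L ^+ 2 by rewrite mulr_ge0// sqr_ge0.
have gw j : (j < 2 ^ n)%N -> u j.+1 <= (1 + h * L) * u j + h ^+ 2 * L ^+ 2.
  move=> jn.
  have j2 : (j.*2.+2 <= 2 ^ n.+1)%N by rewrite expnS mul2n -doubleS leq_double.
  have b2 : `|b j.*2| <= M by apply: bM; apply: ltnW; apply: ltnW.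
  have b3 : `|b j.*2.+1| <= M by apply: bM; apply: ltnW.
  have E1 : a j.+1 = a j + h *: X (a j) by [].
  have E2 : b j.*2.+1 = b j.*2 + (h / 2) *: X (b j.*2) by rewrite /b iterS /estep Ehalf.
  have E3 : b j.+1.*2 = b j.*2 + (h / 2) *: X (b j.*2) + (h / 2) *: X (b j.*2.+1).
    by rewrite doubleS [LHS]iterS /estep -/(b _) Ehalf E2.
  have EE : a j.+1 - b j.+1.*2 = (a j - b j.*2) + h *: (X (a j) - X (b j.*2)) +
      (h / 2) *: (X (b j.*2) - X (b j.*2.+1)).
    rewrite E1 E3 !scalerBr.
    have -> : h *: X (b j.*2) = (h / 2) *: X (b j.*2) + (h / 2) *: X (b j.*2).
      by rewrite -scalerDl -splitr.
    by rewrite !opprD !addrA subrK [in RHS](addrAC (a j)).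
  rewrite /u EE.
  apply: le_trans (ler_normD _ _) _; apply: lerD.
    rewrite mulrDl mul1r; apply: le_trans (ler_normD _ _) _; rewrite lerD2l.
    rewrite normrZ gtr0_norm// -mulrA; apply: ler_wpM2l; first exact: ltW.
    apply: HL' => //; apply: aM; exact: ltnW.
  rewrite normrZ gtr0_norm ?divr_gt0//.
  apply: (@le_trans _ _ (h / 2 * (L * (h / 2 * L)))).
    apply: ler_wpM2l; first by rewrite divr_ge0 ?ltW.
    apply: le_trans (HL' _ _ b2 b3) _; apply: ler_wpM2l; first exact: ltW.
    rewrite E2 opprD addNKr normrN normrZ gtr0_norm ?divr_gt0//.
    by apply: ler_wpM2l; [rewrite divr_ge0 ?ltW|exact: HB'].
  have -> : h / 2 * (L * (h / 2 * L)) = h ^+ 2 * L ^+ 2 / 4 by field.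
  by rewrite ler_pdivrMr// ler_peMr// ler1n.
have u0 : u 0%N = 0 by rewrite /u subrr normr0.
have := gronwall hL20 hL0 (normr_ge0 _ : 0 <= u 0%N) gw (leqnn _).
rewrite u0 add0r => G.
have -> : euler X n z - euler X n.+1 z = a (2 ^ n)%N - b (2 ^ n).*2.
  by rewrite -mul2n -expnS.
apply: le_trans G _.
have -> : (2 ^ n)%:R * (h ^+ 2 * L ^+ 2) = h * L ^+ 2.
  by rewrite mulrA expr2 mulrA h_mul mul1r.
rewrite -mulrA [leRHS]mulrC; apply: ler_wpM2l; first exact: ltW.
by apply: ler_wpM2l; [exact: sqr_ge0|exact: pow_le_exp (ltW L0) _].
Qed.

(** The limit is taken coordinate by coordinate with [cvg_dyadic]. Uniformity on balls is what
    continuity of the flow and the exchange of limit and derivative rest on. *)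
Lemma flow_rate E (X : E -> E) (r : R) : findim E -> complete_field X ->
  exists2 K : R, 0 < K & forall n z, `|z| <= r -> `|euler X n z - flow X z| <= K / 2 ^+ n.
Proof.
move=> fE gX; have [K K0 HK] := euler_cauchy r fE gX.
have [I [e [l [C C0 [lc le lb eb]]]]] := findim_coord_bound fE.
exists (C * (2 * (C * K))); first by rewrite !mulr_gt0.
move=> n z zr.
have Hi i : exists w : R, l i (euler X n z) @[n --> \oo] --> w /\
    forall n, `|l i (euler X n z) - w| <= 2 * (C * K) / 2 ^+ n.
  apply: (@cvg_dyadic _ (fun n => l i (euler X n z)) (C * K)) => m; rewrite -linearB; apply: le_trans (lb _ _) _.
  by rewrite -mulrA; apply: ler_wpM2l; [exact: ltW|exact: HK].
have [w Hw] := choice Hi.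
have D m : `|euler X m z - \sum_i w i *: e i| <= C * (2 * (C * K)) / 2 ^+ m.
  rewrite [X in X - _](le (euler X m z)) -sumrB -mulrA.
  under eq_bigr do rewrite -scalerBl.
  apply: eb => [|i]; last exact: (Hw i).2.
  by rewrite !mulr_ge0 ?invr_ge0 ?exprn_ge0// ltW.
suff -> : flow X z = \sum_i w i *: e i by exact: D.
apply: cvg_lim => //; apply/cvgrPdist_le => ep ep0.
have := @h_cvg0 (C * (2 * (C * K))); move/cvgrPdist_le => /(_ _ ep0); apply: filterS => m.
rewrite sub0r normrN distrC => h; apply: le_trans (D m) (le_trans (ler_norm _) h).
Qed.

Lemma flow_cvg E (X : E -> E) z : findim E -> complete_field X ->
  euler X n z @[n --> \oo] --> flow X z.
Proof.
move=> fE gX; have [K K0 HK] := flow_rate `|z| fE gX.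
apply/cvgrPdist_le => ep ep0.
have := @h_cvg0 K; move/cvgrPdist_le => /(_ _ ep0); apply: filterS => m.
rewrite sub0r normrN distrC => h; exact: le_trans (HK m z (lexx _)) (le_trans (ler_norm _) h).
Qed.

Lemma estep_smooth E (X : E -> E) h j : findim E -> smooth setT X ->
  smooth setT (iter j (estep X h)).
Proof.
move=> fE Xs; apply: smoothP => z _; elim: j => [|j IH]; first exact: smoothAt_id.
apply: (smoothAt_comp (f := estep X h)) => //.
rewrite /estep; apply: smoothAtD; first exact: smoothAt_id.
by apply: smoothAtZ; [exact: smoothAt_cst|exact: smoothT_At].
Qed.

Lemma iter_tangent E (X : E -> E) h j z w : findim E -> smooth setT X ->
  iter j (estep (tangent_field X) h) (z, w) =
  (iter j (estep X h) z, 'D_w (iter j (estep X h)) z).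
Proof.
move=> fE Xs; elim: j => [|j IH]; first by rewrite /= derive_id.
rewrite iterS IH /estep /tangent_field/=; congr (_, _).
have dj : is_derive z w (iter j (estep X h)) ('D_w (iter j (estep X h)) z).
  by apply: smoothAt_is_derive; apply: smoothT_At; exact: estep_smooth.
have dX : differentiable X (iter j (estep X h) z) by exact/smoothAt_diff/smoothT_At.
have d2 := is_derive_chain dj dX.
symmetry; apply: derive_val.
Qed.

(** Tangent vectors obey a linear recursion along the polygon, with a coefficient bounded on the
    ball of radius [M] in which the polygon stays; Gronwall bounds them by [r * expR L]. So tangent
    lifts can be iterated. *)
Lemma complete_tangent E (X : E -> E) : findim E -> complete_field X ->
  complete_field (tangent_field X).
Proof.
move=> fE [Xs Xb].
have Ts : smooth setT (tangent_field X).
  apply: smoothP => -[z w] _; apply: smoothAt_pair.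
    apply: (smoothAt_comp (f := X)) => //; first exact: smoothT_At.
    by apply: smoothAt_fst; exact: smoothAt_id.
  by apply: smoothAt_tangent => //; exact: smoothT_At.
split=> // r; have [M HM] := Xb r.
have [I [e [l [C C0 [lc le lb eb]]]]] := findim_coord_bound fE.
have Bi i : exists B : R, 0 <= B /\ forall x, `|x| <= M -> `|'D_(e i) X x| <= B.
  have c : continuous ('D_(e i) X).
    by move=> x; apply: smoothAt_cont; apply: smoothAt_derive; exact: smoothT_At.
  by have [B B0 HB] := bounded_on_balls M fE c; exists B; rewrite ltW.
have [B HB] := choice Bi.
pose L := \sum_i C * B i.
have L0 : 0 <= L by apply: sumr_ge0 => i _; apply: mulr_ge0; [exact: ltW|exact: (HB i).1].
have HL x w : `|x| <= M -> `|'D_w X x| <= L * `|w|.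
  move=> xM; rewrite (derive_sumE w le (smoothAt_diff (smoothT_At x Xs))).
  apply: le_trans (ler_norm_sum _ _ _) _; rewrite mulr_suml; apply: ler_sum => i _.
  by rewrite normrZ mulrAC; apply: ler_pM => //; exact: (HB i).2.
exists (Num.max M (r * expR L)) => n j [z w] jn; rewrite [`|(z, w)|]prod_normE ge_max => /andP[zr wr].
rewrite iter_tangent// prod_normE /= ge_max le_max HM//= le_max; apply/orP; right.
set h : R := 2 ^- n; have h0 : 0 < h := h_gt0 n.
pose u j := `|'D_w (iter j (estep X h)) z|.
have hL0 : 0 <= h * L by rewrite mulr_ge0// ltW.
have gw k : (k < 2 ^ n)%N -> u k.+1 <= (1 + h * L) * u k + 0.
  move=> kn; rewrite addr0 /u.
  have -> : 'D_w (iter k.+1 (estep X h)) z = 'D_w (iter k (estep X h)) z +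
      h *: 'D_('D_w (iter k (estep X h)) z) X (iter k (estep X h) z).
    by have /(congr1 snd) := iter_tangent h k.+1 z w fE Xs; rewrite iterS iter_tangent.
  apply: le_trans (ler_normD _ _) _; rewrite mulrDl mul1r lerD2l normrZ gtr0_norm//.
  rewrite -mulrA; apply: ler_wpM2l; first exact: ltW.
  by apply: HL; apply: HM => //; exact: ltnW.
have := gronwall (lexx 0) hL0 (normr_ge0 _ : 0 <= u 0%N) gw jn.
rewrite mulr0 addr0 /u derive_id => /le_trans; apply.
apply: ler_pM => //; first by rewrite exprn_ge0// addr_ge0.
exact: pow_le_exp.
Qed.

(** Induction on [k] over all spaces at once: the derivative of the flow along [e i] is the second
    component of the flow of the tangent field at [(z, e i)], a flow on [E * E] of class C^k by
    induction. *)
Lemma flow_Ck k E (X : E -> E) : findim E -> complete_field X -> Ck k setT (flow X).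
Proof.
elim: k E X => [|k IH] E X fE gX.
  move=> x _; apply/contP => ep ep0.
  have [K K0 HK] := flow_rate (`|x| + 1) fE gX.
  have [n Hn] : exists n, K / 2 ^+ n < ep / 3.
    have ep3 : 0 < ep / 3 by rewrite divr_gt0.
    have := @h_cvg0 K; move/cvgrPdist_lt => /(_ _ ep3)[n _ Hn]; exists n.
    by have := Hn n (leqnn n); rewrite /= sub0r normrN gtr0_norm// mulr_gt0// h_gt0.
  have ec : {for x, continuous (euler X n)}.
    by apply: smoothAt_cont; apply: smoothT_At; apply: estep_smooth => //; case: gX.
  have ep3 : 0 < ep / 3 by rewrite divr_gt0.
  have /contP /(_ _ ep3)[d d0 Hd] := ec.
  exists (Num.min d 1); first by rewrite lt_min d0 ltr01.
  move=> y; rewrite lt_min => /andP[yd y1].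
  have b1 := HK n x; rewrite lerDl ler01 in b1; have {}b1 := b1 isT.
  have b2 : `|euler X n y - flow X y| <= K / 2 ^+ n.
    by apply: HK; rewrite -(subrK x y) (le_trans (ler_normD _ _))// addrC lerD2l ltW.
  have -> : flow X y - flow X x =
    - (euler X n y - flow X y) + (euler X n y - euler X n x) + (euler X n x - flow X x).
    by rewrite opprB !addrA subrK subrK.
  apply: le_lt_trans (ler_normD _ _) _.
  apply: (@le_lt_trans _ _ (K / 2 ^+ n + `|euler X n y - euler X n x| + K / 2 ^+ n)).
    by apply: lerD => //; apply: le_trans (ler_normD _ _) _; rewrite normrN lerD.
  by have := Hd y yd; move: Hn; lra.
have fEE : findim (E * E : normedModType R)%type by exact: findim_prod.
have [I [e [l [C C0 [lc le lb eb]]]]] := findim_coord_bound fE.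
have gT := complete_tangent fE gX.
have Tk i : Ck k setT (fun z => (flow (tangent_field X) (z, e i)).2).
  pose L := mklin (@linear_snd _ E E).
  have Lc : continuous L by move=> y; exact: cvg_snd.
  have Ci : Ck k setT (fun z : E => (z, e i)).
    apply: Ck_pair; [exact: openT| |exact: Ck_cst].
    by apply: (@linear_Ck _ _ _ _ _ (mklin (f := @id E) (fun a x y => erefl))) => y; exact: cvg_id.
  apply: (Ck_linpost (L := L)) => //; first exact: openT.
  by apply: (Ck_comp (D' := setT)) Ci => //; [exact: openT|exact: openT|exact: IH].
have dflow i x : is_derive x (e i) (flow X) (flow (tangent_field X) (x, e i)).2.
  have [K1 K10 HK1] := flow_rate (`|x| + 1) fE gX.
  have [K2 K20 HK2] := flow_rate (Num.max (`|x| + 1) `|e i|) fEE gT.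
  have lim_j j : is_derive x (e i) (fun z => l j (flow X z)) (l j (flow (tangent_field X) (x, e i)).2).
    apply: (@derive_limit _ _ (fun n z => l j (euler X n z)) _
      (fun z => l j (flow (tangent_field X) (z, e i)).2) x (e i) 1 (fun n => C * (K1 + K2) * 2 ^- n)) => //.
    - exact: h_cvg0.
    - apply: (@continuous_comp _ _ _ (fun z => (flow (tangent_field X) (z, e i)).2) (l j)).
        exact: (Ck_cont (Tk i)).
      exact: lc.
    - move=> n y _; have H : is_derive y (e i) (euler X n) ('D_(e i) (euler X n) y).
        by apply: smoothAt_is_derive; apply: smoothT_At; apply: estep_smooth => //; case: gX.
      by have [] := is_derive_post (lc j) H.
    - move=> n y yx; rewrite -linearB; apply: le_trans (lb _ _) _; rewrite -mulrA.
      apply: ler_wpM2l; first exact: ltW.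
      apply: (@le_trans _ _ (K1 * 2 ^- n)).
        by apply: HK1; rewrite -(subrK x y) (le_trans (ler_normD _ _))// addrC lerD2l ltW.
      by rewrite ler_wpM2r// ?lerDl ?ltW// h_gt0.
    - move=> n y yx; have H : is_derive y (e i) (euler X n) ('D_(e i) (euler X n) y).
        by apply: smoothAt_is_derive; apply: smoothT_At; apply: estep_smooth => //; case: gX.
      have [_ ->] := is_derive_post (lc j) H.
      rewrite -linearB; apply: le_trans (lb _ _) _; rewrite -mulrA.
      apply: ler_wpM2l; first exact: ltW.
      apply: (@le_trans _ _ (K2 * 2 ^- n)); last by rewrite ler_wpM2r// ?lerDr ?ltW// h_gt0.
      have yr : `|(y, e i)| <= Num.max (`|x| + 1) `|e i|.
        rewrite prod_normE ge_max !le_max lexx orbT andbT /=; apply/orP; left.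
        by rewrite -(subrK x y) (le_trans (ler_normD _ _))// addrC lerD2l ltW.
      have := HK2 n (y, e i) yr.
      rewrite [X in `|X - _|](iter_tangent (2 ^- n) (2 ^ n) y (e i) fE (proj1 gX)).
      apply: le_trans; rewrite prod_normE le_max; apply/orP; right; exact: lexx.
  exact: is_derive_coords lim_j.
apply: (CkS_intro fE openT lc le) => [i y _|i]; first by have [] := dflow i y.
apply: Ck_ext (Tk i); first exact: openT.
by move=> z _; have [_ ->] := dflow i z.
Qed.
End Euler.

(** * Invariance, first integrals and inverses of flows *)

Section FlowLocal.
Context {R : realType}.
Implicit Types E : normedModType R.

(** Since [X] vanishes at 0, a step multiplies the norm by at most [1 + h * L], hence unit time
    multiplies it by at most [expR L]. This is the origin of the radius [d / expR L]. *)
Lemma iter_small E (X : E -> E) (d : R) : findim E -> complete_field X -> X 0 = 0 -> 0 < d ->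
  exists2 d' : R, 0 < d' & forall n j z, (j <= 2 ^ n)%N -> `|z| <= d' ->
    `|iter j (estep X (2 ^- n)) z| <= d.
Proof.
move=> fE [Xs _] X0 d0.
have [L L0 HL] := smooth_lipschitz d fE fE Xs.
exists (d / expR L); first by rewrite divr_gt0 ?expR_gt0.
move=> n j z jn; rewrite ler_pdivlMr ?expR_gt0// => zd.
set h : R := 2 ^- n; have h0 : 0 < h := h_gt0 n.
have hL : 0 <= h * L by rewrite mulr_ge0// ltW.
suff H : `|iter j (estep X h) z| <= `|z| * (1 + h * L) ^+ j.
  apply: le_trans H (le_trans _ zd); apply: ler_wpM2l => //.
  exact: pow_le_exp (ltW L0) jn.
elim: j jn => [|j IH] jn; first by rewrite expr0 mulr1.
have IHj := IH (ltnW jn).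
have jd : `|iter j (estep X h) z| <= d.
  apply: le_trans IHj (le_trans _ zd); apply: ler_wpM2l => //.
  exact: pow_le_exp (ltW L0) (ltnW jn).
rewrite iterS {1}/estep; set w := iter j _ z in IHj jd *.
apply: le_trans (ler_normD _ _) _; rewrite normrZ gtr0_norm//.
have Xw : `|X w| <= L * `|w|.
  by have := HL w 0 jd; rewrite normr0 X0 !subr0; apply; exact: ltW.
apply: (@le_trans _ _ ((1 + h * L) * `|w|)).
  by rewrite mulrDl mul1r lerD2l -mulrA; apply: ler_wpM2l => //; exact: ltW.
rewrite exprS mulrCA; apply: ler_wpM2l => //; exact: addr_ge0.
Qed.

Lemma flow0 E (X : E -> E) z : X z = 0 -> flow X z = z.
Proof.
move=> Xz; have H n : euler X n z = z.
  by rewrite /euler; elim: (2 ^ n)%N => // j IH; rewrite iterS IH /estep Xz scaler0 addr0.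
by rewrite /flow (_ : (fun n => _) = cst z) ?lim_cst//; exact/funext.
Qed.

(** A closed relation kept by every Euler step near 0 survives the limit. With [p z = p z'] it shows
    which variables a component of the flow depends on; with [p z = 0] it shows that a subspace is
    kept. *)
Lemma flow_rel E (X : E -> E) (P : E -> E -> Prop) (d : R) : findim E -> complete_field X ->
  X 0 = 0 -> 0 < d ->
  (forall (u v : nat -> E) x y, u n @[n --> \oo] --> x -> v n @[n --> \oo] --> y ->
    (forall n, P (u n) (v n)) -> P x y) ->
  (forall z z' h, `|z| <= d -> `|z'| <= d -> 0 < h -> P z z' ->
     P (z + h *: X z) (z' + h *: X z')) ->
  exists2 d' : R, 0 < d' & forall z z', `|z| <= d' -> `|z'| <= d' -> P z z' ->
    P (flow X z) (flow X z').
Proof.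
move=> fE gX X0 d0 Pc Ps; have [d' d'0 H] := iter_small fE gX X0 d0.
exists d' => // z z' zd zd' Pz.
apply: Pc; [exact: flow_cvg|exact: flow_cvg|] => n.
suff : forall j, (j <= 2 ^ n)%N -> P (iter j (estep X (2 ^- n)) z) (iter j (estep X (2 ^- n)) z').
  by apply; exact: leqnn.
elim=> [//|j IH] jn; rewrite !iterS; apply: Ps; last exact/IH/ltnW.
- by apply: H => //; exact: ltnW.
- by apply: H => //; exact: ltnW.
- exact: h_gt0.
Qed.

Lemma flow_dep E E' (X : E -> E) (p : {linear E -> E'}) (d : R) : findim E -> complete_field X ->
  X 0 = 0 -> continuous p -> 0 < d ->
  (forall z z', `|z| <= d -> `|z'| <= d -> p z = p z' -> p (X z) = p (X z')) ->
  exists2 d' : R, 0 < d' & forall z z', `|z| <= d' -> `|z'| <= d' -> p z = p z' ->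
    p (flow X z) = p (flow X z').
Proof.
move=> fE gX X0 pc d0 H; apply: (@flow_rel E X (fun z z' => p z = p z') d) => //.
  move=> u v x y ux vy uv.
  have h1 : p (u n) @[n --> \oo] --> p x by apply: cvg_comp ux (pc x).
  have h2 : p (v n) @[n --> \oo] --> p y by apply: cvg_comp vy (pc y).
  have E1 : (fun n => p (u n)) = (fun n => p (v n)) by exact/funext.
  by rewrite E1 in h1; exact: (cvg_unique _ h1 h2).
by move=> z z' h zd zd' _ pz; rewrite !linearD !linearZ pz (H _ _ zd zd' pz).
Qed.

Lemma flow_inv E E' (X : E -> E) (p : {linear E -> E'}) (d : R) : findim E -> complete_field X ->
  X 0 = 0 -> continuous p -> 0 < d ->
  (forall z, `|z| <= d -> p z = 0 -> p (X z) = 0) ->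
  exists2 d' : R, 0 < d' & forall z, `|z| <= d' -> p z = 0 -> p (flow X z) = 0.
Proof.
move=> fE gX X0 pc d0 H.
have [||d' d'0 Hd] := @flow_rel E X (fun z _ => p z = 0) d fE gX X0 d0.
- move=> u v x y ux _ uv.
  have h1 : p (u n) @[n --> \oo] --> p x by apply: cvg_comp ux (pc x).
  have E1 : (fun n => p (u n)) = cst 0 by exact/funext.
  by rewrite E1 in h1; have := cvg_unique _ h1 (@cvg_cst _ _ _ _ _); apply; exact: norm_hausdorff.
- by move=> z z' h zd zd' _ pz; rewrite linearD linearZ pz (H _ zd pz)/= scaler0 addr0.
by exists d' => // z zd; exact: (Hd z z).
Qed.

Lemma step_taylor E (X : E -> E) (J : E -> R) : findim E -> {for 0, continuous X} -> X 0 = 0 ->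
  smoothAt 0 J -> exists d B : R, [/\ 0 < d, 0 <= B &
   forall z h, 0 <= h -> `|z| <= d -> `|z + h *: X z| <= d ->
     `|J (z + h *: X z) - J z - h * 'D_(X z) J z| <= B * h ^+ 2].
Proof.
move=> fE Xc X0 Js.
have Ts : smoothAt (0 : E * E) (fun p => 'D_(p.2) J p.1) by exact: smoothAt_tangent.
have [d1 [L [d10 L0 HL]]] := smoothAt_lipschitz _ _ Ts.
have [d2 d20 H2] := (near0P _).1 (smoothAt_nbhs Js).
have /contP /(_ _ d10)[d3 d30 H3] := Xc.
pose d := Num.min d1 (Num.min d2 d3) / 2.
have m0 : 0 < Num.min d1 (Num.min d2 d3) by rewrite !lt_min d10 d20.
have dm : d < Num.min d1 (Num.min d2 d3) by rewrite /d ltr_pdivrMr// ltr_pMr// ltr1n.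
have d0 : 0 < d by rewrite divr_gt0.
exists d, (L * d1); split=> //; first by rewrite mulr_ge0// ltW.
move=> z h h0 zd zhd.
have lt (x : E) : `|x| <= d -> [/\ `|x| <= d1, `|x| < d2 & `|x| < d3].
  move=> xd; have := le_lt_trans xd dm; rewrite !lt_min => /and3P[a b c].
  by split=> //; exact: ltW.
have seg s : 0 <= s <= 1 -> `|s *: (h *: X z) + z| <= d.
  move=> /andP[s0 s1].
  have -> : s *: (h *: X z) + z = s *: (z + h *: X z) + (1 - s) *: z.
    by rewrite scalerDr scalerBl scale1r [RHS]addrC addrA subrK addrC.
  apply: le_trans (ler_normD _ _) _; rewrite !normrZ !ger0_norm ?subr_ge0//.
  rewrite (_ : d = s * d + (1 - s) * d); last by ring.
  by apply: lerD; apply: ler_wpM2l; rewrite ?subr_ge0.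
have Jd s : 0 <= s <= 1 -> differentiable J (s *: (h *: X z) + z).
  by move=> s01; apply: smoothAt_diff; apply: H2; have [] := lt _ (seg s s01).
have [|s s01] := @mvt01 _ _ J (h *: X z) z; first by move=> s /Jd; exact: diff_derivable.
rewrite [h *: X z + z]addrC => ->.
have -> : 'D_(h *: X z) J (s *: (h *: X z) + z) = h * 'D_(X z) J (s *: (h *: X z) + z).
  by have dJ := Jd s s01; rewrite (deriveE (h *: X z) dJ) (deriveE (X z) dJ) linearZ.
rewrite -mulrBr normrM ger0_norm// expr2 mulrCA; apply: ler_wpM2l => //.
have [zd1 zd2 zd3] := lt _ zd; have [sd1 sd2 sd3] := lt _ (seg s s01).
have Xd : `|X z| <= d1 by have := H3 z; rewrite subr0 X0 subr0 => /(_ zd3)/ltW.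
have := HL (s *: (h *: X z) + z, X z) (z, X z).
rewrite ![X in X <= d1]prod_normE /= !ge_max sd1 zd1 Xd => /(_ isT isT) /le_trans; apply.
rewrite -mulrA; apply: ler_wpM2l; first exact: ltW.
have -> : (s *: (h *: X z) + z, X z) - (z, X z) = (s *: (h *: X z), 0).
  by congr (_, _); rewrite /= ?addrK ?subrr.
rewrite prod_normE /= normr0 (max_idPl (normr_ge0 _)) !normrZ.
case/andP: s01 => s0 s1; rewrite !ger0_norm// mulrCA mulrC; apply: ler_pM => //.
  by rewrite mulr_ge0.
by rewrite -[leRHS]mul1r; apply: ler_pM.
Qed.

(** [J] changes at the rate [C], itself constant along orbits, so unit time adds [C]. On polygons
    each step errs by [O(h^2)] ([step_taylor]), which sums to [O(h)]. *)
Lemma flow_integral E (X : E -> E) (J C : E -> R) : findim E -> complete_field X -> X 0 = 0 ->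
  smoothAt 0 J -> smoothAt 0 C ->
  (\forall z \near (0 : E), 'D_(X z) J z = C z) ->
  (\forall z \near (0 : E), 'D_(X z) C z = 0) ->
  \forall z \near (0 : E), J (flow X z) = J z + C z.
Proof.
move=> fE gX X0 Js Cs JC C0; have [Xs _] := gX.
have Xc : {for 0, continuous X} by apply: smoothAt_cont; exact: smoothT_At.
have [d1 [B1 [d10 B10 H1]]] := step_taylor fE Xc X0 Js.
have [d2 [B2 [d20 B20 H2]]] := step_taylor fE Xc X0 Cs.
have [d3 d30 H3] := (near0P _).1 JC.
have [d4 d40 H4] := (near0P _).1 C0.
have [d5 d50 H5] := (near0P _).1 (smoothAt_nbhs Js).
pose m := Num.min d1 (Num.min d2 (Num.min d3 (Num.min d4 d5))).
have m0 : 0 < m by rewrite !lt_min d10 d20 d30 d40.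
have m20 : 0 < m / 2 by rewrite divr_gt0.
have m2m : m / 2 < m by rewrite ltr_pdivrMr// ltr_pMr// ltr1n.
have ltm (x : E) : `|x| <= m / 2 -> [/\ `|x| <= d1, `|x| <= d2, `|x| < d3, `|x| < d4 & `|x| < d5].
  move=> xm; have := le_lt_trans xm m2m; rewrite !lt_min => /and5P[a b c d e].
  by split=> //; exact: ltW.
have [d' d'0 Hd'] := iter_small fE gX X0 m20.
apply/near0P; exists d' => // z /ltW zd'.
have zc := flow_cvg (z := z) fE gX.
have fm : `|flow X z| <= m / 2.
  have nc : `|euler X n z| @[n --> \oo] --> `|flow X z| by exact: cvg_norm.
  rewrite -(cvg_lim (@Rhausdorff R) nc); apply: limr_le; first by apply/cvg_ex; exists `|flow X z|.
  by apply: nearW => n; exact: Hd'.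
have [_ _ _ _ f5] := ltm _ fm.
have Jc : J (euler X n z) @[n --> \oo] --> J (flow X z).
  apply: cvg_comp zc _; exact: smoothAt_cont (H5 _ f5).
suff : J (euler X n z) @[n --> \oo] --> J z + C z.
  by move=> h; exact: (cvg_unique _ Jc h).
apply/cvgrPdist_le => ep ep0.
have := @h_cvg0 R (B1 + B2); move/cvgrPdist_le => /(_ _ ep0); apply: filterS => n.
rewrite sub0r normrN; set h : R := 2 ^- n; have h0 : 0 < h := h_gt0 n.
rewrite ger0_norm; last by rewrite mulr_ge0 ?addr_ge0// ltW.
apply: le_trans.
pose a j := iter j (estep X h) z.
have am j : (j <= 2 ^ n)%N -> `|a j| <= m / 2 by move=> jn; exact: Hd'.
have nh j : (j <= 2 ^ n)%N -> j%:R * h <= 1.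
  by move=> jn; rewrite -[leRHS](@h_mul R n); apply: ler_wpM2r; [exact: ltW|rewrite ler_nat].
have Ca j : (j <= 2 ^ n)%N -> `|C (a j) - C z| <= j%:R * (B2 * h ^+ 2).
  elim: j => [|j IH] jn; first by rewrite subrr normr0 mul0r.
  have [_ aj2 _ aj4 _] := ltm _ (am j (ltnW jn)); have [_ aS2 _ _ _] := ltm _ (am j.+1 jn).
  have := H2 (a j) h (ltW h0) aj2 aS2; rewrite (H4 _ aj4) mulr0 subr0 => hC.
  have -> : C (a j.+1) - C z = (C (a j) - C z) + (C (a j + h *: X (a j)) - C (a j)).
    by rewrite [RHS]addrC addrA subrK.
  apply: le_trans (ler_normD _ _) _; rewrite -natr1 mulrDl mul1r.
  by apply: lerD => //; exact/IH/ltnW.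
have Ca' j : (j <= 2 ^ n)%N -> `|C (a j) - C z| <= B2 * h.
  move=> jn; apply: le_trans (Ca j jn) _.
  have -> : j%:R * (B2 * h ^+ 2) = (j%:R * h) * (B2 * h) by ring.
  by rewrite -[leRHS]mul1r; apply: ler_wpM2r; [rewrite mulr_ge0// ltW|exact: nh].
have Ja j : (j <= 2 ^ n)%N -> `|J (a j) - J z - j%:R * h * C z| <= j%:R * h * ((B1 + B2) * h).
  elim: j => [|j IH] jn; first by rewrite !mul0r subr0 subrr normr0.
  have [aj1 _ aj3 _ _] := ltm _ (am j (ltnW jn)); have [aS1 _ _ _ _] := ltm _ (am j.+1 jn).
  have := H1 (a j) h (ltW h0) aj1 aS1; rewrite (H3 _ aj3) => hJ.
  have -> : J (a j.+1) - J z - j.+1%:R * h * C z = (J (a j) - J z - j%:R * h * C z) +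
    ((J (a j + h *: X (a j)) - J (a j) - h * C (a j)) + h * (C (a j) - C z)).
    by rewrite -natr1 /a iterS /estep; ring.
  have -> : j.+1%:R * h * ((B1 + B2) * h) = j%:R * h * ((B1 + B2) * h) + (B1 * h ^+ 2 + h * (B2 * h)).
    by rewrite -natr1; ring.
  apply: le_trans (ler_normD _ _) _; apply: lerD; first exact/IH/ltnW.
  apply: le_trans (ler_normD _ _) _; apply: lerD => //.
  rewrite normrM gtr0_norm//; apply: ler_wpM2l; first exact: ltW.
  exact/Ca'/ltnW.
have := Ja _ (leqnn _); rewrite (@h_mul R n) !mul1r => HJ.
by rewrite distrC opprD addrA.
Qed.

(** A step forward followed by a step backward misses its starting point by [O(h^2)]. Cancelling the
    innermost pair first, each of the [2 ^ n] errors is amplified by at most [expR L2], and they sum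
    to [O(h)]. *)
Lemma flow_invol E (X : E -> E) z : findim E -> complete_field X ->
  complete_field (fun z => - X z) -> flow (fun z => - X z) (flow X z) = z.
Proof.
move=> fE gX gY; set Y := fun z => - X z in gY *.
have [Xs Xb] := gX; have [Ys Yb] := gY.
have [M0 HM0] := Xb `|z|.
pose M := `|M0| + `|z|.
have HM n j : (j <= 2 ^ n)%N -> `|iter j (estep X (2 ^- n)) z| <= M.
  move=> jn; apply: le_trans (HM0 n j z jn (lexx _)) _.
  by rewrite /M (le_trans (ler_norm M0))// lerDl.
have zM : `|z| <= M by exact: (HM 0%N 0%N).
have M0' : 0 <= M := le_trans (normr_ge0 _) zM.
have [B B0 HB] := bounded_on_balls M fE (fun x => smoothAt_cont (smoothT_At x Xs)).
have [L1 L10 HL1] := smooth_lipschitz (M + B) fE fE Xs.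
(* [M + B] leaves room for one forward step, and [L1 * B] for the error after stepping back. *)
pose r := M + B + L1 * B.
have LB0 : 0 <= L1 * B by rewrite mulr_ge0// ltW.
have [M' HM'] := Yb r.
have [L2 L20 HL2] := smooth_lipschitz M' fE fE Ys.
have lip n j x y : (j <= 2 ^ n)%N -> `|x| <= r -> `|y| <= r ->
    `|iter j (estep Y (2 ^- n)) x - iter j (estep Y (2 ^- n)) y| <= expR L2 * `|x - y|.
  move=> jn xr yr; set h : R := 2 ^- n; have h0 : 0 < h := h_gt0 n.
  pose u j := `|iter j (estep Y h) x - iter j (estep Y h) y|.
  have hL0 : 0 <= h * L2 by rewrite mulr_ge0// ltW.
  have gw k : (k < 2 ^ n)%N -> u k.+1 <= (1 + h * L2) * u k + 0.
    move=> kn; rewrite addr0 /u !iterS /estep.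
    set p := iter k _ x; set q := iter k _ y.
    rewrite opprD addrACA -scalerBr mulrDl mul1r.
    apply: le_trans (ler_normD _ _) _; rewrite lerD2l normrZ gtr0_norm// -mulrA.
    by apply: ler_wpM2l; [exact: ltW|apply: HL2; apply: HM' => //; exact: ltnW].
  have := gronwall (lexx 0) hL0 (normr_ge0 _ : 0 <= u 0%N) gw jn.
  rewrite mulr0 addr0 => /le_trans; apply; rewrite [leLHS]mulrC; apply: ler_wpM2r => //.
    exact: normr_ge0.
  exact: pow_le_exp (ltW L20) jn.
have back n j : (j <= 2 ^ n)%N ->
    `|iter j (estep Y (2 ^- n)) (iter j (estep X (2 ^- n)) z) - z| <=
    j%:R * (2 ^- n ^+ 2 * (L1 * B) * expR L2).
  set h : R := 2 ^- n; have h0 : 0 < h := h_gt0 n; have h1 : h <= 1 := h_le1 n.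
  elim: j => [|j IH] jn; first by rewrite subrr normr0 mul0r.
  have IHj := IH (ltnW jn).
  rewrite iterSr [iter j.+1 (estep X h) z]iterS; set a := iter j (estep X h) z in IHj *.
  have aM : `|a| <= M by apply: HM; exact: ltnW.
  have a1 : `|estep X h a| <= M + B.
    apply: le_trans (ler_normD _ _) _; apply: lerD => //; rewrite normrZ gtr0_norm//.
    by rewrite -[leRHS]mul1r; apply: ler_pM => //; [exact: ltW|exact: HB].
  have aMB : `|a| <= M + B by rewrite (le_trans aM)// lerDl ltW.
  have dE : estep Y h (estep X h a) - a = h *: (X a - X (estep X h a)).
    by rewrite [estep Y h _]/estep /Y scalerN scalerBr {1}/estep addrAC [a + _]addrC addrK.
  have dN : `|estep Y h (estep X h a) - a| <= h ^+ 2 * (L1 * B).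
    rewrite dE normrZ gtr0_norm// expr2 -mulrA; apply: ler_wpM2l; first exact: ltW.
    apply: le_trans (HL1 _ _ aMB a1) _; rewrite mulrCA; apply: ler_wpM2l; first exact: ltW.
    rewrite /estep opprD addNKr normrN normrZ gtr0_norm//; apply: ler_wpM2l; first exact: ltW.
    exact: HB.
  have h21 : h ^+ 2 <= 1 by rewrite expr_le1// ltW.
  have br : `|estep Y h (estep X h a)| <= r.
    rewrite -[X in `|X|](subrK a) addrC; apply: le_trans (ler_normD _ _) _.
    apply: lerD => //; apply: le_trans dN _; rewrite -[leRHS]mul1r; exact: ler_wpM2r.
  have ar : `|a| <= r by rewrite (le_trans aMB)// lerDl.
  have := lip n j _ _ (ltnW jn) br ar; rewrite -/h => l1.
  rewrite -(subrK (iter j (estep Y h) a) (iter j _ (estep Y h _))) -addrA.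
  apply: le_trans (ler_normD _ _) _; rewrite -natr1 mulrDl mul1r [leRHS]addrC; apply: lerD => //.
  apply: le_trans l1 _; rewrite mulrC; apply: ler_wpM2r => //; exact: expR_ge0.
have fr : `|flow X z| <= r.
  have nc : `|euler X n z| @[n --> \oo] --> `|flow X z| by apply: cvg_norm; exact: flow_cvg.
  rewrite -(cvg_lim (@Rhausdorff R) nc); apply: limr_le; first by apply/cvg_ex; exists `|flow X z|.
  apply: nearW => n; apply: le_trans (HM n _ (leqnn _)) _.
  by rewrite /r -addrA lerDl addr_ge0// ltW.
have [K K0 HK] := flow_rate `|z| fE gX.
have c1 := flow_cvg (z := flow X z) fE gY.
suff c2 : euler Y n (flow X z) @[n --> \oo] --> z by exact: (cvg_unique _ c1 c2).
apply/cvgrPdist_le => ep ep0.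
have := @h_cvg0 R (expR L2 * K + (L1 * B) * expR L2); move/cvgrPdist_le => /(_ _ ep0).
apply: filterS => n; rewrite sub0r normrN => /(le_trans (ler_norm _)); apply: le_trans.
rewrite distrC -(subrK (euler Y n (euler X n z)) (euler Y n _)) -addrA.
apply: le_trans (ler_normD _ _) _; rewrite mulrDl; apply: lerD.
  have er : `|euler X n z| <= r.
    by apply: le_trans (HM n _ (leqnn _)) _; rewrite /r -addrA lerDl addr_ge0// ltW.
  apply: le_trans (lip n _ _ _ (leqnn _) fr er) _; rewrite -mulrA; apply: ler_wpM2l.
    exact: expR_ge0.
  by rewrite distrC; exact: HK.
apply: le_trans (back n _ (leqnn _)) _.
have -> : (2 ^ n)%:R * (2 ^- n ^+ 2 * (L1 * B) * expR L2) =
   ((2 ^ n)%:R * 2 ^- n) * (L1 * B * expR L2 * 2 ^- n) by ring.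
by rewrite (@h_mul R n) mul1r.
Qed.

End FlowLocal.

(** * Cutoff functions and globalization of germs *)

Section Bump.
Context {R : realType}.
Implicit Types V W E : normedModType R.

Lemma Ck_R_intro k (D : set R) (f g : R -> R) : open D ->
  (forall t, D t -> is_derive t (1 : R) f (g t)) -> Ck k D g -> Ck k.+1 D f.
Proof.
move=> oD fg Cg; have df t : D t -> differentiable f t.
  by move=> /fg[? _]; exact/derivable1_diffP.
split=> // v; apply: (Ck_ext (f := fun t => v * g t)) => //; last first.
  by apply: CkM => //; exact: Ck_cst.
move=> t Dt; rewrite [RHS]deriveE; last exact: df.
rewrite -[v in RHS]mulr1 [X in 'd f t X]/(v *: 1) linearZ -deriveE; last exact: df.
by have [_ ->] := fg t Dt.
Qed.

Lemma is_derive_chainR V (f : R -> R) (g : V -> R) x v (df dg : R) :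
  is_derive x v g dg -> is_derive (g x) (1 : R) f df ->
  is_derive x v (fun z => f (g z)) (df * dg).
Proof.
move=> Hg [f1 fE]; have dfd : differentiable f (g x) by exact/derivable1_diffP.
suff -> : df * dg = 'D_dg f (g x) by exact: is_derive_chain.
rewrite deriveE// -[dg in RHS]mulr1 [X in 'd f _ X]/(dg *: 1) linearZ -deriveE// fE.
by rewrite /GRing.scale/= mulrC.
Qed.

(** Differentiation maps the span of these functions to itself ([expN_derive]), so one derivative
    computation gives smoothness of all of them, including at 0. *)
Definition expN (n : nat) (t : R) : R := if 0 < t then t^-1 ^+ n * expR (- t^-1) else 0.

(** With [N = n + 1], the inequality [exp x >= (x / N)^N] at [x = 1 / t] beats [t^-n] and leaves one
    factor [t]. *)
Lemma expN_bound n t : `|expN n t| <= n.+1%:R ^+ n.+1 * `|t|.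
Proof.
rewrite /expN; case: ltP => t0; last by rewrite normr0 mulr_ge0// exprn_ge0.
rewrite (gtr0_norm t0) ger0_norm; last by rewrite mulr_ge0 ?expR_ge0// exprn_ge0// invr_ge0 ltW.
set N : R := n.+1%:R; have N0 : 0 < N by [].
have H : (t^-1 / N) ^+ n.+1 <= expR (t^-1).
  have E : expR (t^-1) = expR (t^-1 / N) ^+ n.+1.
    by rewrite -expRM_natl mulrC divfK// gt_eqF.
  rewrite E; apply: lerXn2r; rewrite ?nnegrE ?expR_ge0 ?divr_ge0 ?invr_ge0 ?(ltW t0)//.
  by apply: le_trans (expR_ge1Dx _); rewrite lerDr.
rewrite expRN ler_pdivrMr ?expR_gt0//.
apply: (@le_trans _ _ (N ^+ n.+1 * t * (t^-1 / N) ^+ n.+1)).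
  rewrite exprMn (exprS t^-1); set a := t^-1 ^+ n; set b := N ^+ n.+1.
  have -> : N ^+ n.+1 * t * (t^-1 * a * N^-1 ^+ n.+1) = (t * t^-1) * (b * N^-1 ^+ n.+1) * a.
    by rewrite /b; ring.
  by rewrite -exprMn !mulfV ?expr1n ?mul1r// gt_eqF.
by apply: ler_wpM2l => //; rewrite mulr_ge0 ?exprn_ge0// ltW.
Qed.

Lemma expN_derive n t : is_derive t (1 : R) (expN n) (- n%:R * expN n.+1 t + expN n.+2 t).
Proof.
have [t0|t0|t0] := ltgtP t 0.
- have -> : - n%:R * expN n.+1 t + expN n.+2 t = 0.
    by rewrite /expN ltNge (ltW t0)/= mulr0 addr0.
  apply: (near_eq_is_derive (f := cst 0)).
  apply/nearP; exists (- t); first by rewrite oppr_gt0.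
  move=> y; rewrite /expN; case: (ltP 0 y) => // y0 /(le_lt_trans (ler_norm _)).
  by rewrite ltrBlDr addNr ltNge (ltW y0).
- apply: (near_eq_is_derive (f := fun t : R => t^-1 ^+ n * expR (- t^-1))).
    apply/nearP; exists t => // y; rewrite distrC => /(le_lt_trans (ler_norm _)).
    by rewrite /expN ltrBlDr ltrDl => ->.
  have t00 := lt0r_neq0 t0.
  have di : is_derive t (1 : R) (fun t : R => t^-1) (- t ^- 2).
    apply: DeriveDef; first by apply: (@derivableV _ _ id).
    by rewrite (@deriveV _ _ id)// derive_id /GRing.scale/= mulr1.
  have d1 : is_derive t (1 : R) (fun t : R => t^-1 ^+ n) (n%:R * t^-1 ^+ n.-1 * - t ^- 2).
    have := is_deriveX n di; congr is_derive; apply/funext => s; by rewrite exprfctE.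
  have d2 : is_derive t (1 : R) (fun t : R => expR (- t^-1)) (expR (- t^-1) * t ^- 2).
    apply: (@is_derive_chainR R expR (fun t : R => - t^-1) t 1 (expR (- t^-1)) (t ^- 2)).
    by rewrite -[X in is_derive _ _ _ X]opprK; exact: is_deriveN.
  have H := is_deriveM d1 d2; rewrite /expN t0.
  apply: (is_derive_eq H); rewrite /GRing.scale/= -exprVn.
  set a := t^-1; set e := expR _; clear; case: n => [|n]; first by rewrite !expr0 /=; ring.
  by rewrite /= !exprS; ring.
- rewrite t0; have -> : - n%:R * expN n.+1 0 + expN n.+2 0 = 0 :> R.
    by rewrite /expN ltxx mulr0 addr0.
  suff H : (fun h : R => h^-1 *: (expN n (h *: 1 + 0) - expN n 0)) @ 0^' --> 0.
    by apply: DeriveDef; [apply/cvg_ex; exists 0|exact: cvg_lim].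
  apply/cvgrPdist_le => ep ep0.
  have c0 : 0 < n.+2%:R ^+ n.+2 :> R by rewrite exprn_gt0.
  near=> h.
  have h0 : h != 0 by near: h; exact: nbhs_dnbhs_neq.
  rewrite sub0r normrN [expN n 0]/expN ltxx subr0 addr0 /GRing.scale/= mulr1.
  have -> : h^-1 * expN n h = expN n.+1 h.
    by rewrite /expN; case: ifP => _; rewrite ?mulr0// exprS mulrA.
  apply: le_trans (expN_bound _ _) _; rewrite mulrC -ler_pdivlMr//.
  apply: ltW; near: h; apply: dnbhs0_lt; exact: divr_gt0.
Unshelve. all: by end_near. Qed.

Lemma expN_smooth n : smooth setT (expN n).
Proof.
move=> k; elim: k n => [|k IH] n.
  move=> t _; apply: differentiable_continuous; apply/derivable1_diffP.
  by case: (expN_derive n t).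
apply: (@Ck_R_intro k setT _ (fun t => - n%:R * expN n.+1 t + expN n.+2 t)) => //.
- exact: openT.
- by move=> t _; exact: expN_derive.
- apply: CkD => //; [exact: openT|].
  by apply: CkM => //; [exact: openT|exact: Ck_cst].
Qed.

Definition cutoff (t : R) : R := expN 0 (2 - t) / (expN 0 (2 - t) + expN 0 (t - 1)).

Lemma expN_ge0 n t : 0 <= expN n t.
Proof.
rewrite /expN; case: ltP => // t0.
by rewrite mulr_ge0 ?expR_ge0// exprn_ge0// invr_ge0 ltW.
Qed.

Lemma expN_gt0 n t : 0 < t -> 0 < expN n t.
Proof. by move=> t0; rewrite /expN t0 mulr_gt0 ?expR_gt0// exprn_gt0// invr_gt0. Qed.

Lemma cutoff_den t : 0 < expN 0 (2 - t) + expN 0 (t - 1).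
Proof.
have [t2|t2] := ltP t 2.
  by rewrite ltr_pwDl ?expN_ge0// expN_gt0// subr_gt0.
by rewrite ltr_wpDl ?expN_ge0// expN_gt0// subr_gt0 (lt_le_trans _ t2)// ltr1n.
Qed.

Lemma cutoff1 t : t <= 1 -> cutoff t = 1.
Proof.
move=> t1; have e0 : expN 0 (t - 1) = 0 by rewrite /expN subr_gt0 ltNge t1.
have := cutoff_den t; rewrite /cutoff e0 addr0 => h.
by rewrite divff// gt_eqF.
Qed.

Lemma cutoff0 t : 2 <= t -> cutoff t = 0.
Proof.
move=> t2; have e0 : expN 0 (2 - t) = 0 by rewrite /expN subr_gt0 ltNge t2.
by rewrite /cutoff e0 mul0r.
Qed.

Lemma cutoff_smooth t : smoothAt t cutoff.
Proof.
have e n (f : R -> R) : smoothAt t f -> smoothAt t (fun t => expN n (f t)).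
  by move=> fs; apply: (smoothAt_comp (f := expN n)) => //; apply: smoothT_At; exact: expN_smooth.
apply: smoothAtM; first by apply: e; sm.
apply: smoothAtV; first by rewrite gt_eqF// cutoff_den.
by apply: smoothAtD; apply: e; sm.
Qed.

(** The norm need not be smooth, so the cutoff is applied to the quadratic form [q] in the
    coordinates. If all coordinates were at most [b = r / (2 C)], the norm would be at most [r / 2];
    hence [q z >= b^2] as soon as the norm is at least [r]. *)
Lemma bump_exists V (r : R) : findim V -> 0 < r -> exists chi : V -> R,
  [/\ smooth setT chi, \forall z \near (0 : V), chi z = 1 & forall z, r <= `|z| -> chi z = 0].
Proof.
move=> fV r0; have [I [e [l [C C0 [lc le lb eb]]]]] := findim_coord_bound fV.
pose b := r / 2 / C; have b0 : 0 < b by rewrite !divr_gt0.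
pose q z := \sum_i l i z ^+ 2.
have qs z : smoothAt z q.
  by apply: smoothAt_sum => i; apply: smoothAtX; exact: smoothAt_lin.
exists (fun z => cutoff (2 / b ^+ 2 * q z)); split.
- apply: smoothP => z _; apply: (smoothAt_comp (f := cutoff)) => //; first exact: cutoff_smooth.
  by apply: smoothAtM => //; exact: smoothAt_cst.
- have q0 : q 0 = 0 by rewrite /q big1// => i _; rewrite raddf0 expr0n.
  have /contP := smoothAt_cont (qs 0) => /(_ (b ^+ 2 / 2)) [|d d0 Hd].
    by rewrite divr_gt0// exprn_gt0.
  apply/near0P; exists d => // z zd; apply: cutoff1.
  have := Hd z; rewrite subr0 q0 subr0 => /(_ zd)/ltW/(le_trans (ler_norm _)) h.
  have E1 : 2 / b ^+ 2 * (b ^+ 2 / 2) = 1 by field; rewrite gt_eqF.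
  by rewrite -[leRHS]E1; apply: ler_wpM2l => //; rewrite divr_ge0// exprn_ge0// ltW.
- move=> z rz; apply: cutoff0.
  have [i bi] : exists i, b < `|l i z|.
    apply: contrapT => /forallNP H.
    have : `|z| <= C * b.
      rewrite {1}(le z); apply: eb; first exact: ltW.
      by move=> i; have /negP := H i; rewrite -leNgt.
    rewrite /b mulrC divfK ?gt_eqF// => /(le_trans rz).
    by move: r0; lra.
  have bq : b ^+ 2 <= q z.
    rewrite /q (bigD1 i)//=; apply: (@le_trans _ _ (l i z ^+ 2)).
      by rewrite -[leRHS]real_normK ?num_real//; apply: lerXn2r; rewrite ?nnegrE// ltW.
    by rewrite lerDl; apply: sumr_ge0 => j _; exact: sqr_ge0.
  have E1 : 2 / b ^+ 2 * (b ^+ 2) = 2 by rewrite divfK// gt_eqF// exprn_gt0.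
  by rewrite -[leLHS]E1; apply: ler_wpM2l => //; rewrite divr_ge0// exprn_ge0// ltW.
Qed.

(** Multiplication by a bump function. Boundedness of the result makes a globalized field
    complete. *)
Lemma globalize V W (f : V -> W) : findim V -> findim W -> smoothAt 0 f ->
  exists g : V -> W, [/\ smooth setT g, \forall z \near (0 : V), g z = f z &
    exists B : R, forall z, `|g z| <= B].
Proof.
move=> fV fW fs; have [d d0 Hd] := (near0P _).1 (smoothAt_nbhs fs).
have d20 : 0 < d / 2 by rewrite divr_gt0.
have d2d : d / 2 < d by rewrite ltr_pdivrMr// ltr_pMr// ltr1n.
have [chi [cs c1 c0]] := bump_exists fV d20.
have gs : smooth setT (fun z => chi z *: f z).
  apply: smoothP => z _; have [zd|zd] := ltP `|z| d.
    by apply: smoothAtZ => //; [exact: smoothT_At|exact: Hd].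
  apply: (smoothAt_near (f := fun=> 0)); last exact: smoothAt_cst.
  apply/nearP; exists (d / 2) => // y yz; rewrite c0 ?scale0r//.
  have := lerB_dist z y; rewrite distrC => h.
  have : `|z| - d / 2 <= `|y| by move: h (ltW yz); lra.
  by apply: le_trans; move: zd; lra.
exists (fun z => chi z *: f z); split=> //.
  by apply: filterS c1 => z ->; rewrite scale1r.
have [B B0 HB] := bounded_on_balls (d / 2) fV (fun x => smoothAt_cont (smoothT_At x gs)).
exists B => z; have [zd|/ltW zd] := leP `|z| (d / 2); first exact: HB.
by rewrite c0// scale0r normr0 ltW.
Qed.

Lemma bounded_complete E (X : E -> E) (B : R) : smooth setT X ->
  (forall z, `|X z| <= B) -> complete_field X.
Proof.
move=> Xs XB; split=> // r; exists (r + B) => n j z jn zr.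
have B0 : 0 <= B := le_trans (normr_ge0 _) (XB 0).
suff H : `|iter j (estep X (2 ^- n)) z| <= r + j%:R * 2 ^- n * B.
  apply: le_trans H _; rewrite lerD2l -[leRHS]mul1r; apply: ler_wpM2r => //.
  rewrite -[leRHS](@h_mul R n); apply: ler_wpM2r; first exact/ltW/h_gt0.
  by rewrite ler_nat.
elim: j jn => [|j IH] jn; first by rewrite !mul0r addr0.
have -> : r + j.+1%:R * 2 ^- n * B = (r + j%:R * 2 ^- n * B) + 2 ^- n * B by rewrite -natr1; ring.
rewrite iterS {1}/estep; apply: le_trans (ler_normD _ _) _.
apply: lerD; first exact/IH/ltnW.
by rewrite normrZ gtr0_norm ?h_gt0//; apply: ler_wpM2l; [exact/ltW/h_gt0|exact: XB].
Qed.

(** An interface to the time-one map that hides the chosen globalization of the germ [X]. The clause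
    on projections will make changes of coordinates triangular; the last clause will keep the origin
    fixed at zero parameters. *)
Definition local_flow_of E (X f : E -> E) : Prop :=
  [/\ smoothAt 0 f /\ f 0 = 0,
     \forall z \near (0 : E), X z = 0 -> f z = z,
     forall J C : E -> R, smoothAt 0 J -> smoothAt 0 C ->
       (\forall z \near (0 : E), 'D_(X z) J z = C z) ->
       (\forall z \near (0 : E), 'D_(X z) C z = 0) ->
       \forall z \near (0 : E), J (f z) = J z + C z,
     forall E' (p : {linear E -> E'}) (d : R), continuous p -> 0 < d ->
       (forall z z', `|z| < d -> `|z'| < d -> p z = p z' -> p (X z) = p (X z')) ->
       exists2 d' : R, 0 < d' & forall z z', `|z| < d' -> `|z'| < d' -> p z = p z' ->
         p (f z) = p (f z') &
     forall E' (p : {linear E -> E'}), continuous p ->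
       (\forall z \near (0 : E), p z = 0 -> p (X z) = 0) ->
       \forall z \near (0 : E), p z = 0 -> p (f z) = 0].

Lemma flow_local E (X Y : E -> E) : findim E -> complete_field Y -> Y 0 = 0 ->
  (\forall z \near (0 : E), Y z = X z) -> local_flow_of X (flow Y).
Proof.
move=> fE gY Y0 YX; have [d0 d00 H0] := (near0P _).1 YX.
split.
- split; last exact: flow0.
  by apply: smoothT_At => k; exact: flow_Ck.
- by apply: filterS YX => z <-; exact: flow0.
- move=> J C Js Cs JC C0; apply: flow_integral => //.
    by apply: filterS2 YX JC => z ->.
  by apply: filterS2 YX C0 => z ->.
- move=> E' p d pc dp H.
  have m0 : 0 < Num.min d d0 / 2 by rewrite divr_gt0// lt_min dp.
  have mm : Num.min d d0 / 2 < Num.min d d0 by rewrite ltr_pdivrMr ?ltr_pMr ?ltr1n// lt_min dp.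
  have [|d' d'0 Hd] := flow_dep fE gY Y0 pc m0.
    move=> z z' /le_lt_trans/(_ mm) + /le_lt_trans/(_ mm).
    by rewrite !lt_min => /andP[a b] /andP[a' b'] pz; rewrite (H0 _ b) (H0 _ b'); exact: H.
  by exists d' => // z z' /ltW zd /ltW zd'; exact: Hd.
- move=> E' p pc /near0P[d dp H].
  have m0 : 0 < Num.min d d0 / 2 by rewrite divr_gt0// lt_min dp.
  have mm : Num.min d d0 / 2 < Num.min d d0 by rewrite ltr_pdivrMr ?ltr_pMr ?ltr1n// lt_min dp.
  have [|d' d'0 Hd] := flow_inv fE gY Y0 pc m0.
    move=> z /le_lt_trans/(_ mm); rewrite !lt_min => /andP[a b] pz.
    by rewrite (H0 _ b); exact: H.
  by apply/near0P; exists d' => // z /ltW; exact: Hd.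
Qed.

Lemma local_flow E (X : E -> E) : findim E -> smoothAt 0 X -> X 0 = 0 ->
  exists f g : E -> E, [/\ local_flow_of X f, local_flow_of (fun z => - X z) g,
    forall z, g (f z) = z & forall z, f (g z) = z].
Proof.
move=> fE Xs X0; have [Y [Ys YX [B YB]]] := globalize fE fE Xs.
have Y0 : Y 0 = 0 by rewrite (nbhs_singleton YX).
have gY := bounded_complete Ys YB.
have Ys' : smooth setT (fun z => - Y z).
  by apply: smoothP => z _; apply: smoothAtN; exact: smoothT_At.
have gY' : complete_field (fun z => - Y z).
  by apply: (bounded_complete (B := B) Ys') => z; rewrite normrN.
exists (flow Y), (flow (fun z => - Y z)); split.
- exact: flow_local.
- by apply: flow_local => //; [rewrite Y0 oppr0|apply: filterS YX => z ->].
- by move=> z; apply: flow_invol.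
- move=> z; have := @flow_invol _ E (fun z => - Y z) z fE gY'.
  by rewrite (_ : (fun z => - - Y z) = Y); [exact|apply/funext => y; rewrite opprK].
Qed.

End Bump.

(** * Division by linear factors and the implicit function theorem *)

Section DeriveRules.
Context {R : realType} {V W : normedModType R} (x v : V).

Lemma isd_cst (a : W) : is_derive x v (fun=> a) 0.
Proof. exact: is_derive_cst. Qed.

Lemma isd_id : is_derive x v (fun z => z) v.
Proof. exact: is_derive_id. Qed.

Lemma isd_add (f g : V -> W) df dg : is_derive x v f df -> is_derive x v g dg ->
  is_derive x v (fun z => f z + g z) (df + dg).
Proof. by move=> Hf Hg; exact: is_deriveD. Qed.

Lemma isd_opp (f : V -> W) df : is_derive x v f df -> is_derive x v (fun z => - f z) (- df).
Proof. by move=> Hf; exact: is_deriveN. Qed.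

Lemma isd_mul (f g : V -> R) df dg : is_derive x v f df -> is_derive x v g dg ->
  is_derive x v (fun z => f z * g z) (f x * dg + g x * df).
Proof. by move=> Hf Hg; exact: is_deriveM. Qed.

Lemma isd_exp (f : V -> R) df n : is_derive x v f df ->
  is_derive x v (fun z => f z ^+ n) (n%:R * f x ^+ n.-1 * df).
Proof.
move=> Hf; have := is_deriveX n Hf; congr is_derive; apply/funext => s; by rewrite exprfctE.
Qed.

End DeriveRules.

(** The derivative is found along with the proof: [eassert] leaves its value open, the rules fill it
    in, and it is then simplified by [ring] or rewriting. *)
Ltac isd1 := first
 [ eassumption
 | match goal with
   | |- is_derive _ _ (@fst _ _) _ => notypeclasses refine (is_derive_fst (isd_id _ _))
   | |- is_derive _ _ (@snd _ _) _ => notypeclasses refine (is_derive_snd (isd_id _ _))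
   | |- is_derive _ _ (fun _ => fst _) _ => notypeclasses refine (is_derive_fst _)
   | |- is_derive _ _ (fun _ => snd _) _ => notypeclasses refine (is_derive_snd _)
   | |- is_derive _ _ (fun x => x) _ => notypeclasses refine (isd_id _ _)
   end
 | notypeclasses refine (isd_cst _ _ _)
 | notypeclasses refine (isd_exp _ _) | notypeclasses refine (isd_add _ _) | notypeclasses refine (isd_opp _) | notypeclasses refine (isd_mul _ _)
 | notypeclasses refine (derivable_pair _ _) ].
Ltac isd := repeat isd1.

Section Hadamard.
Context {R : realType}.
Implicit Types M N E : normedModType R.

Lemma nearT M (x : M) (P : M -> Prop) : (forall y, P y) -> \forall y \near x, P y.
Proof. by move=> HP; exact: nearW. Qed.

Lemma near1 M (x : M) (P Q : M -> Prop) : (\forall y \near x, P y) ->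
  (forall y, P y -> Q y) -> \forall y \near x, Q y.
Proof. by move=> HP PQ; exact: filterS PQ HP. Qed.

Lemma near_subst M N (g : M -> N) (x : M) (y : N) (P : N -> Prop) : g x = y -> smoothAt x g ->
  (\forall z \near y, P z) -> \forall z \near x, P (g z).
Proof. by move=> <- /smoothAt_cont gc H; exact: near_comp. Qed.

Lemma near2 M (x : M) (P Q T : M -> Prop) : (\forall y \near x, P y) ->
  (\forall y \near x, Q y) -> (forall y, P y -> Q y -> T y) -> \forall y \near x, T y.
Proof. by move=> HP HQ PQ; exact: filterS2 PQ HP HQ. Qed.

Lemma near_and M (x : M) (P Q : M -> Prop) : (\forall y \near x, P y) ->
  (\forall y \near x, Q y) -> \forall y \near x, P y /\ Q y.
Proof. by move=> HP HQ; exact: (near2 HP HQ). Qed.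

Lemma derive_pair_lin M N (f : M * N -> R) z (a : R) (v : M) (w : N) : smoothAt z f ->
  'D_(a *: v, w) f z = a * 'D_(v, 0) f z + 'D_(0, w) f z.
Proof.
move=> /smoothAt_diff df.
rewrite -[a * _]/(a *: 'D_(v, 0) f z) -derive_lin//; congr derive.
by rewrite /GRing.add /GRing.scale/= /add_pair/= /scale_pair/= addr0 scaler0 add0r.
Qed.

Lemma derive_pair_lin1 N (f : R * N -> R) z (a : R) (w : N) : smoothAt z f ->
  'D_(a, w) f z = a * 'D_(1, 0) f z + 'D_(0, w) f z.
Proof. by move=> /derive_pair_lin <-; rewrite /GRing.scale/= mulr1. Qed.

Lemma derive00 M N (f : M * N -> R) z : 'D_(0, 0) f z = 0.
Proof. exact: derive0. Qed.

Lemma local_flow_lin E E' (X f : E -> E) (p q : {linear E -> E'}) : findim E' ->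
  local_flow_of X f -> continuous p -> continuous q ->
  (\forall z \near (0 : E), p (X z) = q z) -> (\forall z \near (0 : E), q (X z) = 0) ->
  \forall z \near (0 : E), p (f z) = p z + q z.
Proof.
move=> [I [e [l [lc le]]]] [_ _ Hf _ _] pc qc pX qX.
have H i : \forall z \near (0 : E), l i (p (f z)) = l i (p z) + l i (q z).
  apply: (Hf (fun z => l i (p z)) (fun z => l i (q z))).
  - by apply: smoothAt_linpost => //; exact: smoothAt_lin.
  - by apply: smoothAt_linpost => //; exact: smoothAt_lin.
  - apply: filterS pX => z <-.
    by have [_ ->] := is_derive_post (lc i) (is_derive_post pc (isd_id z (X z))).
  - apply: filterS qX => z qz.
    by have [_ ->] := is_derive_post (lc i) (is_derive_post qc (isd_id z (X z))); rewrite qz raddf0.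
have /filterS : \forall z \near (0 : E), forall i, l i (p (f z)) = l i (p z) + l i (q z).
  exact: filter_forall.
apply => z Hz; rewrite (le (p (f z))) (le (p z + q z)).
by apply: eq_bigr => i _; rewrite Hz linearD.
Qed.

(** The quotient is the mean of ['D_(1, 0) f] over the segment from [(0, m)] to [(x, m)]. A flow
    replaces the integral: one coordinate runs along the segment with constant velocity [x] while
    another accumulates the derivative. Subtracting [k], its value at 0, makes the field vanish at
    the origin. *)
Lemma hadamard0 M (f : R * M -> R) : findim M -> smoothAt 0 f ->
  exists2 g : R * M -> R, smoothAt 0 g &
    \forall z \near (0 : R * M), f z = f (0, z.2) + z.1 * g z.
Proof.
move=> fM fs.
pose E := ((R * R) * (R * M) : normedModType R)%type.
pose fx := 'D_(1, 0) f; pose k := fx 0.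
have fxs : smoothAt 0 fx by exact: smoothAt_derive.
pose X (z : E) : E := ((fx (z.1.2, z.2.2) - k, z.2.1), (0, 0)).
have fE : findim E by exact _.
have Xs : smoothAt 0 X.
  rewrite /X; sm; apply: (smoothAt_comp (f := fx) (g := fun z : E => (z.1.2, z.2.2))) => //; sm.
have X0 : X 0 = 0 by rewrite /X /= -[(0, 0)]/(0 : R * M) subrr.
have [F [_ [HF _ _ _]]] := local_flow fE Xs X0.
have [[Fs F0] _ HJ _ _] := HF.
have pl : linear (fun z : E => (z.1.2, z.2)) by move=> a [[? ?] ?] [[? ?] ?].
have ql : linear (fun z : E => (z.2.1, 0 : R * M)).
  by move=> a [[? ?] [? ?]] [[? ?] [? ?]]; congr (_, _); rewrite /= scaler0 addr0.
have pc : continuous (mklin pl).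
  by move=> z; apply: smoothAt_cont; rewrite /=; sm.
have qc : continuous (mklin ql).
  by move=> z; apply: smoothAt_cont; rewrite /=; sm.
have Hp : \forall z \near (0 : E), mklin pl (F z) = mklin pl z + mklin ql z.
  by apply: (local_flow_lin _ HF pc qc); apply: nearT => z.
(* A first integral. It starts at [- f (0, m)] and ends at [x * a + k * x - f (x, m)], where [a] is
   the accumulated value; hence the quotient [a + k]. *)
pose J (z : E) := z.2.1 * z.1.1 + k * z.1.2 - f (z.1.2, z.2.2).
pose g0 (z : E) := (z.1.2, z.2.2).
have fc : smoothAt 0 g0 by rewrite /g0; sm.
have g00 : g0 0 = 0 by [].
have J1 : smoothAt 0 J.
  by rewrite /J; sm; apply: (smoothAt_comp (f := f) (g := fun z : E => (z.1.2, z.2.2))) => //; sm.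
have J3 : \forall z \near (0 : E), 'D_(X z) J z = 0.
  apply: (near1 (near_subst g00 fc (smoothAt_nbhs fs))) => z fz.
  have H1 : is_derive z (X z) (fun z : E => f (z.1.2, z.2.2)) ('D_(z.2.1, 0) f (z.1.2, z.2.2)).
    eassert (H0 : is_derive z (X z) g0 _) by (rewrite /g0; isd).
    exact: (is_derive_chain H0 (smoothAt_diff fz)).
  have -> : 'D_(X z) J z = z.2.1 * (fx (z.1.2, z.2.2) - k) + k * z.2.1 - 'D_(z.2.1, 0) f (z.1.2, z.2.2).
    eassert (H : is_derive z (X z) J _) by (rewrite /J; isd).
    by have [_ ->] := H; rewrite /X /=; ring.
  by rewrite (derive_pair_lin1 _ _ fz) derive00 addr0 /fx; ring.
have J4 : \forall z \near (0 : E), 'D_(X z) (fun _ : E => 0 : R) z = 0.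
  by apply: nearT => z; rewrite derive_cst.
have HJ' : \forall z \near (0 : E), J (F z) = J z + 0.
  exact: (HJ J (fun=> 0) J1 (smoothAt_cst _ _) J3 J4).
exists (fun z => (F ((0, 0), z)).1.1 + k).
  by sm; apply: (smoothAt_comp (f := F) (g := fun z : R * M => ((0, 0), z) : E)) => //; sm.
pose i0 (z : R * M) : E := ((0, 0), z).
have c : smoothAt 0 i0 by rewrite /i0; sm.
have e : i0 0 = 0 by [].
apply: (near2 (near_subst e c Hp) (near_subst e c HJ')) => -[x m] /= E1 E2.
move: E1 E2; rewrite /J; case: (F _) => -[a b] [c1 c2] /= [-> -> ->]; rewrite !add0r !mulr0 !addr0 /=.
by move=> H; rewrite mulrDr; move: H; lra.
Qed.

(* The value of [g] on [z.1 = x0] is forced by the identity. *)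
Lemma hadamard_at M (f : R * M -> R) x0 m0 : findim M -> smoothAt (x0, m0) f ->
  exists2 g : R * M -> R, smoothAt (x0, m0) g &
    (\forall z \near (x0, m0), f z = f (x0, z.2) + (z.1 - x0) * g z) /\
    (\forall m \near m0, g (x0, m) = 'D_(1, 0) f (x0, m)).
Proof.
move=> fM fs; pose T (z : R * M) : R * M := (x0 + z.1, m0 + z.2).
have Ts z : smoothAt z T by rewrite /T; sm.
have T0 : T 0 = (x0, m0) by rewrite /T /= !addr0.
have [g gs Hg] : exists2 g, smoothAt 0 g &
    \forall z \near (0 : R * M), f (T z) = f (T (0, z.2)) + z.1 * g z.
  by apply: (hadamard0 (f := fun z => f (T z))) => //; apply: smoothAt_comp => //; rewrite T0.
pose S (z : R * M) : R * M := (z.1 - x0, z.2 - m0).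
have Ss z : smoothAt z S by rewrite /S; sm.
have S0 : S (x0, m0) = 0 by rewrite /S /= !subrr.
have TS z : T (S z) = z by rewrite /T /S /= !subrKC; case: z.
have gS : smoothAt (x0, m0) (fun z => g (S z)).
  by apply: (smoothAt_comp (f := g)) => //; rewrite S0.
have H1 : \forall z \near (x0, m0), f z = f (x0, z.2) + (z.1 - x0) * g (S z).
  apply: (near1 (near_subst S0 (Ss _) Hg)) => z.
  by rewrite TS /S /T /= addr0 subrKC.
exists (fun z => g (S z)) => //; split=> //.
have c : smoothAt m0 (fun m : M => (x0, m)) by sm.
have H2 := near_subst erefl c (nbhs_interior H1).
have H3 := near_and (near_subst erefl c (smoothAt_nbhs gS)) (near_subst erefl c (smoothAt_nbhs fs)).
apply: (near2 H2 H3) => m Hm [gm fm].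
have E : 'D_(1, 0) f (x0, m) = 'D_(1, 0) (fun z => f (x0, z.2) + (z.1 - x0) * g (S z)) (x0, m).
  by apply: near_eq_derive; exact: Hm.
rewrite E.
have D1 := smoothAt_is_derive ((1, 0) : R * M) gm.
eassert (D2 : is_derive ((x0, m) : R * M) ((1, 0) : R * M) (fun z : R * M => (x0, z.2)) _) by isd.
have D3 := is_derive_chain D2 (smoothAt_diff fm).
eassert (D4 : is_derive ((x0, m) : R * M) ((1, 0) : R * M) (fun z => f (x0, z.2) + (z.1 - x0) * g (S z)) _) by isd.
by have [_ ->] := D4; rewrite /= derive00 subrr mul0r !addr0 mulr1 !add0r.
Qed.

Lemma hadamard2 M (f : R * M -> R) : findim M -> smoothAt 0 f ->
  exists2 g : R * (R * M) -> R, smoothAt 0 g &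
    \forall z \near (0 : R * (R * M)), f (z.1, z.2.2) = f z.2 + (z.1 - z.2.1) * g z.
Proof.
move=> fM fs.
have Fs : smoothAt 0 (fun z : R * (R * M) => f (z.2.1 + z.1, z.2.2)).
  apply: (smoothAt_comp (f := f) (g := fun z : R * (R * M) => (z.2.1 + z.1, z.2.2))) => //; last by sm.
  by rewrite /= addr0.
have [g gs Hg] := hadamard0 _ Fs.
pose S (z : R * (R * M)) : R * (R * M) := (z.1 - z.2.1, z.2).
have Ss : smoothAt 0 S by rewrite /S; sm.
have S0 : S 0 = 0 by rewrite /S /= subrr.
exists (fun z => g (S z)); first by apply: (smoothAt_comp (f := g)) => //; rewrite S0.
apply: (near1 (near_subst S0 Ss Hg)) => -[x [x' m]] /=.
by rewrite /S /= addr0 subrKC.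
Qed.

Lemma smoothAt_gt0 M (f : M -> R) x : smoothAt x f -> 0 < f x -> \forall y \near x, 0 < f y.
Proof.
move=> /smoothAt_cont/contP H f0; have [d d0 Hd] := H _ f0.
apply/nearP; exists d => // y /Hd; rewrite distrC => /(le_lt_trans (ler_norm _)).
by rewrite ltrBlDr ltrDl.
Qed.

Lemma smoothAt_neq0 M (f : M -> R) x : smoothAt x f -> f x != 0 -> \forall y \near x, f y != 0.
Proof.
move=> /smoothAt_cont/contP H f0; have [|d d0 Hd] := H `|f x|; first by rewrite normr_gt0.
apply/nearP; exists d => // y /Hd; apply: contraTneq => ->.
by rewrite sub0r normrN ltxx.
Qed.

(* The solution is transported from [m = 0] to [m] along the ray through [m]. *)
Lemma implicit_function0 M (F : R * M -> R) : findim M -> smoothAt 0 F -> F 0 = 0 ->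
  'D_(1, 0) F 0 != 0 ->
  exists h : M -> R, [/\ smoothAt 0 h, h 0 = 0, \forall m \near (0 : M), F (h m, m) = 0 &
    \forall z \near (0 : R * M), F z = 0 -> z.1 = h z.2].
Proof.
move=> fM Fs F00 dF; pose E := ((R * M) * M : normedModType R)%type.
pose Fx := 'D_(1, 0) F; have Fxs : smoothAt 0 Fx by exact: smoothAt_derive.
pose T (z : E) : (R * M) * (R * M) := (z.1, (0, z.2)).
have Tsm z : smoothAt z T by rewrite /T; sm.
pose Fm (z : E) := 'D_((0, z.2)) F z.1.
have Fms : smoothAt 0 Fm.
  apply: (smoothAt_comp (f := fun p : (R * M) * (R * M) => 'D_(p.2) F p.1) (g := T)) => //.
  exact: smoothAt_tangent.
pose X (z : E) : E := ((- Fm z / Fx z.1, z.2), 0).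
have Fx1 : smoothAt (0 : E) (fun z : E => Fx z.1) by apply: (smoothAt_comp (f := Fx)) => //; sm.
have Xs : smoothAt 0 X.
  by rewrite /X; sm; apply: smoothAtV => //; sm.
have X0 : X 0 = 0 by rewrite /X /Fm /= derive00 oppr0 mul0r.
have [G [_ [HG _ _ _]]] := local_flow _ Xs X0.
have [[Gs G0] _ HJ _ _] := HG.
have pl : linear (fun z : E => (z.1.2, z.2)) by move=> a [[? ?] ?] [[? ?] ?].
have ql : linear (fun z : E => (z.2, 0 : M)).
  by move=> a [[? ?] ?] [[? ?] ?]; congr (_, _); rewrite /= scaler0 addr0.
have pc : continuous (mklin pl).
  by move=> z; apply: smoothAt_cont; rewrite /=; sm.
have qc : continuous (mklin ql).
  by move=> z; apply: smoothAt_cont; rewrite /=; sm.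
have Hp : \forall z \near (0 : E), mklin pl (G z) = mklin pl z + mklin ql z.
  by apply: (local_flow_lin _ HG pc qc); apply: nearT => z.
pose J (z : E) := F z.1.
have p1 : smoothAt 0 (fun z : E => z.1) by sm.
have J1 : smoothAt 0 J by apply: (smoothAt_comp (f := F)).
have J3 : \forall z \near (0 : E), 'D_(X z) J z = 0.
  have n1 := near_subst (g := fun z : E => z.1) erefl p1 (smoothAt_nbhs Fs).
  have n2 := smoothAt_neq0 Fx1 dF.
  apply: (near2 n1 n2) => z fz xz.
  eassert (H0 : is_derive z (X z) (fun z : E => z.1) _) by isd.
  have [_ ->] := is_derive_chain H0 (smoothAt_diff fz).
  by rewrite /X /= (derive_pair_lin1 _ _ fz) -/Fx divfK// /Fm addNr.
have J4 : \forall z \near (0 : E), 'D_(X z) (fun _ : E => 0 : R) z = 0.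
  by apply: nearT => z; rewrite derive_cst.
have HJ' : \forall z \near (0 : E), J (G z) = J z + 0.
  exact: (HJ J (fun=> 0) J1 (smoothAt_cst _ _) J3 J4).
pose i0 (m : M) : E := (0, m).
have i0s : smoothAt 0 i0 by rewrite /i0; sm.
have i00 : i0 0 = 0 by [].
pose h m := (G (i0 m)).1.1.
have hs : smoothAt 0 h by rewrite /h; sm; apply: (smoothAt_comp (f := G)).
have h0 : h 0 = 0 by rewrite /h i00 G0.
have Hh : \forall m \near (0 : M), F (h m, m) = 0.
  apply: (near2 (near_subst i00 i0s Hp) (near_subst i00 i0s HJ')) => m /= E1 E2.
  move: E1 E2; rewrite /h /J; case: (G _) => -[x a] b /= [-> _].
  by rewrite add0r addr0 F00.
exists h; split=> //.
(* Uniqueness: as [F (h m, m) = 0], the divided difference gives [F (x, m) = (x - h m) * g], and [g]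
   is nonzero near 0 because [g 0] is the derivative of [F]. *)
have [g gs Hg] := hadamard2 fM Fs.
pose S (z : R * M) : R * (R * M) := (z.1, (h z.2, z.2)).
have hs2 : smoothAt 0 (fun z : R * M => h z.2) by apply: (smoothAt_comp (f := h)) => //; sm.
have Ss : smoothAt 0 S by rewrite /S; sm.
have S0 : S 0 = 0 by rewrite /S /= h0.
have g0 : g 0 != 0.
  suff <- : 'D_(1, 0) F 0 = g 0 by [].
  pose S1 (z : R * M) : R * (R * M) := (z.1, (0, z.2)).
  have S1s : smoothAt 0 S1 by rewrite /S1; sm.
  have -> : 'D_(1, 0) F 0 = 'D_(1, 0) (fun z : R * M => F (0, z.2) + z.1 * g (S1 z)) 0.
    apply: near_eq_derive; apply: (near1 (near_subst (y := 0) _ S1s Hg)) => // -[x m] /= ->.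
    by rewrite subr0.
  have gS1 : smoothAt (0 : R * M) (fun z => g (S1 z)) by apply: (smoothAt_comp (f := g)).
  have D1 := smoothAt_is_derive ((1, 0) : R * M) gS1.
  eassert (D2 : is_derive (0 : R * M) ((1, 0) : R * M) (fun z : R * M => (0 : R, z.2)) _) by isd.
  have D3 := is_derive_chain (f := F) D2 (smoothAt_diff Fs).
  eassert (D4 : is_derive (0 : R * M) ((1, 0) : R * M) (fun z : R * M => F (0, z.2) + z.1 * g (S1 z)) _) by isd.
  by have [_ ->] := D4; rewrite /= derive00 mul0r !add0r mulr1.
have n1 := near_subst S0 Ss (smoothAt_neq0 gs g0).
have n2 := near_subst S0 Ss Hg.
have p2 : smoothAt 0 (fun z : R * M => z.2) by sm.
have n3 := near_subst (g := fun z : R * M => z.2) erefl p2 Hh.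
apply: (near2 (near_and n1 n2) n3) => -[x m] /= [gz Hz] Fh Fz.
move: Hz; rewrite Fz Fh add0r => /esym/eqP; rewrite mulf_eq0 (negbTE gz) orbF subr_eq0.
by move/eqP.
Qed.

Lemma implicit_function M (F : R * M -> R) x0 m0 : findim M -> smoothAt (x0, m0) F ->
  F (x0, m0) = 0 -> 'D_(1, 0) F (x0, m0) != 0 ->
  exists h : M -> R, [/\ smoothAt m0 h, h m0 = x0, \forall m \near m0, F (h m, m) = 0 &
    \forall z \near (x0, m0), F z = 0 -> z.1 = h z.2].
Proof.
move=> fM Fs F0 dF; pose T (z : R * M) : R * M := (x0 + z.1, m0 + z.2).
have Ts z : smoothAt z T by rewrite /T; sm.
have T0 : T 0 = (x0, m0) by rewrite /T /= !addr0.
have FT : smoothAt 0 (fun z => F (T z)) by apply: (smoothAt_comp (f := F)) => //; rewrite T0.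
have dFT : 'D_(1, 0) (fun z => F (T z)) 0 != 0.
  eassert (D : is_derive (0 : R * M) ((1, 0) : R * M) T _) by (rewrite /T; isd).
  have FsT : smoothAt (T 0) F by rewrite T0.
  by have [_ ->] := is_derive_chain D (smoothAt_diff FsT); rewrite T0 /= !add0r.
have [|h [hs h0 Fh Hu]] := implicit_function0 fM FT _ dFT; first by rewrite T0.
pose S (m : M) := m - m0.
have Ss m : smoothAt m S by rewrite /S; sm.
have S0 : S m0 = 0 by rewrite /S subrr.
pose S2 (z : R * M) : R * M := (z.1 - x0, z.2 - m0).
have S2s z : smoothAt z S2 by rewrite /S2; sm.
have S20 : S2 (x0, m0) = 0 by rewrite /S2 /= !subrr.
exists (fun m => x0 + h (S m)); split.
- by apply: smoothAtD; [sm|apply: (smoothAt_comp (f := h)) => //; rewrite S0].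
- by rewrite S0 h0 addr0.
- by apply: (near1 (near_subst S0 (Ss _) Fh)) => m; rewrite /T /S /= subrKC.
- apply: (near1 (near_subst S20 (S2s _) Hu)) => -[x m]; rewrite /T /S2 /S /= !subrKC => H /H <-.
  by rewrite subrKC.
Qed.

End Hadamard.

(** * Even functions *)

Section Coefficients.
Context {R : realType}.

(** Taylor coefficients of Euler's product of the factors [1 - x / 4^j] over [j >= 0], an entire
    function whose zeros are the powers [4^n]. *)
Fixpoint euler_coef (k : nat) : R :=
  if k is k'.+1 then - 4^-1 ^+ k' * euler_coef k' / (1 - 4^-1 ^+ k'.+1) else 1.

Lemma euler_den k : 3 / 4 <= 1 - 4^-1 ^+ k.+1 :> R.
Proof.
have : 4^-1 ^+ k.+1 <= 4^-1 :> R.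
  by rewrite exprS ler_piMr// exprn_ile1// invf_le1// ler1n.
lra.
Qed.

Lemma euler_den0 k : 1 - 4^-1 ^+ k.+1 != 0 :> R.
Proof. by rewrite gt_eqF// (lt_le_trans _ (euler_den k))// divr_gt0. Qed.

Lemma q_gt0 k : 0 < 4^-1 ^+ k :> R. Proof. by rewrite exprn_gt0// invr_gt0. Qed.

Lemma euler_coef_ratio k : `|euler_coef k.+1| <= 4 / 3 * 4^-1 ^+ k * `|euler_coef k|.
Proof.
rewrite /= !normrM normrN normfV (gtr0_norm (q_gt0 k)).
have d0 : 0 < 1 - 4^-1 ^+ k.+1 :> R by apply: lt_le_trans (euler_den k); rewrite divr_gt0.
rewrite (gtr0_norm d0) ler_pdivrMr//.
have -> : 4 / 3 * 4^-1 ^+ k * `|euler_coef k| * (1 - 4^-1 ^+ k.+1) =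
  (4^-1 ^+ k * `|euler_coef k|) * (4 / 3 * (1 - 4^-1 ^+ k.+1)) by ring.
rewrite ler_peMr ?mulr_ge0 ?(ltW (q_gt0 k))//.
by have := euler_den k; lra.
Qed.

Lemma q_small (c : R) : 0 < c -> exists N, forall k, (N <= k)%N -> 4^-1 ^+ k <= c.
Proof.
move=> c0; have : (fun k => 4^-1 ^+ k : R) @ \oo --> (0 : R).
  by apply: cvg_expr; rewrite ger0_norm ?invr_ge0// invf_lt1 ?ltr1n.
move/cvgrPdist_le => /(_ c c0)[N _ HN]; exists N => k /HN /=.
by rewrite sub0r normrN gtr0_norm// q_gt0.
Qed.

Lemma euler_coef_sum (b : R) : 0 <= b ->
  exists C, forall N, \sum_(k < N) `|euler_coef k| * b ^+ k <= C.
Proof.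
move=> b0; pose u k := `|euler_coef k| * b ^+ k.
have u0 k : 0 <= u k by rewrite mulr_ge0// exprn_ge0.
have b1 : 0 < b + 1 by rewrite ltr_wpDl.
(* From [K] on, the ratio of successive terms is at most [4/3 * (3/8) / (b + 1) * b], which is below
   [1/2]. *)
have [K HK] := @q_small (3 / 8 / (b + 1)) (divr_gt0 (divr_gt0 (ltr0Sn _ _) (ltr0Sn _ _)) b1).
have uS k : (K <= k)%N -> u k.+1 <= u k / 2.
  move=> /HK h; rewrite /u exprS.
  apply: (@le_trans _ _ ((4 / 3 * 4^-1 ^+ k * `|euler_coef k|) * (b * b ^+ k))).
    by apply: ler_wpM2r; [rewrite mulr_ge0// exprn_ge0|exact: euler_coef_ratio].
  have -> : 4 / 3 * 4^-1 ^+ k * `|euler_coef k| * (b * b ^+ k) = (4 / 3 * 4^-1 ^+ k * b) * u k.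
    by rewrite /u; ring.
  rewrite [leRHS]mulrC; apply: ler_wpM2r => //.
  apply: (@le_trans _ _ (4 / 3 * (3 / 8 / (b + 1)) * b)).
    by apply: ler_wpM2r => //; apply: ler_wpM2l => //; rewrite divr_ge0.
  have -> : 4 / 3 * (3 / 8 / (b + 1)) * b = (b / (b + 1)) / 2 by field; rewrite gt_eqF.
  apply: (@le_trans _ _ (1 / 2)); last by rewrite div1r.
  by rewrite ler_wpM2r// ler_pdivrMr// mul1r lerDl.
pose S N := \sum_(k < N) u k.
have S0 N : S N <= S N.+1 by rewrite /S big_ord_recr/= lerDl.
exists (S K + 2 * u K) => N.
have [NK|KN] := leqP N K.
  apply: (@le_trans _ _ (S K)); last by rewrite lerDl mulr_ge0.
  rewrite -/(S N); move: NK; elim: K {HK uS} => [|K IH]; first by rewrite leqn0 => /eqP ->.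
  by rewrite leq_eqVlt => /orP[/eqP ->//|/IH h]; exact: le_trans h (S0 _).
suff : S N + 2 * u N <= S K + 2 * u K by apply: le_trans; rewrite lerDl mulr_ge0.
move: (ltnW KN); elim: N {KN} => [|N IH]; first by rewrite leqn0 => /eqP ->.
rewrite leq_eqVlt => /orP[/eqP ->//|KN]; apply: le_trans (IH KN).
by rewrite {1}/S big_ord_recr/= -/(S N); have := uS N KN; lra.
Qed.

(** The functional equation [E x = (1 - x) * E (x / 4)] of the product, in the form it takes for
    partial sums. *)
Lemma euler_coef_fun N (x : R) :
  \sum_(k < N.+1) euler_coef k * x ^+ k =
  \sum_(k < N.+1) euler_coef k * (x / 4) ^+ k - x * \sum_(k < N) euler_coef k * (x / 4) ^+ k.
Proof.
pose F N (x : R) := \sum_(k < N) euler_coef k * x ^+ k.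
have FS N' y : F N'.+1 y = F N' y + euler_coef N' * y ^+ N' by rewrite /F big_ord_recr.
rewrite -/(F _ x) -!/(F _ (x / 4)).
elim: N => [|N IH]; first by rewrite !FS /F !big_ord0 !expr0; ring.
have E : euler_coef N.+1 * x ^+ N.+1 = euler_coef N.+1 * (x / 4) ^+ N.+1 - x * (euler_coef N * (x / 4) ^+ N).
  have h : euler_coef N.+1 * (1 - 4^-1 ^+ N.+1) = - 4^-1 ^+ N * euler_coef N.
    by rewrite /= divfK// euler_den0.
  have : euler_coef N.+1 * x ^+ N.+1 - euler_coef N.+1 * (x / 4) ^+ N.+1 =
     (euler_coef N.+1 * (1 - 4^-1 ^+ N.+1)) * x ^+ N.+1 by rewrite exprMn; ring.
  rewrite h => h2; apply: (addIr (- (euler_coef N.+1 * (x / 4) ^+ N.+1))).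
  rewrite h2 !exprMn !exprS; ring.
by rewrite FS IH (FS N.+1 (x / 4)) E [X in _ = _ - x * X](FS N); ring.
Qed.

(** At [x = 1] the functional equation telescopes the partial sum to [euler_coef N / 4^N]; it then
    carries the limit 0 from [4^n] to [4^(n+1)]. *)
Lemma euler_coef_moment n : \sum_(k < N) euler_coef k * (4 ^+ n) ^+ k @[N --> \oo] --> (0 : R).
Proof.
elim: n => [|n IH].
  have [C HC] := @euler_coef_sum 1 ler01.
  have wC k : `|euler_coef k| <= C.
    apply: le_trans (HC k.+1); rewrite big_ord_recr/= expr1n mulr1 lerDr.
    by apply: sumr_ge0 => i _; rewrite mulr_ge0// exprn_ge0.
  rewrite -cvg_shiftS /=.
  have E N : \sum_(k < N.+1) euler_coef k * (4 ^+ 0) ^+ k = euler_coef N * 4^-1 ^+ N.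
    by rewrite euler_coef_fun expr0 !mul1r big_ord_recr/= [X in X - _]addrC addrK.
  under eq_cvg do rewrite E.
  apply/cvgrPdist_le => e e0.
  have C0 : 0 < C + 1 by apply: ltr_wpDl => //; exact: le_trans (normr_ge0 _) (wC 0%N).
  have [N HN] := q_small (divr_gt0 e0 C0).
  exists N => // k Nk /=; rewrite sub0r normrN normrM (gtr0_norm (q_gt0 k)).
  apply: (@le_trans _ _ ((C + 1) * (e / (C + 1)))); last by rewrite mulrC divfK// gt_eqF.
  by apply: ler_pM => //; [apply: le_trans (wC k) _; rewrite lerDl|exact: HN].
rewrite -cvg_shiftS /=.
have E N : \sum_(k < N.+1) euler_coef k * (4 ^+ n.+1) ^+ k =
  \sum_(k < N.+1) euler_coef k * (4 ^+ n) ^+ k - 4 ^+ n.+1 * \sum_(k < N) euler_coef k * (4 ^+ n) ^+ k.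
  by rewrite euler_coef_fun exprS; have -> : 4 * 4 ^+ n / 4 = 4 ^+ n :> R by field.
under eq_cvg do rewrite E.
have cvg_eq (F : set_system R) (l l' : R) : l = l' -> F --> l -> F --> l' by move=> ->.
apply: (cvg_eq _ (0 - 4 ^+ n.+1 * 0)); first by rewrite mulr0 subr0.
apply: cvgB; first by have := IH; rewrite -cvg_shiftS.
by apply: cvgMr; exact: IH.
Qed.

(* Residues at the points [4^k] and [-1] of [t^n / ((t + 1) * prod (1 - t / 4^k))]. *)
Lemma whitney_coef_exists : exists a : nat -> R,
  (forall b, 0 <= b -> exists C, forall N, \sum_(k < N) `|a k| * b ^+ k <= C) /\
  forall n, \sum_(k < N) a k * (- 4 ^+ k) ^+ n @[N --> \oo] --> (1 : R).
Proof.
pose den k : R := 1 + 4 ^+ k.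
have den1 k : 1 <= den k by rewrite lerDl exprn_ge0.
have den0 k : 0 < den k by exact: lt_le_trans ltr01 (den1 k).
(* The factor [1 / den k] accounts for the pole at [-1]. By [mS] two consecutive moments add up to a
   sum that tends to 0, so the limits alternate in sign, as [(-1)^n * m0]; normalizing by [m0] gives
   the weights. *)
pose m n N := \sum_(k < N) euler_coef k * (4 ^+ n) ^+ k / den k.
have mS n N : m n.+1 N = \sum_(k < N) euler_coef k * (4 ^+ n) ^+ k - m n N.
  rewrite /m -sumrB; apply: eq_bigr => k _.
  have -> : (4 ^+ n.+1) ^+ k = (4 ^+ n) ^+ k * 4 ^+ k :> R by rewrite exprS exprMn mulrC.
  by have := den0 k; rewrite /den => /lt0r_neq0 h; field.
have w1 k : `|euler_coef k.+1| <= 4 / 3.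
  elim: k => [|k IH].
    by apply: le_trans (euler_coef_ratio 0) _; rewrite /= expr0 normr1 !mulr1.
  apply: le_trans (euler_coef_ratio _) (le_trans _ IH).
  rewrite ler_piMl//; have : 4^-1 ^+ k.+1 <= 4^-1 :> R.
    by rewrite exprS ler_piMr// exprn_ile1// invf_le1// ler1n.
  lra.
(* [m0] must be nonzero: the term [k = 0] is [1/2], the others are at most [4/3 * 4^-k] in absolute
   value and sum to at most [4/9]. *)
have mlow N : 1 / 2 - 4 / 9 + 4 / 9 * 4^-1 ^+ N <= m 0%N N.+1.
  elim: N => [|N IH].
    rewrite /m big_ord_recr big_ord0 /den /= !expr0 (_ : 1 + 1 = 2%:R :> R)//; lra.
  have -> : m 0%N N.+2 = m 0%N N.+1 + euler_coef N.+1 * (4 ^+ 0) ^+ N.+1 / den N.+1.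
    by rewrite {1}/m big_ord_recr.
  have : - (4 / 3 * 4^-1 ^+ N.+1) <= euler_coef N.+1 * (4 ^+ 0) ^+ N.+1 / den N.+1.
    rewrite expr0 expr1n mulr1; apply: le_trans (_ : - `|euler_coef N.+1 / den N.+1| <= _); last first.
      by rewrite lerNl ler_normr lexx orbT.
    rewrite lerN2 normrM; apply: ler_pM => //.
    rewrite normfV gtr0_norm// exprVn lef_pV2 ?posrE ?exprn_gt0//.
    by rewrite /den lerDr.
  have := q_gt0 N; rewrite !(exprS 4^-1) => q0 h; move: h IH.
  set q : R := 4^-1 ^+ N; rewrite /=; lra.
have [C HC] := @euler_coef_sum 1 ler01.
have wC k : `|euler_coef k| <= C.
  apply: le_trans (HC k.+1); rewrite big_ord_recr/= expr1n mulr1 lerDr.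
  by apply: sumr_ge0 => i _; rewrite mulr_ge0// exprn_ge0.
have C0 : 0 <= C := le_trans (normr_ge0 _) (wC 0%N).
have [m0 [m0c _]] : exists l : R, m 0%N N @[N --> \oo] --> l /\ forall N, `|m 0%N N - l| <= 2 * C / 2 ^+ N.
  apply: cvg_dyadic => N; rewrite /m [X in _ - X]big_ord_recr/= opprD addNKr normrN.
  rewrite expr0 expr1n mulr1 normrM; apply: ler_pM => //.
  rewrite normfV gtr0_norm// lef_pV2 ?posrE ?exprn_gt0// /den.
  apply: (@le_trans _ _ (4 ^+ N)); last by rewrite lerDr.
  by apply: lerXn2r; rewrite ?nnegrE// ler_nat.
have m0pos : 0 < m0.
  apply: (@lt_le_trans _ _ (1 / 2 - 4 / 9)); first by lra.
  have c1 := m0c; rewrite -cvg_shiftS in c1.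
  rewrite -(cvg_lim (@Rhausdorff R) c1); apply: limr_ge; first by apply/cvg_ex; exists m0.
  by apply: nearW => N /=; apply: le_trans (mlow N); rewrite lerDl mulr_ge0 ?(ltW (q_gt0 _)).
have mn n : m n N @[N --> \oo] --> (-1) ^+ n * m0.
  elim: n => [|n IH]; first by rewrite expr0 mul1r.
  have -> : (-1) ^+ n.+1 * m0 = 0 - (-1) ^+ n * m0 by rewrite exprS; ring.
  under eq_cvg do rewrite mS.
  by apply: cvgB; [exact: euler_coef_moment|exact: IH].
exists (fun k => euler_coef k / den k / m0); split=> [b b0|n].
  have [D HD] := euler_coef_sum b0; exists (D / m0) => N.
  apply: (@le_trans _ _ ((\sum_(k < N) `|euler_coef k| * b ^+ k) / m0)).
    rewrite mulr_suml; apply: ler_sum => k _.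
    rewrite !normrM !normfV (gtr0_norm m0pos) (gtr0_norm (den0 k)) mulrAC.
    apply: ler_wpM2r; first by rewrite invr_ge0 ltW.
    apply: ler_wpM2r; first by rewrite exprn_ge0.
    by rewrite ler_pdivrMr// ler_peMr.
  by apply: ler_wpM2r; [rewrite invr_ge0 ltW|exact: HD].
have E1 : (-1) ^+ n * ((-1) ^+ n * m0) / m0 = 1.
  by rewrite mulrA -exprMn mulrNN mulr1 expr1n mul1r divff// gt_eqF.
have E N : \sum_(k < N) euler_coef k / den k / m0 * (- 4 ^+ k) ^+ n = (-1) ^+ n * m n N / m0.
  rewrite /m mulr_sumr mulr_suml; apply: eq_bigr => k _.
  rewrite [in LHS]exprNn (_ : (4 ^+ k) ^+ n = (4 ^+ n) ^+ k :> R); last by rewrite -!exprM mulnC.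
  by ring.
under eq_cvg do rewrite E.
have cvg_eq (F : set_system R) (l l' : R) : l = l' -> F --> l -> F --> l' by move=> ->.
apply: (cvg_eq _ _ _ E1).
by apply: cvgMl; apply: cvgMr; exact: mn.
Qed.

End Coefficients.

(** * Even functions as smooth functions of the square *)

Section Whitney.
Context {R : realType}.
Implicit Types M E : normedModType R.

(** The mean value theorem on each side of 0. It serves where a derivative is known only off a
    singular point, by a formula that extends continuously. *)
Lemma derive_extend (f G : R -> R) (d : R) : 0 < d -> {for 0, continuous f} ->
  {for 0, continuous G} ->
  (forall t, 0 < `|t| < d -> is_derive t (1 : R) f (G t)) -> is_derive (0 : R) (1 : R) f (G 0).
Proof.
move=> d0 fc Gc fG.
have fcont t : `|t| < d -> {for t, continuous f}.
  have [-> //|t0 td] := eqVneq t 0.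
  have [|D _] := fG t; first by rewrite normr_gt0 t0.
  by apply: differentiable_continuous; exact/derivable1_diffP.
suff H : (fun h : R => h^-1 *: (f (h *: 1 + 0) - f 0)) @ 0^' --> G 0.
  by apply: DeriveDef; [apply/cvg_ex; exists (G 0)|exact: cvg_lim].
apply/cvgrPdist_le => e e0; have /contP /(_ e e0)[d1 d10 H1] := Gc.
near=> h.
have h0 : h != 0 by near: h; exact: nbhs_dnbhs_neq.
have hd : `|h| < d by near: h; exact: dnbhs0_lt.
have hd1 : `|h| < d1 by near: h; exact: dnbhs0_lt.
suff [c /andP[c0 ch] E] : exists2 c, 0 < `|c| <= `|h| & f h - f 0 = G c * h.
  rewrite addr0 /GRing.scale/= mulr1 E mulrC mulfK// distrC; apply/ltW/H1.
  by rewrite subr0; exact: le_lt_trans ch hd1.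
have [h1|h1] := ltP 0 h.
  have [||c] := @MVT R f G 0 h h1; last first.
    rewrite subr0 in_itv/= => /andP[c0 ch] E; exists c => //.
    by rewrite !gtr0_norm// c0 ltW.
  - apply: continuous_in_subspaceT => t; rewrite inE/= in_itv/= => /andP[t0 th].
    by apply: fcont; rewrite ger0_norm// (le_lt_trans th)// -(gtr0_norm h1).
  - move=> t; rewrite in_itv/= => /andP[t0 th]; apply: fG; rewrite gtr0_norm// t0/=.
    by rewrite (lt_trans th)// -(gtr0_norm h1).
have h2 : h < 0 by rewrite lt_neqAle h0.
have [||c] := @MVT R f G h 0 h2; last first.
  rewrite sub0r in_itv/= => /andP[c0 ch] E; exists c.
    by rewrite !ltr0_norm// oppr_gt0 ch lerN2 ltW.
  by rewrite -[LHS]opprB E mulrN opprK.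
- apply: continuous_in_subspaceT => t; rewrite inE/= in_itv/= => /andP[t0 th].
  by apply: fcont; rewrite ler0_norm// (le_lt_trans _ hd)// ltr0_norm// lerN2.
- move=> t; rewrite in_itv/= => /andP[t0 th]; apply: fG; rewrite ltr0_norm// oppr_gt0 th/=.
  by rewrite (lt_trans _ hd)// ltr0_norm// ltrN2.
Unshelve. all: by end_near. Qed.

Lemma sqrt_smooth (x : R) : 0 < x -> smoothAt x (@Num.sqrt R).
Proof.
move=> x0; have o0 : open [set z : R | 0 < z] by exact: open_gt.
exists [set z : R | 0 < z]; first by split.
elim=> [|k IH]; first by move=> z z0; exact: sqrt_continuous.
apply: (@Ck_R_intro _ k _ _ (fun z => (2 * Num.sqrt z)^-1)) => //.
have o1 : open [set z : R | z != 0].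
  rewrite openE => z /= z0; apply: (nearP _ (fun y : R => y != 0)).2.
  exists `|z|; first by rewrite normr_gt0.
  by move=> y; apply: contraTneq => ->; rewrite sub0r normrN ltxx.
have Ci : Ck k [set z : R | z != 0] (fun z : R => z^-1).
  by move: k {IH}; apply: smoothP => z z0; exact: smoothAt_inv.
apply: (Ck_comp _ _ o0 o1 _ Ci) => [z z0|].
  by rewrite /= gt_eqF// mulr_gt0// sqrtr_gt0.
by apply: CkM => //; exact: Ck_cst.
Qed.

(** Bounded support in [y] makes the reflected sums below locally finite. The class is stable under
    parameter derivatives and under [sharp], as the induction on the order requires. *)
Definition even_bump M (f : R * M -> R) : Prop :=
  [/\ smooth setT f, forall y m, f (- y, m) = f (y, m) & forall y m, 1 < `|y| -> f (y, m) = 0].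

(** If [f (y, m) = h (y^2, m)], this is the derivative of [h] at [y^2], with its limit value at
    [y = 0]. *)
Definition sharp M (f : R * M -> R) (z : R * M) : R :=
  if z.1 == 0 then 'D_(1, 0) ('D_(1, 0) f) z / 2 else 'D_(1, 0) f z / (2 * z.1).

Lemma even_bump_derive M (f : R * M -> R) c (w : M) : findim M -> even_bump f ->
  [/\ smooth setT ('D_(c, w) f), forall y m, 'D_(c, w) f (- y, m) = 'D_(- c, w) f (y, m) &
    forall y m, 1 < `|y| -> 'D_(c, w) f (y, m) = 0].
Proof.
move=> fM [fs fe fz]; split.
- by apply: smoothP => z _; apply: smoothAt_derive; exact: smoothT_At.
- move=> y m; pose T (z : R * M) : R * M := (- z.1, z.2).
  eassert (D : is_derive ((y, m) : R * M) ((- c, w) : R * M) T _) by (rewrite /T; isd).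
  have fT : (fun z => f (T z)) = f by apply/funext => -[a b]; exact: fe.
  have fd : differentiable f (T (y, m)) by exact/smoothAt_diff/smoothT_At.
  have [_] := is_derive_chain D fd; rewrite fT => ->.
  by rewrite /T /= opprK.
- move=> y m y1; rewrite -(near_eq_derive (f := fun=> 0)); first exact: derive_cst.
  apply/nearP; exists (`|y| - 1); first by rewrite subr_gt0.
  move=> [y' m']; rewrite prod_normE gt_max => /andP[/= h _]; rewrite fz//.
  by have := lerB_dist y y'; rewrite distrC => h2; move: h h2; lra.
Qed.

Lemma even_bump_par M (f : R * M -> R) (w : M) : findim M -> even_bump f ->
  even_bump ('D_(0, w) f).
Proof.
move=> fM fb; have [h1 h2 h3] := even_bump_derive 0 w fM fb; split=> // y m.
by rewrite h2 oppr0.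
Qed.

Lemma even_bump_sharp M (f : R * M -> R) : findim M -> even_bump f -> even_bump (sharp f).
Proof.
move=> fM fb; have [h1 h2 h3] := even_bump_derive 1 0 fM fb.
have fyodd y m : 'D_(1, 0) f (- y, m) = - 'D_(1, 0) f (y, m).
  have [fs _ _] := fb.
  by rewrite h2 (derive_pair_lin1 _ _ (smoothT_At (y, m) fs)) derive00 addr0 mulN1r.
have fy0 m : 'D_(1, 0) f (0, m) = 0.
  by have := fyodd 0 m; rewrite oppr0 => h; lra.
split.
- apply: smoothP => -[y0 m0] _; have [->|y00] := eqVneq y0 0.
    have [g gs [Hg Hg0]] := hadamard_at fM (smoothT_At (0, m0) h1).
    apply: (smoothAt_near (f := fun z => g z / 2)); last first.
      by apply: smoothAtM => //; exact: smoothAt_cst.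
    have p2 : smoothAt ((0, m0) : R * M) (fun z : R * M => z.2) by sm.
    apply: (near2 Hg (near_subst (g := fun z : R * M => z.2) erefl p2 Hg0)) => -[y m] /= E E0.
    rewrite /sharp /=; case: eqVneq => [->|yn0]; first by rewrite E0.
    by rewrite E fy0 add0r subr0; field.
  apply: (smoothAt_near (f := fun z => 'D_(1, 0) f z / (2 * z.1))).
    have p1 : smoothAt ((y0, m0) : R * M) (fun z : R * M => z.1) by sm.
    by apply: (near1 (smoothAt_neq0 p1 y00)) => z /negbTE; rewrite /sharp => ->.
  apply: smoothAtM; first exact: smoothT_At.
  by apply: smoothAtV; [rewrite /= mulf_neq0|sm].
- move=> y m; rewrite /sharp /= oppr_eq0; case: eqVneq => [->|y0]; first by rewrite oppr0.
  by rewrite fyodd mulrN invrN mulrNN.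
- move=> y m y1; have y0 : y != 0.
    by apply: contraTneq y1 => ->; rewrite normr0 -leNgt ler01.
  by rewrite /sharp /= (negbTE y0) h3// mul0r.
Qed.

Section Extension.
Variable (a : nat -> R).
Hypothesis a_sum : forall b, 0 <= b -> exists C, forall N, \sum_(k < N) `|a k| * b ^+ k <= C.
Hypothesis a_mom : forall n, \sum_(k < N) a k * (- 4 ^+ k) ^+ n @[N --> \oo] --> (1 : R).

(** Seeley's reflection. For [f (y, m) = h (y^2, m)], a point [x < 0] receives a combination of the
    values of [h] at [- 4^k x]. Each differentiation in [x] brings out a factor [- 4^k], and [n]
    counts these factors; as all moments of [a] equal 1, the derivatives from both sides agree at
    0. *)
Definition whitney_sum M (n N : nat) (f : R * M -> R) (z : R * M) : R :=
  \sum_(k < N) a k * (- 4 ^+ k) ^+ n * f (2 ^+ k * Num.sqrt (- z.1), z.2).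

(* For [z.1 < 0] the terms with [2 ^+ k * sqrt (- z.1) > 1] vanish. *)
Definition whitney_ext M (n : nat) (f : R * M -> R) (z : R * M) : R :=
  if 0 <= z.1 then f (Num.sqrt z.1, z.2)
  else whitney_sum n (Num.bound (Num.sqrt (- z.1))^-1) f z.

Lemma whitney_sum_stable M (n : nat) (f : R * M -> R) (z : R * M) (N N' : nat) : even_bump f -> z.1 < 0 ->
  (Num.sqrt (- z.1))^-1 < N%:R -> (N <= N')%N -> whitney_sum n N' f z = whitney_sum n N f z.
Proof.
move=> [_ _ fz] z0 HN; elim: N' => [|N' IH]; first by rewrite leqn0 => /eqP ->.
rewrite leq_eqVlt => /orP[/eqP ->//|NN']; rewrite -(IH NN') /whitney_sum big_ord_recr/=.
have s0 : 0 < Num.sqrt (- z.1) by rewrite sqrtr_gt0 oppr_gt0.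
rewrite fz ?mulr0 ?addr0// ger0_norm; last by rewrite mulr_ge0 ?exprn_ge0// ltW.
rewrite -ltr_pdivrMr// div1r; apply: lt_trans HN _; rewrite -natrX ltr_nat.
by apply: (@leq_ltn_trans N'); [rewrite -ltnS|exact: ltn_expl].
Qed.

Lemma whitney_ext_sum M (n : nat) (f : R * M -> R) (z : R * M) (N : nat) : even_bump f -> z.1 < 0 ->
  (Num.sqrt (- z.1))^-1 < N%:R -> whitney_ext n f z = whitney_sum n N f z.
Proof.
move=> fb z0 HN; rewrite /whitney_ext leNgt z0/=; set B := Num.bound _.
have HB : (Num.sqrt (- z.1))^-1 < B%:R.
  by apply: archi_boundP; rewrite invr_ge0 sqrtr_ge0.
have [BN|/ltnW NB] := leqP B N.
  by rewrite (whitney_sum_stable n fb z0 HB BN).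
by rewrite (whitney_sum_stable n fb z0 HN NB).
Qed.

Lemma whitney_ext_near_neg M (n : nat) (f : R * M -> R) (z : R * M) : even_bump f -> z.1 < 0 ->
  exists N0 : nat, forall N : nat, (N0 <= N)%N ->
    \forall y \near z, whitney_ext n f y = whitney_sum n N f y.
Proof.
move=> fb z0; pose s := Num.sqrt (- z.1 / 2).
have z20 : 0 < - z.1 / 2 by rewrite divr_gt0// oppr_gt0.
have s0 : 0 < s by rewrite sqrtr_gt0.
exists (Num.bound s^-1).
have HB : s^-1 < (Num.bound s^-1)%:R.
  by apply: archi_boundP; rewrite invr_ge0 sqrtr_ge0.
move=> N BN; apply/nearP; exists (- z.1 / 2) => // y; rewrite prod_normE gt_max => /andP[/= h _].
have y1 : y.1 < z.1 / 2.
  by have := le_lt_trans (ler_norm _) h; lra.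
have y0 : y.1 < 0 by move: y1 z0; lra.
apply: whitney_ext_sum => //; apply: le_lt_trans (_ : s^-1 < N%:R); last first.
  by apply: lt_le_trans HB _; rewrite ler_nat.
rewrite lef_pV2 ?posrE ?sqrtr_gt0 ?oppr_gt0//; apply: ler_wsqrtr; move: y1; lra.
Qed.

Lemma whitney_term_smooth M (f : R * M -> R) (z : R * M) (c : R) : findim M -> smooth setT f -> z.1 < 0 ->
  smoothAt z (fun z : R * M => f (c * Num.sqrt (- z.1), z.2)).
Proof.
move=> fM fs z0; apply: (smoothAt_comp (f := f) (g := fun z : R * M => (c * Num.sqrt (- z.1), z.2))) => //.
  exact: smoothT_At.
apply: smoothAt_pair; last by sm.
apply: smoothAtM; first by sm.
by apply: (smoothAt_comp (f := @Num.sqrt R)); [apply: sqrt_smooth; rewrite oppr_gt0|sm].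
Qed.

Lemma whitney_sum_smooth M (n N : nat) (f : R * M -> R) (z : R * M) : findim M -> smooth setT f ->
  z.1 < 0 -> smoothAt z (whitney_sum n N f).
Proof.
move=> fM fs z0; apply: smoothAt_sum => k; apply: smoothAtM; first exact: smoothAt_cst.
exact: whitney_term_smooth.
Qed.

Lemma smooth_sqrt_pos M (f : R * M -> R) (z : R * M) : findim M -> smooth setT f -> 0 < z.1 ->
  smoothAt z (fun z : R * M => f (Num.sqrt z.1, z.2)).
Proof.
move=> fM fs z0; apply: (smoothAt_comp (f := f) (g := fun z : R * M => (Num.sqrt z.1, z.2))) => //.
  exact: smoothT_At.
apply: smoothAt_pair; last by sm.
by apply: (smoothAt_comp (f := @Num.sqrt R)); [exact: sqrt_smooth|sm].
Qed.

Lemma whitney_ext_near_pos M (n : nat) (f : R * M -> R) (z : R * M) : 0 < z.1 ->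
  \forall y \near z, whitney_ext n f y = f (Num.sqrt y.1, y.2).
Proof.
move=> z0; have p1 : smoothAt z (fun z : R * M => z.1) by sm.
by apply: (near1 (smoothAt_gt0 p1 z0)) => y /ltW y0; rewrite /whitney_ext y0.
Qed.

Lemma whitney_ext_smooth_off M (n : nat) (f : R * M -> R) (z : R * M) : findim M ->
  even_bump f -> z.1 != 0 -> smoothAt z (whitney_ext n f).
Proof.
move=> fM fb z0; have [fs _ _] := fb; have [zp|zn|/eqP] := ltgtP z.1 0; last by rewrite (negbTE z0).
  have [N HN] := whitney_ext_near_neg n fb zp.
  apply: (smoothAt_near (f := whitney_sum n N f)); last exact: whitney_sum_smooth.
  by apply: (near1 (HN N (leqnn N))) => y ->.
apply: (smoothAt_near (f := fun z : R * M => f (Num.sqrt z.1, z.2))); last exact: smooth_sqrt_pos.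
by apply: (near1 (whitney_ext_near_pos n f zn)) => y ->.
Qed.

Lemma whitney_term_derive M (f : R * M -> R) (z : R * M) (C c : R) (w : M) : smooth setT f ->
  z.1 < 0 -> is_derive z ((c, w) : R * M) (fun z : R * M => f (C * Num.sqrt (- z.1), z.2))
    (- (C * c / (2 * Num.sqrt (- z.1))) * 'D_(1, 0) f (C * Num.sqrt (- z.1), z.2) +
     'D_(0, w) f (C * Num.sqrt (- z.1), z.2)).
Proof.
move=> fs z0; have z0' : 0 < - z.1 by rewrite oppr_gt0.
have D1 : is_derive z ((c, w) : R * M) (fun z : R * M => - z.1) (- c) by isd.
have D2 := is_derive_chainR D1 (is_derive1_sqrt z0').
eassert (D3 : is_derive z ((c, w) : R * M) (fun z : R * M => (C * Num.sqrt (- z.1), z.2)) _) by isd.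
have fz : smoothAt (C * Num.sqrt (- z.1), z.2) f by exact: smoothT_At.
have H := is_derive_chain D3 (smoothAt_diff fz); apply: (is_derive_eq H).
rewrite (derive_pair_lin1 _ _ fz); congr (_ * _ + _).
by rewrite /GRing.scale /=; ring.
Qed.

Lemma whitney_sum_derive M (n N : nat) (f : R * M -> R) (z : R * M) (c : R) (w : M) :
  smooth setT f -> z.1 < 0 ->
  'D_(c, w) (whitney_sum n N f) z =
    c * whitney_sum n.+1 N (sharp f) z + whitney_sum n N ('D_(0, w) f) z.
Proof.
move=> fs z0; have s0 : Num.sqrt (- z.1) != 0 by rewrite gt_eqF// sqrtr_gt0 oppr_gt0.
pose b (k : 'I_N) := a k * (- 4 ^+ k) ^+ n.
pose dk (k : 'I_N) : R := b k * (- (2 ^+ k * c / (2 * Num.sqrt (- z.1))) * 'D_(1, 0) f (2 ^+ k * Num.sqrt (- z.1), z.2) +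
     'D_(0, w) f (2 ^+ k * Num.sqrt (- z.1), z.2)).
have H (k : 'I_N) : is_derive z ((c, w) : R * M)
    (fun z : R * M => b k * f (2 ^+ k * Num.sqrt (- z.1), z.2)) (dk k).
  have D := isd_mul (isd_cst z ((c, w) : R * M) (b k)) (whitney_term_derive (2 ^+ k) c w fs z0).
  by apply: (is_derive_eq D); rewrite mulr0 addr0.
have [_ E] := is_derive_sumf (index_enum 'I_N) H.
rewrite /whitney_sum E mulr_sumr -big_split; apply: eq_bigr => k _ /=.
rewrite /dk /b mulrDr; congr (_ + _); rewrite /sharp /=.
have p0 : 2 ^+ k != 0 :> R by rewrite expf_neq0.
have -> : 2 ^+ k * Num.sqrt (- z.1) == 0 = false by rewrite mulf_eq0 (negbTE s0) (negbTE p0).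
have -> : 4 ^+ k = 2 ^+ k * 2 ^+ k :> R by rewrite -exprMn; congr (_ ^+ _); ring.
by rewrite exprS; field; rewrite s0 p0.
Qed.

Lemma whitney_ext_derive_off M (n : nat) (f : R * M -> R) (z : R * M) (c : R) (w : M) : findim M ->
  even_bump f -> z.1 != 0 ->
  'D_(c, w) (whitney_ext n f) z =
    c * whitney_ext n.+1 (sharp f) z + whitney_ext n ('D_(0, w) f) z.
Proof.
move=> fM fb z0; have fwb := even_bump_par w fM fb; have fsb := even_bump_sharp fM fb.
have [fs _ _] := fb.
have [zp|zn|/eqP] := ltgtP z.1 0; last by rewrite (negbTE z0).
  have [N1 HN1] := whitney_ext_near_neg n fb zp.
  have [N2 HN2] := whitney_ext_near_neg n fwb zp.
  have [N3 HN3] := whitney_ext_near_neg n.+1 fsb zp.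
  pose N := maxn N1 (maxn N2 N3).
  rewrite (near_eq_derive (c, w) (HN1 N (leq_maxl _ _))) whitney_sum_derive//.
  have l2 : (N2 <= N)%N by rewrite /N !leq_max leqnn orbT.
  have l3 : (N3 <= N)%N by rewrite /N !leq_max leqnn !orbT.
  by rewrite (nbhs_singleton (HN2 N l2)) (nbhs_singleton (HN3 N l3)).
rewrite (near_eq_derive (c, w) (whitney_ext_near_pos n f zn)).
have D1 : is_derive z ((c, w) : R * M) (fun z : R * M => z.1) c.
  exact: (is_derive_fst (isd_id z ((c, w) : R * M))).
have D2 := is_derive_chainR D1 (is_derive1_sqrt zn).
eassert (D3 : is_derive z ((c, w) : R * M) (fun z : R * M => (Num.sqrt z.1, z.2)) _) by isd.
have fz : smoothAt (Num.sqrt z.1, z.2) f by exact: smoothT_At.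
have [_ ->] := is_derive_chain D3 (smoothAt_diff fz).
rewrite (derive_pair_lin1 _ _ fz) /whitney_ext (ltW zn) /=; congr (_ + _).
have s0 : Num.sqrt z.1 != 0 by rewrite gt_eqF// sqrtr_gt0.
by rewrite /sharp /= (negbTE s0); field.
Qed.

Lemma even_bump_lip M (f : R * M -> R) (m0 : M) : findim M -> even_bump f ->
  exists2 L : R, 0 < L & forall y m, 0 <= y -> `|m - m0| < 1 ->
    `|f (y, m) - f (0, m0)| <= L * (y + `|m - m0|).
Proof.
move=> fM [fs fe fz]; have [L L0 HL] := smooth_lipschitz (Num.max 1 (`|m0| + 1)) _ _ fs.
exists L => // y m y0 mm.
have f1 : f (1, m) = 0.
  have fc : {for (1 : R, m), continuous f} by exact/smoothAt_cont/smoothT_At.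
  apply/eqP/negPn/negP => h.
  have /contP /(_ `|f (1, m)|) [|d d0 Hd] := fc; first by rewrite normr_gt0.
  have := Hd (1 + d / 2, m); rewrite fz; last first.
    by rewrite ger0_norm; move: d0; lra.
  rewrite sub0r normrN ltxx => H; suff : false by []; apply: H.
  rewrite prod_normE /= [1 + _]addrC addrK subrr normr0 gtr0_norm ?divr_gt0//.
  by rewrite gt_max d0 andbT; move: d0; lra.
have mr : `|m| <= Num.max 1 (`|m0| + 1).
  rewrite le_max; apply/orP; right; rewrite -(subrK m0 m).
  by apply: le_trans (ler_normD _ _) _; rewrite addrC lerD2l ltW.
have m0r : `|m0| <= Num.max 1 (`|m0| + 1) by rewrite le_max lerDl ler01 orbT.
have bd y1 : 0 <= y1 -> y1 <= 1 -> `|f (y1, m) - f (0, m0)| <= L * (y1 + `|m - m0|).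
  move=> y10 y11; apply: le_trans (HL _ _ _ _) _.
  - by rewrite prod_normE ge_max mr andbT /= ger0_norm// le_max y11.
  - by rewrite prod_normE ge_max m0r andbT /= normr0 le_max ler01.
  apply: ler_wpM2l; first exact: ltW.
  by rewrite prod_normE ge_max /= subr0 ger0_norm// lerDl normr_ge0 lerDr y10.
have [y1|y1] := leP y 1; first exact: bd.
have h1 := bd 1 ler01 (lexx _); rewrite f1 in h1.
have yn : 1 < `|y| by rewrite ger0_norm.
rewrite (fz _ _ yn); apply: le_trans h1 _.
by apply: ler_wpM2l; [exact: ltW|rewrite lerD2r ltW].
Qed.

(** Only [z.1 = 0] is delicate. The weights sum to 1 in the limit, so the error is a weighted sum of
    increments of [f] from [(0, m0)] to [(2^k s, m)], of size at most [L] times [2^k s] plus the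
    distance of [m] to [m0]; the weights remain summable after multiplication by [2^k]. *)
Lemma whitney_ext_cont M (n : nat) (f : R * M -> R) (z : R * M) : findim M -> even_bump f ->
  {for z, continuous (whitney_ext n f)}.
Proof.
move=> fM fb; case: z => z1 m0; have [->|z10] := eqVneq z1 0; last first.
  by apply: smoothAt_cont; exact: whitney_ext_smooth_off.
have E0 : whitney_ext n f (0, m0) = f (0, m0) by rewrite /whitney_ext /= lexx sqrtr0.
have [L L0 HL] := even_bump_lip m0 fM fb.
have [C HC] := @a_sum (2 * 4 ^+ n) (mulr_ge0 (ler0n _ _) (exprn_ge0 _ (ler0n _ _))).
have C0 : 0 <= C by have := HC 0%N; rewrite big_ord0.
pose B := L * (C + 1).
have B0 : 0 < B by rewrite mulr_gt0// ltr_wpDl.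
have key y m : `|m - m0| < 1 -> `|whitney_ext n f (y, m) - f (0, m0)| <= B * (Num.sqrt `|y| + `|m - m0|).
  move=> mm; have [y0|y0] := leP 0 y.
    rewrite /whitney_ext /= y0 (ger0_norm y0); apply: le_trans (HL _ _ (sqrtr_ge0 _) mm) _.
    apply: ler_wpM2r; first by rewrite addr_ge0// sqrtr_ge0.
    by rewrite /B ler_peMr ?(ltW L0)// lerDr.
  rewrite (ltr0_norm y0); set s := Num.sqrt (- y).
  have s0 : 0 < s by rewrite sqrtr_gt0 oppr_gt0.
  apply/ler_addgt0Pr => e e0.
  have [N1 HN1] : exists N : nat, s^-1 < N%:R.
    by exists (Num.bound s^-1); apply: archi_boundP; rewrite invr_ge0 sqrtr_ge0.
  have e1 : 0 < e / (`|f (0, m0)| + 1) by rewrite divr_gt0// ltr_wpDl.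
  have := a_mom n; move/cvgrPdist_le => /(_ _ e1)[N2 _ HN2].
  pose N := maxn N1 N2.
  have HN : s^-1 < N%:R by apply: lt_le_trans HN1 _; rewrite ler_nat leq_maxl.
  rewrite (whitney_ext_sum n fb (z := (y, m)) y0 HN) /whitney_sum /=.
  have -> : \sum_(k < N) a k * (- 4 ^+ k) ^+ n * f (2 ^+ k * Num.sqrt (- y), m) - f (0, m0) =
     \sum_(k < N) a k * (- 4 ^+ k) ^+ n * (f (2 ^+ k * s, m) - f (0, m0)) +
     (- (1 - \sum_(k < N) a k * (- 4 ^+ k) ^+ n)) * f (0, m0).
    rewrite opprB mulrBl mul1r [X in _ + (X - _)]mulr_suml addrA -big_split/=; congr (_ - _).
    by apply: eq_bigr => k _; rewrite -/s; ring.
  apply: le_trans (ler_normD _ _) _; apply: lerD; last first.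
    rewrite normrM normrN.
    apply: (@le_trans _ _ (e / (`|f (0, m0)| + 1) * (`|f (0, m0)| + 1))).
      by apply: ler_pM => //; [apply: HN2; exact: leq_maxr|rewrite lerDl].
    by rewrite divfK// gt_eqF// ltr_wpDl.
  apply: le_trans (ler_norm_sum _ _ _) _.
  apply: (@le_trans _ _ (\sum_(k < N) (`|a k| * (2 * 4 ^+ n) ^+ k) * (L * (s + `|m - m0|)))).
    apply: ler_sum => k _; rewrite !normrM.
    have -> : `|(- 4 ^+ k) ^+ n| = (4 ^+ n) ^+ k :> R.
      by rewrite normrX normrN ger0_norm ?exprn_ge0// -!exprM mulnC.
    rewrite exprMn.
    apply: (@le_trans _ _ (`|a k| * (4 ^+ n) ^+ k * (L * (2 ^+ k * s + `|m - m0|)))).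
      apply: ler_wpM2l; first by rewrite mulr_ge0// !exprn_ge0.
      by apply: HL => //; rewrite mulr_ge0 ?exprn_ge0// ltW.
    have -> : `|a k| * (2 ^+ k * 4 ^+ n ^+ k) * (L * (s + `|m - m0|)) =
      `|a k| * 4 ^+ n ^+ k * (L * (2 ^+ k * s + 2 ^+ k * `|m - m0|)) by ring.
    apply: ler_wpM2l; first by rewrite mulr_ge0// !exprn_ge0.
    apply: ler_wpM2l; first exact: ltW.
    by rewrite lerD2l ler_peMl// exprn_ege1// ler1n.
  rewrite -mulr_suml /B [L * (C + 1)]mulrC -mulrA; apply: ler_wpM2r.
    by rewrite mulr_ge0 ?(ltW L0)// addr_ge0// ltW.
  by apply: le_trans (HC N) _; rewrite lerDl.
apply/contP => e e0; rewrite E0.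
have eB : 0 < e / (B * 2) by rewrite divr_gt0// mulr_gt0.
exists (Num.min 1 (Num.min ((e / (B * 2)) ^+ 2) (e / (B * 2)))).
  by rewrite !lt_min ltr01 eB exprn_gt0.
move=> [y m]; rewrite prod_normE gt_max /= !lt_min subr0 => /andP[/and3P[_ y2 _] /and3P[m1 _ m2]].
apply: le_lt_trans (key y m m1) _.
have sy : Num.sqrt `|y| < e / (B * 2).
  by rewrite -(gtr0_norm eB) -(sqrtr_sqr (e / (B * 2))) ltr_sqrt// exprn_gt0.
have -> : e = B * (e / (B * 2) + e / (B * 2)) by field; rewrite gt_eqF.
by rewrite ltr_pM2l// ltrD.
Qed.

(** Along a parameter direction the line through [(0, m0)] stays in [z.1 = 0], where the extension
    is [f] itself; along the first axis the formula valid off 0 extends continuously and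
    [derive_extend] applies. The frame of [frame_pair] consists of these two kinds of directions. *)
Lemma whitney_ext_derive M (n : nat) (f : R * M -> R) (z : R * M) (c : R) (w : M) : findim M ->
  even_bump f -> (c, w) = (1, 0) \/ c = 0 ->
  is_derive z ((c, w) : R * M) (whitney_ext n f)
    (c * whitney_ext n.+1 (sharp f) z + whitney_ext n ('D_(0, w) f) z).
Proof.
move=> fM fb cw; have fsb := even_bump_sharp fM fb; have [fs _ _] := fb.
case: z => z1 m0; have [->|z10] := eqVneq z1 0; last first.
  rewrite -whitney_ext_derive_off//; apply: smoothAt_is_derive.
  exact: whitney_ext_smooth_off.
have line (F : R * M -> R) (v : R * M) (l : R) :
    is_derive (0 : R) (1 : R) (fun t : R => F (t *: v + (0, m0))) l -> is_derive ((0, m0) : R * M) v F l.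
  move=> [D E]; rewrite /derivable /derive in D E.
  have EQ : (fun h : R => h^-1 *: (F (h *: v + (0, m0)) - F (0, m0))) =
    (fun h : R => h^-1 *: (F ((h *: 1 + 0) *: v + (0, m0)) - F (0 *: v + (0, m0)))).
    by apply/funext => h; rewrite addr0 scale0r add0r [h *: 1]mulr1.
  by apply: DeriveDef; rewrite /derivable /derive EQ.
case: cw => [[-> ->]|->]; last first.
  rewrite mul0r add0r; apply: line.
  have -> : (fun t : R => whitney_ext n f (t *: (0, w) + (0, m0))) =
    (fun t : R => f (t *: (0, w) + (0, m0))).
    apply/funext => t; have -> : t *: ((0, w) : R * M) + (0, m0) = (0, t *: w + m0).
      by congr (_, _); rewrite /= scaler0 addr0.
    by rewrite /whitney_ext /= lexx sqrtr0.
  rewrite /whitney_ext /= lexx sqrtr0.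
  have D : derivable f (0 *: ((0, w) : R * M) + (0, m0)) (0, w).
    by apply: diff_derivable; apply: smoothAt_diff; exact: smoothT_At.
  by have := line_derive D; rewrite scale0r add0r.
have D00 : 'D_(0, 0) f = (fun _ : R * M => 0) by apply/funext => y; exact: derive00.
have E0 (y : R * M) : whitney_ext n ('D_(0, 0) f) y = 0.
  by rewrite D00 /whitney_ext /whitney_sum; case: ifP => // _; rewrite big1// => k _; rewrite mulr0.
rewrite mul1r E0 addr0; apply: line.
have lE (t : R) : t *: (1, 0 : M) + (0, m0) = (t, m0).
  by congr (_, _); rewrite /= ?scaler0 ?addr0 ?add0r// [_ *: _]mulr1.
under eq_fun do rewrite lE.
have ps t : smoothAt t (fun t : R => (t, m0)) by sm.
have cc (k : nat) (g : R * M -> R) : even_bump g -> {for 0, continuous (fun t : R => whitney_ext k g (t, m0))}.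
  move=> gb; apply: (@continuous_comp _ _ _ (fun t : R => (t, m0))); last exact: whitney_ext_cont.
  exact: smoothAt_cont (ps 0).
apply: (@derive_extend _ (fun t => whitney_ext n.+1 (sharp f) (t, m0)) 1) => //; [exact: cc|exact: cc|].
move=> t /andP[t0 _]; have tn0 : t != 0 by rewrite -normr_gt0.
have H : smoothAt (t, m0) (whitney_ext n f) by exact: whitney_ext_smooth_off.
eassert (D : is_derive t (1 : R) (fun t : R => (t, m0)) _) by isd.
have H2 := is_derive_chain D (smoothAt_diff H); apply: (is_derive_eq H2).
by rewrite whitney_ext_derive_off// mul1r E0 addr0.
Qed.

Lemma frame_pair M : findim M -> exists (I : finType) (e : I -> R * M) (l : I -> {linear (R * M)%type -> R}),
  [/\ forall i, continuous (l i), forall x, x = \sum_i l i x *: e i &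
      forall i, e i = (1, 0) \/ (e i).1 = 0].
Proof.
move=> [I [e [l [lc le]]]].
have L2 i : linear (fun x : R * M => l i x.2) by move=> a' x y /=; rewrite linearP.
exists ('I_1 + I)%type, (fun i => if i is inr i then (0, e i) else (1, 0)),
  (fun i => if i is inr i then mklin (@L2 i) else mklin (@linear_fst R R M)); split.
- case=> [_|i] x /=; first exact: cvg_fst.
  by apply: (@continuous_comp _ _ _ snd (l i)); [exact: cvg_snd|exact: lc].
- move=> [x y]; rewrite big_sumType/= big_ord1.
  have -> : \sum_i l i y *: (0 : R, e i) = (0, y).
    rewrite [in RHS](le y).
    transitivity (\sum_i (mklin (@linear_inr R R M) (l i y *: e i))).
      by apply: eq_bigr => i _; rewrite linearZ.
    by rewrite -linear_sum.
  by congr (_, _); rewrite /= ?scaler0 ?add0r// addr0 [_ *: _]mulr1.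
- by case=> [_|i]; [left|right].
Qed.

(** The derivatives are extensions again, of [sharp f] with [n.+1] and of parameter derivatives of
    [f] with [n]; hence an induction over all [n] and [f]. *)
Lemma whitney_ext_Ck M k (n : nat) (f : R * M -> R) : findim M -> even_bump f ->
  Ck k setT (whitney_ext n f).
Proof.
move=> fM; elim: k n f => [|k IH] n f fb.
  by move=> z _; exact: whitney_ext_cont.
have [I [e [l [lc le ecase]]]] := frame_pair fM.
have cw i : ((e i).1, (e i).2) = (1, 0) \/ (e i).1 = 0.
  by case: (ecase i) => H; [left; rewrite H|right].
have H i z : is_derive z (e i) (whitney_ext n f)
    ((e i).1 * whitney_ext n.+1 (sharp f) z + whitney_ext n ('D_(0, (e i).2) f) z).
  by have := whitney_ext_derive n z fM fb (cw i); case: (e i).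
apply: (CkS_intro _ openT lc le) => [i y _|i]; first by case: (H i y).
apply: (Ck_ext (f := fun z => (e i).1 * whitney_ext n.+1 (sharp f) z + whitney_ext n ('D_(0, (e i).2) f) z)).
- exact: openT.
- by move=> z _; have [_ ->] := H i z.
- apply: CkD; [exact: openT| |by apply: IH; exact: even_bump_par].
  by apply: CkM; [exact: openT|exact: Ck_cst|apply: IH; exact: even_bump_sharp].
Qed.

End Extension.

Lemma whitney_even M (f : R * M -> R) : findim M -> smoothAt 0 f ->
  (\forall z \near (0 : R * M), f (- z.1, z.2) = f z) ->
  exists2 h : R * M -> R, smoothAt 0 h & \forall z \near (0 : R * M), f z = h (z.1 ^+ 2, z.2).
Proof.
move=> fM fs fe; have [a [a_sum a_mom]] := @whitney_coef_exists R.
have [g [gs gf _]] := globalize _ _ fs.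
pose N (z : R * M) : R * M := (- z.1, z.2).
have Ns z : smoothAt z N by rewrite /N; sm.
(* Symmetrized globally, and cut off where [2 y^2 >= 2], which gives the support asked for by
   [even_bump]. *)
pose f1 (z : R * M) := cutoff (2 * z.1 ^+ 2) * ((g z + g (N z)) / 2).
have f1b : even_bump f1.
  split.
  - apply: smoothP => z _; apply: smoothAtM.
      by apply: (smoothAt_comp (f := cutoff)); [exact: cutoff_smooth|sm].
    apply: smoothAtM; last exact: smoothAt_cst.
    apply: smoothAtD; first exact: smoothT_At.
    by apply: (smoothAt_comp (f := g)) => //; exact: smoothT_At.
  - by move=> y m; rewrite /f1 /N /= sqrrN opprK [X in X / 2]addrC.
  - move=> y m y1; rewrite /f1 /= cutoff0 ?mul0r// -[leLHS]mulr1.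
    by apply: ler_wpM2l => //; rewrite -[leRHS]real_normK ?num_real// exprn_ege1// ltW.
exists (whitney_ext a 0 f1).
  by apply: smoothT_At => k; apply: whitney_ext_Ck.
have q : smoothAt 0 (fun z : R * M => 1 - 2 * z.1 ^+ 2) by sm.
have q0 : 0 < 1 - 2 * (0 : R * M).1 ^+ 2 by rewrite expr0n mulr0 subr0.
have N0 : N 0 = 0 by rewrite /N /= oppr0.
apply: (near2 (near_and fe (smoothAt_gt0 q q0))
  (near_and gf (near_subst N0 (Ns 0) gf))) => -[y m] [/= e1 c1] [/= g1 g2].
rewrite /whitney_ext /= sqr_ge0 sqrtr_sqr.
have -> : f1 (`|y|, m) = f1 (y, m).
  have [_ f1e _] := f1b; have [y0|y0] := leP 0 y; first by rewrite ger0_norm.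
  by rewrite ltr0_norm.
rewrite /f1 /= cutoff1; last by move: c1; lra.
by rewrite g1 g2 /N /= e1; field.
Qed.

Lemma whitney M (f : R * M -> R) : findim M -> smoothAt 0 f ->
  exists r0 r1 : R * M -> R, [/\ smoothAt 0 r0, smoothAt 0 r1 &
    \forall z \near (0 : R * M), f z = r0 (z.1 ^+ 2, z.2) + z.1 * r1 (z.1 ^+ 2, z.2)].
Proof.
move=> fM fs; pose N (z : R * M) : R * M := (- z.1, z.2).
have Ns z : smoothAt z N by rewrite /N; sm.
have N0 : N 0 = 0 by rewrite /N /= oppr0.
have fN : smoothAt 0 (fun z => f (N z)) by apply: (smoothAt_comp (f := f)); rewrite ?N0.
have es : smoothAt 0 (fun z => (f z + f (N z)) / 2) by apply: smoothAtM; [apply: (smoothAtD fs fN)|sm].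
have os : smoothAt 0 (fun z => (f z - f (N z)) / 2) by apply: smoothAtM; [apply: (smoothAtB fs fN)|sm].
have [r0 r0s H0] : exists2 h : R * M -> R, smoothAt 0 h &
    \forall z \near (0 : R * M), (f z + f (N z)) / 2 = h (z.1 ^+ 2, z.2).
  apply: (whitney_even (f := fun z => (f z + f (N z)) / 2) fM es); apply: filterE => -[y m]; rewrite /N /= opprK.
  by rewrite [X in X / 2]addrC.
have [k ks Hk] := hadamard0 fM os.
have ke : \forall z \near (0 : R * M), k (- z.1, z.2) = k z.
  apply: (near2 Hk (near_subst N0 (Ns 0) Hk)) => -[y m]; rewrite /N /= !opprK oppr0 !subrr !mul0r !add0r => h1 h2.
  have [->|y0] := eqVneq y 0; first by rewrite oppr0.
  apply: (mulfI y0); rewrite -h1; apply: oppr_inj; rewrite -mulNr -h2.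
  by rewrite -mulNr opprB.
have [r1 r1s H1] := whitney_even fM ks ke.
exists r0, r1; split=> //.
apply: (near2 (near_and H0 H1) Hk) => -[y m]; rewrite /N /= oppr0 subrr mul0r add0r.
by move=> [<- <-] <-; field.
Qed.

(** In [f = r0 (y^2) + y * r1 (y^2)] the differences between the values at [y^2] and at [D] are
    divisible by [y^2 - D]; the values at [D] form the remainder. *)
Lemma whitney_division M (f : R * M -> R) : findim M -> smoothAt 0 f ->
  exists (q : R * (R * M) -> R) (r0 r1 : R * M -> R),
  [/\ smoothAt 0 q, smoothAt 0 r0, smoothAt 0 r1 &
    \forall z \near (0 : R * (R * M)),
      f (z.1, z.2.2) = q z * (z.1 ^+ 2 - z.2.1) + r0 z.2 + r1 z.2 * z.1].
Proof.
move=> fM fs; have [r0 [r1 [r0s r1s Hr]]] := whitney fM fs.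
have [g0 g0s H0] := hadamard2 fM r0s.
have [g1 g1s H1] := hadamard2 fM r1s.
pose S (z : R * (R * M)) : R * (R * M) := (z.1 ^+ 2, z.2).
have Ss : smoothAt 0 S by rewrite /S; sm.
have S0 : S 0 = 0 by rewrite /S /= expr0n.
pose T (z : R * (R * M)) : R * M := (z.1, z.2.2).
have Ts : smoothAt 0 T by rewrite /T; sm.
have T0 : T 0 = 0 by [].
have gS g : smoothAt 0 g -> smoothAt 0 (fun z => g (S z) : R).
  by move=> gs; apply: (smoothAt_comp (f := g)); rewrite ?S0.
exists (fun z => g0 (S z) + z.1 * g1 (S z)), r0, r1; split=> //.
  by apply: smoothAtD; [exact: gS|apply: smoothAtM; [sm|exact: gS]].
apply: (near2 (near_and (near_subst S0 Ss H0) (near_subst S0 Ss H1))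
  (near_subst T0 Ts Hr)) => -[y [D m]]; rewrite /S /T /= => -[-> ->] ->; ring.
Qed.

End Whitney.

(** * Generic cubic division *)

Section Cusp.
Context {R : realType} {M : normedModType R}.
Hypothesis fM : findim M.
Implicit Types s k : R * (R * M) -> R.

Lemma derive_triple s z (a b : R) (w : M) : smoothAt z s ->
  'D_(a, (b, w)) s z = a * 'D_(1, 0) s z + b * 'D_(0, (1, 0)) s z + 'D_(0, (0, w)) s z.
Proof.
move=> sz; rewrite (derive_pair_lin1 _ _ sz) -addrA; congr (_ + _).
rewrite -[b * _]/(b *: 'D_(0, (1, 0)) s z) -derive_lin; last exact: smoothAt_diff.
by congr derive; congr (_, (_, _)); rewrite /= ?scaler0 ?add0r// addr0 [_ *: _]mulr1.
Qed.

(* A function of a root [r] of [V ^ 3 + p V + q] and of [p] that depends on the cubic only. *)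
Definition fiber_constant s : Prop := forall r r' (m : M),
  s (r, (- (r ^+ 2 + r * r' + r' ^+ 2), m)) = s (r', (- (r ^+ 2 + r * r' + r' ^+ 2), m)).

Let P (r r' : R) := - (r ^+ 2 + r * r' + r' ^+ 2).

Lemma generic_eq (phi : R -> R) (x : R) (c : seq R) : {for x, continuous phi} ->
  (forall y, y \notin c -> phi y = 0) -> phi x = 0.
Proof.
move=> phic H; apply/eqP/negPn/negP => n0.
have /contP /(_ `|phi x|) [|d d0 Hd] := phic; first by rewrite normr_gt0.
(* One point more than [c] has entries, all distinct and within [d] of [x], so some [y i] avoids
   [c]. *)
pose y (i : 'I_(size c).+1) := x + d / i.+2%:R.
have yI : injective y.
  move=> i j /addrI /(mulfI (lt0r_neq0 d0)) /invr_inj /eqP.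
  by rewrite eqr_nat => /eqP [] /ord_inj.
have [i yi] : exists i, y i \notin c.
  apply: contrapT => /forallNP h.
  have /uniq_leq_size : uniq [seq y i | i <- enum 'I_(size c).+1].
    by rewrite map_inj_uniq ?enum_uniq.
  move=> /(_ c); rewrite size_map size_enum_ord ltnn => h2; suff : false by []; apply: h2.
  by move=> _ /mapP[i _ ->]; apply/negPn/negP => /h.
have := Hd (y i); rewrite (H _ yi) sub0r normrN ltxx => h; suff : false by []; apply: h.
rewrite /y addrC addKr gtr0_norm ?divr_gt0//.
by rewrite ltr_pdivrMr// ltr_pMr// ltr1n.
Qed.

(** The third root is [- r - r'], and the excluded values of [r'] are those where two of the three
    roots coincide. They are finitely many, so continuity in [r'] covers them. *)
Lemma generic_fiber s : smooth setT s ->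
  (forall r r' m, r != r' -> 2 * r + r' != 0 -> 2 * r' + r != 0 ->
    s (r, (P r r', m)) = s (r', (P r r', m))) -> fiber_constant s.
Proof.
move=> ss H r r' m; apply/eqP; rewrite -subr_eq0; apply/eqP.
pose phi x := s (r, (P r x, m)) - s (x, (P r x, m)).
apply: (@generic_eq phi r' [:: r; - 2 * r; - r / 2]).
  apply: smoothAt_cont; apply: smoothAtB.
    apply: (smoothAt_comp (f := s) (g := fun x => (r, (P r x, m)))); first exact: smoothT_At.
    by rewrite /P; sm.
  apply: (smoothAt_comp (f := s) (g := fun x => (x, (P r x, m)))); first exact: smoothT_At.
  by rewrite /P; sm.
move=> y; rewrite !inE !negb_or => /and3P[y1 y2 y3]; apply/eqP; rewrite subr_eq0; apply/eqP.
apply: H; first by rewrite eq_sym.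
- by apply: contra y2 => /eqP h; apply/eqP; lra.
- by apply: contra y3 => /eqP h; apply/eqP; lra.
Qed.

(** The identity defining [fiber_constant] is differentiated in [r]; on both sides [p] varies at the
    rate [- (2 r + r')]. *)
Lemma fiber_derive s (r r' : R) (m : M) : smooth setT s -> fiber_constant s ->
  'D_(1, 0) s (r, (P r r', m)) =
    (2 * r + r') * ('D_(0, (1, 0)) s (r, (P r r', m)) - 'D_(0, (1, 0)) s (r', (P r r', m))).
Proof.
move=> ss sf; have sA z : smoothAt z s by exact: smoothT_At.
pose b := - (2 * r + r').
have D1 : is_derive r (1 : R) (fun x => (x, (P x r', m))) (1, (b, 0)).
  eassert (H : is_derive r (1 : R) (fun x => (x, (P x r', m))) _) by (rewrite /P; isd).
  apply: (is_derive_eq H); congr (_, (_, _)); rewrite /b /=; ring.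
have D2 : is_derive r (1 : R) (fun x => (r', (P x r', m))) (0, (b, 0)).
  eassert (H : is_derive r (1 : R) (fun x => (r', (P x r', m))) _) by (rewrite /P; isd).
  by apply: (is_derive_eq H); congr (_, (_, _)); rewrite /b /=; ring.
have [_ E1] := is_derive_chain D1 (smoothAt_diff (sA _)).
have [_ E2] := is_derive_chain D2 (smoothAt_diff (sA _)).
have E : (fun x => s (x, (P x r', m))) = (fun x => s (r', (P x r', m))).
  by apply/funext => x; exact: sf.
move: E1 E2; rewrite E => ->.
rewrite (derive_triple 1 b 0 (sA _)) (derive_triple 0 b 0 (sA _)) !derive00 /b.
set A1 := 'D_(1, 0) s _; set A2 := 'D_(0, _) s _; set A3 := 'D_(0, _) s _ => h.
by move: h; lra.
Qed.

Lemma fold_derive s r m : smooth setT s -> fiber_constant s ->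
  'D_(1, 0) s (r, (- (3 * r ^+ 2), m)) = 0.
Proof.
move=> ss sf; have := fiber_derive r r m ss sf.
have -> : P r r = - (3 * r ^+ 2) by rewrite /P; ring.
by rewrite subrr mulr0.
Qed.

(** With [D = 3 r^2 + p] as a coordinate in place of [p], [fold_derive] says that the derivative of
    [s] vanishes on [D = 0], so Hadamard division by [D] applies. *)
Lemma fold_quotient s : smooth setT s -> fiber_constant s ->
  exists2 k, smooth setT k & forall z, 'D_(1, 0) s z = (3 * z.1 ^+ 2 + z.2.1) * k z.
Proof.
move=> ss sf; have sA z : smoothAt z s by exact: smoothT_At.
pose sr := 'D_(1, 0) s; have srA z : smoothAt z sr by exact: smoothAt_derive.
pose D (z : R * (R * M)) := 3 * z.1 ^+ 2 + z.2.1.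
have DA z : smoothAt z D by rewrite /D; sm.
pose k z := if D z == 0 then 'D_(0, (1, 0)) sr z else sr z / D z.
exists k; last first.
  move=> z; rewrite /k -/(D z) -/sr; case: eqVneq => [D0|D0]; last by rewrite mulrC divfK.
  rewrite D0 mul0r /sr; move: D0; case: z => r [p m]; rewrite /D /= => D0.
  have -> : p = - (3 * r ^+ 2) by move: D0; lra.
  exact: fold_derive.
apply: smoothP => z0 _; have [D0|D0] := eqVneq (D z0) 0; last first.
  apply: (smoothAt_near (f := fun z => sr z / D z)); last by apply: smoothAtM => //; exact: smoothAtV.
  by apply: (near1 (smoothAt_neq0 (DA z0) D0)) => z /negbTE; rewrite /k => ->.
pose T (x : R * (R * M)) : R * (R * M) := (x.2.1, (x.1 - 3 * x.2.1 ^+ 2, x.2.2)).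
have TA x : smoothAt x T by rewrite /T; sm.
pose F x := sr (T x).
have FA x : smoothAt x F by apply: (smoothAt_comp (f := sr)).
have [g gA [Hg Hg0]] := hadamard_at (m0 := (z0.1, z0.2.2)) (x0 := 0) _ (FA _).
pose S (z : R * (R * M)) : R * (R * M) := (D z, (z.1, z.2.2)).
have SA z : smoothAt z S by rewrite /S; sm.
have S0 : S z0 = (0, (z0.1, z0.2.2)) by rewrite /S D0.
apply: (smoothAt_near (f := fun z => g (S z))); last first.
  by apply: (smoothAt_comp (f := g)) => //; rewrite S0.
have p2A : smoothAt z0 (fun z => (S z).2) by rewrite /S; sm.
have p20 : (S z0).2 = (z0.1, z0.2.2) by [].
have TS z : T (S z) = z.
  by case: z => r [p m]; rewrite /T /S /D /=; congr (_, (_, _)); ring.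
apply: (near2 (near_subst S0 (SA _) Hg) (near_subst (g := fun z => (S z).2) p20 p2A Hg0)) => z /= E1 E2.
rewrite /k; case: eqVneq => Dz.
  have -> : S z = (0, (S z).2) by rewrite /S Dz.
  rewrite E2; eassert (D1 : is_derive ((0, (S z).2) : R * (R * M)) ((1, 0) : R * (R * M)) T _) by (rewrite /T; isd).
  have [_ ->] := is_derive_chain D1 (smoothAt_diff (srA _)).
  have -> : T (0, (S z).2) = z by rewrite -[RHS]TS; congr T; rewrite /S Dz.
  by congr derive; congr (_, (_, _)) => /=; ring.
move: E1; rewrite /F TS subr0 => E1.
have F0 : sr (T (0, (S z).2)) = 0.
  rewrite /T /S /= sub0r; exact: fold_derive.
by rewrite E1 F0 add0r mulrC mulKf.
Qed.

(** If [s (r, p) = h (p, q)] with [q = - r^3 - p r], then [k] is [- h_q] and the second function is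
    [h_p]: both partial derivatives of [h] are induced by fiber-constant functions. For distinct
    roots this follows by cancelling [2 r + r'] in [fiber_derive] and exchanging the roots. *)
Lemma fiber_quotient s k : smooth setT s -> fiber_constant s -> smooth setT k ->
  (forall z, 'D_(1, 0) s z = (3 * z.1 ^+ 2 + z.2.1) * k z) ->
  fiber_constant k /\ fiber_constant (fun z => 'D_(0, (1, 0)) s z - z.1 * k z).
Proof.
move=> ss sf ks Hk.
have key r r' m : r != r' -> 2 * r + r' != 0 ->
    'D_(0, (1, 0)) s (r, (P r r', m)) - 'D_(0, (1, 0)) s (r', (P r r', m)) = (r - r') * k (r, (P r r', m)).
  move=> _ n2; have := fiber_derive r r' m ss sf; rewrite Hk /= => h.
  by apply: (mulfI n2); rewrite -h /P; ring.
have Pc r r' : P r r' = P r' r by rewrite /P; ring.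
have kf : fiber_constant k.
  apply: generic_fiber => // r r' m n1 n2 n3.
  have E1 := key r r' m n1 n2; have E2 := key r' r m; rewrite eq_sym in E2.
  have {}E2 := E2 n1 n3; rewrite Pc in E1.
  have n4 : r - r' != 0 by rewrite subr_eq0.
  by rewrite Pc; apply: (mulfI n4); rewrite -E1 -[LHS]opprB E2; ring.
split=> //; apply: generic_fiber.
  apply: smoothP => z _; apply: smoothAtB; first by apply: smoothAt_derive; exact: smoothT_At.
  by apply: smoothAtM; [sm|exact: smoothT_At].
move=> r r' m n1 n2 _ /=; have E1 := key r r' m n1 n2.
by have := kf r r' m; rewrite -/(P r r') => <-; move: E1; lra.
Qed.

Lemma fiber_derive_par s (w : M) : smooth setT s -> fiber_constant s ->
  fiber_constant ('D_(0, (0, w)) s).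
Proof.
move=> ss sf r r' m; have sA z : smoothAt z s by exact: smoothT_At.
eassert (D1 : is_derive m w (fun m => (r, (P r r', m))) _) by isd.
eassert (D2 : is_derive m w (fun m => (r', (P r r', m))) _) by isd.
have [_ E1] := is_derive_chain D1 (smoothAt_diff (sA _)).
have [_ E2] := is_derive_chain D2 (smoothAt_diff (sA _)).
rewrite -E1 -E2; congr derive; apply/funext => y; exact: sf.
Qed.

Definition cubic (p q r : R) := r ^+ 3 + p * r + q.

Lemma cubic_root p q : exists r, cubic p q r = 0.
Proof.
pose B := 1 + `|p| + `|q|.
have B1 : 1 <= B by rewrite /B -addrA lerDl addr_ge0.
have B0 : 0 < B by exact: lt_le_trans B1.
have pq : `|p| * B + `|q| <= B ^+ 3.
  apply: (@le_trans _ _ ((`|p| + `|q|) * B)); first by rewrite mulrDl lerD2l ler_peMr.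
  apply: (@le_trans _ _ (B * B)); first by apply: ler_wpM2r; [exact: ltW|rewrite /B -addrA lerDr].
  by rewrite exprSr ler_peMr// mulr_ge0// ltW.
have cc : {within `[- B, B], continuous (cubic p q)}.
  by apply: continuous_subspaceT => x; apply: smoothAt_cont; rewrite /cubic; sm.
have pB : - (`|p| * B) <= p * B <= `|p| * B by rewrite -mulNr !ler_pM2r// -ler_norml.
have qq : - `|q| <= q <= `|q| by rewrite -ler_norml.
have [r _ Hr] : exists2 c, c \in `[- B, B] & cubic p q c = 0.
  apply: IVT => //; first by lra.
  have -> : cubic p q (- B) = - (B ^+ 3) - p * B + q by rewrite /cubic; ring.
  have -> : cubic p q B = B ^+ 3 + p * B + q by [].
  move: pB qq => /andP[? ?] /andP[? ?]; rewrite ge_min le_max; apply/andP; split; apply/orP.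
    by left; lra.
  by right; lra.
by exists r.
Qed.

Definition root3 p q : R := projT1 (cid (cubic_root p q)).

Lemma root3P p q : cubic p q (root3 p q) = 0.
Proof. by rewrite /root3; case: cid. Qed.

Lemma cubic_root_small (e : R) : 0 < e -> exists2 d : R, 0 < d &
  forall p q r, `|p| < d -> `|q| < d -> cubic p q r = 0 -> `|r| < e.
Proof.
move=> e0; exists (Num.min (e ^+ 2 / 2) (e ^+ 3 / 2)).
  by rewrite lt_min !divr_gt0// exprn_gt0.
move=> p q r; rewrite !lt_min => /andP[p1 _] /andP[_ q2] c0; rewrite ltNge; apply/negP => er.
have E : `|r| ^+ 3 <= `|p| * `|r| + `|q|.
  rewrite -normrX; have -> : r ^+ 3 = - (p * r + q) by move: c0; rewrite /cubic; lra.
  by rewrite normrN; apply: le_trans (ler_normD _ _) _; rewrite normrM.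
have h1 : `|p| * `|r| < e ^+ 2 / 2 * `|r| by rewrite ltr_pM2r// (lt_le_trans e0).
have h2 : e ^+ 2 * e <= e ^+ 2 * `|r| by rewrite ler_pM2l// exprn_gt0.
have h3 : e ^+ 2 * `|r| <= `|r| ^+ 3.
  rewrite [in leRHS]exprSr; apply: ler_wpM2r => //.
  by apply: lerXn2r => //; rewrite nnegrE ltW.
have h4 : e ^+ 3 = e ^+ 2 * e by rewrite exprSr.
by move: E h1 h2 h3 q2; rewrite h4; lra.
Qed.

(** If a root [r] is multiple, the roots are [r], [r], [- 2 r] and the derivative at [- 2 r] is
    [9 r^2]; [r = 0] would force [p = q = 0]. *)
Lemma cubic_simple_root p q : (p != 0) || (q != 0) -> exists2 r, cubic p q r = 0 & 3 * r ^+ 2 + p != 0.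
Proof.
move=> pq; have [r r0] := cubic_root p q.
have [D0|D0] := eqVneq (3 * r ^+ 2 + p) 0; last by exists r.
have p3 : p = - (3 * r ^+ 2) by move: D0; lra.
have q2 : q = 2 * r ^+ 3 by move: r0; rewrite /cubic p3 => h; rewrite !exprS expr0 in h *; lra.
have rn0 : r != 0.
  by apply: contraTneq pq => h; rewrite p3 q2 h !expr0n /= !mulr0 oppr0 eqxx.
exists (- 2 * r); first by rewrite /cubic p3 q2; ring.
have -> : 3 * (- 2 * r) ^+ 2 + p = 9 * r ^+ 2 by rewrite p3; ring.
by rewrite mulf_neq0// expf_neq0.
Qed.

(** The root chosen by [root3] need not vary continuously. For fiber-constant [s] every root gives
    the same value ([descendE]), so one may switch to a root that is convenient locally. *)
Definition descend s (z : R * (R * M)) : R := s (root3 z.1 z.2.1, (z.1, z.2.2)).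

Lemma descendE s p q m r : fiber_constant s -> cubic p q r = 0 ->
  descend s (p, (q, m)) = s (r, (p, m)).
Proof.
move=> sf r0; rewrite /descend /=; have [->//|n] := eqVneq r (root3 p q).
have n' : r - root3 p q != 0 by rewrite subr_eq0.
suff E : p = - (r ^+ 2 + r * root3 p q + root3 p q ^+ 2).
  by have := sf r (root3 p q) m; rewrite -E.
apply: (mulfI n'); have := root3P p q; rewrite -r0 /cubic.
move: (root3 p q) => x h; have -> : (r - x) * p = x ^+ 3 - r ^+ 3 by move: h; lra.
by ring.
Qed.

Lemma descend_cont s z : smooth setT s -> fiber_constant s ->
  z.1 = 0 -> z.2.1 = 0 -> {for z, continuous (descend s)}.
Proof.
case: z => p [q m] ss sf /= -> ->; apply/contP => e e0.
have := smoothAt_cont (smoothT_At (0, (0, m)) ss) => /contP /(_ e e0)[d d0 Hd].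
have [d1 d10 H1] := cubic_root_small d0.
have c0 : cubic 0 0 0 = 0 by rewrite /cubic !expr0n /=; ring.
exists (Num.min d d1); first by rewrite lt_min d0.
move=> [p' [q' m']]; rewrite !prod_normE /= !subr0 !gt_max !lt_min.
move=> /and3P[/andP[p1 p2] /andP[_ q2] /andP[m1 _]].
rewrite (descendE _ sf c0) /descend /=; apply: Hd.
rewrite !prod_normE /= !subr0 !gt_max p1 m1 !andbT.
exact: H1 p2 q2 (root3P _ _).
Qed.

(** Off [p = q = 0] some root is simple and continues smoothly as [h z], so [descend s] is [s]
    evaluated along [h]. Differentiating the cubic equation gives
    [(3 r^2 + p) * 'D_v h = - (a r + b)], which absorbs the factor in [Hk]. *)
Lemma descend_off s k z (a b : R) (w : M) : smooth setT s -> fiber_constant s -> smooth setT k ->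
  (forall z, 'D_(1, 0) s z = (3 * z.1 ^+ 2 + z.2.1) * k z) -> fiber_constant k ->
  fiber_constant (fun z => 'D_(0, (1, 0)) s z - z.1 * k z) ->
  (z.1 != 0) || (z.2.1 != 0) ->
  smoothAt z (descend s) /\
  is_derive z ((a, (b, w)) : R * (R * M)) (descend s)
    (a * descend (fun z => 'D_(0, (1, 0)) s z - z.1 * k z) z - b * descend k z + descend ('D_(0, (0, w)) s) z).
Proof.
case: z => p [q m] ss sf ks Hk kf lf pq; have sA y : smoothAt y s by exact: smoothT_At.
have [r r0 D0] := cubic_simple_root pq.
pose F (x : R * (R * (R * M))) := cubic x.2.1 x.2.2.1 x.1.
have FA x : smoothAt x F by rewrite /F /cubic; sm.
have dF : 'D_(1, 0) F (r, (p, (q, m))) = 3 * r ^+ 2 + p.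
  eassert (D1 : is_derive ((r, (p, (q, m))) : R * (R * (R * M))) ((1, 0) : R * (R * (R * M))) F _) by (rewrite /F /cubic; isd).
  by have [_ ->] := D1; rewrite /=; ring.
have [|h [hA h0 Hh _]] := implicit_function (m0 := (p, (q, m))) (x0 := r) _ (FA _) r0.
  by rewrite dF.
pose g z := s (h z, (z.1, z.2.2)).
have iA : smoothAt (p, (q, m)) (fun z : R * (R * M) => (h z, (z.1, z.2.2))) by sm.
have gA : smoothAt (p, (q, m)) g.
  by apply: (smoothAt_comp (f := s) (g := fun z : R * (R * M) => (h z, (z.1, z.2.2)))).
have gE : \forall z \near (p, (q, m)), g z = descend s z.
  by apply: (near1 Hh) => -[p' [q' m']] H; rewrite /g (descendE _ sf H).
split; first exact: smoothAt_near gA.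
pose v : R * (R * M) := (a, (b, w)).
have Dh := smoothAt_is_derive v hA.
apply: (near_eq_is_derive gE).
eassert (D1 : is_derive ((p, (q, m)) : R * (R * M)) v (fun z : R * (R * M) => (h z, (z.1, z.2.2))) _) by isd.
have D2 := is_derive_chain D1 (smoothAt_diff (sA _)).
apply: (is_derive_eq D2); rewrite h0 /= (derive_triple _ _ _ (sA _)) Hk /=.
rewrite !(descendE _ _ r0)//; last exact: fiber_derive_par.
eassert (D3 : is_derive ((p, (q, m)) : R * (R * M)) v (fun z : R * (R * M) => F (h z, z)) _) by (rewrite /F /cubic; isd).
have [_] := D3; rewrite (near_eq_derive v Hh) derive_cst h0 /=.
move=> /esym E; have {}E : 'D_v h (p, (q, m)) * (3 * r ^+ 2 + p) = - (a * r + b).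
  by move: E; set X := 'D_v h _ => E; apply/eqP; rewrite -subr_eq0 -E; apply/eqP; ring.
have -> : 'D_v h (p, (q, m)) * ((3 * r ^+ 2 + p) * k (r, (p, m))) = - (a * r + b) * k (r, (p, m)).
  by rewrite mulrA E.
by ring.
Qed.

Lemma descend_derive s k z (a b : R) (w : M) : smooth setT s -> fiber_constant s -> smooth setT k ->
  (forall z, 'D_(1, 0) s z = (3 * z.1 ^+ 2 + z.2.1) * k z) -> fiber_constant k ->
  fiber_constant (fun z => 'D_(0, (1, 0)) s z - z.1 * k z) ->
  is_derive z ((a, (b, w)) : R * (R * M)) (descend s)
    (a * descend (fun z => 'D_(0, (1, 0)) s z - z.1 * k z) z - b * descend k z + descend ('D_(0, (0, w)) s) z).
Proof.
move=> ss sf ks Hk kf lf; set l := (fun z => _ - _).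
have [pq|pq] := boolP ((z.1 != 0) || (z.2.1 != 0)); first by case: (descend_off a b w ss sf ks Hk kf lf pq).
case: z pq => p [q m]; rewrite negb_or !negbK /= => /andP[/eqP -> /eqP ->].
have ls : smooth setT l.
  apply: smoothP => z _; apply: smoothAtB; first by apply: smoothAt_derive; exact: smoothT_At.
  by apply: smoothAtM; [sm|exact: smoothT_At].
have ws : smooth setT ('D_(0, (0, w)) s) by apply: smoothP => z _; apply: smoothAt_derive; exact: smoothT_At.
have wf : fiber_constant ('D_(0, (0, w)) s) by exact: fiber_derive_par.
have c0 : cubic 0 0 0 = 0 by rewrite /cubic !expr0n /=; ring.
pose c (t : R) : R * (R * M) := t *: (a, (b, w)) + (0, (0, m)).
have cE t : c t = (t * a, (t * b, t *: w + m)) by congr (_, (_, _)); rewrite /= addr0.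
have c0E : c 0 = (0, (0, m)) by rewrite cE !mul0r scale0r add0r.
have line l' : is_derive (0 : R) (1 : R) (fun t : R => descend s (c t)) l' ->
    is_derive ((0, (0, m)) : R * (R * M)) ((a, (b, w)) : R * (R * M)) (descend s) l'.
  move=> [D E]; rewrite /derivable /derive in D E.
  have EQ : (fun h : R => h^-1 *: (descend s (h *: (a, (b, w)) + (0, (0, m))) - descend s (0, (0, m)))) =
    (fun h : R => h^-1 *: (descend s (c (h *: 1 + 0)) - descend s (c 0))).
    by apply/funext => h; rewrite addr0 c0E [h *: 1]mulr1.
  by apply: DeriveDef; rewrite /derivable /derive EQ.
apply: line.
(* If [a] or [b] is nonzero, the line meets [p = q = 0] at [t = 0] only and [derive_extend] applies;
   otherwise [p] and [q] stay 0 and the value is that of [s] at the triple root 0. *)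
have [ab|] := boolP ((a != 0) || (b != 0)); last first.
  rewrite negb_or !negbK => /andP[/eqP a0 /eqP b0].
  rewrite a0 b0 !mul0r subr0 add0r (descendE _ wf c0).
  have -> : (fun t => descend s (c t)) = (fun t : R => s (0, (0, t *: w + m))).
    by apply/funext => t; rewrite cE a0 b0 !mulr0 (descendE _ sf c0).
  have D : derivable s (0 *: ((0, (0, w)) : R * (R * M)) + (0, (0, m))) (0, (0, w)).
    by apply: diff_derivable; apply: smoothAt_diff; exact: smoothT_At.
  have := line_derive D; rewrite scale0r add0r; congr is_derive.
  by apply/funext => t; congr s; congr (_, (_, _)); rewrite /= ?scaler0 addr0.
pose G z := a * descend l z - b * descend k z + descend ('D_(0, (0, w)) s) z.
have cc : {for 0, continuous c}.
  have wA : smoothAt 0 (fun t : R => t *: w).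
    exact: (smoothAtZ fM (smoothAt_id _) (smoothAt_cst _ _)).
  apply: smoothAt_cont; have -> : c = (fun t => (t * a, (t * b, t *: w + m))) by apply/funext.
  by sm.
have cG g : smooth setT g -> fiber_constant g -> {for 0, continuous (fun t => descend g (c t))}.
  move=> gs gf; apply: (@continuous_comp _ _ _ c (descend g)) => //.
  by rewrite c0E; exact: descend_cont.
have -> : a * descend l (0, (0, m)) - b * descend k (0, (0, m)) + descend ('D_(0, (0, w)) s) (0, (0, m)) = G (c 0).
  by rewrite c0E.
apply: (@derive_extend _ (fun t => descend s (c t)) (fun t => G (c t)) 1) => //; first exact: cG.
  have := cG l ls lf; have := cG k ks kf; have := cG _ ws wf => h1 h2 h3.
  apply: continuousD => //; apply: continuousB; apply: continuousM => //; exact: cst_continuous.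
move=> t /andP[t0 _]; have tn0 : t != 0 by rewrite -normr_gt0.
have pq : ((c t).1 != 0) || ((c t).2.1 != 0) by rewrite cE /= !mulf_eq0 (negbTE tn0).
have [sc D] := descend_off a b w ss sf ks Hk kf lf pq.
have Dc : is_derive t (1 : R) c (a, (b, w)).
  have -> : c = (fun t => (t * a, (t * b, t *: w + m))) by apply/funext.
  have Dw : is_derive t (1 : R) (fun t : R => t *: w + m) w.
    have H : is_derive t (1 : R) (fun t : R => t *: w) (1 *: w).
      apply: (is_derive_post (L := mklin (@linear_scaler R M w)) _ (isd_id t (1 : R))).
      exact: continuous_scaler.
    have H2 := isd_add H (isd_cst t (1 : R) m).
    by apply: (is_derive_eq H2); rewrite scale1r addr0.
  eassert (H : is_derive t (1 : R) (fun t => (t * a, (t * b, t *: w + m))) _) by isd.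
  by apply: (is_derive_eq H); congr (_, (_, _)) => /=; rewrite mulr0 add0r mulr1.
have H := is_derive_chain Dc (smoothAt_diff sc).
by apply: (is_derive_eq H); have [_ ->] := D.
Qed.

(** [descend_derive] expresses the derivatives by descents of fiber-constant functions, so the
    induction runs over all such [s]. *)
Lemma descend_Ck n s : smooth setT s -> fiber_constant s -> Ck n setT (descend s).
Proof.
elim: n s => [|n IH] s ss sf.
  move=> z _; have [k ks Hk] := fold_quotient ss sf; have [kf lf] := fiber_quotient ss sf ks Hk.
  have [pq|] := boolP ((z.1 != 0) || (z.2.1 != 0)).
    by apply: smoothAt_cont; case: (descend_off 0 0 0 ss sf ks Hk kf lf pq).
  by rewrite negb_or !negbK => /andP[/eqP ? /eqP ?]; exact: descend_cont.
have [k ks Hk] := fold_quotient ss sf; have [kf lf] := fiber_quotient ss sf ks Hk.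
have fE : findim (R * (R * M) : normedModType R)%type by exact _.
have [I [e [l [lc le]]]] := fE.
have H i z := descend_derive z (e i).1 (e i).2.1 (e i).2.2 ss sf ks Hk kf lf.
have eE i : ((e i).1, ((e i).2.1, (e i).2.2)) = e i by case: (e i) => ? [].
apply: (CkS_intro _ openT lc le) => [i y _|i]; first by have [] := H i y; rewrite eE.
pose ls z := 'D_(0, (1, 0)) s z - z.1 * k z.
apply: (Ck_ext (f := fun z => (e i).1 * descend ls z - (e i).2.1 * descend k z + descend ('D_(0, (0, (e i).2.2)) s) z)).
- exact: openT.
- by move=> z _; have [_] := H i z; rewrite eE => ->.
- have Cm (c : R) g : Ck n setT g -> Ck n setT (fun z : R * (R * M) => c * g z : R).
    by move=> Cg; apply: CkM => //; [exact: openT|exact: Ck_cst].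
  apply: CkD; [exact: openT| |].
    apply: (Ck_ext (f := fun z => (e i).1 * descend ls z + (- (e i).2.1) * descend k z)).
    - exact: openT.
    - by move=> z _; rewrite mulNr.
    apply: CkD; [exact: openT|apply: Cm; apply: IH => //|by apply: Cm; exact: IH].
    apply: smoothP => z _; apply: smoothAtB; first by apply: smoothAt_derive; exact: smoothT_At.
    by apply: smoothAtM; [sm|exact: smoothT_At].
  apply: IH; last exact: fiber_derive_par.
  by apply: smoothP => z _; apply: smoothAt_derive; exact: smoothT_At.
Qed.

End Cusp.

Section CubicDivision.
Context {R : realType} {M : normedModType R}.
Hypothesis fM : findim M.

Lemma quadratic_zero (x y z c0 c1 c2 : R) : x != y -> y != z -> x != z ->
  c0 + c1 * x + c2 * x ^+ 2 = 0 -> c0 + c1 * y + c2 * y ^+ 2 = 0 ->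
  c0 + c1 * z + c2 * z ^+ 2 = 0 -> [/\ c0 = 0, c1 = 0 & c2 = 0].
Proof.
rewrite -!(subr_eq0 x) -(subr_eq0 y) => xy yz xz ex ey ez.
have c2E : c2 = 0.
  apply: (mulfI xy); apply: (mulfI yz); apply: (mulfI xz); rewrite !mulr0.
  transitivity ((y - z) * (c0 + c1 * x + c2 * x ^+ 2) - (x - z) * (c0 + c1 * y + c2 * y ^+ 2)
    + (x - y) * (c0 + c1 * z + c2 * z ^+ 2)); first by ring.
  by rewrite ex ey ez !mulr0 subr0 addr0.
have c1E : c1 = 0.
  apply: (mulfI xy); rewrite mulr0.
  transitivity ((c0 + c1 * x + c2 * x ^+ 2) - (c0 + c1 * y + c2 * y ^+ 2)); first by rewrite c2E; ring.
  by rewrite ex ey subr0.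
by split=> //; move: ex; rewrite c1E c2E !mul0r !addr0.
Qed.

(** The cubic with root [r] factors as [(V - r) * (V^2 + r V + r^2 + p)]: [f] is divided by the
    linear factor with [hadamard2], then its quotient by the quadratic one. *)
Lemma root_division (f : R * M -> R) : smoothAt 0 f ->
  exists (q : R * (R * (R * M)) -> R) (s0 s1 s2 : R * (R * M) -> R),
  [/\ smoothAt 0 s0, smoothAt 0 s1, smoothAt 0 s2 &
    \forall z \near (0 : R * (R * (R * M))), f (z.1, z.2.2.2) =
      cubic z.2.2.1 (- z.2.1 ^+ 3 - z.2.2.1 * z.2.1) z.1 * q z + s0 z.2 + s1 z.2 * z.1 + s2 z.2 * z.1 ^+ 2].
Proof.
move=> fs; have [f1 f1s Hf1] := hadamard2 fM fs.
pose F (z : R * (R * M)) := f1 (z.1 - z.2.1 / 2, z.2).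
have Fs : smoothAt 0 F.
  apply: (smoothAt_comp (f := f1) (g := fun z : R * (R * M) => (z.1 - z.2.1 / 2, z.2))); last by sm.
  by rewrite /= mul0r subr0.
have [q [r0 [r1 [qs r0s r1s HF]]]] := whitney_division _ Fs.
(* Completing the square, [V^2 + r V + r^2 + p = (V + r / 2)^2 + (3/4 r^2 + p)]; the first entry is
   the [D] of [whitney_division]. *)
pose T (z : R * (R * M)) : R * (R * M) := (- (3 / 4 * z.1 ^+ 2 + z.2.1), (z.1, z.2.2)).
have Ts : smoothAt 0 T by rewrite /T; sm.
have T0 : T 0 = 0 by rewrite /T /= expr0n /= mulr0 addr0 oppr0.
pose S (z : R * (R * (R * M))) : R * (R * (R * M)) := (z.1 + z.2.1 / 2, T z.2).
have Ss : smoothAt 0 S by rewrite /S /T; sm.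
have S0 : S 0 = 0 by rewrite /S T0 /= mul0r addr0.
have r0T : smoothAt 0 (fun z => r0 (T z)) by apply: (smoothAt_comp (f := r0)); rewrite ?T0.
have r1T : smoothAt 0 (fun z => r1 (T z)) by apply: (smoothAt_comp (f := r1)); rewrite ?T0.
pose g0 (z : R * (R * M)) : R * M := (z.1, z.2.2).
have g0s : smoothAt 0 g0 by rewrite /g0; sm.
have fT : smoothAt 0 (fun z => f (g0 z)) by apply: (smoothAt_comp (f := f)).
exists (fun z => q (S z)),
  (fun z => f (g0 z) - z.1 * (r0 (T z) + r1 (T z) * z.1 / 2)),
  (fun z => r0 (T z) + r1 (T z) * z.1 / 2 - z.1 * r1 (T z)), (fun z => r1 (T z)).
split; [by sm|by sm|by sm|].
pose g1 (z : R * (R * (R * M))) : R * (R * M) := (z.1, (z.2.1, z.2.2.2)).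
have g1s : smoothAt 0 g1 by rewrite /g1; sm.
have g10 : g1 0 = 0 by [].
apply: (near2 (near_subst g10 g1s Hf1) (near_subst S0 Ss HF)) => -[V [r [p m]]] /=.
rewrite /g1 /S /T /F /cubic /g0 /= => -> E.
have -> : f1 (V, (r, m)) = f1 (V + r / 2 - r / 2, (r, m)) by congr f1; congr (_, _); ring.
rewrite E; set Q := q _; set A0 := r0 _; set A1 := r1 _; by field.
Qed.

(** At three distinct small roots the quadratic remainder takes the values of [f], whichever root
    was adjoined. Three values determine it, so its coefficients are fiber-constant and descend to
    functions of [(p, q)]. What is left of [f] vanishes on the zeros of the cubic. *)
Lemma cubic_division (f : R * M -> R) : smoothAt 0 f ->
  exists (q : R * (R * (R * M)) -> R) (h0 h1 h2 : R * (R * M) -> R),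
  [/\ smoothAt 0 q, [/\ smoothAt 0 h0, smoothAt 0 h1 & smoothAt 0 h2] &
    \forall z \near (0 : R * (R * (R * M))), f (z.1, z.2.2.2) =
      cubic z.2.1 z.2.2.1 z.1 * q z + h0 z.2 + h1 z.2 * z.1 + h2 z.2 * z.1 ^+ 2].
Proof.
move=> fs; have [q [s0 [s1 [s2 [s0s s1s s2s Hs]]]]] := root_division fs.
have [d d0 Hd] := (near0P _).1 Hs.
have fc : exists2 rho : R, 0 < rho & forall r r' m, `|r| < rho -> `|r'| < rho -> `|m| < rho ->
    r != r' -> 2 * r + r' != 0 -> 2 * r' + r != 0 ->
    let p := - (r ^+ 2 + r * r' + r' ^+ 2) in
    [/\ s0 (r, (p, m)) = s0 (r', (p, m)), s1 (r, (p, m)) = s1 (r', (p, m)) & s2 (r, (p, m)) = s2 (r', (p, m))].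
  exists (Num.min 1 (d / 3)); first by rewrite lt_min ltr01 divr_gt0.
  move=> r r' m; rewrite !lt_min => /andP[r1 rd] /andP[r'1 r'd] /andP[_ md] n1 n2 n3 p.
  have pd : `|p| < d.
    have h0 : `|r| ^+ 2 < d / 3 by rewrite expr2; apply: le_lt_trans rd; rewrite ler_piMl// ltW.
    have h1 : `|r'| ^+ 2 < d / 3 by rewrite expr2; apply: le_lt_trans r'd; rewrite ler_piMl// ltW.
    have h2 : `|r| * `|r'| < d / 3 by apply: le_lt_trans r'd; rewrite ler_piMl// ltW.
    rewrite /p normrN; apply: le_lt_trans (ler_normD _ _) _; rewrite normrX.
    apply: le_lt_trans (lerD (ler_normD _ _) (lexx _)) _; rewrite normrX normrM.
    by move: h0 h1 h2; lra.
  pose r'' := - r - r'.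
  have r''d : `|r''| < d.
    rewrite /r''; apply: le_lt_trans (ler_normD _ _) _; rewrite !normrN.
    by move: rd r'd d0; lra.
  have rd' : `|r| < d by move: rd d0; lra.
  have r'd' : `|r'| < d by move: r'd d0; lra.
  have md' : `|m| < d by move: md d0; lra.
  have E x y : `|x| < d -> `|y| < d -> cubic p (- y ^+ 3 - p * y) x = 0 ->
      s0 (y, (p, m)) + s1 (y, (p, m)) * x + s2 (y, (p, m)) * x ^+ 2 = f (x, m).
    move=> xd yd c0; have := Hd (x, (y, (p, m))).
    rewrite !prod_normE /= !gt_max xd yd pd md' => /(_ isT) ->.
    by rewrite c0 mul0r add0r.
  have cc x y : x \in [:: r; r'; r''] -> y \in [:: r; r'] -> cubic p (- y ^+ 3 - p * y) x = 0.
    by rewrite !inE /p /r'' /cubic => /or3P[] /eqP -> /orP[] /eqP ->; ring.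
  have D x : x \in [:: r; r'; r''] -> `|x| < d ->
    (s0 (r, (p, m)) - s0 (r', (p, m))) + (s1 (r, (p, m)) - s1 (r', (p, m))) * x +
    (s2 (r, (p, m)) - s2 (r', (p, m))) * x ^+ 2 = 0.
    move=> xI xd.
    have := E x r xd rd'; rewrite cc// ?mem_head// => /(_ erefl).
    have := E x r' xd r'd'; rewrite cc// ?inE ?eqxx ?orbT// => /(_ erefl) <-.
    by move=> h; rewrite !mulrBl; move: h; lra.
  have n4 : r' != r'' by apply: contra n3 => /eqP; rewrite /r'' => h; apply/eqP; lra.
  have n5 : r != r'' by apply: contra n2 => /eqP; rewrite /r'' => h; apply/eqP; lra.
  have [] := quadratic_zero n1 n4 n5 (D r _ rd') (D r' _ r'd') (D r'' _ r''d); rewrite ?inE ?eqxx ?orbT//.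
  by move=> /eqP h0 /eqP h1 /eqP h2; split; apply/eqP; rewrite -subr_eq0.
have [rho rho0 Hrho] := fc.
have descent (s : R * (R * M) -> R) : smoothAt 0 s ->
    (forall r r' m, `|r| < rho -> `|r'| < rho -> `|m| < rho ->
      r != r' -> 2 * r + r' != 0 -> 2 * r' + r != 0 ->
      s (r, (- (r ^+ 2 + r * r' + r' ^+ 2), m)) = s (r', (- (r ^+ 2 + r * r' + r' ^+ 2), m))) ->
    exists2 h : R * (R * M) -> R, smoothAt 0 h & \forall z \near (0 : R * (R * M)),
      h (z.2.1, (- z.1 ^+ 3 - z.2.1 * z.1, z.2.2)) = s z.
  move=> ss sf; have [g [gs gE _]] := globalize _ _ ss.
  have [d1 d10 H1] := (near0P _).1 gE.
  have r10 : 0 < Num.min rho d1 by rewrite lt_min rho0.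
  have [d2 d20 H2] := cubic_root_small r10.
  pose delta := Num.min d2 (Num.min rho d1).
  have delta0 : 0 < delta by rewrite lt_min d20.
  have [chi [chis chi1 chi0]] : exists chi : R * (R * M) -> R,
    [/\ smooth setT chi, \forall z \near (0 : R * (R * M)), chi z = 1 & forall z, delta <= `|z| -> chi z = 0].
    exact: bump_exists.
  pose T (z : R * (R * M)) : R * (R * M) := (z.2.1, (- z.1 ^+ 3 - z.2.1 * z.1, z.2.2)).
  have TA z : smoothAt z T by rewrite /T; sm.
  have T0 : T 0 = 0 by rewrite /T /= expr0n /= mul0r ?oppr0 ?addr0.
  (* The cutoff depends on [(p, q, m)] only, so it is the same at all roots of one cubic and
     preserves fiber constancy. Where it is nonzero, [cubic_root_small] makes all roots small enough
     for [sf]. *)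
  pose t z := chi (T z) * g z.
  have ts : smooth setT t.
    apply: smoothP => z _; apply: smoothAtM; last exact: smoothT_At.
    by apply: (smoothAt_comp (f := chi)) => //; exact: smoothT_At.
  have tf : fiber_constant t.
    apply: generic_fiber => // r r' m n1 n2 n3; set p := - _; rewrite /t.
    have -> : T (r', (p, m)) = T (r, (p, m)) by rewrite /T /p /=; congr (_, (_, _)); ring.
    have [small|] := ltP `|T (r, (p, m))| delta; last by move=> /chi0 ->; rewrite !mul0r.
    move: small; rewrite /T !prod_normE /= !gt_max !lt_min.
    move=> /and3P[/and3P[p1 p2 p3] /and3P[q1 q2 q3] /and3P[m1 m2 m3]].
    have cr : cubic p (- r ^+ 3 - p * r) r = 0 by rewrite /cubic; ring.
    have cr' : cubic p (- r ^+ 3 - p * r) r' = 0 by rewrite /cubic /p; ring.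
    have := H2 _ _ _ p1 q1 cr; rewrite lt_min => /andP[a1 a2].
    have := H2 _ _ _ p1 q1 cr'; rewrite lt_min => /andP[b1 b2].
    rewrite !H1 ?prod_normE /= ?gt_max ?a2 ?b2 ?p3 ?m3//.
    by congr (_ * _); apply: sf.
  exists (descend t); first by apply: smoothT_At => n; exact: descend_Ck.
  apply: (near2 (near_subst T0 (TA 0) chi1) gE) => -[r [p m]] /= E1 E2.
  have cr : cubic p (- r ^+ 3 - p * r) r = 0 by rewrite /cubic; ring.
  by rewrite (descendE _ tf cr) /t E1 mul1r.
have [h0 h0s H0] := descent _ s0s (fun r r' m a b c e f g => let: And3 x _ _ := Hrho r r' m a b c e f g in x).
have [h1 h1s H1] := descent _ s1s (fun r r' m a b c e f g => let: And3 _ x _ := Hrho r r' m a b c e f g in x).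
have [h2 h2s H2] := descent _ s2s (fun r r' m a b c e f g => let: And3 _ _ x := Hrho r r' m a b c e f g in x).
(* Coordinates in which the value of the cubic is the first variable and [q] is expressed by it;
   division by the cubic becomes [hadamard0]. *)
pose T (z : R * (R * (R * M))) : R * (R * M) := (z.2.2.1, (z.1 - z.2.1 ^+ 3 - z.2.2.1 * z.2.1, z.2.2.2)).
have TA z : smoothAt z T by rewrite /T; sm.
have T0 : T 0 = 0 by rewrite /T /= expr0n /= mul0r !subr0.
pose g0 (z : R * (R * (R * M))) : R * M := (z.2.1, z.2.2.2).
have g0s : smoothAt 0 g0 by rewrite /g0; sm.
have fT : smoothAt 0 (fun z => f (g0 z)) by apply: (smoothAt_comp (f := f)).
have hT h : smoothAt 0 h -> smoothAt 0 (fun z => h (T z) : R).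
  by move=> hs; apply: (smoothAt_comp (f := h)); rewrite ?T0.
pose Psi z := f (g0 z) - h0 (T z) - h1 (T z) * z.2.1 - h2 (T z) * z.2.1 ^+ 2.
have Psis : smoothAt 0 Psi.
  have := hT _ h0s; have := hT _ h1s; have := hT _ h2s => a b c.
  by rewrite /Psi; sm.
have [g gs Hg] := hadamard0 _ Psis.
pose S (z : R * (R * (R * M))) : R * (R * (R * M)) := (cubic z.2.1 z.2.2.1 z.1, (z.1, (z.2.1, z.2.2.2))).
have Ss : smoothAt 0 S by rewrite /S /cubic; sm.
have S0 : S 0 = 0 by rewrite /S /cubic /= expr0n /= mul0r !addr0.
exists (fun z => g (S z)), h0, h1, h2; split=> //.
  by apply: (smoothAt_comp (f := g)); rewrite ?S0.
pose U (z : R * (R * (R * M))) : R * (R * M) := (z.1, (z.2.1, z.2.2.2)).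
have Us : smoothAt 0 U by rewrite /U; sm.
have U0 : U 0 = 0 by [].
pose W (z : R * (R * (R * M))) : R * (R * (R * M)) := (z.1, U z).
have Ws : smoothAt 0 W by rewrite /W /U; sm.
have W0 : W 0 = 0 by [].
have n1 := near_and (near_subst U0 Us H0) (near_subst U0 Us H1).
have n2 := near_and (near_subst U0 Us H2) (near_subst W0 Ws Hs).
apply: (near2 (near_subst S0 Ss Hg) (near_and n1 n2)).
move=> -[V [p [x m]]]; rewrite /S /U /W /Psi /T /g0 /= => E [[E0 E1] [E2 E3]].
have cV : cubic p (- V ^+ 3 - p * V) V = 0 by rewrite /cubic; ring.
move: E3; rewrite cV mul0r add0r -E0 -E1 -E2 => E3.
move: E; rewrite !sub0r E3.
have -> : cubic p x V - V ^+ 3 - p * V = x by rewrite /cubic; ring.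
move: (cubic p x V * _) => X E; lra.
Qed.

End CubicDivision.

(** * Weierstrass division *)

Section Implicit.
Context {R : realType}.
Implicit Types M : normedModType R.

Lemma implicit_derive M (F : R * M -> R) (h : M -> R) (w : M) : findim M -> smoothAt 0 F -> smoothAt 0 h ->
  h 0 = 0 -> (\forall m \near (0 : M), F (h m, m) = 0) -> 'D_(1, 0) F 0 != 0 -> 'D_(0, w) F 0 = 0 ->
  'D_w h 0 = 0.
Proof.
move=> fM Fs hs h0 Fh n1 e2; have Dh := smoothAt_is_derive w hs.
eassert (D1 : is_derive (0 : M) w (fun m => (h m, m)) _) by isd.
have Fs' : smoothAt (h 0, 0 : M) F by rewrite h0.
have [_] := is_derive_chain D1 (smoothAt_diff Fs').
rewrite (near_eq_derive w Fh) derive_cst h0 (derive_pair_lin1 _ _ Fs) e2 addr0 => /esym/eqP.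
by rewrite mulf_eq0 (negbTE n1) orbF => /eqP.
Qed.

(* Triangularity of the Jacobian lets one solve one equation at a time. *)
Lemma implicit_system2 M (F G : R * (R * M) -> R) : findim M -> smoothAt 0 F -> smoothAt 0 G ->
  F 0 = 0 -> G 0 = 0 -> 'D_(1, 0) F 0 != 0 -> 'D_(0, (1, 0)) F 0 = 0 -> 'D_(0, (1, 0)) G 0 != 0 ->
  exists a b : M -> R, [/\ smoothAt 0 a, smoothAt 0 b, a 0 = 0 /\ b 0 = 0 &
    \forall m \near (0 : M), F (a m, (b m, m)) = 0 /\ G (a m, (b m, m)) = 0].
Proof.
move=> fM Fs Gs F0 G0 F1 F2 G2.
have [h [hs h0 Fh _]] := implicit_function0 _ Fs F0 F1.
have h1 : 'D_(1, 0) h 0 = 0 by exact: (implicit_derive _ Fs hs h0 Fh F1 F2).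
pose H z := G (h z, z).
have Hs : smoothAt 0 H by apply: (smoothAt_comp (f := G) (g := fun z => (h z, z))); [rewrite h0|sm].
have [||b [bs b0 Hb _]] := implicit_function0 fM Hs; first by rewrite /H h0.
  have Dh := smoothAt_is_derive ((1, 0) : R * M) hs; rewrite h1 in Dh.
  eassert (D1 : is_derive (0 : R * M) ((1, 0) : R * M) (fun z => (h z, z)) _) by isd.
  have Gs' : smoothAt (h 0, 0 : R * M) G by rewrite h0.
  by have [_] := is_derive_chain D1 (smoothAt_diff Gs'); rewrite /H h0 => ->.
pose i (m : M) : R * M := (b m, m).
have is_ : smoothAt 0 i by rewrite /i; sm.
have i0 : i 0 = 0 by rewrite /i b0.
exists (fun m => h (i m)), b; split=> //.
- by apply: (smoothAt_comp (f := h)); rewrite ?i0.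
- by rewrite i0 h0 b0.
- by apply: (near2 Hb (near_subst i0 is_ Fh)).
Qed.

Lemma implicit_system3 M (F G H : R * (R * (R * M)) -> R) : findim M ->
  smoothAt 0 F -> smoothAt 0 G -> smoothAt 0 H -> F 0 = 0 -> G 0 = 0 -> H 0 = 0 ->
  'D_(1, 0) F 0 != 0 -> 'D_(0, (1, 0)) F 0 = 0 -> 'D_(0, (0, (1, 0))) F 0 = 0 ->
  'D_(0, (1, 0)) G 0 != 0 -> 'D_(0, (0, (1, 0))) G 0 = 0 -> 'D_(0, (0, (1, 0))) H 0 != 0 ->
  exists a b c : M -> R, [/\ smoothAt 0 a, smoothAt 0 b, smoothAt 0 c, [/\ a 0 = 0, b 0 = 0 & c 0 = 0] &
    \forall m \near (0 : M), [/\ F (a m, (b m, (c m, m))) = 0, G (a m, (b m, (c m, m))) = 0 &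
      H (a m, (b m, (c m, m))) = 0]].
Proof.
move=> fM Fs Gs Hs F0 G0 H0 F1 F2 F3 G2 G3 H3.
have [h [hs h0 Fh _]] := implicit_function0 _ Fs F0 F1.
have h1 : 'D_(1, 0) h 0 = 0 by exact: (implicit_derive _ Fs hs h0 Fh F1 F2).
have h2 : 'D_(0, (1, 0)) h 0 = 0 by exact: (implicit_derive _ Fs hs h0 Fh F1 F3).
pose sub (K : R * (R * (R * M)) -> R) z := K (h z, z).
have subs K : smoothAt 0 K -> smoothAt 0 (sub K).
  by move=> Ks; apply: (smoothAt_comp (f := K) (g := fun z => (h z, z))); [rewrite h0|sm].
have subD K (v : R * (R * M)) : smoothAt 0 K -> 'D_v h 0 = 0 -> 'D_v (sub K) 0 = 'D_(0, v) K 0.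
  move=> Ks hv; have Dh := smoothAt_is_derive v hs; rewrite hv in Dh.
  eassert (D1 : is_derive (0 : R * (R * M)) v (fun z => (h z, z)) _) by isd.
  have Ks' : smoothAt (h 0, 0 : R * (R * M)) K by rewrite h0.
  by have [_] := is_derive_chain D1 (smoothAt_diff Ks'); rewrite /sub h0 => ->.
have e1 : sub G 0 = 0 by rewrite /sub h0.
have e2 : sub H 0 = 0 by rewrite /sub h0.
have e3 : 'D_(1, 0) (sub G) 0 != 0 by rewrite subD.
have e4 : 'D_(0, (1, 0)) (sub G) 0 = 0 by rewrite subD.
have e5 : 'D_(0, (1, 0)) (sub H) 0 != 0 by rewrite subD.
have [b [c [bs cs [b0 c0] Hbc]]] := implicit_system2 fM (subs _ Gs) (subs _ Hs) e1 e2 e3 e4 e5.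
pose i (m : M) : R * (R * M) := (b m, (c m, m)).
have is_ : smoothAt 0 i by rewrite /i; sm.
have i0 : i 0 = 0 by rewrite /i b0 c0.
exists (fun m => h (i m)), b, c; split=> //.
- by apply: (smoothAt_comp (f := h)); rewrite ?i0.
- by rewrite i0 h0 b0 c0.
- by apply: (near2 Hbc (near_subst i0 is_ Fh)) => m [E1 E2] E3; split.
Qed.

End Implicit.

Section Weierstrass.
Context {R : realType}.
Implicit Types M : normedModType R.

Lemma punctured_zero (g : R -> R) (d : R) : 0 < d -> {for 0, continuous g} ->
  (forall y, 0 < `|y| < d -> g y = 0) -> g 0 = 0.
Proof.
move=> d0 /contP gc H; apply/eqP/negPn/negP => n0.
have [|e e0 He] := gc `|g 0|; first by rewrite normr_gt0.
pose y := Num.min (d / 2) (e / 2).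
have y0 : 0 < y by rewrite !lt_min !divr_gt0.
have y1 : y <= d / 2 by rewrite /y !ge_min lexx.
have y2 : y <= e / 2 by rewrite /y !ge_min lexx orbT.
have E : g y = 0 by apply: H; rewrite gtr0_norm// y0 /=; move: y1 d0; lra.
have := He y; rewrite E subr0 sub0r normrN ltxx gtr0_norm// => h.
by suff : false by []; apply: h; move: y2 e0; lra.
Qed.

(** With [flat2] and [flat3] this gives uniqueness of division at zero parameters: a polynomial of
    degree below [n] that equals [y^n] times a continuous function has only zero coefficients,
    compared one after the other at [y = 0]. *)
Lemma flat1 (g : R -> R) (d r0 : R) : 0 < d -> {for 0, continuous g} ->
  (forall y, 0 < `|y| < d -> y * g y = r0) -> r0 = 0.
Proof.
move=> d0 gc H; have := @punctured_zero (fun y => y * g y - r0) d d0.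
rewrite mul0r sub0r => h; apply: oppr_inj; rewrite oppr0; apply: h => [|y /H ->]; last exact: subrr.
by apply: continuousB; [apply: continuousM|exact: cst_continuous].
Qed.

Lemma flat2 (g : R -> R) (d r0 r1 : R) : 0 < d -> {for 0, continuous g} ->
  (forall y, 0 < `|y| < d -> y ^+ 2 * g y = r0 + r1 * y) -> r0 = 0 /\ r1 = 0.
Proof.
move=> d0 gc H; have r00 : r0 = 0.
  apply: (@flat1 (fun y => y * g y - r1) d) => //.
    by apply: continuousB; [apply: continuousM|exact: cst_continuous].
  by move=> y /H; rewrite mulrBr => E; move: E; rewrite expr2 -mulrA => ->; ring.
split=> //; apply: (@flat1 g d) => // y yd; have := H y yd; rewrite r00 add0r.
move: yd => /andP[]; rewrite normr_gt0 => y0 _ E; apply: (mulIf y0); rewrite -E; ring.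
Qed.

Lemma flat3 (g : R -> R) (d r0 r1 r2 : R) : 0 < d -> {for 0, continuous g} ->
  (forall y, 0 < `|y| < d -> y ^+ 3 * g y = r0 + r1 * y + r2 * y ^+ 2) -> [/\ r0 = 0, r1 = 0 & r2 = 0].
Proof.
move=> d0 gc H; have gc' : {for 0, continuous (fun y : R => y * g y - r2)}.
  by apply: continuousB; [apply: continuousM|exact: cst_continuous].
have r00 : r0 = 0.
  apply: (@flat1 (fun y => y * (y * g y - r2) - r1) d) => //.
    by apply: continuousB; [apply: continuousM|exact: cst_continuous].
  move=> y yd; have := H y yd => E; apply/eqP; rewrite -subr_eq0; apply/eqP.
  by move: E; rewrite !exprS expr0; lra.
have [r10 r20] : r1 = 0 /\ r2 = 0.
  apply: (flat2 d0 gc) => y yd; have := H y yd; rewrite r00 add0r.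
  by move: yd => /andP[]; rewrite normr_gt0 => y0 _ E; apply: (mulIf y0); transitivity (y ^+ 3 * g y); [ring|rewrite E; ring].
by split.
Qed.

Lemma near0_punctured M (Q : M -> Prop) (g : R -> M) : smoothAt 0 g -> g 0 = 0 ->
  (\forall z \near (0 : M), Q z) -> exists2 d : R, 0 < d & forall y, 0 < `|y| < d -> Q (g y).
Proof.
move=> gs g0 HQ; have /near0P[d d0 Hd] := near_subst g0 gs HQ.
by exists d => // y /andP[_ /Hd].
Qed.

Lemma weierstrass1 M (P : R * M -> R) : findim M -> smoothAt 0 P -> P 0 = 0 -> 'D_(1, 0) P 0 != 0 ->
  exists (t : M -> R) (e : R * M -> R), [/\ smoothAt 0 t, t 0 = 0, smoothAt 0 e, e 0 != 0 &
    \forall z \near (0 : R * M), P z = (z.1 - t z.2) * e z].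
Proof.
move=> fM Ps P0 P1; have [t [ts t0 Pt _]] := implicit_function0 fM Ps P0 P1.
have [g gs Hg] := hadamard2 fM Ps.
pose i (z : R * M) : R * (R * M) := (z.1, (t z.2, z.2)).
have tz : smoothAt (0 : R * M) (fun z => t z.2) by apply: (smoothAt_comp (f := t)) => //; sm.
have is_ : smoothAt 0 i by rewrite /i; sm.
have i0 : i 0 = 0 by rewrite /i t0.
have p2 : smoothAt 0 (fun z : R * M => z.2) by sm.
have HP : \forall z \near (0 : R * M), P z = (z.1 - t z.2) * g (i z).
  apply: (near2 (near_subst i0 is_ Hg) (near_subst (g := fun z : R * M => z.2) erefl p2 Pt)) => -[y m].
  by rewrite /i /= => -> ->; rewrite add0r.
have gis : smoothAt 0 (fun z => g (i z)) by apply: (smoothAt_comp (f := g)); rewrite ?i0.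
exists t, (fun z => g (i z)); split=> //.
have Dg := smoothAt_is_derive ((1, 0) : R * M) gis.
have Dt : is_derive (0 : R * M) ((1, 0) : R * M) (fun z => t z.2) 0.
  eassert (H : is_derive (0 : R * M) ((1, 0) : R * M) (fun z : R * M => z.2) _) by isd.
  have := is_derive_chain H (smoothAt_diff (ts : smoothAt ((0 : R * M).2) t)).
  by rewrite /= derive0.
eassert (D1 : is_derive (0 : R * M) ((1, 0) : R * M) (fun z => (z.1 - t z.2) * g (i z)) _) by isd.
apply: contra P1 => /eqP g0; have [_] := D1; rewrite -(near_eq_derive _ HP) => ->.
by rewrite g0 /= t0 subrr !mul0r addr0.
Qed.

(** Shifting [y] by half of the linear coefficient [a] turns the generic quadratic into [y^2 - D]
    with [D = a^2 / 4 - b]. *)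
Lemma generic_division2 M (f : R * M -> R) : findim M -> smoothAt 0 f ->
  exists (q : R * (R * (R * M)) -> R) (r0 r1 : R * (R * M) -> R),
  [/\ smoothAt 0 q, smoothAt 0 r0, smoothAt 0 r1 &
    \forall z \near (0 : R * (R * (R * M))),
      f (z.1, z.2.2.2) = (z.1 ^+ 2 + z.2.2.1 * z.1 + z.2.1) * q z + r0 z.2 + r1 z.2 * z.1].
Proof.
move=> fM fs; pose g (z : R * (R * M)) : R * M := (z.1 - z.2.1 / 2, z.2.2).
have gs : smoothAt 0 g by rewrite /g; sm.
have g0 : g 0 = 0 by rewrite /g /= mul0r subr0.
have Fs : smoothAt 0 (fun z => f (g z)) by apply: (smoothAt_comp (f := f)); rewrite ?g0.
have [q [r0 [r1 [qs r0s r1s H]]]] := whitney_division _ Fs.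
pose T (z : R * (R * M)) : R * (R * M) := (z.2.1 ^+ 2 / 4 - z.1, z.2).
have Ts : smoothAt 0 T by rewrite /T; sm.
have T0 : T 0 = 0 by rewrite /T /= expr0n /= mul0r subr0.
pose S (z : R * (R * (R * M))) : R * (R * (R * M)) := (z.1 + z.2.2.1 / 2, T z.2).
have Ss : smoothAt 0 S by rewrite /S /T; sm.
have S0 : S 0 = 0 by rewrite /S T0 /= mul0r addr0.
have rT r : smoothAt 0 r -> smoothAt 0 (fun z => r (T z) : R).
  by move=> rs; apply: (smoothAt_comp (f := r)); rewrite ?T0.
have r0T := rT _ r0s; have r1T := rT _ r1s.
have qS : smoothAt 0 (fun z => q (S z)) by apply: (smoothAt_comp (f := q)); rewrite ?S0.
exists (fun z => q (S z)), (fun z => r0 (T z) + r1 (T z) * z.2.1 / 2), (fun z => r1 (T z)).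
split; [by []|by sm|by []|].
apply: (near1 (near_subst S0 Ss H)) => -[y [b [a m]]]; rewrite /S /T /g /= addrK => ->.
by field.
Qed.

(** A shift by a third of the quadratic coefficient depresses the cubic; [T] lists the resulting [p]
    and [q]. *)
Lemma generic_division3 M (f : R * M -> R) : findim M -> smoothAt 0 f ->
  exists (q : R * (R * (R * (R * M))) -> R) (r0 r1 r2 : R * (R * (R * M)) -> R),
  [/\ smoothAt 0 q, [/\ smoothAt 0 r0, smoothAt 0 r1 & smoothAt 0 r2] &
    \forall z \near (0 : R * (R * (R * (R * M)))),
      f (z.1, z.2.2.2.2) = (z.1 ^+ 3 + z.2.2.2.1 * z.1 ^+ 2 + z.2.2.1 * z.1 + z.2.1) * q z
        + r0 z.2 + r1 z.2 * z.1 + r2 z.2 * z.1 ^+ 2].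
Proof.
move=> fM fs; pose g (z : R * (R * M)) : R * M := (z.1 - z.2.1 / 3, z.2.2).
have gs : smoothAt 0 g by rewrite /g; sm.
have g0 : g 0 = 0 by rewrite /g /= mul0r subr0.
have Fs : smoothAt 0 (fun z => f (g z)) by apply: (smoothAt_comp (f := f)); rewrite ?g0.
have [q [r0 [r1 [r2 [qs [r0s r1s r2s] H]]]]] := cubic_division _ Fs.
pose T (z : R * (R * (R * M))) : R * (R * (R * M)) :=
  (z.2.1 - z.2.2.1 ^+ 2 / 3, (2 * z.2.2.1 ^+ 3 / 27 - z.2.2.1 * z.2.1 / 3 + z.1, z.2.2)).
have Ts : smoothAt 0 T by rewrite /T; sm.
have T0 : T 0 = 0 by rewrite /T /= !expr0n /= ?mulr0 ?mul0r ?subr0 ?addr0.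
pose S (z : R * (R * (R * (R * M)))) : R * (R * (R * (R * M))) := (z.1 + z.2.2.2.1 / 3, T z.2).
have Ss : smoothAt 0 S by rewrite /S /T; sm.
have S0 : S 0 = 0 by rewrite /S T0 /= mul0r addr0.
have rT r : smoothAt 0 r -> smoothAt 0 (fun z => r (T z) : R).
  by move=> rs; apply: (smoothAt_comp (f := r)); rewrite ?T0.
have r0T := rT _ r0s; have r1T := rT _ r1s; have r2T := rT _ r2s.
have qS : smoothAt 0 (fun z => q (S z)) by apply: (smoothAt_comp (f := q)); rewrite ?S0.
exists (fun z => q (S z)),
  (fun z => r0 (T z) + r1 (T z) * z.2.2.1 / 3 + r2 (T z) * (z.2.2.1 / 3) ^+ 2),
  (fun z => r1 (T z) + 2 * r2 (T z) * z.2.2.1 / 3), (fun z => r2 (T z)).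
split; [by []|by split; [sm|sm|]|].
apply: (near1 (near_subst S0 Ss H)) => -[y [c [b [a m]]]]; rewrite /S /T /g /cubic /= addrK => ->.
by field.
Qed.

(** [P] itself is divided by the generic quadratic, and the coefficients [b], [a] are chosen as
    functions of [m] so that the remainder vanishes. Then [P] is this quadratic up to a nonvanishing
    factor, and dividing [f] by the quadratic divides it by [P]. *)
Lemma weierstrass2 M (P : R * M -> R) (C : R) : findim M -> smoothAt 0 P -> C != 0 ->
  (\forall y \near (0 : R), P (y, 0) = C * y ^+ 2) ->
  forall f : R * M -> R, smoothAt 0 f ->
  exists (q : R * M -> R) (r0 r1 : M -> R), [/\ smoothAt 0 q, smoothAt 0 r0, smoothAt 0 r1 &
    \forall z \near (0 : R * M), f z = q z * P z + r0 z.2 + r1 z.2 * z.1].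
Proof.
move=> fM Ps C0 PC f fs; pose Z := (R * (R * (R * M)) : normedModType R)%type.
have [q [r0 [r1 [qs r0s r1s H]]]] := generic_division2 fM Ps.
pose j (y : R) : Z := (y, 0); have js y : smoothAt y j by rewrite /j; sm.
have j0 : j 0 = 0 by [].
have contj (g : Z -> R) : smoothAt 0 g -> {for 0, continuous (fun y => g (j y))}.
  by move=> gs; apply: smoothAt_cont; apply: (smoothAt_comp (f := g)); rewrite ?j0.
have [d1 d10 H1] := near0_punctured (js 0) j0 H.
have [d2 d20 H2] := (near0P _).1 PC.
have E0 y : 0 < `|y| < Num.min d1 d2 -> y ^+ 2 * (C - q (j y)) = r0 0 + r1 0 * y.
  rewrite lt_min => /and3P[y0 y1 y2]; have := H1 y; rewrite y0 y1 => /(_ isT) /=.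
  by rewrite (H2 _ y2) mul0r !addr0 -/(j y); lra.
have d0 : 0 < Num.min d1 d2 by rewrite lt_min d10.
have cC : {for 0, continuous (fun y => C - q (j y))}.
  by apply: continuousB; [exact: cst_continuous|exact: contj].
have [r00 r10] := flat2 d0 cC E0.
have qC y : 0 < `|y| < Num.min d1 d2 -> q (j y) = C.
  move=> yd; have := E0 y yd; rewrite r00 r10 mul0r addr0 => /eqP.
  move: yd; rewrite normr_gt0 => /andP[y0 _].
  by rewrite mulf_eq0 expf_eq0 /= (negbTE y0) /= subr_eq0 => /eqP.
have qs' := near_subst j0 (js 0) (smoothAt_nbhs qs).
have Ps' : \forall y \near (0 : R), smoothAt (y, 0 : M) P.
  by apply: (near_subst (g := fun y : R => (y, 0 : M)) (y := 0) _ _ (smoothAt_nbhs Ps)) => //; sm.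
have Hs' := near_subst j0 (js 0) (nbhs_interior H).
have [d3 d30 H3] := (near0P _).1 (near_and (near_and qs' Ps') Hs').
pose d := Num.min (Num.min d1 d2) d3.
have dd0 : 0 < d by rewrite lt_min d0.
(* The Jacobian of the remainder in [(b, a)] at 0 is [- C] times the identity: the division identity
   is differentiated in the coefficients at the points [j y], where [q = C], and [flat2] compares
   powers of [y]. *)
have D (b a : R) : b * C + 'D_(b, (a, 0)) r0 0 = 0 /\ a * C + 'D_(b, (a, 0)) r1 0 = 0.
  pose v : Z := (0, (b, (a, 0))).
  apply: (@flat2 (fun y => - 'D_v q (j y)) d) => // [|y].
    by apply: continuousN; apply: (contj ('D_v q)); exact: smoothAt_derive.
  rewrite [_ < d]lt_min => /andP[y0 /andP[yd y3]]; have [[qy Py] Hy] := H3 _ y3.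
  have Dq := smoothAt_is_derive v qy.
  have r0j : smoothAt (j y).2 r0 by [].
  have r1j : smoothAt (j y).2 r1 by [].
  eassert (D2 : is_derive (j y) v (fun z : Z => z.2) _) by isd.
  have Dr0 := is_derive_chain D2 (smoothAt_diff r0j).
  have Dr1 := is_derive_chain D2 (smoothAt_diff r1j).
  eassert (DP : is_derive (j y) v (fun z : Z => (z.1 ^+ 2 + z.2.2.1 * z.1 + z.2.1) * q z + r0 z.2 + r1 z.2 * z.1) _) by isd.
  have [_] := DP; rewrite -(near_eq_derive v Hy).
  eassert (DQ : is_derive (j y) v (fun z : Z => (z.1, z.2.2.2)) _) by isd.
  have [_ ->] := is_derive_chain DQ (smoothAt_diff (Py : smoothAt ((j y).1, (j y).2.2.2) P)).
  rewrite qC; last by rewrite y0.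
  rewrite /= derive00 r10.
  set A := 'D_v q _; set A0 := 'D__ r0 _; set A1 := 'D__ r1 _ => E.
  by apply/eqP; rewrite -subr_eq0 -oppr_eq0 [X in _ == X]E; apply/eqP; ring.
have F1 : 'D_(1, 0) r0 0 != 0.
  by have [h _] := D 1 0; apply: contra C0 => /eqP h2; move: h; rewrite h2 mul1r addr0 => ->.
have F2 : 'D_(0, (1, 0)) r0 0 = 0 by have [h _] := D 0 1; move: h; rewrite mul0r add0r.
have G2 : 'D_(0, (1, 0)) r1 0 != 0.
  by have [_ h] := D 0 1; apply: contra C0 => /eqP h2; move: h; rewrite h2 mul1r addr0 => ->.
have [b [a [bs as_ [b0 a0] Hba]]] := implicit_system2 fM r0s r1s r00 r10 F1 F2 G2.
pose c (m : M) : R * (R * M) := (b m, (a m, m)).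
have cs : smoothAt 0 c by rewrite /c; sm.
have c0 : c 0 = 0 by rewrite /c b0 a0.
have p2 : smoothAt 0 (fun z : R * M => z.2) by sm.
have cps : smoothAt 0 (fun z : R * M => c z.2) by apply: (smoothAt_comp (f := c)).
pose S (z : R * M) : Z := (z.1, c z.2).
have Ss : smoothAt 0 S by rewrite /S; sm.
have S0 : S 0 = 0 by rewrite /S c0.
have qS : smoothAt 0 (fun z => q (S z)) by apply: (smoothAt_comp (f := q)); rewrite ?S0.
have q0 : q 0 != 0.
  suff h : q 0 - C = 0 by move: C0; rewrite -(subr_eq0 C) subr0; apply: contra => /eqP h2; move: h; rewrite h2 => /eqP; rewrite sub0r oppr_eq0.
  apply: (@punctured_zero (fun y => q (j y) - C) _ d0) => [|y /qC ->]; last exact: subrr.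
  by apply: continuousB; [exact: contj|exact: cst_continuous].
have PS : \forall z \near (0 : R * M), P z = (z.1 ^+ 2 + a z.2 * z.1 + b z.2) * q (S z).
  apply: (near2 (near_subst S0 Ss H) (near_subst (g := fun z : R * M => z.2) erefl p2 Hba)) => -[y m] /= ->.
  by rewrite /S /c /= => -[-> ->]; rewrite mul0r !addr0.
have [Q [h0 [h1 [Qs h0s h1s HQ]]]] := generic_division2 fM fs.
exists (fun z => Q (S z) / q (S z)), (fun m => h0 (c m)), (fun m => h1 (c m)); split.
- apply: smoothAtM; first by apply: (smoothAt_comp (f := Q)); rewrite ?S0.
  by apply: smoothAtV; rewrite ?S0.
- by apply: (smoothAt_comp (f := h0)); rewrite ?c0.
- by apply: (smoothAt_comp (f := h1)); rewrite ?c0.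
have qSn : \forall z \near (0 : R * M), q (S z) != 0 by apply: smoothAt_neq0 => //; rewrite S0.
apply: (near2 (near_subst S0 Ss HQ) (near_and PS qSn)) => -[y m].
by rewrite /S /= => -> [-> qn]; rewrite -/(c m); field.
Qed.

(** The argument of order 2, with three coefficients to solve for and [flat3] for the Jacobian. *)
Lemma weierstrass3 M (P : R * M -> R) (C : R) : findim M -> smoothAt 0 P -> C != 0 ->
  (\forall y \near (0 : R), P (y, 0) = C * y ^+ 3) ->
  forall f : R * M -> R, smoothAt 0 f ->
  exists (q : R * M -> R) (r0 r1 r2 : M -> R),
  [/\ smoothAt 0 q, [/\ smoothAt 0 r0, smoothAt 0 r1 & smoothAt 0 r2] &
    \forall z \near (0 : R * M), f z = q z * P z + r0 z.2 + r1 z.2 * z.1 + r2 z.2 * z.1 ^+ 2].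
Proof.
move=> fM Ps C0 PC f fs; pose Z := (R * (R * (R * (R * M))) : normedModType R)%type.
have [q [r0 [r1 [r2 [qs [r0s r1s r2s] H]]]]] := generic_division3 fM Ps.
pose j (y : R) : Z := (y, 0); have js y : smoothAt y j by rewrite /j; sm.
have j0 : j 0 = 0 by [].
have contj (g : Z -> R) : smoothAt 0 g -> {for 0, continuous (fun y => g (j y))}.
  by move=> gs; apply: smoothAt_cont; apply: (smoothAt_comp (f := g)); rewrite ?j0.
have [d1 d10 H1] := near0_punctured (js 0) j0 H.
have [d2 d20 H2] := (near0P _).1 PC.
have E0 y : 0 < `|y| < Num.min d1 d2 -> y ^+ 3 * (C - q (j y)) = r0 0 + r1 0 * y + r2 0 * y ^+ 2.
  rewrite lt_min => /and3P[y0 y1 y2]; have := H1 y; rewrite y0 y1 => /(_ isT) /=.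
  by rewrite (H2 _ y2) !mul0r !addr0 -/(j y); lra.
have d0 : 0 < Num.min d1 d2 by rewrite lt_min d10.
have cC : {for 0, continuous (fun y => C - q (j y))}.
  by apply: continuousB; [exact: cst_continuous|exact: contj].
have [r00 r10 r20] := flat3 d0 cC E0.
have qC y : 0 < `|y| < Num.min d1 d2 -> q (j y) = C.
  move=> yd; have := E0 y yd; rewrite r00 r10 r20 !mul0r !addr0 => /eqP.
  move: yd; rewrite normr_gt0 => /andP[y0 _].
  by rewrite mulf_eq0 expf_eq0 /= (negbTE y0) /= subr_eq0 => /eqP.
have qs' := near_subst j0 (js 0) (smoothAt_nbhs qs).
have Ps' : \forall y \near (0 : R), smoothAt (y, 0 : M) P.
  by apply: (near_subst (g := fun y : R => (y, 0 : M)) (y := 0) _ _ (smoothAt_nbhs Ps)) => //; sm.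
have Hs' := near_subst j0 (js 0) (nbhs_interior H).
have [d3 d30 H3] := (near0P _).1 (near_and (near_and qs' Ps') Hs').
pose d := Num.min (Num.min d1 d2) d3.
have dd0 : 0 < d by rewrite lt_min d0.
have D (c b a : R) : [/\ c * C + 'D_(c, (b, (a, 0))) r0 0 = 0, b * C + 'D_(c, (b, (a, 0))) r1 0 = 0 &
    a * C + 'D_(c, (b, (a, 0))) r2 0 = 0].
  pose v : Z := (0, (c, (b, (a, 0)))).
  apply: (@flat3 (fun y => - 'D_v q (j y)) d) => // [|y].
    by apply: continuousN; apply: (contj ('D_v q)); exact: smoothAt_derive.
  rewrite [_ < d]lt_min => /andP[y0 /andP[yd y3]]; have [[qy Py] Hy] := H3 _ y3.
  have Dq := smoothAt_is_derive v qy.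
  have r0j : smoothAt (j y).2 r0 by [].
  have r1j : smoothAt (j y).2 r1 by [].
  have r2j : smoothAt (j y).2 r2 by [].
  eassert (D2 : is_derive (j y) v (fun z : Z => z.2) _) by isd.
  have Dr0 := is_derive_chain D2 (smoothAt_diff r0j).
  have Dr1 := is_derive_chain D2 (smoothAt_diff r1j).
  have Dr2 := is_derive_chain D2 (smoothAt_diff r2j).
  eassert (DP : is_derive (j y) v (fun z : Z => (z.1 ^+ 3 + z.2.2.2.1 * z.1 ^+ 2 + z.2.2.1 * z.1 + z.2.1) * q z
        + r0 z.2 + r1 z.2 * z.1 + r2 z.2 * z.1 ^+ 2) _) by isd.
  have [_] := DP; rewrite -(near_eq_derive v Hy).
  eassert (DQ : is_derive (j y) v (fun z : Z => (z.1, z.2.2.2.2)) _) by isd.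
  have [_ ->] := is_derive_chain DQ (smoothAt_diff (Py : smoothAt ((j y).1, (j y).2.2.2.2) P)).
  rewrite qC; last by rewrite y0.
  rewrite /= derive00 r10 r20.
  set A := 'D_v q _; set A0 := 'D__ r0 _; set A1 := 'D__ r1 _; set A2 := 'D__ r2 _ => E.
  by apply/eqP; rewrite -subr_eq0 -oppr_eq0 [X in _ == X]E; apply/eqP; ring.
have F1 : 'D_(1, 0) r0 0 != 0.
  by have [h _ _] := D 1 0 0; apply: contra C0 => /eqP h2; move: h; rewrite h2 mul1r addr0 => ->.
have F2 : 'D_(0, (1, 0)) r0 0 = 0 by have [h _ _] := D 0 1 0; move: h; rewrite mul0r add0r.
have F3 : 'D_(0, (0, (1, 0))) r0 0 = 0 by have [h _ _] := D 0 0 1; move: h; rewrite mul0r add0r.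
have G2 : 'D_(0, (1, 0)) r1 0 != 0.
  by have [_ h _] := D 0 1 0; apply: contra C0 => /eqP h2; move: h; rewrite h2 mul1r addr0 => ->.
have G3 : 'D_(0, (0, (1, 0))) r1 0 = 0 by have [_ h _] := D 0 0 1; move: h; rewrite mul0r add0r.
have H4 : 'D_(0, (0, (1, 0))) r2 0 != 0.
  by have [_ _ h] := D 0 0 1; apply: contra C0 => /eqP h2; move: h; rewrite h2 mul1r addr0 => ->.
have [c [b [a [cs bs as_ [c0 b0 a0] Hcba]]]] := implicit_system3 fM r0s r1s r2s r00 r10 r20 F1 F2 F3 G2 G3 H4.
pose k (m : M) : R * (R * (R * M)) := (c m, (b m, (a m, m))).
have ks : smoothAt 0 k by rewrite /k; sm.
have k0 : k 0 = 0 by rewrite /k c0 b0 a0.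
have p2 : smoothAt 0 (fun z : R * M => z.2) by sm.
have kps : smoothAt 0 (fun z : R * M => k z.2) by apply: (smoothAt_comp (f := k)).
pose S (z : R * M) : Z := (z.1, k z.2).
have Ss : smoothAt 0 S by rewrite /S; sm.
have S0 : S 0 = 0 by rewrite /S k0.
have qS : smoothAt 0 (fun z => q (S z)) by apply: (smoothAt_comp (f := q)); rewrite ?S0.
have q0 : q 0 != 0.
  suff h : q 0 - C = 0 by move: C0; rewrite -(subr_eq0 C) subr0; apply: contra => /eqP h2; move: h; rewrite h2 => /eqP; rewrite sub0r oppr_eq0.
  apply: (@punctured_zero (fun y => q (j y) - C) _ d0) => [|y /qC ->]; last exact: subrr.
  by apply: continuousB; [exact: contj|exact: cst_continuous].
have PS : \forall z \near (0 : R * M), P z = (z.1 ^+ 3 + a z.2 * z.1 ^+ 2 + b z.2 * z.1 + c z.2) * q (S z).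
  apply: (near2 (near_subst S0 Ss H) (near_subst (g := fun z : R * M => z.2) erefl p2 Hcba)) => -[y m] /= ->.
  by rewrite /S /k /= => -[-> -> ->]; rewrite !mul0r !addr0.
have [Q [h0 [h1 [h2 [Qs [h0s h1s h2s] HQ]]]]] := generic_division3 fM fs.
exists (fun z => Q (S z) / q (S z)), (fun m => h0 (k m)), (fun m => h1 (k m)), (fun m => h2 (k m)); split.
- apply: smoothAtM; first by apply: (smoothAt_comp (f := Q)); rewrite ?S0.
  by apply: smoothAtV; rewrite ?S0.
- split.
  + by apply: (smoothAt_comp (f := h0)); rewrite ?k0.
  + by apply: (smoothAt_comp (f := h1)); rewrite ?k0.
  + by apply: (smoothAt_comp (f := h2)); rewrite ?k0.
have qSn : \forall z \near (0 : R * M), q (S z) != 0 by apply: smoothAt_neq0 => //; rewrite S0.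
apply: (near2 (near_subst S0 Ss HQ) (near_and PS qSn)) => -[y m].
by rewrite /S /= => -> [-> qn]; rewrite -/(k m); field.
Qed.

End Weierstrass.

(** * Infinitesimal versality *)

Section Versality.
Context {R : realType}.
Implicit Types M : normedModType R.

(** For each [m] the factor vanishes at a single value of [u], and there [F] is 0 by continuity. *)
Lemma cancel_linear M (t : M -> R) (F : R * M -> R) : findim M -> smoothAt 0 t -> smoothAt 0 F ->
  (\forall z \near (0 : R * M), (z.1 - t z.2) * F z = 0) -> \forall z \near (0 : R * M), F z = 0.
Proof.
move=> fM ts Fs H; have p2 : smoothAt 0 (fun z : R * M => z.2) by sm.
apply: (near2 (nbhs_interior H) (smoothAt_nbhs Fs)) => -[u m] Hu Fu.
pose i (x : R) : R * M := (u + x, m); have is_ x : smoothAt x i by rewrite /i; sm.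
have i0 : i 0 = (u, m) by rewrite /i addr0.
have /near0P[d d0 Hd] := near_subst i0 (is_ 0) Hu.
have Fi : {for 0, continuous (fun x => F (i x))}.
  by apply: smoothAt_cont; apply: (smoothAt_comp (f := F)); rewrite ?i0.
have [ut|ut] := eqVneq u (t m); last first.
  by have := nbhs_singleton Hu; move/eqP; rewrite /= mulf_eq0 subr_eq0 (negbTE ut) => /eqP.
rewrite -i0; apply: (@punctured_zero _ (fun x => F (i x)) d) => // x /andP[x0 xd].
have := Hd x xd => /eqP; rewrite /i /= ut addrAC subrr add0r mulf_eq0.
by rewrite -normr_eq0 (gt_eqF x0) => /eqP.
Qed.

Context {M : normedModType R}.
Hypothesis fM : findim M.
Variables (K : R * (R * M) -> R) (s b : R).
Hypotheses (Ks : smoothAt 0 K) (s0 : s != 0) (b0 : b != 0)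
  (K0 : \forall z \near (0 : R * R), K (z.1, (z.2, 0)) = s * z.1 ^+ 3 - b * z.2 ^+ 2).
Let Ky := 'D_(1, 0) K.
Let Ku := 'D_(0, (1, 0)) K.
Let i0 (z : R * R) : R * (R * M) := (z.1, (z.2, 0)).

Let i0s z : smoothAt z i0. Proof. by rewrite /i0; sm. Qed.
Let i00 : i0 0 = 0. Proof. by []. Qed.

Lemma central_derivatives : \forall z \near (0 : R * R),
  Ky (i0 z) = 3 * s * z.1 ^+ 2 /\ Ku (i0 z) = - 2 * b * z.2.
Proof.
apply: (near2 (nbhs_interior K0) (near_subst i00 (i0s 0) (smoothAt_nbhs Ks))) => z Hz Kz; split.
- eassert (D1 : is_derive z ((1, 0) : R * R) i0 _) by (rewrite /i0; isd).
  have [_ E] := is_derive_chain D1 (smoothAt_diff Kz).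
  rewrite /Ky -E (near_eq_derive ((1, 0) : R * R) Hz).
  eassert (D2 : is_derive z ((1, 0) : R * R) (fun z : R * R => s * z.1 ^+ 3 - b * z.2 ^+ 2) _) by isd.
  by have [_ ->] := D2; rewrite /=; ring.
- eassert (D1 : is_derive z ((0, 1) : R * R) i0 _) by (rewrite /i0; isd).
  have [_ E] := is_derive_chain D1 (smoothAt_diff Kz).
  rewrite /Ku -E (near_eq_derive ((0, 1) : R * R) Hz).
  eassert (D2 : is_derive z ((0, 1) : R * R) (fun z : R * R => s * z.1 ^+ 3 - b * z.2 ^+ 2) _) by isd.
  by have [_ ->] := D2; rewrite /=; ring.
Qed.

(** [x0] is read off at the origin. Differentiating in [y] at [y = 0] kills the term with [ups],
    which is independent of [y], and leaves [x1 + x2 u = - b u^2 q_y]. So 1, [y], [u y] are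
    independent modulo the tangent space of the singularity. *)
Lemma central_unique (q eta : R * R -> R) (ups : R -> R) (x0 x1 x2 : R) :
  smoothAt 0 q -> smoothAt 0 eta -> smoothAt 0 ups ->
  (\forall z \near (0 : R * R), x0 + x1 * z.1 + x2 * z.2 * z.1 =
    q z * (s * z.1 ^+ 3 - b * z.2 ^+ 2) + eta z * (3 * s * z.1 ^+ 2) + ups z.2 * (- 2 * b * z.2)) ->
  [/\ x0 = 0, x1 = 0 & x2 = 0].
Proof.
move=> qs es us H; split.
- by have := nbhs_singleton H; rewrite /= !expr0n /= !mulr0 subr0 !mulr0 !addr0.
all: suff [] : x1 = 0 /\ x2 = 0 by [].
all: pose j (u : R) : R * R := (0, u); have js u : smoothAt u j by rewrite /j; sm.
all: have j0 : j 0 = 0 by [].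
all: have n1 := near_subst j0 (js 0) (nbhs_interior H).
all: have n2 := near_subst j0 (js 0) (near_and (smoothAt_nbhs qs) (smoothAt_nbhs es)).
all: have [d d0 Hd] := (near0P _).1 (near_and n1 (near_and n2 (smoothAt_nbhs us))).
all: pose qy := 'D_(1, 0) q; have qys : smoothAt 0 qy by exact: smoothAt_derive.
all: apply: (@flat2 _ (fun u => - b * qy (j u)) d) => // [|u /andP[_ ud]].
1,3: by apply: smoothAt_cont; apply: smoothAtM; [sm|apply: (smoothAt_comp (f := qy))].
all: have [Hu [[qu eu] uu]] := Hd u ud.
all: pose v : R * R := (1, 0).
all: have Dq := smoothAt_is_derive v qu.
all: have De := smoothAt_is_derive v eu.
all: have Dz2 : is_derive (j u) v (fun z : R * R => z.2) 0 by exact: (is_derive_snd (isd_id (j u) v)).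
all: have Du := is_derive_chain Dz2 (smoothAt_diff (uu : smoothAt (j u).2 ups)).
all: eassert (D1 : is_derive (j u) v (fun z : R * R => x0 + x1 * z.1 + x2 * z.2 * z.1) _) by isd.
all: eassert (D2 : is_derive (j u) v (fun z : R * R => q z * (s * z.1 ^+ 3 - b * z.2 ^+ 2)
  + eta z * (3 * s * z.1 ^+ 2) + ups z.2 * (- 2 * b * z.2)) _) by isd.
all: have [_ E2] := D2; have [_] := D1; rewrite (near_eq_derive v Hu) E2 /v /j /=.
all: rewrite derive0 -/v -/(j u) /qy; set A := 'D_v q _ => E.
all: apply/eqP; rewrite -subr_eq0; move/eqP: E; rewrite -subr_eq0 => /eqP E.
all: by rewrite -[X in _ == X]E; apply/eqP; ring.
Qed.

(** Modulo [Ky] every function becomes a pair of functions of [(u, m)]. Pairs are then divided by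
    those of [Ku] and of [z.1 * K], whose determinant has order 3 in [u]; three functions of [m]
    remain. The term [hs] arises because the second entry of the pair of [Ku] vanishes at [m = 0]
    only. *)
Lemma reduction : exists hs : R * M -> R, [/\ smoothAt 0 hs,
  \forall u \near (0 : R), hs (u, 0) = 0 &
  forall p, smoothAt 0 p -> exists (q eta : R * (R * M) -> R) (ups : R * M -> R) (c1 c2 c3 : M -> R),
   [/\ [/\ smoothAt 0 q, smoothAt 0 eta & smoothAt 0 ups], [/\ smoothAt 0 c1, smoothAt 0 c2 & smoothAt 0 c3] &
    \forall z \near (0 : R * (R * M)), p z = q z * K z + eta z * Ky z + ups z.2 * Ku z +
      c1 z.2.2 * (1 + hs z.2 * z.1) + c2 z.2.2 * z.1 + c3 z.2.2 * z.2.1 * z.1]].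
Proof.
have Kys : smoothAt 0 Ky by exact: smoothAt_derive.
have Kus : smoothAt 0 Ku by exact: smoothAt_derive.
have c0 : 3 * s != 0 by rewrite mulf_neq0.
have KyC : \forall y \near (0 : R), Ky (y, 0) = 3 * s * y ^+ 2.
  apply: (near1 (near_subst (g := fun y : R => (y, 0 : R)) (y := 0) _ _ central_derivatives)) => //; first by sm.
  by move=> y [].
have fRM : findim (R * M : normedModType R)%type by exact _.
have W2 := weierstrass2 fRM Kys c0 KyC.
have [q1 [h0 [h1 [q1s h0s h1s Hh]]]] := W2 Ku Kus.
(* [K] alone adds nothing at zero parameters: modulo [Ky] it is [- b u^2], a multiple of [Ku]. The
   factor [y] yields the independent pair [(0, - b u^2)]. *)
have yKs : smoothAt 0 (fun z : R * (R * M) => z.1 * K z) by sm.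
have [q2 [m0 [m1 [q2s m0s m1s Hm]]]] := W2 _ yKs.
(* At zero parameters the remainder modulo [Ky] is unique by [flat2], so any explicit division
   computes it. *)
have central (q : R * (R * M) -> R) (r0 r1 : R * M -> R) (f : R * (R * M) -> R) (g : R * R -> R) (a0 a1 : R -> R) :
    smoothAt 0 q -> smoothAt 0 g -> (\forall z \near (0 : R * (R * M)), f z = q z * Ky z + r0 z.2 + r1 z.2 * z.1) ->
    (\forall z \near (0 : R * R), f (i0 z) = g z * z.1 ^+ 2 + a0 z.2 + a1 z.2 * z.1) ->
    \forall u \near (0 : R), r0 (u, 0) = a0 u /\ r1 (u, 0) = a1 u.
  move=> qs gs Hf Hg; pose k (u : R) : R * R := (0, u).
  have ks u : smoothAt u k by rewrite /k; sm.
  have k0 : k 0 = 0 by [].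
  have n1 := near_subst i00 (i0s 0) Hf.
  have n2 := nbhs_interior (near_and (near_and n1 Hg) central_derivatives).
  have n3 := near_and (near_subst i00 (i0s 0) (smoothAt_nbhs qs)) (smoothAt_nbhs gs).
  apply: (near2 (near_subst k0 (ks 0) n2) (near_subst k0 (ks 0) n3)) => u Hu [qu gu].
  pose l (y : R) : R * R := (y, u); have ls y : smoothAt y l by rewrite /l; sm.
  have l0 : l 0 = k u by [].
  have [d d0 Hd] := (near0P _).1 (near_subst l0 (ls 0) Hu).
  suff [E1 E2] : r0 (u, 0) - a0 u = 0 /\ r1 (u, 0) - a1 u = 0 by move: E1 E2; split; lra.
  apply: (@flat2 _ (fun y => g (l y) - 3 * s * q (i0 (l y))) d) => // [|y /andP[_ yd]].
    apply: smoothAt_cont; apply: smoothAtB; first exact: (smoothAt_comp (f := g)).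
    apply: smoothAtM; first exact: smoothAt_cst.
    apply: (smoothAt_comp (f := q) (g := fun y => i0 (l y))) => //.
    by apply: (smoothAt_comp (f := i0)).
  have [[E1 E2] [E3 _]] := Hd y yd; rewrite E1 E3 in E2.
  by move: E2; rewrite /i0 /l /=; lra.
have hc : \forall u \near (0 : R), h0 (u, 0) = - 2 * b * u /\ h1 (u, 0) = 0.
  apply: (central q1 h0 h1 Ku (fun=> 0) (fun u => - 2 * b * u) (fun=> 0)) => //; first by sm.
  by apply: (near1 central_derivatives) => z [_ ->]; ring.
have mc : \forall u \near (0 : R), m0 (u, 0) = 0 /\ m1 (u, 0) = - b * u ^+ 2.
  apply: (central q2 m0 m1 (fun z => z.1 * K z) (fun z => s * z.1 ^+ 2) (fun=> 0) (fun u => - b * u ^+ 2)) => //; first by sm.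
  by apply: (near1 K0) => z; rewrite /i0 /= => ->; ring.
have h00 : h0 0 = 0 by have [] := nbhs_singleton hc; rewrite mulr0.
have h01 : 'D_(1, 0) h0 0 != 0.
  pose k (u : R) : R * M := (u, 0); eassert (D1 : is_derive (0 : R) (1 : R) k _) by (rewrite /k; isd).
  have [_ <-] := is_derive_chain D1 (smoothAt_diff (h0s : smoothAt (k 0) h0)).
  have hc' : \forall u \near (0 : R), h0 (k u) = - 2 * b * u by apply: (near1 hc) => u [].
  rewrite (near_eq_derive (1 : R) hc').
  eassert (D2 : is_derive (0 : R) (1 : R) (fun u : R => - 2 * b * u) _) by isd.
  by have [_ ->] := D2; rewrite mulr1 mul0r addr0 mulf_neq0// oppr_eq0.
have [u0 [e [u0s u00 es e0 He]]] := weierstrass1 fM h0s h00 h01.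
pose H z := h1 z / e z; have Hs : smoothAt 0 H by apply: smoothAtM => //; exact: smoothAtV.
have u0z : smoothAt 0 (fun z : R * M => u0 z.2) by apply: (smoothAt_comp (f := u0)) => //; sm.
(* Up to the unit [e], the determinant of the pairs [(h0, h1)] and [(m0, m1)]. The same determinant
   formed with the pair of [p] is [X], from which [ups] has disappeared. *)
pose P3 z := (z.1 - u0 z.2) * m1 z - H z * m0 z.
have P3s : smoothAt 0 P3 by rewrite /P3; sm.
have nb0 : - b != 0 by rewrite oppr_eq0.
have P3c : \forall u \near (0 : R), P3 (u, 0) = - b * u ^+ 3.
  by apply: (near1 mc) => u; rewrite /P3 /= u00 => -[-> ->]; ring.
have [g gs Hg] := hadamard2 fM Hs.
pose at0 (z : R * M) : R * (R * M) := (z.1, (u0 z.2, z.2)).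
have at0s : smoothAt 0 at0 by rewrite /at0; sm.
have at00 : at0 0 = 0 by rewrite /at0 u00.
have {}Hg := near_subst at00 at0s Hg.
have gas : smoothAt 0 (fun z => g (at0 z)) by apply: (smoothAt_comp (f := g)); rewrite ?at00.
pose w (u : R) : R * M := (u, 0); have ws u : smoothAt u w by rewrite /w; sm.
have w0 : w 0 = 0 by [].
have en : \forall z \near (0 : R * M), e z != 0 by exact: smoothAt_neq0.
exists (fun z => g (at0 z)); split=> //.
  have hz : \forall u \near (0 : R), u * g (at0 (w u)) = 0.
    apply: (near2 (near_subst w0 (ws 0) Hg) hc) => u; rewrite /at0 /w /= u00 subr0 /H => E [_ E1].
    have E2 := (nbhs_singleton hc).2; move: E; by rewrite E1 E2 !mul0r add0r => /esym.
  have /near0P[d d0 Hd] := hz.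
  apply/near0P; exists d => // u ud; have [->|un] := eqVneq u 0; last first.
    by have /eqP := Hd u ud; rewrite mulf_eq0 (negbTE un) => /eqP.
  apply: (@punctured_zero _ (fun u => g (at0 (w u))) d) => //.
    by apply: smoothAt_cont; apply: (smoothAt_comp (f := fun z => g (at0 z))).
  by move=> y /andP[y0 yd]; have /eqP := Hd y yd; rewrite mulf_eq0 -normr_eq0 (gt_eqF y0) => /eqP.
move=> p ps; have [q0 [r0 [r1 [q0s r0s r1s Hr]]]] := W2 p ps.
pose X z := (z.1 - u0 z.2) * r1 z - H z * r0 z.
have Xs : smoothAt 0 X by rewrite /X; sm.
have [Q [c0' [c1 [c2 [Qs [c0s c1s c2s] HQ]]]]] := weierstrass3 fM P3s nb0 P3c Xs.
(* With [Q] times the pair of [y K] removed, the first entry at [u = u0 m] becomes the coefficient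
   [rho]; its remaining part is divisible by [u - u0 m] and determines [ups]. *)
pose r0' z := r0 z - Q z * m0 z; pose r1' z := r1 z - Q z * m1 z.
have r0's : smoothAt 0 r0' by rewrite /r0'; sm.
have r1's : smoothAt 0 r1' by rewrite /r1'; sm.
have [x xs Hx] := hadamard2 fM r0's.
have {}Hx := near_subst at00 at0s Hx.
have xas : smoothAt 0 (fun z => x (at0 z)) by apply: (smoothAt_comp (f := x)); rewrite ?at00.
pose ups z := x (at0 z) / e z.
have upss : smoothAt 0 ups by apply: smoothAtM => //; exact: smoothAtV.
pose z0 (m : M) : R * M := (u0 m, m).
have z0s : smoothAt 0 z0 by rewrite /z0; sm.
have z00 : z0 0 = 0 by rewrite /z0 u00.
pose rho m := r0' (z0 m).
have rhos : smoothAt 0 rho by apply: (smoothAt_comp (f := r0')); rewrite ?z00.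
pose c1' m := c1 m + c2 m * u0 m.
have c1's : smoothAt 0 c1' by rewrite /c1'; sm.
pose p2 (z : R * M) := z.2; have p2s : smoothAt 0 p2 by rewrite /p2; sm.
have p20 : p2 0 = 0 by [].
(* The part of the determinant identity independent of [u]; evaluating [E1] at [u = u0 m] shows that
   it vanishes. *)
pose cst m := H (z0 m) * rho m + c0' m + c1 m * u0 m + c2 m * u0 m ^+ 2.
pose D z := r1' z - ups z * h1 z - g (at0 z) * rho z.2 - c1' z.2 - c2 z.2 * z.1.
have rhoz : smoothAt 0 (fun z : R * M => rho z.2) by apply: (smoothAt_comp (f := rho)).
have c1z : smoothAt 0 (fun z : R * M => c1' z.2) by apply: (smoothAt_comp (f := c1')).
have c2z : smoothAt 0 (fun z : R * M => c2 z.2) by apply: (smoothAt_comp (f := c2)).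
have Ds : smoothAt 0 D by rewrite /D; sm.
have E1 : \forall z \near (0 : R * M), (z.1 - u0 z.2) * D z = cst z.2.
  have n1 := near_and (near_and He Hg) (near_and HQ Hx).
  apply: (near2 n1 en) => -[u m] /= [[E1 E2] [E3 E4]] e1.
  move: E2 E4; rewrite /at0 /= -/(z0 m) -/(rho m) => E2 E4.
  have E5 : (u - u0 m) * r1' (u, m) - H (u, m) * r0' (u, m) = c0' m + c1 m * u + c2 m * u ^+ 2.
    move: E3; rewrite /X /P3 /r0' /r1' /= => E3.
    transitivity ((u - u0 m) * r1 (u, m) - H (u, m) * r0 (u, m) - Q (u, m) * ((u - u0 m) * m1 (u, m) - H (u, m) * m0 (u, m))); first by ring.
    by rewrite E3; ring.
  have E6 : (u - u0 m) * (ups (u, m) * h1 (u, m)) = H (u, m) * (r0' (u, m) - rho m).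
    by rewrite E4 /ups /H /at0 /=; field.
  transitivity (((u - u0 m) * r1' (u, m) - H (u, m) * r0' (u, m)) + H (u, m) * r0' (u, m)
      - (u - u0 m) * (ups (u, m) * h1 (u, m)) - ((u - u0 m) * g (at0 (u, m))) * rho m
      - (u - u0 m) * (c1' m + c2 m * u)); first by rewrite /D /=; ring.
  have -> : (u - u0 m) * g (at0 (u, m)) = H (u, m) - H (z0 m) by rewrite E2 /at0 /=; ring.
  by rewrite E5 E6 /cst /c1'; ring.
have E2 : \forall z \near (0 : R * M), (z.1 - u0 z.2) * D z = 0.
  have n1 := near_subst z00 z0s E1.
  apply: (near2 E1 (near_subst p20 p2s n1)) => z -> /=.
  by rewrite subrr mul0r => <-.
have D0 := cancel_linear fM u0s Ds E2.
pose P2 (z : R * (R * M)) := z.2; have P2s : smoothAt 0 P2 by rewrite /P2; sm.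
have P20 : P2 0 = 0 by [].
have lift (f : R * M -> R) : smoothAt 0 f -> smoothAt 0 (fun z : R * (R * M) => f z.2).
  by move=> fs; apply: (smoothAt_comp (f := f)).
exists (fun z => Q z.2 * z.1), (fun z => q0 z - Q z.2 * q2 z - ups z.2 * q1 z), ups, rho, c1', c2.
split; [split=> //|by []|].
- by have := lift _ Qs => h; sm.
- by have := lift _ Qs; have := lift _ upss => a h; sm.
have n1 := near_and (near_subst P20 P2s D0) (near_subst P20 P2s Hx).
have n2 := near_and (near_subst P20 P2s He) (near_subst P20 P2s en).
apply: (near2 (near_and n1 n2) (near_and Hr (near_and Hh Hm))).
move=> -[y [u m]]; rewrite /P2 /= => -[[E3 E4] [E5 E6]] [-> [E7 E8]].
have F0 : r0 (u, m) = Q (u, m) * m0 (u, m) + ups (u, m) * h0 (u, m) + rho m.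
  have -> : ups (u, m) * h0 (u, m) = (u - u0 m) * x (at0 (u, m)) by rewrite E5 /ups /=; field.
  by rewrite /at0 /=; move: E4; rewrite /r0' /rho /r0' /z0 /at0 /=; lra.
have F1 : r1 (u, m) = Q (u, m) * m1 (u, m) + ups (u, m) * h1 (u, m) + g (at0 (u, m)) * rho m + c1' m + c2 m * u.
  by move: E3; rewrite /D /r1' /=; lra.
rewrite F0 F1.
have -> : h0 (u, m) = Ku (y, (u, m)) - q1 (y, (u, m)) * Ky (y, (u, m)) - h1 (u, m) * y by rewrite E7; ring.
have -> : m0 (u, m) = y * K (y, (u, m)) - q2 (y, (u, m)) * Ky (y, (u, m)) - m1 (u, m) * y by rewrite E8; ring.
by ring.
Qed.

(** [reduction] is applied to 1 and to [K3] as well; [central_unique] computes their coefficients at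
    [m = 0], which shows that the passage to the generators 1, [y], [K3] is invertible near 0. *)
Lemma versal (K3 : R * (R * M) -> R) (k : R) : smoothAt 0 K3 -> k != 0 ->
  (\forall z \near (0 : R * R), K3 (z.1, (z.2, 0)) = k * z.2 * z.1) ->
  forall p, smoothAt 0 p -> exists (q eta : R * (R * M) -> R) (ups : R * M -> R) (t1 t2 t3 : M -> R),
   [/\ [/\ smoothAt 0 q, smoothAt 0 eta & smoothAt 0 ups], [/\ smoothAt 0 t1, smoothAt 0 t2 & smoothAt 0 t3] &
    \forall z \near (0 : R * (R * M)), p z = q z * K z + eta z * Ky z + ups z.2 * Ku z +
      t1 z.2.2 + t2 z.2.2 * z.1 + t3 z.2.2 * K3 z].
Proof.
move=> K3s k0 HK3; have [hs [hss hs0 red]] := reduction.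
have hs0' : \forall z \near (0 : R * R), hs (z.2, 0) = 0.
  have p2s : smoothAt 0 (fun z : R * R => z.2) by sm.
  exact: (near_subst (g := fun z : R * R => z.2) erefl p2s hs0).
have central (q eta : R * (R * M) -> R) (ups : R * M -> R) (c1 c2 c3 : M -> R) (f : R * (R * M) -> R) (y0 y1 y2 : R) :
    smoothAt 0 q -> smoothAt 0 eta -> smoothAt 0 ups ->
    (\forall z \near (0 : R * (R * M)), f z = q z * K z + eta z * Ky z + ups z.2 * Ku z +
      c1 z.2.2 * (1 + hs z.2 * z.1) + c2 z.2.2 * z.1 + c3 z.2.2 * z.2.1 * z.1) ->
    (\forall z \near (0 : R * R), f (i0 z) = y0 + y1 * z.1 + y2 * z.2 * z.1) ->
    [/\ c1 0 = y0, c2 0 = y1 & c3 0 = y2].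
  move=> qs es us Hf Hy.
  have n1 := near_and (near_subst i00 (i0s 0) Hf) Hy.
  have n2 := near_and (near_and central_derivatives K0) hs0'.
  have [||||E1 E2 E3] := @central_unique (fun z => q (i0 z)) (fun z => eta (i0 z)) (fun u => ups (u, 0))
     (y0 - c1 0) (y1 - c2 0) (y2 - c3 0).
  - exact: (smoothAt_comp (f := q)).
  - exact: (smoothAt_comp (f := eta)).
  - by apply: (smoothAt_comp (f := ups) (g := fun u : R => (u, 0 : M))) => //; sm.
  - apply: (near2 n1 n2) => -[y u] [E1 E2] [[[E3 E4] E5] E6]; move: E1 E2 E3 E4 E5 E6.
    rewrite /i0 /= => E1 E2 E3 E4 E5 E6; rewrite E1 E3 E4 E5 E6 in E2.
    by move: E2; rewrite mul0r addr0 mulr1; lra.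
  - by split; [move: E1|move: E2|move: E3]; lra.
have [q1 [e1 [u1 [a11 [a12 [a13 [[q1s e1s u1s] [a11s a12s a13s] H1]]]]]]] := red (fun=> 1) (smoothAt_cst _ _).
have [q3 [e3 [u3 [a31 [a32 [a33 [[q3s e3s u3s] [a31s a32s a33s] H3]]]]]]] := red K3 K3s.
have [A11 _ A13] : [/\ a11 0 = 1, a12 0 = 0 & a13 0 = 0].
  apply: (central q1 e1 u1 a11 a12 a13 (fun=> 1)) => //.
  by apply: filterE => z; rewrite !mul0r !addr0.
have [A31 _ A33] : [/\ a31 0 = 0, a32 0 = 0 & a33 0 = k].
  apply: (central q3 e3 u3 a31 a32 a33 K3) => //.
  by apply: (near1 HK3) => z; rewrite /i0 => ->; ring.
move=> p ps.
have [q [e [u [c1 [c2 [c3 [[qs es us] [c1s c2s c3s] H]]]]]]] := red p ps.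
(* Determinant of the linear system that expresses [c1], [c3] by [t1], [t3]. Its value at [m = 0] is
   [k]; [t2] is then explicit. *)
pose D m := a11 m * a33 m - a31 m * a13 m.
have Ds : smoothAt 0 D by rewrite /D; sm.
have D0 : D 0 != 0 by rewrite /D A11 A13 A33 mulr0 subr0 mul1r.
pose t1 m := (c1 m * a33 m - c3 m * a31 m) / D m.
pose t3 m := (a11 m * c3 m - a13 m * c1 m) / D m.
pose t2 m := c2 m - t1 m * a12 m - t3 m * a32 m.
have t1s : smoothAt 0 t1 by apply: smoothAtM; [sm|exact: smoothAtV].
have t3s : smoothAt 0 t3 by apply: smoothAtM; [sm|exact: smoothAtV].
have t2s : smoothAt 0 t2 by rewrite /t2; sm.
pose P2 (z : R * (R * M)) := z.2.2; have P2s : smoothAt 0 P2 by rewrite /P2; sm.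
have P20 : P2 0 = 0 by [].
pose p2 (z : R * M) := z.2; have p2s : smoothAt 0 p2 by rewrite /p2; sm.
have lift (f : M -> R) : smoothAt 0 f -> smoothAt 0 (fun z : R * (R * M) => f z.2.2).
  by move=> fs; apply: (smoothAt_comp (f := f) (g := P2)).
have lift2 (f : M -> R) : smoothAt 0 f -> smoothAt 0 (fun z : R * M => f z.2).
  by move=> fs; apply: (smoothAt_comp (f := f) (g := p2)).
have l1 := lift _ t1s; have l3 := lift _ t3s; have l1' := lift2 _ t1s; have l3' := lift2 _ t3s.
exists (fun z => q z - t1 z.2.2 * q1 z - t3 z.2.2 * q3 z), (fun z => e z - t1 z.2.2 * e1 z - t3 z.2.2 * e3 z),
  (fun z => u z - t1 z.2 * u1 z - t3 z.2 * u3 z), t1, t2, t3.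
split; [by split; sm|by []|].
apply: (near2 (near_and H (near_subst P20 P2s (smoothAt_neq0 Ds D0))) (near_and H1 H3)).
move=> -[y [w m]] /= [E Dn] [E1 E3].
have F1 : t1 m * a11 m + t3 m * a31 m = c1 m by rewrite /t1 /t3; move: Dn; rewrite /P2 /D /= => Dn; field.
have F3 : t1 m * a13 m + t3 m * a33 m = c3 m by rewrite /t1 /t3; move: Dn; rewrite /P2 /D /= => Dn; field.
have F2 : c2 m = t2 m + t1 m * a12 m + t3 m * a32 m by rewrite /t2; ring.
rewrite E; set z := (y, (w, m)); set z2 := (w, m).
transitivity ((q z - t1 m * q1 z - t3 m * q3 z) * K z + (e z - t1 m * e1 z - t3 m * e3 z) * Ky z +
  (u z2 - t1 m * u1 z2 - t3 m * u3 z2) * Ku z + t2 m * y + t1 m *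
  (q1 z * K z + e1 z * Ky z + u1 z2 * Ku z + a11 m * (1 + hs z2 * y) + a12 m * y + a13 m * w * y) + t3 m *
  (q3 z * K z + e3 z * Ky z + u3 z2 * Ku z + a31 m * (1 + hs z2 * y) + a32 m * y + a33 m * w * y)).
  by rewrite -F1 -F3 F2; ring.
by rewrite -E1 -E3; ring.
Qed.

End Versality.

(** * Homotopies of families *)

Lemma derive_scale (R : realType) (V U : normedModType R) (f : V -> U) (z v : V) (a : R) :
  smoothAt z f -> 'D_(a *: v) f z = a *: 'D_v f z.
Proof. by move=> fz; rewrite -[a *: v]addr0 derive_lin ?derive0 ?addr0//; exact: smoothAt_diff. Qed.

Section Homotopy.
Context {R : realType}.
Let A3 := (R * (R * R))%type.
Let par := (A3 * (R * R))%type.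
Let W := (R * (R * par))%type.
Let Z := ((R * (R * ((R * (R * R)) * (R * R)))) * (R * R) : normedModType R)%type.
Variables (K q eta : R * (R * ((R * (R * R)) * (R * R))) -> R) (ups : R * ((R * (R * R)) * (R * R)) -> R)
  (T : (R * (R * R)) * (R * R) -> R * (R * R)).
Hypotheses (Ks : smoothAt 0 K) (qs : smoothAt 0 q) (es : smoothAt 0 eta) (us : smoothAt 0 ups) (Ts : smoothAt 0 T)
  (HK : \forall z \near (0 : W), 'D_((eta z, (ups z.2, (T z.2.2, (-1, 0)))) : W) K z = - q z * K z).

(* [w.2.2] is the elapsed time, kept constant, so that the field vanishes with it; [w.2.1] makes
   [(1 + w.2.1) * K w.1] a first integral. *)
Definition hfield (w : Z) : Z :=
  ((w.2.2 * eta w.1, (w.2.2 * ups w.1.2, (w.2.2 *: T w.1.2.2, (- w.2.2, 0)))), (w.2.2 * q w.1 * (1 + w.2.1), 0)).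

Let lift1 (f : W -> R) : smoothAt 0 f -> smoothAt 0 (fun w : Z => f w.1).
Proof. by move=> fs; apply: (smoothAt_comp (f := f)) => //; sm. Qed.

Lemma hfield_smooth : smoothAt 0 hfield.
Proof.
have e1 := lift1 es; have q1 := lift1 qs.
have u1 : smoothAt 0 (fun w : Z => ups w.1.2) by apply: (smoothAt_comp (f := ups)) => //; sm.
have T1 : smoothAt 0 (fun w : Z => T w.1.2.2) by apply: (smoothAt_comp (f := T)) => //; sm.
have T2 : smoothAt 0 (fun w : Z => w.2.2 *: T w.1.2.2) by apply: smoothAtZ => //; sm.
by rewrite /hfield; sm.
Qed.

Lemma hfield0 : hfield 0 = 0.
Proof. by rewrite /hfield /= !mul0r scale0r oppr0. Qed.

Lemma hfield_stationary w : w.2.2 = 0 -> hfield w = 0.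
Proof. by move=> E; rewrite /hfield E !mul0r scale0r oppr0. Qed.

(** The time-one flow of [hfield] brings the deformation parameter to 0, because the speed is its
    initial value; the stored factor [1 + w.2.1] becomes [Q]. [Y], [U], [A] are components of the
    endpoint, and respect for projections makes [U] independent of [y], and [A] of [y] and [u]. The
    primed maps come from the opposite field. *)
Lemma homotopy : exists (Q Y Y' : W -> R) (U U' : R * par -> R) (A A' : par -> A3),
  [/\ [/\ smoothAt 0 Q, smoothAt 0 Y, smoothAt 0 U & smoothAt 0 A],
      [/\ smoothAt 0 Y', smoothAt 0 U' & smoothAt 0 A'],
      \forall z \near (0 : W), K z = Q z * K (Y z, (U z.2, (A z.2.2, (0, z.2.2.2.2)))),
      (\forall z \near (0 : W), z.2.2.2.1 = 0 ->
         [/\ Q z = 1, Y z = z.1, U z.2 = z.2.1 & A z.2.2 = z.2.2.1] /\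
         [/\ Y' z = z.1, U' z.2 = z.2.1 & A' z.2.2 = z.2.2.1]) /\
      ((\forall z \near (0 : W), (Y' (Y z, (U z.2, (A z.2.2, z.2.2.2))), (U' (U z.2, (A z.2.2, z.2.2.2)),
         (A' (A z.2.2, z.2.2.2), z.2.2.2))) = z) /\
       (\forall z \near (0 : W), (Y (Y' z, (U' z.2, (A' z.2.2, z.2.2.2))), (U (U' z.2, (A' z.2.2, z.2.2.2)),
         (A (A' z.2.2, z.2.2.2), z.2.2.2))) = z)) &
      ((\forall z \near (0 : W), (z.1, (z.2.1, z.2.2.1)) = 0 -> (eta z, (ups z.2, T z.2.2)) = 0) ->
       \forall z \near (0 : W), (z.1, (z.2.1, z.2.2.1)) = 0 ->
         [/\ Y z = 0, U z.2 = 0 & A z.2.2 = 0] /\ [/\ Y' z = 0, U' z.2 = 0 & A' z.2.2 = 0])].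
Proof.
have fZ : findim Z by exact _.
have [f [g [Hf Hg gf fg]]] := local_flow fZ hfield_smooth hfield0.
have [[fs f0] fid fJ fdep finv] := Hf; have [[gs g0] gid gJ gdep ginv] := Hg.
have cst0 (c : R) (v z : Z) : 'D_v (fun=> c) z = 0 by exact: derive_cst.
have K1 := lift1 Ks; have q1 := lift1 qs.
have projs : smoothAt 0 (fun w : Z => w.1) by sm.
have J0 : \forall w \near (0 : Z), 'D_(hfield w) (fun w : Z => (1 + w.2.1) * K w.1) w = 0.
  have n1 := near_subst (g := fun w : Z => w.1) erefl projs HK.
  have n2 := near_subst (g := fun w : Z => w.1) erefl projs (smoothAt_nbhs Ks).
  apply: (near2 n1 n2) => w Hw Kw.
  eassert (D1 : is_derive w (hfield w) (fun w : Z => w.1) _) by isd.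
  have DK := is_derive_chain D1 (smoothAt_diff Kw).
  eassert (DJ : is_derive w (hfield w) (fun w : Z => (1 + w.2.1) * K w.1) _) by isd.
  have [_ ->] := DJ; rewrite /hfield /=.
  have -> : (w.2.2 * eta w.1, (w.2.2 * ups w.1.2, (w.2.2 *: T w.1.2.2, (- w.2.2, 0)))) =
    w.2.2 *: ((eta w.1, (ups w.1.2, (T w.1.2.2, (-1, 0)))) : W).
    by congr (_, (_, (_, (_, _)))); rewrite /= ?mulrN1 ?mulr0// /GRing.scale /= ?mulrN1 ?mulr0.
  rewrite (derive_scale _ _ Kw).
  rewrite Hw /GRing.scale /=; ring.
have J0' : \forall w \near (0 : Z), 'D_(- hfield w) (fun w : Z => (1 + w.2.1) * K w.1) w = 0.
  have JS : smoothAt 0 (fun w : Z => (1 + w.2.1) * K w.1) by sm.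
  apply: (near2 J0 (smoothAt_nbhs JS)) => w E Jw.
  by rewrite -scaleN1r (derive_scale _ _ Jw) E scaler0.
have JS : smoothAt 0 (fun w : Z => (1 + w.2.1) * K w.1) by sm.
have fK : \forall w \near (0 : Z), (1 + (f w).2.1) * K (f w).1 = (1 + w.2.1) * K w.1.
  by apply: (near1 (fJ _ (fun=> 0) JS (smoothAt_cst _ _) J0 _)) => [|w ->]; [exact: filterE|rewrite addr0].
have pl : linear (fun w : Z => (w.1.2.2.2, w.2.2)) by move=> a [[? [? [? ?]]] [? ?]] [[? [? [? ?]]] [? ?]].
have ql : linear (fun w : Z => ((- w.2.2, 0), 0) : (R * R) * R).
  move=> a [[? [? [? ?]]] [? x]] [[? [? [? ?]]] [? y]]; congr ((_, _), _); rewrite /= ?scaler0 ?addr0//.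
  by rewrite opprD scalerN.
have pc : continuous (mklin pl) by move=> z; apply: smoothAt_cont; rewrite /=; sm.
have qc : continuous (mklin ql) by move=> z; apply: smoothAt_cont; rewrite /=; sm.
have ql' : linear (fun w : Z => ((w.2.2, 0), 0) : (R * R) * R).
  by move=> a [[? [? [? ?]]] [? x]] [[? [? [? ?]]] [? y]]; congr ((_, _), _); rewrite /= ?scaler0 ?addr0.
have qc' : continuous (mklin ql') by move=> z; apply: smoothAt_cont; rewrite /=; sm.
have ft : \forall w \near (0 : Z), (f w).1.2.2.2 = (w.1.2.2.2.1 - w.2.2, w.1.2.2.2.2) /\ (f w).2.2 = w.2.2.
  have H : \forall w \near (0 : Z), mklin pl (f w) = mklin pl w + mklin ql w.
    by apply: (local_flow_lin _ Hf pc qc); apply: filterE => w //=; rewrite oppr0.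
  apply: (near1 H) => w /= [-> ->]; split; last by rewrite addr0.
  by congr (_, _); rewrite /= addr0.
have gt : \forall w \near (0 : Z), (g w).1.2.2.2 = (w.1.2.2.2.1 + w.2.2, w.1.2.2.2.2) /\ (g w).2.2 = w.2.2.
  have H : \forall w \near (0 : Z), mklin pl (g w) = mklin pl w + mklin ql' w.
    apply: (local_flow_lin _ Hg pc qc'); apply: filterE => w //=; last by rewrite oppr0.
    by congr ((_, _), _); rewrite /= ?oppr0 ?opprK.
  apply: (near1 H) => w /= [-> ->]; split; last by rewrite addr0.
  by congr (_, _); rewrite /= addr0.
(* [i] starts at [z] with elapsed time equal to the deformation parameter; [j] starts at deformation
   parameter 0 with the same elapsed time, for the way back. *)
pose i (z : W) : Z := (z, (0, z.2.2.2.1)).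
pose j (z : W) : Z := ((z.1, (z.2.1, (z.2.2.1, (0, z.2.2.2.2)))), (0, z.2.2.2.1)).
have is_ : smoothAt 0 i by rewrite /i; sm.
have js : smoothAt 0 j by rewrite /j; sm.
have i0 : i 0 = 0 by []. have j0 : j 0 = 0 by [].
have fi : smoothAt 0 (fun z => f (i z)) by exact: (smoothAt_comp (f := f)).
have gj : smoothAt 0 (fun z => g (j z)) by exact: (smoothAt_comp (f := g)).
pose k1 (z : R * par) : W := (0, z). pose k2 (z : par) : W := (0, (0, z)).
have k1s : smoothAt 0 k1 by rewrite /k1; sm.
have k2s : smoothAt 0 k2 by rewrite /k2; sm.
have fi1 : smoothAt 0 (fun z => f (i (k1 z))) by apply: (smoothAt_comp (f := fun z => f (i z))).
have fi2 : smoothAt 0 (fun z => f (i (k2 z))) by apply: (smoothAt_comp (f := fun z => f (i z))).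
have gj1 : smoothAt 0 (fun z => g (j (k1 z))) by apply: (smoothAt_comp (f := fun z => g (j z))).
have gj2 : smoothAt 0 (fun z => g (j (k2 z))) by apply: (smoothAt_comp (f := fun z => g (j z))).
pose Q (z : W) := 1 + (f (i z)).2.1; pose Y z := (f (i z)).1.1; pose Y' z := (g (j z)).1.1.
pose U z := (f (i (k1 z))).1.2.1; pose U' z := (g (j (k1 z))).1.2.1.
pose A z := (f (i (k2 z))).1.2.2.1; pose A' z := (g (j (k2 z))).1.2.2.1.
have small h : smoothAt 0 h -> h 0 = 0 -> forall d : R, 0 < d -> \forall z \near (0 : W), `|h z : Z| < d.
  move=> hs h0 d d0; have /contP /(_ d d0)[e e0 He] := smoothAt_cont hs.
  by apply/near0P; exists e => // y ye; have := He y; rewrite h0 !subr0; exact.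
pose P1 (w : Z) := (w.1.2, w.2.2). pose P2 (w : Z) := (w.1.2.2, w.2.2). pose P0 (w : Z) := (w.1, w.2.2).
have P1l : linear P1 by move=> a [[? ?] [? ?]] [[? ?] [? ?]].
have P2l : linear P2 by move=> a [[? [? ?]] [? ?]] [[? [? ?]] [? ?]].
have P0l : linear P0 by move=> a [? [? ?]] [? [? ?]].
have P1c : continuous (mklin P1l) by move=> z; apply: smoothAt_cont; rewrite /= /P1; sm.
have P2c : continuous (mklin P2l) by move=> z; apply: smoothAt_cont; rewrite /= /P2; sm.
have P0c : continuous (mklin P0l) by move=> z; apply: smoothAt_cont; rewrite /= /P0; sm.
have P1X (z z' : Z) : P1 z = P1 z' -> P1 (hfield z) = P1 (hfield z') by rewrite /P1 /hfield /= => -[-> ->].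
have P2X (z z' : Z) : P2 z = P2 z' -> P2 (hfield z) = P2 (hfield z') by rewrite /P2 /hfield /= => -[-> ->].
have P0X (z z' : Z) : P0 z = P0 z' -> P0 (hfield z) = P0 (hfield z') by rewrite /P0 /hfield /= => -[-> ->].
have dep (h : Z -> Z) (X : Z -> Z) (hX : local_flow_of X h) (E' : normedModType R) (p : {linear Z -> E'}) : continuous p ->
    (forall z z', p z = p z' -> p (X z) = p (X z')) ->
    exists2 d : R, 0 < d & forall z z', `|z| < d -> `|z'| < d -> p z = p z' -> p (h z) = p (h z').
  move=> c H; have [_ _ _ D _] := hX; have [|d d0 Hd] := D E' p 1 c ltr01; first by move=> z z' _ _; exact: H.
  by exists d.
have opp (E' : normedModType R) (p : {linear Z -> E'}) : (forall z z', p z = p z' -> p (hfield z) = p (hfield z')) ->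
    forall z z', p z = p z' -> p (- hfield z) = p (- hfield z').
  move=> H z z' /H E; transitivity (- p (hfield z)); first exact: raddfN.
  by rewrite E; apply: esym; exact: raddfN.
have agree h (X : Z -> Z) (l : W -> Z) (hX : local_flow_of X h) (E' : normedModType R) (p : {linear Z -> E'}) (m : W -> W) : continuous p ->
    (forall z z', p z = p z' -> p (X z) = p (X z')) -> smoothAt 0 l -> l 0 = 0 ->
    smoothAt 0 m -> m 0 = 0 -> (forall z, p (l z) = p (l (m z))) ->
    \forall z \near (0 : W), p (h (l z)) = p (h (l (m z))).
  move=> c H ls l0 ms m0 E; have [d d0 Hd] := dep h X hX E' p c H.
  have lms : smoothAt 0 (fun z => l (m z)) by apply: (smoothAt_comp (f := l)); rewrite ?m0.
  have lm0 : l (m 0) = 0 by rewrite m0.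
  by apply: (near2 (small _ ls l0 d d0) (small _ lms lm0 d d0)) => z a b; exact: Hd.
pose m1 (z : W) : W := (0, z.2). pose m2 (z : W) : W := (0, (0, z.2.2)).
have m1s : smoothAt 0 m1 by rewrite /m1; sm.
have m2s : smoothAt 0 m2 by rewrite /m2; sm.
have fE : \forall z \near (0 : W), f (i z) = ((Y z, (U z.2, (A z.2.2, (0, z.2.2.2.2)))), (Q z - 1, z.2.2.2.1)).
  have n1 := agree f hfield i Hf _ (mklin P1l) m1 P1c P1X is_ i0 m1s erefl (fun z => erefl).
  have n2 := agree f hfield i Hf _ (mklin P2l) m2 P2c P2X is_ i0 m2s erefl (fun z => erefl).
  apply: (near2 (near_and n1 n2) (near_subst i0 is_ ft)) => z [].
  rewrite /= /P1 /P2 => -[E1 E1'] [E2 E2'] [E3 E4].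
  have E5 : (f (i z)).1.2.1 = U z.2 by rewrite E1.
  have E6 : (f (i z)).1.2.2.1 = A z.2.2 by rewrite E2.
  rewrite -E5 -E6 -E4 /Q addrAC subrr add0r /Y.
  have -> : (0, z.2.2.2.2) = (f (i z)).1.2.2.2 by rewrite E3 /i /= subrr.
  by case: (f (i z)) => [[? [? [? ?]]] [? ?]].
have gE : \forall z \near (0 : W), exists s : R, g (j z) = ((Y' z, (U' z.2, (A' z.2.2, z.2.2.2))), (s, z.2.2.2.1)).
  have n1 := agree g _ j Hg _ (mklin P1l) m1 P1c (opp _ (mklin P1l) P1X) js j0 m1s erefl (fun z => erefl).
  have n2 := agree g _ j Hg _ (mklin P2l) m2 P2c (opp _ (mklin P2l) P2X) js j0 m2s erefl (fun z => erefl).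
  apply: (near2 (near_and n1 n2) (near_subst j0 js gt)) => z [].
  rewrite /= /P1 /P2 => -[E1 E1'] [E2 E2'] [E3 E4].
  have E5 : (g (j z)).1.2.1 = U' z.2 by rewrite E1.
  have E6 : (g (j z)).1.2.2.1 = A' z.2.2 by rewrite E2.
  exists (g (j z)).2.1; rewrite -E5 -E6 -E4 /Y'.
  have -> : z.2.2.2 = (g (j z)).1.2.2.2 by rewrite E3 /j /= add0r; case: z.2.2.2.
  by case: (g (j z)) => [[? [? [? ?]]] [? ?]].
have fi0 : f (i 0) = 0 by rewrite i0. have gj0 : g (j 0) = 0 by rewrite j0.
exists Q, Y, Y', U, U', A, A'; split.
- by split; rewrite ?/Q ?/Y ?/U ?/A; sm.
- by split; rewrite ?/Y' ?/U' ?/A'; sm.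
- apply: (near2 fE (near_subst i0 is_ fK)) => z E; rewrite E /i /= addr0 mul1r => <-.
  by congr (_ * _); ring.
- split.
    have n1 := near_and (near_subst i0 is_ fid) (near_subst j0 js gid).
    apply: (near2 n1 (near_and fE gE)) => z [a b] [E [s E']] z0.
    have Xi : hfield (i z) = 0 by apply: hfield_stationary.
    have Xj : - hfield (j z) = 0 by rewrite hfield_stationary ?oppr0.
    have Ei := a Xi; have Ej := b Xj.
    have E2 : U z.2 = (f (i z)).1.2.1 by rewrite E.
    have E3 : A z.2.2 = (f (i z)).1.2.2.1 by rewrite E.
    have F2 : U' z.2 = (g (j z)).1.2.1 by rewrite E'.
    have F3 : A' z.2.2 = (g (j z)).1.2.2.1 by rewrite E'.
    by split; split; rewrite ?E2 ?E3 ?F2 ?F3 ?Ei ?Ej ?/Q ?/Y ?/Y' ?Ei ?Ej ?addr0.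
  split.
    have [d d0 Hd] := dep g _ Hg _ (mklin P0l) P0c (opp _ (mklin P0l) P0X).
    pose l z := (Y z, (U z.2, (A z.2.2, z.2.2.2))) : W.
    have Y_ : smoothAt 0 Y by rewrite /Y; sm.
    have U_ : smoothAt 0 (fun z : W => U z.2) by rewrite /U; apply: (smoothAt_comp (f := fun z => (f (i (k1 z))).1.2.1)); sm.
    have A_ : smoothAt 0 (fun z : W => A z.2.2) by rewrite /A; apply: (smoothAt_comp (f := fun z => (f (i (k2 z))).1.2.2.1)); sm.
    have ls : smoothAt 0 l by rewrite /l; sm.
    have l0 : l 0 = 0 by rewrite /l /Y /U /A /= -![i _]/(i 0) i0 f0.
    have jls : smoothAt 0 (fun z => j (l z)) by apply: (smoothAt_comp (f := j)); rewrite ?l0.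
    have jl0 : j (l 0) = 0 by rewrite l0.
    have n1 := near_and (small _ fi fi0 d d0) (small _ jls jl0 d d0).
    apply: (near2 n1 (near_and fE (near_subst l0 ls gE))) => z [a b] [E [s E']].
    have := Hd _ _ a b; rewrite gf E' /= /P0 E /j /= => /(_ erefl) /(congr1 fst) /= H.
    have H1 := congr1 (fun w : W => w.1) H; have H2 := congr1 (fun w : W => w.2.1) H.
    have H3 := congr1 (fun w : W => w.2.2.1) H; rewrite /l /= in H1 H2 H3.
    by rewrite /= -H1 -H2 -H3; case: z {a b E E' H H1 H2 H3} => [? [? [? ?]]].
  have [d d0 Hd] := dep f _ Hf _ (mklin P0l) P0c P0X.
  pose l z := (Y' z, (U' z.2, (A' z.2.2, z.2.2.2))) : W.
  have Y_ : smoothAt 0 Y' by rewrite /Y'; sm.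
  have U_ : smoothAt 0 (fun z : W => U' z.2) by rewrite /U'; apply: (smoothAt_comp (f := fun z => (g (j (k1 z))).1.2.1)); sm.
  have A_ : smoothAt 0 (fun z : W => A' z.2.2) by rewrite /A'; apply: (smoothAt_comp (f := fun z => (g (j (k2 z))).1.2.2.1)); sm.
  have ls : smoothAt 0 l by rewrite /l; sm.
  have l0 : l 0 = 0 by rewrite /l /Y' /U' /A' /= -![j _]/(j 0) j0 g0.
  have ils : smoothAt 0 (fun z => i (l z)) by apply: (smoothAt_comp (f := i)); rewrite ?l0.
  have il0 : i (l 0) = 0 by rewrite l0.
  have n1 := near_and (small _ gj gj0 d d0) (small _ ils il0 d d0).
  apply: (near2 n1 (near_and gE (near_subst l0 ls fE))) => z [a b] [[s E'] E].
  have := Hd _ _ a b; rewrite fg E /= /P0 E' /i /= => /(_ erefl) /(congr1 fst) /= H.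
  have H1 := congr1 (fun w : W => w.1) H; have H2 := congr1 (fun w : W => w.2.1) H.
  have H3 := congr1 (fun w : W => w.2.2.1) H; rewrite /= in H1 H2 H3.
  by rewrite -H1 -H2 -H3; case: z {a b E E' H H1 H2 H3} => [? [? [? ?]]].
(* If the field vanishes in [y], [u] and the unfolding parameters where these are 0, it is tangent
   to that subspace, and both flows keep it. *)
move=> H0; pose O (w : Z) : R * (R * A3) := (w.1.1, (w.1.2.1, w.1.2.2.1)).
have Ol : linear O by move=> a [[? [? [? ?]]] ?] [[? [? [? ?]]] ?].
have Oc : continuous (mklin Ol) by move=> z; apply: smoothAt_cont; rewrite /= /O; sm.
have OX : \forall w \near (0 : Z), mklin Ol w = 0 -> mklin Ol (hfield w) = 0.
  apply: (near1 (near_subst (g := fun w : Z => w.1) erefl projs H0)) => w Hw /Hw [E1 E2 E3].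
  by rewrite /= /O /hfield /= E1 E2 E3 !mulr0 scaler0.
have OX' : \forall w \near (0 : Z), mklin Ol w = 0 -> mklin Ol (- hfield w) = 0.
  apply: (near1 OX) => w Hw /Hw E; transitivity (- mklin Ol (hfield w)); first exact: raddfN.
  by rewrite E oppr0.
have n1 := near_subst i0 is_ (finv _ (mklin Ol) Oc OX).
have n2 := near_subst j0 js (ginv _ (mklin Ol) Oc OX').
apply: (near2 (near_and n1 n2) (near_and fE gE)).
move=> z [a b] [E [s E']] z0; move: (a z0) (b z0); rewrite E E' /= /O /=.
by move=> [-> -> ->] [-> -> ->].
Qed.

End Homotopy.

(** * The model family *)

Lemma scale_pairE (R : realType) (V W : normedModType R) (h : R) (a : V) (b : W) :
  h *: ((a, b) : V * W) = (h *: a, h *: b).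
Proof. by []. Qed.

Lemma add_pairE (R : realType) (V W : normedModType R) (a a' : V) (b b' : W) :
  (a, b) + ((a', b') : V * W) = (a + a', b + b').
Proof. by []. Qed.

Section Model.
Context {R : realType}.
Let A3 := (R * (R * R))%type.
Let par := (A3 * (R * R))%type.
Let W := (R * (R * ((R * (R * R)) * (R * R))) : normedModType R)%type.
Variables (C B : R -> R).
Hypotheses (Cs : smoothAt 0 C) (Bs : smoothAt 0 B) (C0 : 0 < C 0) (B0 : 0 < B 0).

Lemma derive_affine (V : normedModType R) (F : V -> R) (z v : V) (c : R) :
  (forall h, F (h *: v + z) = F z + h * c) -> 'D_v F z = c.
Proof.
move=> H; rewrite /derive; apply: cvg_lim => //.
apply: (cvg_near_cst (U := R)); near=> h.
have h0 : h != 0 by near: h; exact: nbhs_dnbhs_neq.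
by rewrite /= H addrAC subrr add0r [_ *: _]mulKf.
Unshelve. all: by end_near. Qed.

Definition shear (y u : R) (a : R * (R * R)) : R := u + a.2.2 * y / 2.

Definition model (e y u : R) (a : R * (R * R)) : R :=
  - y ^+ 3 * C (e ^+ 2 * y) - shear y u a ^+ 2 * B (e ^+ 3 * shear y u a) + a.1 + a.2.1 * y.

(* [l] is one of the two projections: [fst] when the weight parameter is the deformation parameter,
   [snd] when the perturbation [P] is. *)
Definition modelK (l : R * R -> R) (P : R * R -> R) (z : W) : R :=
  model (l z.2.2.2) z.1 z.2.1 z.2.2.1 + z.2.2.2.1 * P (l z.2.2.2 ^+ 2 * z.1, l z.2.2.2 ^+ 3 * z.2.1).

Section Unfold.
Variables (l P : R * R -> R).
Hypotheses (ls : smooth setT l) (l0 : l 0 = 0) (Ps : smoothAt 0 P).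

Let lA : smoothAt 0 (fun z : W => l z.2.2.2).
Proof. by apply: (smoothAt_comp (f := l)); [exact: smoothT_At|sm]. Qed.

Lemma modelK_smooth : smoothAt 0 (modelK l P).
Proof.
have C1 : smoothAt 0 (fun z : W => C (l z.2.2.2 ^+ 2 * z.1)).
  by apply: (smoothAt_comp (f := C)); [rewrite /= mulr0|sm].
have B1 : smoothAt 0 (fun z : W => B (l z.2.2.2 ^+ 3 * shear z.1 z.2.1 z.2.2.1)).
  apply: (smoothAt_comp (f := B)); last by rewrite /shear; sm.
  by rewrite /= [l _]l0 expr0n mul0r.
have P1 : smoothAt 0 (fun z : W => P (l z.2.2.2 ^+ 2 * z.1, l z.2.2.2 ^+ 3 * z.2.1)).
  apply: (smoothAt_comp (f := P) (g := fun z : W => (l z.2.2.2 ^+ 2 * z.1, l z.2.2.2 ^+ 3 * z.2.1))); last by sm.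
  by rewrite /= !mulr0.
by rewrite /modelK /model /shear; sm.
Qed.

Lemma modelK_center y u g : modelK l P (y, (u, ((0, (0, g)), 0))) = - C 0 * y ^+ 3 - B 0 * (u + g * y / 2) ^+ 2.
Proof. by rewrite /modelK /model /shear /= l0 !expr0n /= !mul0r !addr0; ring. Qed.

Let dy := 'D_(1, 0) (modelK l P).
Let du := 'D_(0, (1, 0)) (modelK l P).
Let ea : W := (0, (0, ((1, (0, 0)), 0))).
Let eb : W := (0, (0, ((0, (1, 0)), 0))).
Let eg : W := (0, (0, ((0, (0, 1)), 0))).

Lemma modelK_alpha z : 'D_ea (modelK l P) z = 1.
Proof.
apply: derive_affine => h; case: z => y [u [[a [b g]] s]].
have -> : h *: ea + (y, (u, ((a, (b, g)), s))) = (y, (u, ((h + a, (b, g)), s))).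
  by rewrite !scale_pairE !add_pairE !scaler0 !add0r [h *: 1]mulr1.
by rewrite /modelK /model /shear /=; ring.
Qed.

Lemma modelK_beta z : 'D_eb (modelK l P) z = z.1.
Proof.
apply: derive_affine => h; case: z => y [u [[a [b g]] s]].
have -> : h *: eb + (y, (u, ((a, (b, g)), s))) = (y, (u, ((a, (h + b, g)), s))).
  by rewrite !scale_pairE !add_pairE !scaler0 !add0r [h *: 1]mulr1.
by rewrite /modelK /model /shear /=; ring.
Qed.

Lemma modelK_gamma : \forall z \near (0 : R * R), 'D_eg (modelK l P) (z.1, (z.2, 0)) = - B 0 * z.2 * z.1.
Proof.
pose i (z : R * R) : W := (z.1, (z.2, 0)).
have is_ : smoothAt 0 i by rewrite /i; sm.
apply: (near1 (near_subst (y := 0) erefl is_ (smoothAt_nbhs modelK_smooth))) => -[y u] /=; rewrite /i /= => Kz.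
pose k (s : R) : W := (y, (u, ((0, (0, s)), 0))).
eassert (D1 : is_derive (0 : R) (1 : R) k _) by (rewrite /k; isd).
have [_ E] := is_derive_chain D1 (smoothAt_diff (Kz : smoothAt (k 0) (modelK l P))).
rewrite -[LHS]E.
have -> : (fun s => modelK l P (k s)) = (fun s : R => - C 0 * y ^+ 3 - B 0 * (u + s * y / 2) ^+ 2).
  by apply/funext => s; exact: modelK_center.
eassert (D2 : is_derive (0 : R) (1 : R) (fun s : R => - C 0 * y ^+ 3 - B 0 * (u + s * y / 2) ^+ 2) _) by isd.
by have [_ ->] := D2; field.
Qed.

(** An instance of [versal], with the derivative in [gamma] as third generator; its value
    [- B 0 * u * y] at zero parameters supplies the nonzero [k]. The combination is written as one
    directional derivative, ready to become a vector field. *)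
Lemma modelK_versal (p : W -> R) : smoothAt 0 p ->
  exists (q eta : W -> R) (ups : R * par -> R) (T : par -> A3),
  [/\ smoothAt 0 q, smoothAt 0 eta, smoothAt 0 ups, smoothAt 0 T &
    \forall z \near (0 : W), p z = q z * modelK l P z +
      'D_((eta z, (ups z.2, (T z.2.2, 0))) : W) (modelK l P) z].
Proof.
move=> ps; have Ks := modelK_smooth.
have K0 : \forall z \near (0 : R * R), modelK l P (z.1, (z.2, 0)) = - C 0 * z.1 ^+ 3 - B 0 * z.2 ^+ 2.
  by apply: filterE => -[y u] /=; rewrite -[0]/((0, (0, 0)), 0) modelK_center mul0r mul0r addr0.
have c0 : - C 0 != 0 by rewrite oppr_eq0 gt_eqF.
have b0 : B 0 != 0 by rewrite gt_eqF.
have nb0 : - B 0 != 0 by rewrite oppr_eq0.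
have gs : smoothAt 0 ('D_eg (modelK l P)) by exact: smoothAt_derive.
have fp : findim (R * (R * R) * (R * R) : normedModType R)%type by exact _.
have [q [eta [ups [t1 [t2 [t3 [[qs es us] [t1s t2s t3s] H]]]]]]] := versal fp Ks c0 b0 K0 gs nb0 modelK_gamma ps.
exists q, eta, ups, (fun m => (t1 m, (t2 m, t3 m))); split=> //; first by sm.
apply: (near2 H (smoothAt_nbhs Ks)) => z -> Kz; rewrite -!addrA; congr (_ + _).
have -> : ((eta z, (ups z.2, ((t1 z.2.2, (t2 z.2.2, t3 z.2.2)), 0))) : W) =
   eta z *: (1, 0) + (ups z.2 *: (0, (1, 0)) + (t1 z.2.2 *: ea + (t2 z.2.2 *: eb + t3 z.2.2 *: eg))).
  by rewrite !scale_pairE !add_pairE !scaler0 !add0r !addr0 ![_ *: 1]mulr1.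
rewrite !derive_lin; try exact: smoothAt_diff.
by rewrite derive_scale// modelK_alpha modelK_beta [t1 _ *: 1]mulr1.
Qed.

End Unfold.
End Model.

(** * Equivalence of germs of families *)

Section Families.
Context {R : realType}.
Let A3 := (R * (R * R))%type.
Let par := (A3 * (R * R))%type.
Let W := (R * (R * ((R * (R * R)) * (R * R))) : normedModType R)%type.
Let V := (R * (R * (R * (R * R))) : normedModType R)%type.

(* Equivalence of germs of families [F z.1 z.2.1 z.2.2] with output [z.1], input [z.2.1] and
   parameters [z.2.2], as a map of the total space respecting the two projections. *)
Definition triangular (Phi : V -> V) : Prop := forall z z',
  (z.2 = z'.2 -> (Phi z).2 = (Phi z').2) /\ (z.2.2 = z'.2.2 -> (Phi z).2.2 = (Phi z').2.2).

Definition germ_map (Phi : V -> V) : Prop :=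
  [/\ triangular Phi, smoothAt 0 Phi, Phi 0 = 0, 0 < ('D_(1, 0) Phi 0).1 & 0 < ('D_(0, (1, 0)) Phi 0).2.1].

(** The inverse is part of the data, as the flow of the opposite field provides it; symmetry is then
    immediate. The sign conditions at the origin spread to a neighborhood by continuity. *)
Definition germ_equiv (F G : V -> R) : Prop := exists (Phi Psi : V -> V) (Q : V -> R),
  [/\ germ_map Phi, germ_map Psi,
      (\forall z \near (0 : V), Psi (Phi z) = z) /\ (\forall z \near (0 : V), Phi (Psi z) = z),
      smoothAt 0 Q & 0 < Q 0 /\ \forall z \near (0 : V), F z = Q z * G (Phi z)].

Lemma triangular_derive_y Phi z : triangular Phi -> smoothAt z Phi -> ('D_(1, 0) Phi z).2 = 0.
Proof.
move=> t s; have [_ <-] := is_derive_snd (smoothAt_is_derive ((1, 0) : V) s).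
rewrite /derive; apply: cvg_lim => //; apply: cvg_near_cst; apply: filterE => h /=.
have -> : (Phi (h *: ((1, 0) : V) + z)).2 = (Phi z).2.
  by apply: (t _ _).1; rewrite scale_pairE scaler0 /= add0r.
by rewrite subrr scaler0.
Qed.

Lemma triangular_derive_u Phi z : triangular Phi -> smoothAt z Phi -> ('D_(0, (1, 0)) Phi z).2.2 = 0.
Proof.
move=> t s; have [_ <-] := is_derive_snd (is_derive_snd (smoothAt_is_derive ((0, (1, 0)) : V) s)).
rewrite /derive; apply: cvg_lim => //; apply: cvg_near_cst; apply: filterE => h /=.
have -> : (Phi (h *: ((0, (1, 0)) : V) + z)).2.2 = (Phi z).2.2.
  by apply: (t _ _).2; rewrite !scale_pairE !scaler0 /= add0r.
by rewrite subrr scaler0.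
Qed.

(** Triangularity makes the Jacobians block triangular, so the two diagonal entries are
    multiplied. *)
Lemma germ_map_comp Phi Phi' : germ_map Phi -> germ_map Phi' -> germ_map (fun z => Phi' (Phi z)).
Proof.
move=> [t s z0 d1 d2] [t' s' z0' d1' d2']; have s'' : smoothAt (Phi 0) Phi' by rewrite z0.
have D (v : V) : 'D_v (fun z => Phi' (Phi z)) 0 = 'D_('D_v Phi 0) Phi' 0.
  by have [_ ->] := is_derive_chain (smoothAt_is_derive v s) (smoothAt_diff s''); rewrite z0.
have par2 := triangular_derive_y t s; have par2' := triangular_derive_y t' s'.
have E1 : 'D_(1, 0) Phi 0 = ('D_(1, 0) Phi 0).1 *: ((1, 0) : V).
  by move: par2; case: ('D_(1, 0) Phi 0) => x y /= ->; rewrite scale_pairE scaler0 [_ *: 1]mulr1.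
have E2 : 'D_(0, (1, 0)) Phi 0 = ('D_(0, (1, 0)) Phi 0).2.1 *: ((0, (1, 0)) : V) + ('D_(0, (1, 0)) Phi 0).1 *: ((1, 0) : V).
  have := triangular_derive_u t s.
  case: ('D_(0, (1, 0)) Phi 0) => [x [y w]] /= ->.
  by rewrite !scale_pairE !add_pairE !scaler0 !add0r !addr0 ![_ *: 1]mulr1.
split.
- move=> z z'; have [a b] := t z z'; have [a' b'] := t' (Phi z) (Phi z').
  by split=> [/a /a'|/b /b'].
- by apply: (smoothAt_comp (f := Phi')).
- by rewrite z0 z0'.
- by rewrite D E1 derive_scale//= mulr_gt0.
- rewrite D E2 derive_lin; last exact: smoothAt_diff.
  rewrite derive_scale//; move: d2 d2' par2'.
  case: ('D_(1, 0) Phi' 0) => [x1 x2]; case: ('D_(0, (1, 0)) Phi' 0) => [y1 [y2 y3]].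
  case: ('D_(0, (1, 0)) Phi 0) => [w1 [w2 w3]] h1 h2 h3; cbn [fst snd] in h1, h2, h3 |- *.
  rewrite h3 !scale_pairE scaler0 add_pairE addr0; cbn [fst snd].
  exact: mulr_gt0.
Qed.

Lemma germ_equiv_trans F G H : germ_equiv F G -> germ_equiv G H -> germ_equiv F H.
Proof.
move=> [Phi [Psi [Q [m n [a b] Qs [Q0 E]]]]] [Phi' [Psi' [Q' [m' n' [a' b'] Q's [Q'0 E']]]]].
have [_ s z0 _ _] := m; have [_ s' z0' _ _] := m'; have [_ r w0 _ _] := n; have [_ r' w0' _ _] := n'.
exists (fun z => Phi' (Phi z)), (fun z => Psi (Psi' z)), (fun z => Q z * Q' (Phi z)); split.
- exact: germ_map_comp.
- exact: germ_map_comp.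
- split.
    by apply: (near2 a (near_subst z0 s a')) => z E1 ->.
  by apply: (near2 b' (near_subst w0' r' b)) => z E1 ->.
- by apply: smoothAtM => //; apply: (smoothAt_comp (f := Q')); rewrite ?z0.
- split; first by rewrite z0 mulr_gt0.
  by apply: (near2 E (near_subst z0 s E')) => z -> ->; rewrite mulrA.
Qed.

Lemma germ_equiv_sym F G : germ_equiv F G -> germ_equiv G F.
Proof.
move=> [Phi [Psi [Q [m n [a b] Qs [Q0 E]]]]].
have [_ s z0 _ _] := m; have [_ r w0 _ _] := n.
have QP : smoothAt 0 (fun z => Q (Psi z)) by apply: (smoothAt_comp (f := Q)); rewrite ?w0.
have QP0 : 0 < Q (Psi 0) by rewrite w0.
exists Psi, Phi, (fun z => (Q (Psi z))^-1); split=> //.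
- by apply: smoothAtV; rewrite ?gt_eqF.
- split; first by rewrite invr_gt0.
  apply: (near2 (near_subst w0 r E) (near_and b (smoothAt_gt0 QP QP0))) => z -> [-> h].
  by rewrite mulKf// gt_eqF.
Qed.

Lemma germ_equiv_unit F G (Q : V -> R) : smoothAt 0 Q -> 0 < Q 0 ->
  (\forall z \near (0 : V), F z = Q z * G z) -> germ_equiv F G.
Proof.
move=> Qs Q0 E; have idm : germ_map id.
  split=> //; first by sm.
    by rewrite derive_id ltr01.
  by rewrite derive_id ltr01.
by exists id, id, Q; split=> //; split; exact: filterE.
Qed.

End Families.

Section Slices.
Context {R : realType}.
Let A3 := (R * (R * R))%type.
Let par := (A3 * (R * R))%type.
Let W := (R * (R * ((R * (R * R)) * (R * R))) : normedModType R)%type.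
Let V := (R * (R * (R * (R * R))) : normedModType R)%type.

Definition at_time (e : R) (z : V) : W := (z.1, (z.2.1, (z.2.2, (e, 0)))).

Lemma at_time_smooth e z : smoothAt z (at_time e).
Proof. by rewrite /at_time; sm. Qed.

Lemma near_at_time (P : W -> Prop) : (\forall z \near (0 : W), P z) ->
  \forall e \near (0 : R), \forall z \near (0 : V), P (at_time e z).
Proof.
move=> H; pose k (e : R) : W := (0, (0, (0, (e, 0)))).
have ks : smoothAt 0 k by rewrite /k; sm.
apply: (near1 (near_subst (y := 0) erefl ks (nbhs_interior H))) => e He.
exact: (near_subst (g := at_time e) (P := P) (x := (0 : V)) (y := k e) erefl (at_time_smooth e 0) He).
Qed.

Definition slice (Y : W -> R) (U : R * par -> R) (A : par -> A3) (e : R) (z : V) : V :=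
  (Y (at_time e z), (U (at_time e z).2, A (at_time e z).2.2)).

(** At [e = 0] the slice is the identity in [y] and [u], so both derivatives are 1 there and stay
    positive for small [e]. *)
Lemma slice_germ_map (Y : W -> R) (U : R * par -> R) (A : par -> A3) :
  smoothAt 0 Y -> smoothAt 0 U -> smoothAt 0 A ->
  (\forall z \near (0 : W), z.2.2.2.1 = 0 -> Y z = z.1 /\ U z.2 = z.2.1) ->
  (\forall z \near (0 : W), (z.1, (z.2.1, z.2.2.1)) = 0 -> [/\ Y z = 0, U z.2 = 0 & A z.2.2 = 0]) ->
  \forall e \near (0 : R), germ_map (slice Y U A e).
Proof.
move=> Ys Us As H0 HO; pose k (e : R) : W := (0, (0, (0, (e, 0)))).
have ks : smoothAt 0 k by rewrite /k; sm.
have k0 : k 0 = 0 by [].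
have U2s : smoothAt 0 (fun z : W => U z.2) by apply: (smoothAt_comp (f := U)) => //; sm.
have A2s : smoothAt 0 (fun z : W => A z.2.2) by apply: (smoothAt_comp (f := A)) => //; sm.
pose Yy := 'D_(1, 0) Y; pose Uu := 'D_(0, (1, 0)) (fun z : W => U z.2).
have Yy0 : Yy 0 = 1.
  pose l (s : R) : W := (s, 0); have ls : smoothAt 0 l by rewrite /l; sm.
  eassert (D1 : is_derive (0 : R) (1 : R) l _) by (rewrite /l; isd).
  have [_ E] := is_derive_chain D1 (smoothAt_diff (Ys : smoothAt (l 0) Y)).
  have H : \forall s \near (0 : R), Y (l s) = s.
    by apply: (near1 (near_subst (y := 0) erefl ls H0)) => s /(_ erefl) [].
  by rewrite /Yy -[LHS]E (near_eq_derive (1 : R) H) derive_id.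
have Uu0 : Uu 0 = 1.
  pose l (s : R) : W := (0, (s, 0)); have ls : smoothAt 0 l by rewrite /l; sm.
  eassert (D1 : is_derive (0 : R) (1 : R) l _) by (rewrite /l; isd).
  have [_ E] := is_derive_chain D1 (smoothAt_diff (U2s : smoothAt (l 0) _)).
  have H : \forall s \near (0 : R), U (l s).2 = s.
    by apply: (near1 (near_subst (y := 0) erefl ls H0)) => s /(_ erefl) [].
  by rewrite /Uu -[LHS]E (near_eq_derive (1 : R) H) derive_id.
have n1 : \forall z \near (0 : W), 0 < Yy z.
  by apply: smoothAt_gt0; [exact: smoothAt_derive|rewrite Yy0].
have n2 : \forall z \near (0 : W), 0 < Uu z.
  by apply: smoothAt_gt0; [exact: smoothAt_derive|rewrite Uu0].
have n3 := near_and (smoothAt_nbhs Ys) (near_and (smoothAt_nbhs U2s) (smoothAt_nbhs A2s)).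
have n4 := near_and (near_and n1 n2) (near_and n3 HO).
apply: (near1 (near_subst k0 ks n4)) => e [[Yp Up] [[Ye [Ue Ae]] Oe]].
have e0 : at_time e 0 = k e by [].
have Ya : smoothAt 0 (fun z => Y (at_time e z)) by apply: (smoothAt_comp (f := Y)) => //; exact: at_time_smooth.
have Ua : smoothAt 0 (fun z => U (at_time e z).2).
  by apply: (smoothAt_comp (f := fun z => U z.2) (g := at_time e)) => //; exact: at_time_smooth.
have Aa : smoothAt 0 (fun z => A (at_time e z).2.2).
  by apply: (smoothAt_comp (f := fun z => A z.2.2) (g := at_time e)) => //; exact: at_time_smooth.
have Ss : smoothAt 0 (slice Y U A e) by rewrite /slice; sm.
split=> //.
- by move=> z z'; rewrite /slice /at_time /=; split=> ->.
- by have [] := Oe erefl; rewrite -e0 /slice => -> -> ->.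
- have [_ <-] := is_derive_fst (smoothAt_is_derive ((1, 0) : V) Ss).
  eassert (D1 : is_derive (0 : V) ((1, 0) : V) (at_time e) _) by (rewrite /at_time; isd).
  have [_ E] := is_derive_chain D1 (smoothAt_diff (Ye : smoothAt (at_time e 0) Y)).
  by move: Yp; rewrite /Yy /slice /= -e0 => h; rewrite [X in 0 < X]E.
- have [_ <-] := is_derive_fst (is_derive_snd (smoothAt_is_derive ((0, (1, 0)) : V) Ss)).
  eassert (D1 : is_derive (0 : V) ((0, (1, 0)) : V) (at_time e) _) by (rewrite /at_time; isd).
  have [_ E] := is_derive_chain D1 (smoothAt_diff (Ue : smoothAt (at_time e 0) _)).
  by move: Up; rewrite /Uu /slice /= -e0 => h; rewrite [X in 0 < X]E.
Qed.

End Slices.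

(** * Deformation of the model to constant coefficients *)

Section Model.
Context {R : realType}.
Let A3 := (R * (R * R))%type.
Let par := (A3 * (R * R))%type.
Let W := (R * (R * ((R * (R * R)) * (R * R))) : normedModType R)%type.
Let V := (R * (R * (R * (R * R))) : normedModType R)%type.
Variables (C B : R -> R).
Hypotheses (Cs : smoothAt 0 C) (Bs : smoothAt 0 B) (C0 : 0 < C 0) (B0 : 0 < B 0).

Let l1 (p : R * R) := p.1.
Let l1s : smooth setT l1. Proof. by apply: smoothP => z _; rewrite /l1; sm. Qed.
Let K := modelK C B l1 (fun=> 0).
Let et : W := (0, (0, (0, (1, 0)))).

Let Cd := 'D_1 C. Let Bd := 'D_1 B.
Let t (z : W) := z.2.2.2.1.
Let v (z : W) := shear z.1 z.2.1 z.2.2.1.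
Let c z := C (t z ^+ 2 * z.1).
Let cd z := Cd (t z ^+ 2 * z.1).
Let b z := B (t z ^+ 3 * v z).
Let bd z := Bd (t z ^+ 3 * v z).
Let om z := 3 * c z + t z ^+ 2 * z.1 * cd z.
Let th z := (3 * t z ^+ 2 * v z * (bd z / b z) * z.1 * c z - 2 * t z * z.1 ^+ 2 * cd z) / om z.
Let wd z := 2 * v z * b z + t z ^+ 3 * v z ^+ 2 * bd z.

(* [z.1 ^ 2 * om z] is eliminated through the expression of the derivative in [y]; the terms linear in
   the parameters make the field vanish at the origin for zero parameters. *)
Lemma model_time_derivative : \forall z \near (0 : W), 'D_et K z =
  3 * t z ^+ 2 * v z * (bd z / b z) * K z - th z * 'D_(1, 0) K z
  + z.2.2.1.1 * (- 3 * t z ^+ 2 * v z * (bd z / b z))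
  + z.2.2.1.2.1 * (th z - 3 * t z ^+ 2 * v z * (bd z / b z) * z.1)
  + z.2.2.1.2.2 * (- th z * wd z / 2).
Proof.
pose xc (z : W) : R := t z ^+ 2 * z.1. pose xb (z : W) : R := t z ^+ 3 * v z.
have xcs : smoothAt 0 xc by rewrite /xc /t; sm.
have xbs : smoothAt 0 xb by rewrite /xb /t /v /shear; sm.
have xc0 : xc 0 = 0 by rewrite /xc /= mulr0.
have xb0 : xb 0 = 0 by rewrite /xb /t /= expr0n /= mul0r.
have cs : smoothAt 0 c by apply: (smoothAt_comp (f := C) (g := xc)); rewrite ?xc0.
have bs : smoothAt 0 b by apply: (smoothAt_comp (f := B) (g := xb)); rewrite ?xb0.
have cds : smoothAt 0 cd by apply: (smoothAt_comp (f := Cd) (g := xc)); rewrite ?xc0//; exact: smoothAt_derive.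
have oms : smoothAt 0 om by rewrite /om /t; sm.
have b00 : b 0 != 0 by rewrite /b -/(xb 0) xb0 gt_eqF.
have om0 : om 0 != 0 by rewrite /om /c -!/(xc 0) xc0 mul0r addr0 mulf_neq0// gt_eqF.
have n1 := near_and (smoothAt_neq0 bs b00) (smoothAt_neq0 oms om0).
have n2 := near_and (near_subst xc0 xcs (smoothAt_nbhs Cs)) (near_subst xb0 xbs (smoothAt_nbhs Bs)).
apply: (near2 n1 n2) => z [bz omz] [Cz Bz].
have DC : is_derive (t z ^+ 2 * z.1) (1 : R) C (cd z) by exact: smoothAt_is_derive.
have DB : is_derive (t z ^+ 3 * v z) (1 : R) B (bd z) by exact: smoothAt_is_derive.
have KE : K = (fun z : W => - z.1 ^+ 3 * C (t z ^+ 2 * z.1) -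
   (z.2.1 + z.2.2.1.2.2 * z.1 * 2^-1) ^+ 2 * B (t z ^+ 3 * v z) + z.2.2.1.1 + z.2.2.1.2.1 * z.1).
  by apply/funext => y; rewrite /K /modelK /model /= mulr0 addr0.
have D1 : 'D_et K z = - 2 * t z * z.1 ^+ 4 * cd z - 3 * t z ^+ 2 * v z ^+ 3 * bd z.
  eassert (F1 : is_derive z et (fun z : W => t z ^+ 2 * z.1) _) by (rewrite /t; isd).
  eassert (F2 : is_derive z et (fun z : W => t z ^+ 3 * v z) _) by (rewrite /t /v /shear; isd).
  have F3 := is_derive_chainR F1 DC; have F4 := is_derive_chainR F2 DB.
  rewrite KE; eassert (F5 : is_derive z et (fun z : W => - z.1 ^+ 3 * C (t z ^+ 2 * z.1) -
   (z.2.1 + z.2.2.1.2.2 * z.1 * 2^-1) ^+ 2 * B (t z ^+ 3 * v z) + z.2.2.1.1 + z.2.2.1.2.1 * z.1) _) by isd.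
  by have [_ ->] := F5; rewrite /t /v /shear /et /=; field.
have D2 : 'D_(1, 0) K z = - z.1 ^+ 2 * om z - wd z * z.2.2.1.2.2 / 2 + z.2.2.1.2.1.
  pose e1 : W := (1, 0).
  eassert (F1 : is_derive z e1 (fun z : W => t z ^+ 2 * z.1) _) by (rewrite /t; isd).
  eassert (F2 : is_derive z e1 (fun z : W => t z ^+ 3 * v z) _) by (rewrite /t /v /shear; isd).
  have F3 := is_derive_chainR F1 DC; have F4 := is_derive_chainR F2 DB.
  rewrite KE; eassert (F5 : is_derive z e1 (fun z : W => - z.1 ^+ 3 * C (t z ^+ 2 * z.1) -
   (z.2.1 + z.2.2.1.2.2 * z.1 * 2^-1) ^+ 2 * B (t z ^+ 3 * v z) + z.2.2.1.1 + z.2.2.1.2.1 * z.1) _) by isd.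
  by have [_ ->] := F5; rewrite /om /wd /c /b /t /v /shear /e1 /=; field.
rewrite D1 D2 KE -/(c z) -/(b z).
have -> : z.2.1 + z.2.2.1.2.2 * z.1 * 2^-1 = v z by [].
have Eth : th z * om z = 3 * t z ^+ 2 * v z * (bd z / b z) * z.1 * c z - 2 * t z * z.1 ^+ 2 * cd z.
  by rewrite /th divfK.
transitivity (z.1 ^+ 2 * (th z * om z) - 3 * t z ^+ 2 * v z * (bd z / b z) * (z.1 ^+ 3 * c z + v z ^+ 2 * b z)).
  by rewrite Eth; field.
by ring.
Qed.

(** Versality is applied only to the coefficients [p1], [p2], [p3] of [alpha], [beta], [gamma] in
    the time derivative. Multiplied again by the parameters, the resulting field vanishes at the
    origin for zero parameters, which versality applied to the whole derivative would not
    guarantee. *)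
Lemma model_equiv_center : \forall e \near (0 : R),
  germ_equiv (fun z : V => model C B e z.1 z.2.1 z.2.2) (fun z : V => model C B 0 z.1 z.2.1 z.2.2).
Proof.
pose xc (z : W) : R := t z ^+ 2 * z.1. pose xb (z : W) : R := t z ^+ 3 * v z.
have xcs : smoothAt 0 xc by rewrite /xc /t; sm.
have xbs : smoothAt 0 xb by rewrite /xb /t /v /shear; sm.
have xc0 : xc 0 = 0 by rewrite /xc /= mulr0.
have xb0 : xb 0 = 0 by rewrite /xb /t /= expr0n /= mul0r.
have cs : smoothAt 0 c by apply: (smoothAt_comp (f := C) (g := xc)); rewrite ?xc0.
have bs : smoothAt 0 b by apply: (smoothAt_comp (f := B) (g := xb)); rewrite ?xb0.
have cds : smoothAt 0 cd by apply: (smoothAt_comp (f := Cd) (g := xc)); rewrite ?xc0//; exact: smoothAt_derive.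
have bds : smoothAt 0 bd by apply: (smoothAt_comp (f := Bd) (g := xb)); rewrite ?xb0//; exact: smoothAt_derive.
have ts : smoothAt 0 t by rewrite /t; sm.
have vs : smoothAt 0 v by rewrite /v /shear; sm.
have oms : smoothAt 0 om by rewrite /om; sm.
have b00 : b 0 != 0 by rewrite /b -/(xb 0) xb0 gt_eqF.
have om0 : om 0 != 0 by rewrite /om /c -!/(xc 0) xc0 mul0r addr0 mulf_neq0// gt_eqF.
have bis : smoothAt 0 (fun z => (b z)^-1) by exact: smoothAtV.
have omis : smoothAt 0 (fun z => (om z)^-1) by exact: smoothAtV.
have ths : smoothAt 0 th by rewrite /th; sm.
have wds : smoothAt 0 wd by rewrite /wd; sm.
have Ps : smoothAt (0 : R * R) (fun=> 0 : R) by sm.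
have l10 : l1 0 = 0 by [].
have Ks : smoothAt 0 K := modelK_smooth Cs Bs l1s l10 Ps.
pose p1 z := - 3 * t z ^+ 2 * v z * (bd z / b z).
pose p2 z := th z - 3 * t z ^+ 2 * v z * (bd z / b z) * z.1.
pose p3 z := - th z * wd z / 2.
have p1s : smoothAt 0 p1 by rewrite /p1; sm.
have p2s : smoothAt 0 p2 by rewrite /p2; sm.
have p3s : smoothAt 0 p3 by rewrite /p3; sm.
have [q1 [e1 [u1 [T1 [q1s e1s u1s T1s H1]]]]] := modelK_versal Cs Bs C0 B0 l1s l10 Ps p1s.
have [q2 [e2 [u2 [T2 [q2s e2s u2s T2s H2]]]]] := modelK_versal Cs Bs C0 B0 l1s l10 Ps p2s.
have [q3 [e3 [u3 [T3 [q3s e3s u3s T3s H3]]]]] := modelK_versal Cs Bs C0 B0 l1s l10 Ps p3s.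
pose q z := 3 * t z ^+ 2 * v z * (bd z / b z) + z.2.2.1.1 * q1 z + z.2.2.1.2.1 * q2 z + z.2.2.1.2.2 * q3 z.
pose eta z := - th z + z.2.2.1.1 * e1 z + z.2.2.1.2.1 * e2 z + z.2.2.1.2.2 * e3 z.
pose ups (w : R * par) := w.2.1.1 * u1 w + w.2.1.2.1 * u2 w + w.2.1.2.2 * u3 w.
pose T (m : par) := m.1.1 *: T1 m + m.1.2.1 *: T2 m + m.1.2.2 *: T3 m.
have qs : smoothAt 0 q by rewrite /q; sm.
have es : smoothAt 0 eta by rewrite /eta; sm.
have us : smoothAt 0 ups by rewrite /ups; sm.
have Ts : smoothAt 0 T.
  by rewrite /T; apply: smoothAtD; [apply: smoothAtD|]; apply: smoothAtZ => //; sm.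
have HK : \forall z \near (0 : W), 'D_((eta z, (ups z.2, (T z.2.2, (-1, 0)))) : W) K z = - q z * K z.
  have n1 := near_and H1 (near_and H2 H3).
  apply: (near2 (near_and n1 (smoothAt_nbhs Ks)) model_time_derivative) => z [[h1 [h2 h3]] Kz] ht.
  pose V1 : W := (e1 z, (u1 z.2, (T1 z.2.2, 0))).
  pose V2 : W := (e2 z, (u2 z.2, (T2 z.2.2, 0))).
  pose V3 : W := (e3 z, (u3 z.2, (T3 z.2.2, 0))).
  have -> : ((eta z, (ups z.2, (T z.2.2, (-1, 0)))) : W) =
      -1 *: et + (- th z *: (1, 0) + (z.2.2.1.1 *: V1 + (z.2.2.1.2.1 *: V2 + z.2.2.1.2.2 *: V3))).
    rewrite /et /V1 /V2 /V3 !scale_pairE !add_pairE !scaler0 !add0r !addr0 ![_ *: 1]mulr1.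
    by rewrite /eta /ups /T -!addrA.
  rewrite !derive_lin; try exact: smoothAt_diff.
  rewrite (derive_scale _ _ Kz) /V1 /V2 /V3.
  move: ht h1 h2 h3; rewrite -/K -/(p1 z) -/(p2 z) -/(p3 z).
  set d := 'D_et K z; set d1 := 'D_(1, 0) K z => -> h1 h2 h3.
  rewrite /GRing.scale /= in h1 h2 h3 *.
  move: h1 h2 h3; set x1 := 'D_(e1 z, _) K z; set x2 := 'D_(e2 z, _) K z; set x3 := 'D_(e3 z, _) K z => h1 h2 h3.
  have f1 : x1 = p1 z - q1 z * K z by rewrite h1; ring.
  have f2 : x2 = p2 z - q2 z * K z by rewrite h2; ring.
  have f3 : x3 = p3 z - q3 z * K z by rewrite h3; ring.
  by rewrite f1 f2 f3 /q; ring.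
have [Q [Y [Y' [U [U' [A [A' [[Qs Ys Us As] [Y's U's A's] HE [Hid [HL HR]] HO]]]]]]]] := homotopy Ks qs es us Ts HK.
have {}HO := HO _; have HO' : \forall z \near (0 : W), (z.1, (z.2.1, z.2.2.1)) = 0 ->
    [/\ Y z = 0, U z.2 = 0 & A z.2.2 = 0] /\ [/\ Y' z = 0, U' z.2 = 0 & A' z.2.2 = 0].
  apply: HO; apply: filterE => z [z1 z2 z3].
  have z31 : z.2.2.1.1 = 0 by rewrite z3. have z32 : z.2.2.1.2.1 = 0 by rewrite z3.
  have z33 : z.2.2.1.2.2 = 0 by rewrite z3.
  congr (_, (_, _)).
  - by rewrite /eta z31 z32 z33 /th z1 expr0n /= !mulr0 !mul0r subrr mul0r oppr0 !addr0.
  - by rewrite /ups z31 z32 z33 !mul0r !addr0.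
  - by rewrite /T z31 z32 z33 !scale0r !addr0.
have Q0 : 0 < Q 0 by have [[-> _ _ _] _] := nbhs_singleton Hid erefl.
have g1 : \forall e \near (0 : R), germ_map (slice Y U A e).
  apply: slice_germ_map => //; first by apply: (near1 Hid) => z H /H [[]].
  by apply: (near1 HO') => z H /H [].
have g2 : \forall e \near (0 : R), germ_map (slice Y' U' A' e).
  apply: slice_germ_map => //; first by apply: (near1 Hid) => z H /H [_ []].
  by apply: (near1 HO') => z H /H [].
have n1 := near_at_time (near_and HL HR).
have n2 := near_at_time (near_and HE (near_and (smoothAt_nbhs Qs) (smoothAt_gt0 Qs Q0))).
apply: (near2 (near_and g1 g2) (near_and n1 n2)) => e [G1 G2] [N1 N2].
exists (slice Y U A e), (slice Y' U' A' e), (fun z => Q (at_time e z)); split=> //.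
- split; apply: (near1 N1) => -[y [u a]] [E1 E2].
    have F1 := congr1 (fun w : W => (w.1, (w.2.1, w.2.2.1))) E1.
    by rewrite /slice /at_time /= in F1 *.
  have F1 := congr1 (fun w : W => (w.1, (w.2.1, w.2.2.1))) E2.
  by rewrite /slice /at_time /= in F1 *.
- by apply: (smoothAt_comp (f := Q)); [have [_ []] := nbhs_singleton N2|exact: at_time_smooth].
- split; first by have [_ []] := nbhs_singleton N2.
  apply: (near1 N2) => -[y [u a]] [E1 _]; move: E1.
  by rewrite /K /modelK /at_time /slice /= !mulr0 !addr0.
Qed.

End Model.

(** * Rescaling by weights, normal form and unfolding of the model *)

Section Reduction.
Context {R : realType}.
Let A3 := (R * (R * R))%type.
Let par := (A3 * (R * R))%type.
Let W := (R * (R * ((R * (R * R)) * (R * R))) : normedModType R)%type.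
Let V := (R * (R * (R * (R * R))) : normedModType R)%type.
Variables (C B : R -> R).
Hypotheses (Cs : smoothAt 0 C) (Bs : smoothAt 0 B) (C0 : 0 < C 0) (B0 : 0 < B 0).

Definition weight (e : R) (z : V) : V :=
  (e ^+ 2 * z.1, (e ^+ 3 * z.2.1, (e ^+ 6 * z.2.2.1, (e ^+ 4 * z.2.2.2.1, e * z.2.2.2.2)))).

Lemma model_weight e (z : V) : e ^+ 6 * model C B e z.1 z.2.1 z.2.2 =
  model C B 1 (weight e z).1 (weight e z).2.1 (weight e z).2.2.
Proof.
rewrite /model /weight /=.
have -> : shear (e ^+ 2 * z.1) (e ^+ 3 * z.2.1) (e ^+ 6 * z.2.2.1, (e ^+ 4 * z.2.2.2.1, e * z.2.2.2.2)) =
  e ^+ 3 * shear z.1 z.2.1 z.2.2 by rewrite /shear /=; ring.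
by rewrite !expr1n !mul1r; ring.
Qed.

Lemma weightK e : e != 0 -> cancel (weight e) (weight e^-1).
Proof. by move=> e0 [y [u [a [b g]]]]; rewrite /weight /=; congr (_, (_, (_, (_, _)))); field. Qed.

Lemma weight_germ_map e : 0 < e -> germ_map (weight e).
Proof.
move=> e0; have ws : smoothAt 0 (weight e) by rewrite /weight; sm.
split=> //.
- by move=> z z'; rewrite /weight; split=> ->.
- by rewrite /weight /= !mulr0.
- eassert (D : is_derive (0 : V) ((1, 0) : V) (weight e) _) by (rewrite /weight; isd).
  by have [_ ->] := D; rewrite /= mulr1 mul0r addr0 exprn_gt0.
- eassert (D : is_derive (0 : V) ((0, (1, 0)) : V) (weight e) _) by (rewrite /weight; isd).
  by have [_ ->] := D; rewrite /= mulr1 mul0r addr0 exprn_gt0.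
Qed.

Lemma model_scale (e : R) : 0 < e ->
  germ_equiv (fun z : V => model C B 1 z.1 z.2.1 z.2.2) (fun z : V => model C B e z.1 z.2.1 z.2.2).
Proof.
move=> e0; apply: germ_equiv_sym; exists (weight e), (weight e^-1), (fun=> e^-1 ^+ 6); split.
- exact: weight_germ_map.
- by apply: weight_germ_map; rewrite invr_gt0.
- split; apply: filterE => z; first by rewrite weightK// gt_eqF.
  by rewrite -{1}[e]invrK weightK// invr_eq0 gt_eqF.
- by sm.
- split; first by rewrite exprn_gt0// invr_gt0.
  by apply: filterE => z; rewrite -model_weight exprVn mulKf// expf_neq0// gt_eqF.
Qed.

Definition normal_family (z : V) : R :=
  - z.1 ^+ 3 - z.2.1 ^+ 2 + z.2.2.1 + z.2.2.2.1 * z.1 + z.2.2.2.2 * z.2.1 * z.1.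

(* Completing the cube in [y] and the square in [u]. *)
Lemma center_normal :
  germ_equiv (fun z : V => model C B 0 z.1 z.2.1 z.2.2) normal_family.
Proof.
have [k k3] := cubic_root 0 (- C 0); have {}k3 : k ^+ 3 = C 0 by move: k3; rewrite /cubic; lra.
have k0 : 0 < k.
  rewrite ltNge; apply/negP => k0; have : k ^+ 3 <= 0.
    by rewrite exprS mulr_le0_ge0// sqr_ge0.
  by rewrite k3 leNgt C0.
pose m := Num.sqrt (B 0); have m2 : m ^+ 2 = B 0 by rewrite sqr_sqrtr// ltW.
have m0 : 0 < m by rewrite sqrtr_gt0.
(* The shift that removes the [y^2] term: in [- k^3 (y + d)^3] it has to produce
   [- m^2 g^2 y^2 / 4], so [3 k^3 d = m^2 g^2 / 4]. [Psi] solves for the parameters starting with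
   [gamma]. *)
pose d g : R := m ^+ 2 * g ^+ 2 / (12 * k ^+ 3).
have d00 : d 0 = 0 by rewrite /d expr0n mulr0 mul0r.
pose Phi (z : V) : V := let g := z.2.2.2.2 in
  (k * (z.1 + d g), (m * (z.2.1 - g * d g / 2),
   (z.2.2.1 + k ^+ 3 * d g ^+ 3 - d g * (z.2.2.2.1 + 3 * k ^+ 3 * d g ^+ 2) + m ^+ 2 * g ^+ 2 * d g ^+ 2 / 4,
   ((z.2.2.2.1 + 3 * k ^+ 3 * d g ^+ 2 - m ^+ 2 * g ^+ 2 * d g / 2) / k, - m * g / k)))).
pose Psi (z : V) : V := let g := - z.2.2.2.2 * k / m in
  let b := z.2.2.2.1 * k - 3 * k ^+ 3 * d g ^+ 2 + m ^+ 2 * g ^+ 2 * d g / 2 in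
  (z.1 / k - d g, (z.2.1 / m + g * d g / 2,
   (z.2.2.1 - k ^+ 3 * d g ^+ 3 + d g * (b + 3 * k ^+ 3 * d g ^+ 2) - m ^+ 2 * g ^+ 2 * d g ^+ 2 / 4,
   (b, g)))).
have kn : k != 0 by rewrite gt_eqF. have mn : m != 0 by rewrite gt_eqF.
have Phis : smoothAt 0 Phi by rewrite /Phi /d; sm.
have Psis : smoothAt 0 Psi by rewrite /Psi /d; sm.
exists Phi, Psi, (fun=> 1); split.
- split=> //.
  + by move=> z z'; rewrite /Phi; split=> ->.
  + by rewrite /Phi /= d00 !expr0n /= !(mulr0n, mulr0, mul0r, addr0, subr0, oppr0).
  + eassert (D : is_derive (0 : V) ((1, 0) : V) Phi _) by (rewrite /Phi /d; cbv zeta; isd).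
    by have [_ ->] := D; rewrite /= !(mulr0, mul0r, addr0, subr0, oppr0, mulr1).
  + eassert (D : is_derive (0 : V) ((0, (1, 0)) : V) Phi _) by (rewrite /Phi /d; cbv zeta; isd).
    by have [_ ->] := D; rewrite /= !(mulr0, mul0r, addr0, subr0, oppr0, mulr1).
- split=> //.
  + by move=> z z'; rewrite /Psi; split=> ->.
  + by rewrite /Psi /= !(oppr0, mul0r) d00 !expr0n /= !(mulr0n, mulr0, mul0r, addr0, subr0, oppr0).
  + eassert (D : is_derive (0 : V) ((1, 0) : V) Psi _) by (rewrite /Psi /d; cbv zeta; isd).
    by have [_ ->] := D; rewrite /= !(mulr0, mul0r, addr0, add0r, subr0, oppr0, mulr1) invr_gt0.
  + eassert (D : is_derive (0 : V) ((0, (1, 0)) : V) Psi _) by (rewrite /Psi /d; cbv zeta; isd).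
    by have [_ ->] := D; rewrite /= !(mulr0, mul0r, addr0, add0r, subr0, oppr0, mulr1) invr_gt0.
- split; apply: filterE => -[y [u [a [b g]]]]; rewrite /Phi /Psi /=.
    have -> : - (- m * g / k) * k / m = g by field; rewrite kn mn.
    by rewrite /d; congr (_, (_, (_, (_, _)))); field; rewrite ?kn ?mn.
  set g' := - g * k / m; have -> : - m * g' / k = g by rewrite /g'; field; rewrite kn mn.
  by rewrite /d; congr (_, (_, (_, (_, _)))); field; rewrite ?kn ?mn.
- by sm.
- split=> //; apply: filterE => -[y [u [a [b g]]]]; rewrite mul1r /normal_family /model /shear /Phi /=.
  by rewrite !expr0n /= !mul0r -k3 -m2 /d; field.
Qed.

(** The homotopy reaches the center from small [e] only, and [model_scale] identifies any such [e],
    here [d / 2], with 1. *)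
Lemma model_equiv_normal :
  germ_equiv (fun z : V => model C B 1 z.1 z.2.1 z.2.2) normal_family.
Proof.
have [d d0 H] := (near0P _).1 (model_equiv_center Cs Bs C0 B0).
have d20 : 0 < d / 2 by rewrite divr_gt0.
apply: germ_equiv_trans (model_scale d20) _; apply: germ_equiv_trans center_normal; apply: H.
by rewrite gtr0_norm// ltr_pdivrMr// ltr_pMr// ltr1n.
Qed.

(** [versal] asks for an exact cube and square, which the model has at [e = 0]; the homotopy in the
    size of the perturbation therefore lives near [e = 0]. One small [e] is fixed and the weights
    carry the result to 1. Evaluating [P] at [(e^2 y, e^3 u)] makes it [P (y, u)] there, of size
    [c / e^6] before rescaling. *)
Lemma model_unfolding (P : R * R -> R) : smoothAt 0 P ->
  exists (Q Y : R * R * R -> R) (U : R * R -> R) (A : R -> A3),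
  [/\ [/\ smoothAt 0 Q, smoothAt 0 Y, smoothAt 0 U & smoothAt 0 A], A 0 = 0,
    \forall z \near (0 : R * R), [/\ Q (z, 0) = 1, Y (z, 0) = z.1 & U (z.2, 0) = z.2] &
    \forall w \near (0 : R * R * R), model C B 1 w.1.1 w.1.2 0 + w.2 * P w.1 =
      Q w * model C B 1 (Y w) (U (w.1.2, w.2)) (A w.2)].
Proof.
move=> Ps; pose l2 (p : R * R) := p.2.
have l2s : smooth setT l2 by apply: smoothP => z _; rewrite /l2; sm.
have l20 : l2 0 = 0 by [].
pose K := modelK C B l2 P; have Ks : smoothAt 0 K := modelK_smooth Cs Bs l2s l20 Ps.
pose p (z : W) : R := P (z.2.2.2.2 ^+ 2 * z.1, z.2.2.2.2 ^+ 3 * z.2.1).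
have ps : smoothAt 0 p.
  apply: (smoothAt_comp (f := P) (g := fun z : W => (z.2.2.2.2 ^+ 2 * z.1, z.2.2.2.2 ^+ 3 * z.2.1))); last by sm.
  by rewrite /= !mulr0.
have [q [eta [ups [T [qs es us Ts H]]]]] := modelK_versal Cs Bs C0 B0 l2s l20 Ps ps.
pose et : W := (0, (0, (0, (1, 0)))).
have HK : \forall z \near (0 : W), 'D_((eta z, (ups z.2, (T z.2.2, (-1, 0)))) : W) K z = - q z * K z.
  apply: (near2 H (smoothAt_nbhs Ks)) => z Hz Kz.
  have -> : ((eta z, (ups z.2, (T z.2.2, (-1, 0)))) : W) = -1 *: et + (eta z, (ups z.2, (T z.2.2, 0))).
    by rewrite /et !scale_pairE !add_pairE !scaler0 !add0r !addr0 ![_ *: 1]mulr1.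
  rewrite derive_lin; last exact: smoothAt_diff.
  have -> : 'D_et K z = p z.
    apply: derive_affine => h; case: z {Hz Kz} => y [u [a [s e]]].
    have -> : h *: et + (y, (u, (a, (s, e)))) = (y, (u, (a, (h + s, e)))).
      by rewrite !scale_pairE !add_pairE !scaler0 !add0r [h *: 1]mulr1.
    by rewrite /K /modelK /p /l2 /=; ring.
  by rewrite Hz -/K [_ *: _]mulN1r; ring.
have [Q [Y [Y1 [U [U1 [A [A1 [[Qs Ys Us As] _ HE [Hid _] _]]]]]]]] := homotopy Ks qs es us Ts HK.
pose k (e : R) : W := (0, (0, (0, (0, e)))).
have ks : smoothAt 0 k by rewrite /k; sm.
have U2s : smoothAt 0 (fun z : W => U z.2) by apply: (smoothAt_comp (f := U)) => //; sm.
have A2s : smoothAt 0 (fun z : W => A z.2.2) by apply: (smoothAt_comp (f := A)) => //; sm.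
have n1 := near_and (smoothAt_nbhs Qs) (smoothAt_nbhs Ys).
have n2 := near_and (smoothAt_nbhs U2s) (smoothAt_nbhs A2s).
have n3 := near_and (nbhs_interior HE) (nbhs_interior Hid).
have n4 := near_subst (y := 0) erefl ks (near_and (near_and n1 n2) n3).
have [d d0 Hd] := (near0P _).1 n4.
pose e := d / 2; have e0 : 0 < e by rewrite divr_gt0.
have en : e != 0 by rewrite gt_eqF.
have [|[[Qe Ye] [Ue Ae]] [HEe Hide]] := Hd e.
  by rewrite gtr0_norm// ltr_pdivrMr// ltr_pMr// ltr1n.
pose i (w : R * R * R) : W := (w.1.1 / e ^+ 2, (w.1.2 / e ^+ 3, (0, (w.2 / e ^+ 6, e)))).
have is_ w : smoothAt w i by rewrite /i; sm.
have i0 : i 0 = k e by rewrite /i /k /= !mul0r.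
pose j (w : R * R) : W := (0, (w.1 / e ^+ 3, (0, (w.2 / e ^+ 6, e)))).
have js w : smoothAt w j by rewrite /j; sm.
have j0 : j 0 = k e by rewrite /j /k /= !mul0r.
pose h (c : R) : W := (0, (0, (0, (c / e ^+ 6, e)))).
have hs c : smoothAt c h by rewrite /h; sm.
have h0 : h 0 = k e by rewrite /h /k /= !mul0r.
have Qi : smoothAt 0 (fun w => Q (i w)) by apply: (smoothAt_comp (f := Q)); rewrite ?i0.
have Yi : smoothAt 0 (fun w => Y (i w)) by apply: (smoothAt_comp (f := Y)); rewrite ?i0.
have Uj : smoothAt 0 (fun w => U (j w).2) by apply: (smoothAt_comp (f := fun z => U z.2) (g := j)); rewrite ?j0.
have Ah : smoothAt 0 (fun c => A (h c).2.2) by apply: (smoothAt_comp (f := fun z => A z.2.2) (g := h)); rewrite ?h0.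
exists (fun w => Q (i w)), (fun w => e ^+ 2 * Y (i w)), (fun w => e ^+ 3 * U (j w).2),
  (fun c => (e ^+ 6 * (A (h c).2.2).1, (e ^+ 4 * (A (h c).2.2).2.1, e * (A (h c).2.2).2.2))).
split; first by split; sm.
- have [_ _ _ E] := (nbhs_singleton Hide erefl).1.
  by rewrite h0 E /k /= !mulr0.
- pose i2 (z : R * R) : R * R * R := (z, 0); have i2s : smoothAt 0 i2 by rewrite /i2; sm.
  have ii : smoothAt 0 (fun z => i (i2 z)) by apply: (smoothAt_comp (f := i)).
  apply: (near1 (near_subst (g := fun z => i (i2 z)) i0 ii Hide)) => -[y u] E.
  have [|Q1 Y2 U2 _] := (E _).1; first by rewrite /i /i2 /= mul0r.
  rewrite /i2 in Q1 Y2 U2; split=> //; first by rewrite Y2 /i /=; field.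
  by move: U2; rewrite /i /j /= => ->; field.
- apply: (near1 (near_subst i0 (is_ 0) HEe)) => -[[y u] c]; rewrite /i /j /h /=.
  set z := (y / e ^+ 2, _) => E.
  have E1 : model C B 1 y u 0 = e ^+ 6 * model C B e (y / e ^+ 2) (u / e ^+ 3) 0.
    have := model_weight e ((y / e ^+ 2, (u / e ^+ 3, 0)) : V); rewrite /= => ->.
    rewrite /weight /= !mulr0.
    have -> : e ^+ 2 * (y / e ^+ 2) = y by field.
    by have -> : e ^+ 3 * (u / e ^+ 3) = u by field.
  have E2 := model_weight e ((Y z, (U z.2, A z.2.2)) : V).
  rewrite /weight /= in E2; rewrite -E2 E1.
  move: E; rewrite /K /modelK /l2 /= mul0r addr0.
  have -> : e ^+ 2 * (y / e ^+ 2) = y by field.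
  have -> : e ^+ 3 * (u / e ^+ 3) = u by field.
  move=> E; rewrite mulrCA -E; by field.
Qed.

End Reduction.

(** * Sigmoidal behaviors *)

Section Behavior.
Context {R : realType}.
Let V := (R * (R * (R * (R * R))) : normedModType R)%type.

Definition param_row (a : R * (R * R)) : 'rV[R]_3 :=
  a.1 *: delta_mx 0 0 + a.2.1 *: delta_mx 0 1 + a.2.2 *: delta_mx 0 2.

Definition row_param (a : 'rV[R]_3) : R * (R * R) := (a 0 0, (a 0 1, a 0 2)).

Lemma param_rowK : cancel param_row row_param.
Proof.
move=> [a [b g]]; rewrite /row_param /param_row !mxE /=.
by rewrite !(mulr0, mulr1, addr0, add0r).
Qed.

Lemma row_paramK : cancel row_param param_row.
Proof.
move=> a; apply/rowP => i; rewrite /param_row /row_param !mxE /=.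
case: i => -[|[|[|//]]] i3; rewrite ?(mulr0, mulr1, addr0, add0r) /=; congr (a _ _); exact/val_inj.
Qed.

Lemma param_row_smooth a : smoothAt a param_row.
Proof. by rewrite /param_row; apply: smoothAtD; [apply: smoothAtD|]; apply: smoothAtZ; sm. Qed.

Lemma row_param_smooth a : smoothAt a row_param.
Proof.
have H (i : 'I_3) : smoothAt a (fun a : 'rV[R]_3 => a 0 i).
  have L : linear (fun a : 'rV[R]_3 => a 0 i) by move=> c x y; rewrite !mxE.
  have Lc : continuous (mklin L) by move=> x; exact: coord_continuous.
  exact: (smoothAt_lin a Lc).
by rewrite /row_param; apply: smoothAt_pair => //; apply: smoothAt_pair.
Qed.

Lemma hadamardR (f : R -> R) : smoothAt 0 f -> exists2 g : R -> R, smoothAt 0 g &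
  \forall x \near (0 : R), f x = f 0 + x * g x.
Proof.
move=> fs; have fs2 : smoothAt (0 : R * R) (fun z => f z.1) by apply: (smoothAt_comp (f := f)) => //; sm.
have [g gs H] := hadamard0 _ fs2.
have is_ : smoothAt 0 (fun x : R => (x, 0 : R)) by sm.
exists (fun x => g (x, 0)); first by apply: (smoothAt_comp (f := g) (g := fun x : R => (x, 0 : R))).
exact: (near_subst (y := (0 : R * R)) erefl is_ H).
Qed.

Lemma punctured (g : R -> R) : smoothAt 0 g -> (\forall x \near (0 : R), x * g x = 0) -> g 0 = 0.
Proof.
move=> gs /near0P[d d0 Hd]; apply: (punctured_zero d0); first exact: smoothAt_cont.
by move=> y /andP[y0 /Hd/eqP]; rewrite mulf_eq0 -normr_eq0 (gt_eqF y0) => /eqP.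
Qed.

Lemma even_square (f : R -> R) : smoothAt 0 f -> (\forall x \near (0 : R), f (- x) = f x) ->
  exists2 g : R -> R, smoothAt 0 g & \forall x \near (0 : R), f x = f 0 + x ^+ 2 * g x.
Proof.
move=> fs fe; have [g gs Hg] := hadamardR fs.
have Ns : smoothAt 0 (fun x : R => - x) by sm.
have N0 : - (0 : R) = 0 by rewrite oppr0.
have gN : smoothAt 0 (fun x => g (- x)) by apply: (smoothAt_comp (f := g)); rewrite ?oppr0.
have g0 : g 0 = 0.
  have : g 0 + g (- 0) = 0.
    apply: (punctured (smoothAtD gs gN)).
    apply: (near2 (near_and Hg (near_subst N0 Ns Hg)) fe) => x [E1 E2] E3.
    by move: E3; rewrite E1 E2; lra.
  by rewrite oppr0; lra.
have [h hs Hh] := hadamardR gs; exists h => //.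
by apply: (near2 Hg Hh) => x -> ->; rewrite g0; ring.
Qed.

(** The second derivative is [x * h x] with [h 0 = 6 * g 0], and [h 0] is the third derivative,
    hence nonzero. If it were positive, the second derivative would be nonnegative at small
    [x > 0]. *)
Lemma cubic_part_signs (S g : R -> R) : smoothAt 0 S -> smoothAt 0 g ->
  (\forall x \near (0 : R), S x = x + x ^+ 3 * g x) -> (forall u, 0 < u -> derive1n 2 S u < 0) ->
  derive1n 3 S 0 != 0 -> g 0 < 0.
Proof.
move=> Ss gs HS S2 S3; pose g1 := 'D_1 g; pose g2 := 'D_1 g1.
have g1s : smoothAt 0 g1 by exact: smoothAt_derive.
have g2s : smoothAt 0 g2 by exact: smoothAt_derive.
have dE (f : R -> R) : derive1 f = 'D_1 f by apply/funext => x; rewrite derive1E.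
pose h x := 6 * g x + 6 * x * g1 x + x ^+ 2 * g2 x.
have hs : smoothAt 0 h by rewrite /h; sm.
have E1 : \forall x \near (0 : R), derive1 S x = 1 + 3 * x ^+ 2 * g x + x ^+ 3 * g1 x.
  apply: (near2 (nbhs_interior HS) (smoothAt_nbhs gs)) => x Hx gx.
  rewrite derive1E (near_eq_derive (1 : R) Hx); have Dg := smoothAt_is_derive (1 : R) gx.
  eassert (D : is_derive x (1 : R) (fun x : R => x + x ^+ 3 * g x) _) by isd.
  by have [_ ->] := D; rewrite /g1 /=; ring.
have E2 : \forall x \near (0 : R), derive1n 2 S x = x * h x.
  apply: (near2 (nbhs_interior E1) (near_and (smoothAt_nbhs gs) (smoothAt_nbhs g1s))) => x Hx [gx g1x].
  rewrite derive1nS derive1E (near_eq_derive (1 : R) Hx).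
  have Dg := smoothAt_is_derive (1 : R) gx; have Dg1 := smoothAt_is_derive (1 : R) g1x.
  eassert (D : is_derive x (1 : R) (fun x : R => 1 + 3 * x ^+ 2 * g x + x ^+ 3 * g1 x) _) by isd.
  by have [_ ->] := D; rewrite /h /g2 /= -/(g1 x); ring.
have E3 : derive1n 3 S 0 = h 0.
  rewrite derive1nS derive1E (near_eq_derive (1 : R) E2); have Dh := smoothAt_is_derive (1 : R) hs.
  eassert (D : is_derive (0 : R) (1 : R) (fun x : R => x * h x) _) by isd.
  by have [_ ->] := D; rewrite mul0r add0r mulr1.
have h0 : h 0 != 0 by rewrite -E3.
have h6 : h 0 = 6 * g 0 by rewrite /h expr0n /= mulr0 !mul0r !addr0.
suff : h 0 <= 0 by move: h0; rewrite h6 => n0 hn; move: n0 hn; rewrite mulf_eq0 /= pnatr_eq0/= => n0; rewrite pmulr_rle0// le_eqVlt (negbTE n0).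
rewrite leNgt; apply/negP => hp.
have [d d0 Hd] := (near0P _).1 (near_and E2 (smoothAt_gt0 hs hp)).
have d20 : 0 < d / 2 by rewrite divr_gt0.
have [|E H] := Hd (d / 2); first by rewrite gtr0_norm// ltr_pdivrMr// ltr_pMr// ltr1n.
have h1 := S2 _ d20; rewrite E in h1.
have h2 : 0 <= d / 2 * h (d / 2) by apply: mulr_ge0; apply: ltW.
by move: h2; rewrite leNgt h1.
Qed.

(** The zero [t y] of [- y + S (y + x)] in [x] is the inverse of [S] minus the identity. Inserting
    it in [S w = w + w^3 * S3 w] gives [t y = - (y + t y)^3 * S3 (y + t y)], of order 3 in [y], and
    [C 0 = - S3 0] is positive. The unit has the value 1, the slope of [S], at 0. *)
Lemma sigmoidal_inverse (S : R -> R) : sigmoidal S -> exists (C : R -> R) (e : R * R -> R),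
  [/\ smoothAt 0 C, smoothAt 0 e, 0 < C 0, 0 < e 0 &
    \forall z \near (0 : R * R), - z.2 + S (z.2 + z.1) = (z.1 - z.2 ^+ 3 * C z.2) * e z].
Proof.
move=> hS; have SA x : smoothAt x S by exact: smoothT_At (sigmoidal_smooth hS).
have S0 : S 0 = 0 by have := sigmoidal_odd hS 0; rewrite oppr0; lra.
have [S1 S1s HS1] := hadamardR (SA 0).
have S10 : S1 0 = 1.
  rewrite -(sigmoidal_slope0 hS) derive1E (near_eq_derive (1 : R) HS1).
  have D1 := smoothAt_is_derive (1 : R) S1s.
  eassert (D : is_derive (0 : R) (1 : R) (fun x : R => S 0 + x * S1 x) _) by isd.
  by have [_ ->] := D; rewrite mul0r !add0r mulr1.
have Ns : smoothAt 0 (fun x : R => - x) by sm.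
have N0 : - (0 : R) = 0 by rewrite oppr0.
have S1e : \forall x \near (0 : R), S1 (- x) = S1 x.
  apply: (near2 HS1 (near_subst N0 Ns HS1)) => x; rewrite S0 !add0r (sigmoidal_odd hS) => -> E.
  have [->|x0] := eqVneq x 0; first by rewrite oppr0.
  by apply: (mulfI x0); move: E; rewrite mulNr => /oppr_inj.
have [S3 S3s HS3] := even_square S1s S1e.
have HS : \forall x \near (0 : R), S x = x + x ^+ 3 * S3 x.
  by apply: (near2 HS1 HS3) => x -> ->; rewrite S0 S10; ring.
have S30 : S3 0 < 0.
  apply: (cubic_part_signs (SA 0) S3s HS) => [u u0|]; last exact: (sigmoidal_odd_derivatives hS 1).
  have := sigmoidal_sg2 hS; move/(_ u); rewrite gt_eqF// => /(_ isT); rewrite (gtr0_sg u0) => h.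
  by rewrite -sgr_lt0 h oppr_lt0.
pose P (z : R * R) := - z.2 + S (z.2 + z.1).
have Ps : smoothAt 0 P.
  by rewrite /P; sm; apply: (smoothAt_comp (f := S)) => //; sm.
have P0 : P 0 = 0 by rewrite /P /= addr0 S0 oppr0 addr0.
have P1 : 'D_(1, 0) P 0 = 1.
  eassert (D1 : is_derive (0 : R * R) ((1, 0) : R * R) (fun z : R * R => z.2 + z.1) _) by isd.
  have DS := smoothAt_is_derive (1 : R) (SA ((0 : R * R).2 + (0 : R * R).1)).
  have D2 := is_derive_chainR D1 DS.
  eassert (D3 : is_derive (0 : R * R) ((1, 0) : R * R) P _) by (rewrite /P; isd).
  have [_ ->] := D3; rewrite /= addr0 -derive1E (sigmoidal_slope0 hS).
  by rewrite oppr0 !add0r mulr1.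
have [|t [e [ts t0 es e0 He]]] := weierstrass1 _ Ps P0; first by rewrite P1 oner_eq0.
have e1 : e 0 = 1.
  have De := smoothAt_is_derive ((1, 0) : R * R) es.
  have Dt : is_derive (0 : R * R) ((1, 0) : R * R) (fun z => t z.2) 0.
    have H : is_derive (0 : R * R) ((1, 0) : R * R) (fun z : R * R => z.2) 0.
      exact: (is_derive_snd (isd_id (0 : R * R) ((1, 0) : R * R))).
    have := is_derive_chain H (smoothAt_diff (ts : smoothAt ((0 : R * R).2) t)).
    by rewrite /= derive0.
  eassert (D1 : is_derive (0 : R * R) ((1, 0) : R * R) (fun z => (z.1 - t z.2) * e z) _) by isd.
  have [_] := D1; rewrite -(near_eq_derive ((1, 0) : R * R) He) P1 /= t0 subrr mul0r add0r oppr0 addr0 mulr1.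
  by move=> <-.
have [t1 t1s Ht1] := hadamardR ts.
pose C y := - (1 + t1 y) ^+ 3 * S3 (y + t y).
have yts : smoothAt 0 (fun y : R => y + t y) by sm.
have yt0 : 0 + t 0 = 0 by rewrite t0 addr0.
have S3c : smoothAt 0 (fun y => S3 (y + t y)) by apply: (smoothAt_comp (f := S3)); rewrite ?yt0.
have Cs : smoothAt 0 C by rewrite /C; sm.
have is_ : smoothAt 0 (fun y : R => (t y, y)) by sm.
have i0 : (t 0, 0) = (0 : R * R) by rewrite t0.
have tC : \forall y \near (0 : R), t y = y ^+ 3 * C y.
  apply: (near2 (near_subst (g := fun y : R => (t y, y)) i0 is_ He) (near_and (near_subst (g := fun y : R => y + t y) yt0 yts HS) Ht1)) => y.
  rewrite /P /= subrr mul0r => E1 [E2 E3]; rewrite E2 in E1.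
  have E4 : y + t y = y * (1 + t1 y) by rewrite E3 t0; ring.
  have -> : t y = - (y + t y) ^+ 3 * S3 (y + t y) by move: E1; lra.
  by rewrite [in (y + t y) ^+ 3]E4 /C; ring.
have t10 : t1 0 = 0.
  have : t1 0 - 0 ^+ 2 * C 0 = 0.
    apply: (@punctured (fun y => t1 y - y ^+ 2 * C y)); first by sm.
    by apply: (near2 tC Ht1) => y -> E; move: E; rewrite t0 add0r => E; rewrite mulrBr -E; ring.
  by rewrite expr0n mul0r subr0.
exists C, e; split=> //.
- by rewrite /C t10 yt0 addr0 expr1n mulN1r oppr_gt0.
- by rewrite e1 ltr01.
- have p2 : smoothAt (0 : R * R) (fun z : R * R => z.2) by sm.
  have n2 := near_subst (g := fun z : R * R => z.2) (x := (0 : R * R)) (y := (0 : R)) erefl p2 tC.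
  by apply: (near2 He n2) => z; rewrite /P => -> ->.
Qed.

(** Oddness of [S] makes the response even in [v] and 0 at [v = 0]. Its second derivative there is
    the one of [S] at [delta] minus the one at [- delta], negative by the sign condition; hence the
    sign of [B 0]. *)
Lemma bump_square (S : R -> R) (delta : R) : sigmoidal S -> 0 < delta ->
  exists B : R -> R, [/\ smoothAt 0 B, 0 < B 0 &
    \forall v \near (0 : R), bump_response S delta v = - v ^+ 2 * B v].
Proof.
move=> hS d0; have SA x : smoothAt x S by exact: smoothT_At (sigmoidal_smooth hS).
pose F := bump_response S delta.
have Sp x : smoothAt x (fun v => S (v + delta)) by apply: (smoothAt_comp (f := S)) => //; sm.
have Sm x : smoothAt x (fun v => S (v - delta)) by apply: (smoothAt_comp (f := S)) => //; sm.
have Fs : smoothAt 0 F by rewrite /F /bump_response; have a := Sp 0; have b := Sm 0; sm.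
have Fe : \forall x \near (0 : R), F (- x) = F x.
  apply: filterE => x; rewrite /F /bump_response.
  have -> : - x + delta = - (x - delta) by ring.
  have -> : - x - delta = - (x + delta) by ring.
  by rewrite !(sigmoidal_odd hS); ring.
have [g gs Hg] := even_square Fs Fe.
have F0 : F 0 = 0 by rewrite /F /bump_response add0r sub0r (sigmoidal_odd hS); ring.
exists (fun v => - g v); split; first by sm.
  rewrite oppr_gt0; have g1s := smoothAt_derive (1 : R) gs.
  have E1 : \forall x \near (0 : R), 'D_1 F x = 2 * x * g x + x ^+ 2 * 'D_1 g x.
    apply: (near2 (nbhs_interior Hg) (smoothAt_nbhs gs)) => x Hx gx.
    rewrite (near_eq_derive (1 : R) Hx); have Dg := smoothAt_is_derive (1 : R) gx.
    eassert (D : is_derive x (1 : R) (fun x : R => F 0 + x ^+ 2 * g x) _) by isd.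
    by have [_ ->] := D; rewrite /=; ring.
  have E2 : 'D_1 ('D_1 F) 0 = 2 * g 0.
    rewrite (near_eq_derive (1 : R) E1); have Dg := smoothAt_is_derive (1 : R) gs.
    have Dg1 := smoothAt_is_derive (1 : R) g1s.
    eassert (D : is_derive (0 : R) (1 : R) (fun x : R => 2 * x * g x + x ^+ 2 * 'D_1 g x) _) by isd.
    by have [_ ->] := D; rewrite /=; ring.
  have shift (f : R -> R) (c x : R) : (forall y, smoothAt y f) -> is_derive x (1 : R) (fun v => f (v + c)) ('D_1 f (x + c)).
    move=> fA; eassert (D1 : is_derive x (1 : R) (fun v : R => v + c) _) by isd.
    have D2 := is_derive_chainR D1 (smoothAt_is_derive (1 : R) (fA (x + c))).
    by apply: (is_derive_eq D2); rewrite addr0 mulr1.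
  have E3 : 'D_1 F = (fun x => 'D_1 S (x + delta) - 'D_1 S (x - delta)).
    apply/funext => x; have D1 := shift S delta x SA; have D2 := shift S (- delta) x SA.
    eassert (D : is_derive x (1 : R) F _) by (rewrite /F /bump_response; isd).
    by have [_ ->] := D; ring.
  have S1A x : smoothAt x ('D_1 S) by exact: smoothAt_derive.
  have E4 : 'D_1 ('D_1 F) 0 = 'D_1 ('D_1 S) delta - 'D_1 ('D_1 S) (- delta).
    have D1 := shift ('D_1 S) delta 0 S1A; have D2 := shift ('D_1 S) (- delta) 0 S1A.
    rewrite E3; eassert (D : is_derive (0 : R) (1 : R) (fun x => 'D_1 S (x + delta) - 'D_1 S (x - delta)) _) by isd.
    by have [_ ->] := D; rewrite !add0r.
  have dE (f : R -> R) : derive1 f = 'D_1 f by apply/funext => x; rewrite derive1E.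
  have n2 : derive1n 2 S = 'D_1 ('D_1 S) by rewrite !derive1nS derive1n0 !dE.
  have n2u u : derive1n 2 S u = 'D_1 ('D_1 S) u := congr1 (fun f => f u) n2.
  have dn : delta != 0 by rewrite gt_eqF.
  have dn' : - delta != 0 by rewrite oppr_eq0.
  have s1 : Num.sg ('D_1 ('D_1 S) delta) = - Num.sg delta.
    exact: etrans (congr1 Num.sg (esym (n2u delta))) (sigmoidal_sg2 hS dn).
  have s2 : Num.sg ('D_1 ('D_1 S) (- delta)) = - Num.sg (- delta).
    exact: etrans (congr1 Num.sg (esym (n2u (- delta)))) (sigmoidal_sg2 hS dn').
  have h1 : 'D_1 ('D_1 S) delta < 0 by rewrite -sgr_lt0 s1 (gtr0_sg d0) oppr_lt0.
  have h2 : 0 < 'D_1 ('D_1 S) (- delta) by rewrite -sgr_gt0 s2 sgrN opprK (gtr0_sg d0).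
  rewrite E2 in E4; move: E4 h1 h2; clear.
  by move: ('D_1 _ delta) ('D_1 _ (- delta)) (g 0) => a b c; lra.
by apply: (near1 Hg) => v; rewrite -/(F v) F0 => ->; ring.
Qed.

Lemma behavior_model (S : R -> R) (delta : R) : sigmoidal S -> 0 < delta ->
  exists (C B : R -> R) (E : V -> R),
  [/\ [/\ smoothAt 0 C, smoothAt 0 B & smoothAt 0 E], 0 < C 0, 0 < B 0, 0 < E 0 &
    \forall z \near (0 : V), wcusp_behavior S delta z.1 z.2.1 (param_row z.2.2) =
      E z * model C B 1 z.1 z.2.1 z.2.2].
Proof.
move=> hS d0; have [C [e [Cs es C0 e0 He]]] := sigmoidal_inverse hS.
have [B [Bs B0 HB]] := bump_square hS d0.
pose v (z : V) := shear z.1 z.2.1 z.2.2.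
have vs : smoothAt 0 v by rewrite /v /shear; sm.
have v0 : v 0 = 0 by rewrite /v /shear /= !mul0r addr0.
have Bv : smoothAt 0 (fun z => B (v z)) by apply: (smoothAt_comp (f := B)); rewrite ?v0.
pose X (z : V) := - v z ^+ 2 * B (v z) + z.2.2.1 + z.2.2.2.1 * z.1.
have Xs : smoothAt 0 X by rewrite /X; sm.
have X0 : X 0 = 0 by rewrite /X v0 expr0n /= oppr0 !mul0r !addr0.
pose i (z : V) := (X z, z.1); have is_ : smoothAt 0 i by rewrite /i; sm.
have i0 : i 0 = 0 by rewrite /i X0.
exists C, B, (fun z => e (i z)); split=> //.
- by split=> //; apply: (smoothAt_comp (f := e)); rewrite ?i0.
- by rewrite i0.
- apply: (near2 (near_subst v0 vs HB) (near_subst i0 is_ He)) => -[y [u [a [b g]]]].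
  rewrite /v /i /X /v /wcusp_behavior => E1; have := param_rowK (a, (b, g)); rewrite /row_param => -[-> -> ->].
  rewrite /shear /= in E1 *; rewrite E1 => E2.
  have -> : - (u + g * y / 2) ^+ 2 * B (u + g * y / 2) + y + a + b * y =
    y + (- (u + g * y / 2) ^+ 2 * B (u + g * y / 2) + a + b * y) by ring.
  by rewrite E2 [in RHS]mulrC; congr (_ * _); rewrite /model /shear /= !expr1n !mul1r; ring.
Qed.

End Behavior.

(** * Persistent diagrams *)

Section Persistence.
Context {R : realType}.
Let V := (R * (R * (R * (R * R))) : normedModType R)%type.
Let A3 := (R * (R * R))%type.
Implicit Types F G : V -> R.

Definition pt (z : V) : R * R := (z.1, z.2.1).
Definition at_par (p : R * R) (a : R * (R * R)) : V := (p.1, (p.2, a)).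

Lemma pt_par z : at_par (pt z) z.2.2 = z. Proof. by case: z => [? [? ?]]. Qed.

Lemma at_par_norm p a (d : R) : `|p| < d -> `|a| < d -> `|at_par p a| < d.
Proof. by rewrite !prod_normE /= !gt_max => /andP[-> ->] ->. Qed.

Lemma pt_norm (z : V) (d : R) : `|z| < d -> `|pt z| < d.
Proof. by rewrite !prod_normE /= !gt_max => /and3P[-> -> _]. Qed.

Lemma par_norm (z : V) (d : R) : `|z| < d -> `|z.2.2| < d.
Proof. by rewrite prod_normE gt_max prod_normE gt_max => /and3P[]. Qed.

Lemma ball0E (p : R * R) (r : R) : ball (0 : R * R) r p = (`|p| < r) :> Prop.
Proof. by rewrite -ball_normE /ball_ /= sub0r normrN. Qed.

Definition of_family F (y u : R) (a : 'rV[R]_3) : R := F (y, (u, row_param a)).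

Definition crit_y F z := F z = 0 /\ 'D_(1, 0) F z = 0.
Definition crit_u F z := 'D_(0, (1, 0)) F z = 0.
Definition crit_yy F z := 'D_(1, 0) ('D_(1, 0) F) z = 0.

Lemma line_y (f : V -> R) y u a : smoothAt (y, (u, a)) f ->
  derive1 (fun t => f (t, (u, a))) y = 'D_(1, 0) f (y, (u, a)).
Proof.
move=> fs; rewrite derive1E.
eassert (D : is_derive y (1 : R) (fun t : R => (t, (u, a)) : V) _) by isd.
by have [_ ->] := is_derive_chain D (smoothAt_diff (fs : smoothAt ((fun t : R => (t, (u, a)) : V) y) f)).
Qed.

Lemma line_u (f : V -> R) y u a : smoothAt (y, (u, a)) f ->
  derive1 (fun t => f (y, (t, a))) u = 'D_(0, (1, 0)) f (y, (u, a)).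
Proof.
move=> fs; rewrite derive1E.
eassert (D : is_derive u (1 : R) (fun t : R => (y, (t, a)) : V) _) by isd.
by have [_ ->] := is_derive_chain D (smoothAt_diff (fs : smoothAt ((fun t : R => (y, (t, a)) : V) u) f)).
Qed.

Lemma line_yy (f : V -> R) y u a : smoothAt (y, (u, a)) f ->
  d_y (d_y (fun y u => f (y, (u, a)))) y u = 'D_(1, 0) ('D_(1, 0) f) (y, (u, a)).
Proof.
move=> fs; rewrite -line_y; last exact: smoothAt_derive.
rewrite /d_y !derive1E; apply: near_eq_derive.
have ts : smoothAt y (fun t : R => (t, (u, a)) : V) by sm.
apply: (near1 (near_subst (g := fun t : R => (t, (u, a)) : V) erefl ts (smoothAt_nbhs fs))) => t ft.
exact: line_y.
Qed.

Definition transition F (D : set (R * R)) (a : A3) : Prop :=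
  [\/ exists p, D p /\ (crit_y F (at_par p a) /\ crit_u F (at_par p a)),
      exists p, D p /\ (crit_y F (at_par p a) /\ crit_yy F (at_par p a)) |
      exists p p', [/\ p.1 <> p'.1, p.2 = p'.2, D p /\ crit_y F (at_par p a) & D p' /\ crit_y F (at_par p' a)]].

Lemma transitionE F (D : set (R * R)) (a : 'rV[R]_3) :
  (forall p, D p -> smoothAt (at_par p (row_param a)) F) ->
  transition_variety D (of_family F) a <-> transition F D (row_param a).
Proof.
move=> FD; rewrite /transition_variety /transition /of_family /crit_y /crit_u /crit_yy /=.
have Ey y u : D (y, u) -> d_y (fun y u => F (y, (u, row_param a))) y u = 'D_(1, 0) F (y, (u, row_param a)).
  by move=> /FD; exact: line_y.
have Eu y u : D (y, u) -> d_u (fun y u => F (y, (u, row_param a))) y u = 'D_(0, (1, 0)) F (y, (u, row_param a)).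
  by move=> /FD; exact: line_u.
have Eyy y u : D (y, u) -> d_y (d_y (fun y u => F (y, (u, row_param a)))) y u = 'D_(1, 0) ('D_(1, 0) F) (y, (u, row_param a)).
  by move=> /FD; exact: line_yy.
split=> -[].
- move=> [y [u [yu [h1 h2 h3]]]]; apply: Or31; exists (y, u).
  exact: (conj yu (conj (conj h1 (etrans (esym (Ey y u yu)) h2)) (etrans (esym (Eu y u yu)) h3))).
- move=> [y [u [yu [h1 h2 h3]]]]; apply: Or32; exists (y, u).
  exact: (conj yu (conj (conj h1 (etrans (esym (Ey y u yu)) h2)) (etrans (esym (Eyy y u yu)) h3))).
- move=> [u [y1 [y2 [n [h1 [h2 h3]] [h4 [h5 h6]]]]]]; apply: Or33; exists (y1, u), (y2, u).
  exact: (And4 n erefl (conj h1 (conj h2 (etrans (esym (Ey y1 u h1)) h3)))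
    (conj h4 (conj h5 (etrans (esym (Ey y2 u h4)) h6)))).
- move=> [[y u] [yu [[h1 h2] h3]]]; apply: Or31; exists y, u.
  exact: (conj yu (And3 h1 (etrans (Ey y u yu) h2) (etrans (Eu y u yu) h3))).
- move=> [[y u] [yu [[h1 h2] h3]]]; apply: Or32; exists y, u.
  exact: (conj yu (And3 h1 (etrans (Ey y u yu) h2) (etrans (Eyy y u yu) h3))).
- move=> [[y u] [[y' u'] [n uu [h1 [h2 h3]] [h4 [h5 h6]]]]]; cbn [fst snd] in n, uu; subst u'.
  apply: Or33; exists u, y, y'.
  exact: (And3 n (conj h1 (conj h2 (etrans (Ey y u h1) h3))) (conj h4 (conj h5 (etrans (Ey y' u h4) h6)))).
Qed.

Section Transfer.
Variables (F G : V -> R) (Phi : V -> V) (Q : V -> R) (z : V).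
Hypotheses (t : triangular Phi) (Ps : smoothAt z Phi) (Gs : smoothAt (Phi z) G) (Qs : smoothAt z Q)
  (E : \forall y \near z, F y = Q y * G (Phi y)).

Let dF x v : smoothAt x Phi -> smoothAt (Phi x) G -> smoothAt x Q -> (\forall y \near x, F y = Q y * G (Phi y)) ->
  'D_v F x = Q x * 'D_('D_v Phi x) G (Phi x) + G (Phi x) * 'D_v Q x.
Proof.
move=> Px Gx Qx Ex; rewrite (near_eq_derive v Ex).
have D1 := is_derive_chain (smoothAt_is_derive v Px) (smoothAt_diff Gx).
have D2 := smoothAt_is_derive v Qx.
eassert (D : is_derive x v (fun y => Q y * G (Phi y)) _) by isd.
by have [_ ->] := D.
Qed.

Let dPhi_y x : smoothAt x Phi -> 'D_(1, 0) Phi x = ('D_(1, 0) Phi x).1 *: ((1, 0) : V).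
Proof.
move=> Px; have := triangular_derive_y t Px; case: ('D_(1, 0) Phi x) => a b /= ->.
by rewrite scale_pairE scaler0 [_ *: 1]mulr1.
Qed.

Let dF_y x : smoothAt x Phi -> smoothAt (Phi x) G -> smoothAt x Q -> (\forall y \near x, F y = Q y * G (Phi y)) ->
  'D_(1, 0) F x = Q x * (('D_(1, 0) Phi x).1 * 'D_(1, 0) G (Phi x)) + G (Phi x) * 'D_(1, 0) Q x.
Proof.
move=> Px Gx Qx Ex; rewrite dF//; congr (_ * _ + _).
by rewrite {1}(dPhi_y Px) derive_scale.
Qed.

(** Here and in the next two lemmas, [G] and [G_y] vanish at the image point, so the terms with
    derivatives of [Q] drop out, and triangularity leaves only the derivatives of [G] that are
    assumed to vanish. *)
Lemma transfer_crit_y : crit_y G (Phi z) -> crit_y F z.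
Proof.
move=> [G0 G1]; split; first by rewrite (nbhs_singleton E) G0 mulr0.
by rewrite dF_y// G0 G1 mul0r !mulr0 addr0.
Qed.

Lemma transfer_crit_u : crit_y G (Phi z) -> crit_u G (Phi z) -> crit_u F z.
Proof.
move=> [G0 G1] G2; rewrite /crit_u dF// G0 mul0r addr0.
have := triangular_derive_u t Ps; case: ('D_(0, (1, 0)) Phi z) => a [b c] /= ->.
have -> : ((a, (b, 0)) : V) = a *: (1, 0) + b *: (0, (1, 0)).
  by rewrite !scale_pairE !add_pairE !scaler0 !add0r !addr0 ![_ *: 1]mulr1.
rewrite derive_lin; last exact: smoothAt_diff.
by rewrite derive_scale// G1 G2 !scaler0 addr0 mulr0.
Qed.

Lemma transfer_crit_yy : crit_y G (Phi z) -> crit_yy G (Phi z) -> crit_yy F z.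
Proof.
move=> [G0 G1] G2; rewrite /crit_yy; pose x y := ('D_(1, 0) Phi y).1; pose Gy := 'D_(1, 0) G; pose Qy := 'D_(1, 0) Q.
have n1 := near_and (smoothAt_nbhs Ps) (near_subst erefl Ps (smoothAt_nbhs Gs)).
have n2 := near_and (smoothAt_nbhs Qs) (nbhs_interior E).
have H : \forall y \near z, 'D_(1, 0) F y = Q y * (x y * Gy (Phi y)) + G (Phi y) * Qy y.
  by apply: (near2 n1 n2) => y [Py Gp] [Qp Ey]; exact: dF_y.
rewrite (near_eq_derive ((1, 0) : V) H).
have xs : smoothAt z x by rewrite /x; have := smoothAt_derive ((1, 0) : V) Ps => h; sm.
have Gys : smoothAt (Phi z) Gy by exact: smoothAt_derive.
have Qys : smoothAt z Qy by exact: smoothAt_derive.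
pose v : V := (1, 0).
have Dp := smoothAt_is_derive v Ps.
have D1 := is_derive_chain Dp (smoothAt_diff Gys).
have D2 := is_derive_chain Dp (smoothAt_diff Gs).
have f1 : 'D_('D_v Phi z) Gy (Phi z) = 0 by rewrite (dPhi_y Ps) derive_scale// [X in _ *: X]G2 scaler0.
have f2 : 'D_('D_v Phi z) G (Phi z) = 0 by rewrite (dPhi_y Ps) derive_scale// [X in _ *: X]G1 scaler0.
rewrite f1 in D1; rewrite f2 in D2.
have D3 := smoothAt_is_derive v xs; have D4 := smoothAt_is_derive v Qs; have D5 := smoothAt_is_derive v Qys.
eassert (D : is_derive z v (fun y => Q y * (x y * Gy (Phi y)) + G (Phi y) * Qy y) _) by isd.
have [_ ->] := D; rewrite G0 [Gy _]G1.
by rewrite !mulr0 !mul0r !addr0 !mulr0.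
Qed.

End Transfer.

Section Equivalent.
Variables (F G : V -> R) (Phi Psi : V -> V) (Q : V -> R) (d : R).
Hypotheses (tPhi : triangular Phi) (tPsi : triangular Psi) (Phi0 : Phi 0 = 0) (Psi0 : Psi 0 = 0) (d0 : 0 < d).
Hypothesis (H : forall z : V, `|z| < d -> [/\ [/\ Psi (Phi z) = z, Phi (Psi z) = z, smoothAt z Phi & smoothAt z Psi],
  [/\ smoothAt z Q, smoothAt z F & smoothAt z G],
  [/\ 0 < Q z, 0 < ('D_(1, 0) Phi z).1 & 0 < ('D_(0, (1, 0)) Phi z).2.1] &
  \forall y \near z, F y = Q y * G (Phi y)]).

(** By triangularity the parameter component does not depend on [y] and [u], so it is read off at
    [(0, 0)]. *)
Definition image_par (a : A3) : A3 := (Phi (0, (0, a))).2.2.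

(** Transition points of [G] are pulled back by [Psi]. Two points over one input remain over one
    input by triangularity and distinct by injectivity. [D] and [D'] are separate because a ball is
    not carried to itself. *)
Lemma transition_transfer (a : A3) (D D' : set (R * R)) : `|a| < d -> `|image_par a| < d ->
  (forall p, D p -> [/\ `|p| < d, `|Psi (at_par p (image_par a))| < d & D' (pt (Psi (at_par p (image_par a))))]) ->
  transition G D (image_par a) -> transition F D' a.
Proof.
move=> ad bd HD; set b := image_par a in ad bd HD *.
have key p : D p -> let z := Psi (at_par p b) in
    [/\ `|z| < d, D' (pt z), at_par (pt z) a = z & Phi z = at_par p b].
  move=> Dp z; have [pd zd D'z] := HD p Dp.
  have [[_ E1 _ _] _ _ _] := H (at_par_norm pd bd); split=> //.
  have E2 : z.2.2 = (Psi (Phi (0, (0, a)))).2.2 by apply: (tPsi _ _).2.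
  have ad' : `|(0, (0, a)) : V| < d by apply: (@at_par_norm (0, 0)); rewrite ?normr0.
  have [[E3 _ _ _] _ _ _] := H ad'; rewrite E3 /= in E2.
  by rewrite -[in RHS](pt_par z) E2.
have cy p : D p -> crit_y G (at_par p b) -> crit_y F (Psi (at_par p b)).
  move=> Dp; have [zd _ _ Ez] := key p Dp; have [[_ _ Ps _] [Qs _ _] _ E] := H zd.
  have [pd _ _] := HD p Dp; have [_ [_ _ Gs] _ _] := H (at_par_norm pd bd).
  move=> c; have c' : crit_y G (Phi (Psi (at_par p b))) by rewrite Ez.
  have Gs' : smoothAt (Phi (Psi (at_par p b))) G by rewrite Ez.
  exact: (transfer_crit_y tPhi Ps Gs' Qs E c').
case=> [[p [Dp [c1 c2]]]|[p [Dp [c1 c2]]]|[p [p' [n e [Dp c1] [Dp' c2]]]]].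
- have [zd D'z az Ez] := key p Dp; have [[_ _ Ps _] [Qs _ _] _ E] := H zd.
  have [pd _ _] := HD p Dp; have [_ [_ _ Gs] _ _] := H (at_par_norm pd bd).
  apply: Or31; exists (pt (Psi (at_par p b))); rewrite az; split; first exact: D'z.
  split; first exact: cy.
  have c1' : crit_y G (Phi (Psi (at_par p b))) by rewrite Ez.
  have c2' : crit_u G (Phi (Psi (at_par p b))) by rewrite Ez.
  have Gs' : smoothAt (Phi (Psi (at_par p b))) G by rewrite Ez.
  exact: (transfer_crit_u tPhi Ps Gs' Qs E c1' c2').
- have [zd D'z az Ez] := key p Dp; have [[_ _ Ps _] [Qs _ _] _ E] := H zd.
  have [pd _ _] := HD p Dp; have [_ [_ _ Gs] _ _] := H (at_par_norm pd bd).
  apply: Or32; exists (pt (Psi (at_par p b))); rewrite az; split; first exact: D'z.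
  split; first exact: cy.
  have c1' : crit_y G (Phi (Psi (at_par p b))) by rewrite Ez.
  have c2' : crit_yy G (Phi (Psi (at_par p b))) by rewrite Ez.
  have Gs' : smoothAt (Phi (Psi (at_par p b))) G by rewrite Ez.
  exact: (transfer_crit_yy tPhi Ps Gs' Qs E c1' c2').
have [zd D'z az Ez] := key p Dp; have [zd' D'z' az' Ez'] := key p' Dp'.
apply: Or33; exists (pt (Psi (at_par p b))), (pt (Psi (at_par p' b))); split.
- move=> e1; apply: n; have e2 : (Psi (at_par p b)).2 = (Psi (at_par p' b)).2.
    by apply: (tPsi _ _).1; rewrite /at_par e.
  have e3 : Psi (at_par p b) = Psi (at_par p' b) by apply: injective_projections.
  by have := Ez; rewrite e3 Ez' => /(congr1 fst).
- have e2 : (Psi (at_par p b)).2 = (Psi (at_par p' b)).2 by apply: (tPsi _ _).1; rewrite /at_par e.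
  by rewrite /pt /= e2.
- by split=> //; rewrite az; exact: cy.
- by split=> //; rewrite az'; exact: cy.
Qed.

Let small (f : V -> V) (r : R) : smoothAt 0 f -> f 0 = 0 -> 0 < r ->
  exists2 s : R, 0 < s & forall z, `|z| < s -> `|f z| < r.
Proof.
move=> fs f0 r0; have /contP /(_ r r0)[s s0 Hs] := smoothAt_cont fs.
by exists s => // z zs; have := Hs z; rewrite f0 !subr0; exact.
Qed.

Let smallr (X Y : normedModType R) (f : X -> Y) (r : R) : smoothAt 0 f -> f 0 = 0 -> 0 < r ->
  exists2 s : R, 0 < s & forall z, `|z| < s -> `|f z| < r.
Proof.
move=> fs f0 r0; have /contP /(_ r r0)[s s0 Hs] := smoothAt_cont fs.
by exists s => // z zs; have := Hs z; rewrite f0 !subr0; exact.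
Qed.

Lemma open_norm_lt (h : R * R -> R * R) (r : R) (N : set (R * R)) :
  (forall p, N p -> {for p, continuous h}) -> (forall p, N p = (`|p| < r /\ `|h p| < r)) ->
  (forall p, `|p| < r -> {for p, continuous h}) -> open N.
Proof.
move=> _ NE hc; rewrite openE => p; rewrite NE => -[p1 p2].
have c (f : R * R -> R * R) : {for p, continuous f} -> `|f p| < r -> \forall q \near p, `|f q| < r.
  move=> /contP fc fp; have [|e e0 He] := fc (r - `|f p|); first by rewrite subr_gt0.
  apply/nearP; exists e => // q /He h1; rewrite -(subrK (f p) (f q)).
  by apply: le_lt_trans (ler_normD _ _) _; rewrite -ltrBrDr.
have ic : {for p, continuous (fun q : R * R => q)} by exact: cvg_id.
apply: (near2 (c _ ic p1) (c _ (hc p p1) p2)) => q q1 q2.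
by rewrite NE.
Qed.

(** The assumption concerns one and the same ball on both sides; all the rest follows from
    continuity, with radii fixed before the parameter is given. *)
Lemma persistent_diagrams_of_transfer :
  (exists2 r0 : R, 0 < r0 & forall r : R, 0 < r < r0 -> exists2 rho : R, 0 < rho &
    forall a, `|a| < rho -> transition G [set p | `|p| < r] (image_par a) -> transition F [set p | `|p| < r] a) ->
  persistent_diagrams_among (of_family F) (of_family G).
Proof.
move=> [r0 r00 Htr]; exists (Num.min r0 d); first by rewrite lt_min r00.
move=> r /andP[rp]; rewrite lt_min => /andP[rr0 rd].
have rr : 0 < r < r0 by rewrite rp.
have [rho rho0 Hrho] := Htr r rr.
have z0d : `|0 : V| < d by rewrite normr0.
have [[_ _ Ps0 Qs0] _ _ _] := H z0d.
have [s1 s10 Hs1] := small Ps0 Phi0 rp.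
have [s2 s20 Hs2] := small Qs0 Psi0 rp.
have pr0 : param_row (0 : A3) = 0 :> 'rV[R]_3 by rewrite /param_row /= !scale0r !addr0.
have rp0 : row_param (0 : 'rV[R]_3) = 0 :> A3 by rewrite /row_param !mxE.
have [s3 s30 Hs3] := smallr (param_row_smooth (0 : A3)) pr0 rp.
pose s := Num.min (Num.min s1 s2) r.
have sp : 0 < s by rewrite !lt_min s10 s20.
have ss1 : s <= s1 by rewrite /s !ge_min lexx.
have ss2 : s <= s2 by rewrite /s !ge_min lexx orbT.
have ssr : s <= r by rewrite /s !ge_min lexx orbT.
have sm3 : 0 < Num.min s s3 by rewrite lt_min sp.
have [s4 s40 Hs4] := small Ps0 Phi0 sm3.
pose s5 := Num.min (Num.min s s4) rho.
have s50 : 0 < s5 by rewrite /s5 lt_min [0 < Num.min s s4]lt_min sp s40.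
have [s6 s60 Hs6] := smallr (row_param_smooth (0 : 'rV[R]_3)) rp0 s50.
exists s, s6; split=> // a' a's ntv.
set a := row_param a'; have : `|a| < s5 by exact: Hs6.
rewrite /s5 lt_min [_ < Num.min s s4]lt_min => /andP[/andP[as_ as4] arho].
pose b := image_par a.
have : `|b| < Num.min s s3.
  by apply: par_norm; apply: Hs4; apply: (@at_par_norm (0, 0)); rewrite ?normr0.
rewrite lt_min => /andP[bs bs3].
have ad : `|a| < d by apply: lt_trans rd; exact: lt_le_trans ssr.
have bd : `|b| < d by apply: lt_trans rd; exact: lt_le_trans ssr.
have sub (p : R * R) : `|p| < r -> `|p| < d by move=> h; exact: lt_trans rd.
exists (param_row b); split; first exact: Hs3.
  move=> tv; apply: ntv.
  have /transitionE -> : forall p, ball (0 : R * R) r p -> smoothAt (at_par p (row_param a')) F.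
    by move=> p; rewrite ball0E => /sub pd; have [_ []] := H (at_par_norm pd ad).
  have tv2 : transition G (ball (0 : R * R) r) (image_par a).
    rewrite -/b -[b]param_rowK; apply/transitionE => // p; rewrite param_rowK ball0E => /sub pd.
    by have [_ []] := H (at_par_norm pd bd).
  have bE : ball (0 : R * R) r = [set p | `|p| < r] by apply/funext => p; exact: ball0E.
  by move: tv2; rewrite bE; exact: Hrho.
pose ph (p : R * R) := pt (Phi (at_par p a)); pose ps (p : R * R) := pt (Psi (at_par p b)).
have phE p : at_par (ph p) b = Phi (at_par p a).
  have E : (Phi (at_par p a)).2.2 = b by apply: (tPhi _ _).2.
  by rewrite /ph -E pt_par.
have psE p : `|p| < r -> at_par (ps p) a = Psi (at_par p b).
  move=> pr; have E2 : (Psi (at_par p b)).2.2 = (Psi (Phi (0, (0, a)))).2.2 by apply: (tPsi _ _).2.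
  have ad' : `|(0, (0, a)) : V| < d by apply: (@at_par_norm (0, 0)); rewrite ?normr0.
  by have [[E3 _ _ _] _ _ _] := H ad'; rewrite E3 /= in E2; rewrite -E2 pt_par.
have psph p : `|p| < r -> ps (ph p) = p.
  move=> /sub pd; have [[E _ _ _] _ _ _] := H (at_par_norm pd ad).
  by rewrite /ps phE E /pt; case: p {pd E}.
have phps p : `|p| < r -> ph (ps p) = p.
  move=> pr; have [[_ E _ _] _ _ _] := H (at_par_norm (sub _ pr) bd).
  by rewrite /ph psE// E /pt; case: p {pr E}.
(* A point and its image are both required to lie in the ball. So [ph] is a bijection from [N] to
   [M] with inverse [ps], and both sets contain the ball of radius [s]. *)
pose N : set (R * R) := [set p | `|p| < r /\ `|ph p| < r].
pose M : set (R * R) := [set p | `|p| < r /\ `|ps p| < r].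
have phs p : `|p| < r -> smoothAt p ph.
  move=> /sub pd; have [[_ _ Pp _] _ _ _] := H (at_par_norm pd ad).
  have : smoothAt p (fun p => Phi (at_par p a)).
    by apply: (smoothAt_comp (f := Phi) (g := fun p => at_par p a)) => //; rewrite /at_par; sm.
  by rewrite /ph /pt => h; sm.
have pss p : `|p| < r -> smoothAt p ps.
  move=> /sub pd; have [[_ _ _ Pp] _ _ _] := H (at_par_norm pd bd).
  have : smoothAt p (fun p => Psi (at_par p b)).
    by apply: (smoothAt_comp (f := Psi) (g := fun p => at_par p b)) => //; rewrite /at_par; sm.
  by rewrite /ps /pt => h; sm.
exists N, M; split.
- split.
    apply: (@open_norm_lt ph r) => // p; last by move=> /phs/smoothAt_cont.
    by move=> [/phs/smoothAt_cont].
  apply: (@open_norm_lt ps r) => // p; last by move=> /pss/smoothAt_cont.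
  by move=> [/pss/smoothAt_cont].
- split=> [p|p []]; rewrite ball0E// => pss'; split; first exact: lt_le_trans ssr.
  by apply: pt_norm; apply: Hs1; apply: lt_le_trans ss1; exact: at_par_norm.
- split=> [p|p []]; rewrite ball0E// => pss'; split; first exact: lt_le_trans ssr.
  by apply: pt_norm; apply: Hs2; apply: lt_le_trans ss2; exact: at_par_norm.
have NE p : (Phi (at_par p a)).2.1 = (Phi (at_par (0, p.2) a)).2.1.
  by congr (_.1); apply: (tPhi _ _).1.
exists (fun y u => Q (at_par (y, u) a)), (fun y u => (Phi (at_par (y, u) a)).1), (fun u => (Phi (at_par (0, u) a)).2.1).
have phE2 p : ((Phi (at_par (p.1, p.2) a)).1, (Phi (at_par (0, p.2) a)).2.1) = ph p.
  by rewrite -NE /ph /pt; case: p.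
have u0d u : (exists2 p : R * R, N p & p.2 = u) -> `|at_par (0, u) a| < d.
  move=> [p [/sub pd _] pu]; apply: at_par_norm => //; move: pd; rewrite !prod_normE /= !gt_max normr0 d0 /=.
  by move=> /andP[_]; rewrite -pu.
split.
- apply: smoothP => p [/sub pd _]; have [_ [Qp _ _] _ _] := H (at_par_norm pd ad).
  by apply: (smoothAt_comp (f := Q) (g := fun p : R * R => at_par (p.1, p.2) a)); [case: p {pd} Qp|rewrite /at_par; sm].
- apply: smoothP => p [/phs + _]; rewrite /ph /pt => h.
  have : smoothAt p (fun p => (Phi (at_par p a)).1) by exact: (smoothAt_fst h).
  by apply: smoothAt_near; apply: filterE => -[].
- apply: smoothP => u [p Np pu]; have ud : `|at_par (0, u) a| < d by apply: u0d; exists p.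
  have [[_ _ Pp _] _ _ _] := H ud.
  have : smoothAt u (fun u => Phi (at_par (0, u) a)).
    by apply: (smoothAt_comp (f := Phi) (g := fun u => at_par (0, u) a)) => //; rewrite /at_par; sm.
  by move=> h; sm.
- have -> : (fun z : R * R => ((Phi (at_par (z.1, z.2) a)).1, (Phi (at_par (0, z.2) a)).2.1)) = ph.
    by apply/funext => p; exact: phE2.
  split.
  + by move=> p [p1 p2]; split=> //; rewrite psph.
  + move=> p q; rewrite !inE => -[p1 _] [q1 _] e.
    by rewrite -(psph p p1) -(psph q q1) e.
  + move=> m [m1 m2]; exists (ps m); last exact: phps.
    by split=> //; rewrite phps.
- move=> y u Nyu; have [/sub pd _] := Nyu; have zd := at_par_norm pd ad.
  have [[_ _ Pz _] _ [Q0 y0 _] E] := H zd.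
  have ud : `|at_par (0, u) a| < d by apply: u0d; exists (y, u).
  have [[_ _ Pu _] _ [_ _ u0] _] := H ud.
  split=> //.
  + have := is_derive_fst (smoothAt_is_derive ((1, 0) : V) Pz) => -[_ e].
    by rewrite /d_y (line_y (f := fun z => (Phi z).1)) ?e//; exact: smoothAt_fst.
  + have := is_derive_fst (is_derive_snd (smoothAt_is_derive ((0, (1, 0)) : V) Pu)) => -[_ e].
    rewrite (line_u (f := fun z => (Phi z).2.1)) ?e//; exact: (smoothAt_fst (smoothAt_snd Pu)).
  + rewrite /of_family -/a (nbhs_singleton E) param_rowK; congr (_ * G _).
    by rewrite -phE /ph /pt /at_par /= -(NE (y, u)).
Qed.

End Equivalent.
End Persistence.

(** * Location of transition points and the properties of the behavior *)

Section Final.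
Context {R : realType}.
Let V := (R * (R * (R * (R * R))) : normedModType R)%type.
Let A3 := (R * (R * R))%type.
Implicit Types F G : V -> R.

(* For small parameters the points responsible for a transition are close to the origin. *)
Definition concentrated F : Prop := forall e : R, 0 < e -> exists2 rho : R, 0 < rho &
  forall b : A3, `|b| < rho -> forall D, transition F D b -> transition F [set p | `|p| < e] b.

(** In the first case the derivatives give [u = g y / 2] and [3 y^2 = b + g u], so [y] is small with
    the parameters; in the second, [y = 0] and [u^2 = a]. The third never occurs: vanishing
    derivatives force [y = - y'], and then vanishing values force [y'^3 = 0]. *)
Lemma normal_concentrated : concentrated (@normal_family R).
Proof.
move=> e e0; exists (Num.min 1 (Num.min e (e ^+ 2))).
  by rewrite !lt_min ltr01 e0 exprn_gt0.
move=> [a [b g]]; rewrite !prod_normE /= !gt_max !lt_min.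
move=> /and3P[/and3P[_ _ a2] /and3P[b1 _ b2] /and3P[g1 ge _]] D.
have E1 z : 'D_(1, 0) (@normal_family R) z = - 3 * z.1 ^+ 2 + z.2.2.2.1 + z.2.2.2.2 * z.2.1.
  eassert (H : is_derive z ((1, 0) : V) (@normal_family R) _) by (rewrite /normal_family; isd).
  by have [_ ->] := H; rewrite /=; ring.
have E2 z : 'D_(0, (1, 0)) (@normal_family R) z = - 2 * z.2.1 + z.2.2.2.2 * z.1.
  eassert (H : is_derive z ((0, (1, 0)) : V) (@normal_family R) _) by (rewrite /normal_family; isd).
  by have [_ ->] := H; rewrite /=; ring.
have E3 z : 'D_(1, 0) ('D_(1, 0) (@normal_family R)) z = - 6 * z.1.
  have -> : 'D_(1, 0) (@normal_family R) = (fun z : V => - 3 * z.1 ^+ 2 + z.2.2.2.1 + z.2.2.2.2 * z.2.1).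
    by apply/funext => y; exact: E1.
  eassert (H : is_derive z ((1, 0) : V) (fun z : V => - 3 * z.1 ^+ 2 + z.2.2.2.1 + z.2.2.2.2 * z.2.1) _) by isd.
  by have [_ ->] := H; rewrite /=; ring.
rewrite /transition /crit_y /crit_u /crit_yy /at_par.
case=> [[[y u] [Dp [[h0 h1] h2]]]|[[y u] [Dp [[h0 h1] h2]]]|[[y u] [[y' u'] [n uu [_ [h0 h1]] [_ [h0' h1']]]]]].
- apply: Or31; exists (y, u); split; last by [].
  rewrite E1 /= in h1; rewrite E2 /= in h2.
  have h3 : u = g * y / 2 by move: h2; lra.
  have g2 : `|g * y / 2| <= `|y| / 2.
    rewrite !normrM normfV normr_nat; apply: ler_wpM2r; first by rewrite invr_ge0.
    by rewrite ler_piMl// ltW.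
  have h4 : 3 * `|y| ^+ 2 <= `|b| + `|g| * (`|y| / 2).
    have -> : 3 * `|y| ^+ 2 = b + g * u by rewrite -normrX ger0_norm ?sqr_ge0//; move: h1; lra.
    apply: le_trans (ler_norm _) _; apply: le_trans (ler_normD _ _) _; rewrite lerD2l normrM.
    by apply: ler_wpM2l => //; rewrite h3.
  have ye : `|y| < e.
    rewrite ltNge; apply/negP => ey.
    have h5 : e * `|y| <= `|y| ^+ 2 by rewrite expr2; apply: ler_wpM2r.
    have h6 : e ^+ 2 <= `|y| ^+ 2 by apply: lerXn2r => //; rewrite nnegrE// ltW.
    have h7 : `|g| * `|y| <= e * `|y| by apply: ler_wpM2r => //; exact: ltW.
    have h8 : 0 < e ^+ 2 by rewrite exprn_gt0.
    rewrite mulrA in h4.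
    by move: h4 h5 h6 h7 h8 b2; move: (`|y| ^+ 2) (`|g| * `|y|) (e * `|y|) (e ^+ 2) => *; lra.
  rewrite /= prod_normE /= gt_max ye h3 /=; apply: le_lt_trans g2 _.
  by have := normr_ge0 y; move: ye; lra.
- apply: Or32; exists (y, u); split; last by [].
  rewrite E3 /= in h2; have y0 : y = 0 by move: h2; lra.
  move: h0; rewrite /normal_family /= y0 expr0n /= !mulr0 !addr0 => h0.
  have u2 : `|u| ^+ 2 < e ^+ 2.
    by rewrite -normrX ger0_norm ?sqr_ge0//; have := ler_norm a; move: h0 a2; lra.
  rewrite /= prod_normE /= gt_max normr0 e0 /=.
  by move: u2; rewrite ltr_sqr ?nnegrE// ltW.
- cbn [fst snd] in n, uu; subst u'; exfalso; apply: n.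
  rewrite E1 /= in h1; rewrite E1 /= in h1'; rewrite /normal_family /= in h0 h0'.
  have h2 : (y - y') * (y + y') = 0 by move: h1 h1'; rewrite !expr2; lra.
  have /eqP := h2; rewrite mulf_eq0 subr_eq0 addr_eq0 => /orP[/eqP//|/eqP yy].
  rewrite yy in h0 h1 *.
  have h3 : y' ^+ 3 = 0.
    have s : b + g * u = 3 * y' ^+ 2 by move: h1'; lra.
    have s2 : b * y' + g * u * y' = 3 * y' ^+ 3 by rewrite -mulrDl s; ring.
    by move: h0 h0'; rewrite !mulrN exprNn -signr_odd /= expr1 mulN1r; lra.
  by move/eqP: h3; rewrite expf_eq0 /= => /eqP ->; rewrite oppr0.
Qed.

(** A transition point of [G] in the ball may be pulled back outside of it. If [F] is concentrated,
    that point is replaced by one inside; if [G] is, the point is first replaced by one so close to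
    the origin that its preimage lies in the ball. *)
Lemma persistent_diagrams_among_germ F G : germ_equiv F G -> smoothAt 0 F -> smoothAt 0 G ->
  concentrated F \/ concentrated G -> persistent_diagrams_among (of_family F) (of_family G).
Proof.
move=> [Phi [Psi [Q [[tP Ps P0 y0 u0] [tS Ss S0 _ _] [a b] Qs [Q0 E]]]]] Fs Gs conc.
have ys : smoothAt 0 (fun z => ('D_(1, 0) Phi z).1).
  by have := smoothAt_derive ((1, 0) : V) Ps => h; exact: (smoothAt_fst h).
have us : smoothAt 0 (fun z => ('D_(0, (1, 0)) Phi z).2.1).
  by have := smoothAt_derive ((0, (1, 0)) : V) Ps => h; exact: (smoothAt_fst (smoothAt_snd h)).
have n1 := near_and (near_and a b) (near_and (smoothAt_nbhs Ps) (smoothAt_nbhs Ss)).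
have n2 := near_and (smoothAt_nbhs Qs) (near_and (smoothAt_nbhs Fs) (smoothAt_nbhs Gs)).
have n3 := near_and (smoothAt_gt0 Qs Q0) (near_and (smoothAt_gt0 ys y0) (smoothAt_gt0 us u0)).
have n4 := near_and (near_and n1 n2) (near_and n3 (nbhs_interior E)).
have [d d0 Hd] := (near0P _).1 n4.
have H z : `|z| < d -> [/\ [/\ Psi (Phi z) = z, Phi (Psi z) = z, smoothAt z Phi & smoothAt z Psi],
  [/\ smoothAt z Q, smoothAt z F & smoothAt z G],
  [/\ 0 < Q z, 0 < ('D_(1, 0) Phi z).1 & 0 < ('D_(0, (1, 0)) Phi z).2.1] &
  \forall y \near z, F y = Q y * G (Phi y)].
  by move=> /Hd [[[[? ?] [? ?]] [? [? ?]]] [[? [? ?]] ?]].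
apply: (@persistent_diagrams_of_transfer R F G Phi Psi Q d tP tS P0 S0 d0 H).
have small (f : V -> V) (r : R) : smoothAt 0 f -> f 0 = 0 -> 0 < r ->
    exists2 s : R, 0 < s & forall z, `|z| < s -> `|f z| < r.
  move=> fs f0 r0; have /contP /(_ r r0)[s s0 Hs] := smoothAt_cont fs.
  by exists s => // z zs; have := Hs z; rewrite f0 !subr0; exact.
have im (r : R) : 0 < r -> exists2 s : R, 0 < s & forall c, `|c| < s -> `|image_par Phi c| < r.
  move=> r0; have [s s0 Hs] := small Phi r Ps P0 r0; exists s => // c cs.
  by apply: par_norm; apply: Hs; apply: (@at_par_norm _ (0, 0)); rewrite ?normr0.
case: conc => conc.
- have [s s0 Hs] := small Psi d Ss S0 d0.
  exists (Num.min s d); first by rewrite lt_min s0.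
  move=> r /andP[r0]; rewrite lt_min => /andP[rs rd].
  have [rho rho0 Hrho] := conc r r0.
  have r1 : 0 < Num.min s d by rewrite lt_min s0.
  have [x x0 Hx] := im _ r1.
  exists (Num.min (Num.min rho d) x); first by rewrite !lt_min rho0 d0.
  move=> c; rewrite !lt_min => /andP[/andP[cr cd] cx] tr.
  have := Hx c cx; rewrite lt_min => /andP[is_ id].
  apply: (Hrho c cr setT); apply: (transition_transfer tP tS d0 H cd id _ tr) => p pr.
  split=> //; first exact: lt_trans pr rd.
  by apply: Hs; apply: at_par_norm => //; exact: lt_trans pr rs.
exists d => // r /andP[r0 rd].
have [s s0 Hs] := small Psi r Ss S0 r0.
have e0 : 0 < Num.min s d by rewrite lt_min s0.
have [rho rho0 Hrho] := conc _ e0.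
have r1 : 0 < Num.min rho (Num.min s d) by rewrite lt_min rho0.
have [x x0 Hx] := im _ r1.
exists (Num.min d x); first by rewrite lt_min d0.
move=> c; rewrite lt_min => /andP[cd cx] tr.
have := Hx c cx; rewrite !lt_min => /and3P[irho is_ id].
have tr2 := Hrho _ irho _ tr.
apply: (transition_transfer tP tS d0 H cd id _ tr2) => p /=; rewrite lt_min => /andP[ps pd].
have z : `|Psi (at_par p (image_par Phi c))| < r by apply: Hs; exact: at_par_norm.
by split=> //; [exact: lt_trans z rd|exact: pt_norm].
Qed.

Lemma behavior_smooth (S : R -> R) (delta : R) : smooth setT S ->
  smoothAt 0 (fun z : R * R * 'rV[R]_3 => wcusp_behavior S delta z.1.1 z.1.2 z.2).
Proof.
move=> Ss; have SA x : smoothAt x S by exact: smoothT_At.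
have c (i : 'I_3) : smoothAt (0 : R * R * 'rV[R]_3) (fun z => z.2 0 i).
  have L : linear (fun a : 'rV[R]_3 => a 0 i) by move=> c x y; rewrite !mxE.
  have Lc : continuous (mklin L) by move=> x; exact: coord_continuous.
  have p2 : smoothAt (0 : R * R * 'rV[R]_3) (fun z => z.2) by sm.
  by apply: (smoothAt_comp (f := fun a : 'rV[R]_3 => a 0 i)) => //; exact: (smoothAt_lin _ Lc).
have c0 := c 0; have c1 := c 1; have c2 := c 2.
pose v (z : R * R * 'rV[R]_3) : R := z.1.2 + z.2 0 2 * z.1.1 / 2.
have vs : smoothAt 0 v by rewrite /v; sm.
have s1 : smoothAt 0 (fun z => S (v z + delta)) by apply: (smoothAt_comp (f := S)) => //; sm.
have s2 : smoothAt 0 (fun z => S (v z - delta)) by apply: (smoothAt_comp (f := S)) => //; sm.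
pose X z := S (v z + delta) - S (v z - delta) - 2 * S delta + z.1.1 + z.2 0 0 + z.2 0 1 * z.1.1.
have Xs : smoothAt 0 X by rewrite /X; sm.
have SX : smoothAt 0 (fun z => S (X z)) by apply: (smoothAt_comp (f := S)).
have : smoothAt 0 (fun z : R * R * 'rV[R]_3 => - z.1.1 + S (X z)) by sm.
by apply: smoothAt_near; apply: filterE => z.
Qed.

Section Main.
Variables (S : R -> R) (delta : R).
Hypotheses (hS : sigmoidal S) (d0 : 0 < delta).

Let beh (z : V) := wcusp_behavior S delta z.1 z.2.1 (param_row z.2.2).

Let family_beh : of_family beh = wcusp_behavior S delta.
Proof.
apply/funext => y; apply/funext => u; apply/funext => a.
by rewrite /of_family /beh /= row_paramK.
Qed.

Let family_normal : of_family (@normal_family R) = @wcusp_normal_unfolding R.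
Proof.
apply/funext => y; apply/funext => u; apply/funext => a.
by rewrite /of_family /normal_family /wcusp_normal_unfolding /row_param.
Qed.

Let param_row0 : param_row (0 : A3) = 0 :> 'rV[R]_3.
Proof. by rewrite /param_row /= !scale0r !addr0. Qed.

Let beh_smooth : smoothAt 0 beh.
Proof.
pose k (z : V) : R * R * 'rV[R]_3 := ((z.1, z.2.1), param_row z.2.2).
have ps : smoothAt 0 (fun z : V => param_row z.2.2).
  by apply: (smoothAt_comp (f := @param_row R)); [exact: param_row_smooth|sm].
have ks : smoothAt 0 k by rewrite /k; sm.
have k0 : k 0 = 0 by rewrite /k param_row0.
apply: (smoothAt_comp (f := fun z : R * R * 'rV[R]_3 => wcusp_behavior S delta z.1.1 z.1.2 z.2) (g := k)) => //.
by rewrite k0; exact: behavior_smooth (sigmoidal_smooth hS).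
Qed.

Lemma behavior_persistent : same_persistent_diagrams (wcusp_behavior S delta) (@wcusp_normal_unfolding R).
Proof.
have [C [B [E [[Cs Bs Es] C0 B0 E0 HE]]]] := behavior_model hS d0.
have ge : germ_equiv beh (@normal_family R).
  apply: germ_equiv_trans (model_equiv_normal Cs Bs C0 B0).
  exact: (germ_equiv_unit Es E0 HE).
have ns : smoothAt 0 (@normal_family R) by rewrite /normal_family; sm.
rewrite -family_beh -family_normal; split.
- by apply: persistent_diagrams_among_germ => //; right; exact: normal_concentrated.
- apply: persistent_diagrams_among_germ => //; first exact: germ_equiv_sym.
  by left; exact: normal_concentrated.
Qed.

(** At zero parameters the model is [- y^3 * C y - u^2 * B u], which is [B u] times
    [- (y h)^3 - u^2] for the smooth cube root [h] of [C y / B u]. So the input is left unchanged,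
    and [E * B] is the unit. *)
Lemma behavior_center : strongly_equivalent (fun y u => wcusp_behavior S delta y u 0) (@wcusp R).
Proof.
have [C [B [E [[Cs Bs Es] C0 B0 E0 HE]]]] := behavior_model hS d0.
have [k k3] := cubic_root 0 (- (C 0 / B 0)); have {}k3 : k ^+ 3 = C 0 / B 0 by move: k3; rewrite /cubic; lra.
have k0 : 0 < k.
  rewrite ltNge; apply/negP => k0; have : k ^+ 3 <= 0 by rewrite exprS mulr_le0_ge0// sqr_ge0.
  by rewrite k3 leNgt divr_gt0.
have C1 : smoothAt (0 : R * R) (fun z => C z.1) by apply: (smoothAt_comp (f := C)) => //; sm.
have B1 : smoothAt (0 : R * R) (fun z => B z.2) by apply: (smoothAt_comp (f := B)) => //; sm.
pose r (z : R * R) := C z.1 / B z.2.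
have Bn : B (0 : R * R).2 != 0 by rewrite gt_eqF.
have rs : smoothAt 0 r by apply: smoothAtM => //; exact: smoothAtV.
pose F (x : R * (R * R)) := x.1 ^+ 3 - r x.2.
have rs2 : smoothAt ((k, 0) : R * (R * R)) (fun x => r x.2) by apply: (smoothAt_comp (f := r)) => //; sm.
have Fs : smoothAt ((k, 0) : R * (R * R)) F by rewrite /F; sm.
have F0 : F (k, 0) = 0 by rewrite /F /= k3 subrr.
have F1 : 'D_(1, 0) F (k, 0) != 0.
  pose l (x : R) : R * (R * R) := (x, 0).
  eassert (D1 : is_derive k (1 : R) l _) by (rewrite /l; isd).
  have [_ e] := is_derive_chain D1 (smoothAt_diff (Fs : smoothAt (l k) F)).
  rewrite -[X in X != 0]e /F /l /=.
  eassert (D2 : is_derive k (1 : R) (fun x : R => x ^+ 3 - r 0) _) by isd.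
  by have [_ ->] := D2; rewrite /= addr0 mulr1 mulf_neq0// expf_neq0// gt_eqF.
have [h [hs h0 Hh _]] := implicit_function _ Fs F0 F1.
pose Y (z : R * R) := z.1 * h z; have Ys : smoothAt 0 Y by rewrite /Y; sm.
pose i (z : R * R) : V := (z.1, (z.2, 0)); have is_ : smoothAt 0 i by rewrite /i; sm.
have Ei : smoothAt 0 (fun z => E (i z)) by apply: (smoothAt_comp (f := E)).
have EB : smoothAt 0 (fun z => E (i z) * B z.2) by sm.
have EB0 : 0 < E (i 0) * B (0 : R * R).2 by rewrite mulr_gt0.
have Y1 : 0 < 'D_(1, 0) Y 0.
  have Dh := smoothAt_is_derive ((1, 0) : R * R) hs.
  eassert (D : is_derive (0 : R * R) ((1, 0) : R * R) Y _) by (rewrite /Y; isd).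
  by have [_ ->] := D; rewrite /= mul0r add0r mulr1 h0.
exists (fun y u => E (i (y, u)) * B u), (fun y u => Y (y, u)); split.
- by move: EB; apply: smoothAt_near; apply: filterE => -[].
- by move: Ys; apply: smoothAt_near; apply: filterE => -[].
- by rewrite /Y mul0r.
have n1 := near_and (smoothAt_gt0 EB EB0) (smoothAt_gt0 (smoothAt_derive ((1, 0) : R * R) Ys) Y1).
have n2 := near_and (smoothAt_nbhs Ys) (smoothAt_neq0 B1 Bn).
have i0 : i 0 = 0 by [].
pose HP (z : V) : Prop := wcusp_behavior S delta z.1 z.2.1 (param_row z.2.2) = E z * model C B 1 z.1 z.2.1 z.2.2.
have HE' : \forall z \near (0 : V), HP z by apply: (near1 HE).
have HEi : \forall z \near (0 : R * R), HP (i z) by exact: (near_subst i0 is_ HE').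
have n3 := near_and Hh HEi.
apply: (near2 n1 (near_and n2 n3)) => -[y u] [q1 q2] [[q3 q4] [q5 q6]]; split=> //.
- rewrite /d_y derive1E /=.
  eassert (D1 : is_derive y (1 : R) (fun t : R => (t, u)) _) by isd.
  by have [_ ->] := is_derive_chain D1 (smoothAt_diff (q3 : smoothAt ((fun t : R => (t, u)) y) Y)).
- move: q6; rewrite /HP /i /= param_row0 => ->.
  move: q5; rewrite /F /r /= => /eqP; rewrite subr_eq0 => /eqP q5.
  rewrite -mulrA; congr (_ * _); rewrite /model /shear /wcusp /Y /= mul0r mul0r addr0 !expr1n !mul1r exprMn q5.
  by rewrite !addr0; move: q4 => /= q4; field.
Qed.

(** With [E] taken at zero parameters, a perturbation [c p] of [E] times the model is [E] times the
    perturbation [c p / E] of the model. [model_unfolding] applies, and [E] at the image point is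
    divided out again in [Q']. *)
Lemma behavior_universal :
  universal_unfolding (fun y u => wcusp_behavior S delta y u 0) (wcusp_behavior S delta).
Proof.
have [C [B [E [[Cs Bs Es] C0 B0 E0 HE]]]] := behavior_model hS d0.
split; [exact: behavior_smooth (sigmoidal_smooth hS)|exact: filterE|move=> p ps].
pose i (z : R * R) : V := (z.1, (z.2, 0)); have is_ : smoothAt 0 i by rewrite /i; sm.
have Ei : smoothAt 0 (fun z => E (i z)) by apply: (smoothAt_comp (f := E)).
have i0 : i 0 = 0 by [].
have Ei0 : E (i 0) != 0 by rewrite gt_eqF.
pose P (z : R * R) := p z.1 z.2 / E (i z).
have Ps : smoothAt 0 P by apply: smoothAtM => //; exact: smoothAtV.
have [Q [Y [U [A [[Qs Ys Us As] A0 Hid H]]]]] := model_unfolding Cs Bs C0 B0 Ps.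
have [_ Y0 U0] := nbhs_singleton Hid.
pose k (w : R * R * R) : V := (Y w, (U (w.1.2, w.2), A w.2)).
have U2 : smoothAt 0 (fun w : R * R * R => U (w.1.2, w.2)).
  by apply: (smoothAt_comp (f := U) (g := fun w : R * R * R => (w.1.2, w.2))) => //; sm.
have A2 : smoothAt 0 (fun w : R * R * R => A w.2) by apply: (smoothAt_comp (f := A)) => //; sm.
have ks : smoothAt 0 k by rewrite /k; sm.
have k0 : k 0 = 0.
  have e1 : Y 0 = 0 by exact: Y0.
  have e2 : U ((0 : R * R * R).1.2, (0 : R * R * R).2) = 0 by exact: U0.
  have e3 : A (0 : R * R * R).2 = 0 by exact: A0.
  by rewrite /k e1 e2 e3.
have Ek : smoothAt 0 (fun w => E (k w)).
  by apply: (smoothAt_comp (f := E) (g := k)); rewrite ?k0.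
have Ek0 : E (k 0) != 0 by rewrite k0 gt_eqF.
have p1 : smoothAt (0 : R * R * R) (fun w => w.1) by sm.
have Eiw : smoothAt 0 (fun w : R * R * R => E (i w.1)) by apply: (smoothAt_comp (f := fun z => E (i z))).
pose Q' (w : R * R * R) := E (i w.1) * Q w / E (k w).
have Qs' : smoothAt 0 Q'.
  by apply: smoothAtM; [exact: smoothAtM|exact: smoothAtV].
exists (fun y u c => Q' ((y, u), c)), (fun y u c => Y ((y, u), c)), (fun u c => U (u, c)), (fun c => param_row (A c)).
split.
- split.
  + by move: Qs'; apply: smoothAt_near; apply: filterE => -[[]].
  + by move: Ys; apply: smoothAt_near; apply: filterE => -[[]].
  + by move: Us; apply: smoothAt_near; apply: filterE => -[].
  + by apply: (smoothAt_comp (f := @param_row R)) => //; exact: param_row_smooth.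
- have n := smoothAt_neq0 Ei Ei0.
  apply: (near2 Hid n) => -[y u] [q1 q2 q3] en; split=> //.
  rewrite /Q' q1 mulr1 /k /= q2 q3 A0; exact: divff.
- by rewrite A0 param_row0.
pose HP (z : V) : Prop := wcusp_behavior S delta z.1 z.2.1 (param_row z.2.2) = E z * model C B 1 z.1 z.2.1 z.2.2.
have HE' : \forall z \near (0 : V), HP z by apply: (near1 HE).
have HEi : \forall z \near (0 : R * R), HP (i z) by exact: (near_subst i0 is_ HE').
have HEk : \forall z \near (0 : R * R * R), HP (k z) by exact: (near_subst k0 ks HE').
have n1 := near_and H HEk.
have n2 := near_subst (g := fun w : R * R * R => w.1) (x := (0 : R * R * R)) (y := (0 : R * R)) erefl p1
  (near_and HEi (smoothAt_neq0 Ei Ei0)).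
apply: (near2 (near_and n1 n2) (smoothAt_neq0 Ek Ek0)) => -[[y u] c] [[e1 e2] [e3 e4]] e5 _.
move: e1 e2 e3 e4 e5; rewrite /HP /P /Q' /k /i /= param_row0 => e1 e2 e3 e4 e5.
rewrite e2 e3.
have -> : c * p y u = E (y, (u, 0)) * (c * (p y u / E (y, (u, 0)))) by field.
by rewrite -mulrDr e1; field.
Qed.

End Main.
End Final.

Theorem proposition4 (R : realType) (S : R -> R) (hS : sigmoidal S) :
  exists2 delta0 : R, 0 < delta0 &
    forall delta : R, 0 < delta < delta0 ->
      wcusp_universal_unfolding (wcusp_behavior S delta) /\
      same_persistent_diagrams (wcusp_behavior S delta)
        (@wcusp_normal_unfolding R).
Proof.
exists 1 => // delta /andP[d0 _]; split; last exact: behavior_persistent.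
by split; [exact: behavior_center|exact: behavior_universal].
Qed.
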